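(* Let $\mathcal L$ be the transfer operator cocycle generated by $\omega\mapsto T_\omega\in\mathcal M_\epsilon(T)$ over the ergodic invertible system $(\Omega,\mathcal F,\mathbb P,\sigma)$, let $(\mu_\omega)_{\omega\in\Omega}$ be the associated equivariant family of probability measures on $X$, and let $g$ be an observable satisfying the regularity, boundedness and fiberwise centering conditions of the context. Assume that the non-random variance $\Sigma^2$ satisfies $\Sigma^2>0$. Then, for every bounded and continuous function $\phi\colon\mathbb R\to\mathbb R$ and $\mathbb P$-a.e. $\omega\in\Omega$, $$\lim_{n\to\infty}\int_X\phi\Big(\frac{S_ng(\omega,x)}{\sqrt n}\Big)\,d\mu_\omega(x)=\int\phi\,d\mathcal N(0,\Sigma^2),$$ where $\mathcal N(0,\Sigma^2)$ is the centered normal distribution with variance $\Sigma^2$.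
   Context: Spaces. $X$ is a $d$-dimensional $C^\infty$ compact connected Riemannian manifold, $r>2$, and $T:X\to X$ is a topologically transitive Anosov diffeomorphism of class $C^{r+1}$ with stable and unstable dimensions $d_s,d_u$ and stable bundle $E^s$. The metric is adapted to $T$: there are $0<\nu<1<\lambda$ with $\lambda$ less than the minimal expansion along unstable directions, $\nu$ greater than the minimal contraction along stable directions, and the angles between stable and unstable spaces are close to $\pi/2$. Fix $C^\infty$ charts $\psi_i:(-r_i,r_i)^d\to X$, $1\le i\le N$, with $\bigcup_i\psi_i((-r_i/2,r_i/2)^d)=X$, $D\psi_i(0)(\mathbb R^{d_s}\times\{0\})=E^s(\psi_i(0))$, $|\psi_i|_{C^{r+1}},|\psi_i^{-1}|_{C^{r+1}}\le 1+\kappa$ with $r_i,\kappa$ small, and constants $c_i\in(0,1)$ such that the cone $\{u+v:u\in\mathbb R^{d_s}\times\{0\},v\in\{0\}\times\mathbb R^{d_u},|v|\le c_i|u|\}$ is mapped by $D\psi_i$ compatibly with a stable cone field of $T$. Fix $K$ large, $A$ large (depending on $\kappa,\nu$) and $\delta>0$ small with $A\delta<\min_i r_i/6$. $\Xi_i$ (admissible graphs) is the set of $C^{r+1}$ maps $\chi:\overline B(x,A\delta)\to(-2r_i/3,2r_i/3)^{d_u}$, where $\overline B(x,A\delta)\subset(-2r_i/3,2r_i/3)^{d_s}$, with $|\chi|_{C^{r+1}}\le K$ and $|D\chi|\le c_i$. For $h\in C^r(X,\mathbb C)$ and an integer $p\ge0$, $q\ge0$ put $$\|h\|^\sim_{p,q}=\sup_{|\alpha|=p,\,1\le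 i\le N}\ \sup_{\chi:\overline B(x,A\delta)\to\mathbb R^{d_u},\,\chi\in\Xi_i}\ \sup_{\varphi\in C_0^q(\overline B(x,\delta),\mathbb C),\,|\varphi|_{C^q}\le1}\Big|\int_{B(x,\delta)}[\partial^\alpha(h\circ\psi_i)]\circ(\mathrm{Id},\chi)\cdot\varphi\Big|,$$ $\|h\|_{p,q}=\sup_{0\le k\le p}\|h\|^\sim_{k,q+k}$; here $C^q_0$ denotes $C^q$ functions vanishing near the boundary. $\mathcal B^{p,q}$ is the completion of $C^r(X,\mathbb C)$ for $\|\cdot\|_{p,q}$. Elements $h\in\mathcal B^{1,1}$ are distributions: $|h(\varphi)|\le C\|h\|_{1,1}|\varphi|_{C^1}$, with $h(\varphi)=\int_Xh\varphi$ if $h\in C^r$. One writes $h\ge0$ if $h(\varphi)\ge0$ for all real $\varphi\ge0$ in $C^1$. For $f\in C^r(X,\mathbb C)$, $f\cdot h\in\mathcal B^{1,1}$ is the continuous extension of multiplication, $(f\cdot h)(\varphi)=h(f\varphi)$. Cocycle. For an Anosov map $S$ of class $C^{r+1}$ near $T$, $\mathcal L_S:\mathcal B^{1,1}\to\mathcal B^{1,1}$ is the transfer operator $(\mathcal L_Sh)(\varphi)=h(\varphi\circ S)$. $\mathcal M_\epsilon(T)$ is the set of Anosov maps $S$ of class $C^{r+1}$ with $d_{C^{r+1}}(S,T)<\epsilon$. $(\Omega,\mathcal F,\mathbb P)$ is a probability space, $\Omega$ a Borel subset of a separable complete metric space, $\sigma:\Omega\to\Omega$ ergodic, invertible, $\mathbb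 P$-preserving; $\omega\mapsto T_\omega\in\mathcal M_\epsilon(T)$ is measurable. Put $\mathcal L_\omega=\mathcal L_{T_\omega}$, $\mathcal L_\omega^{(n)}=\mathcal L_{\sigma^{n-1}\omega}\circ\cdots\circ\mathcal L_\omega$, $T_\omega^{(n)}=T_{\sigma^{n-1}\omega}\circ\cdots\circ T_\omega$. Throughout $\epsilon>0$ is fixed small enough (depending on $T$) that for some $D,\lambda',B>0$, $a\in(0,1)$ and all $\omega$, $n$, $h\in\mathcal B^{1,1}$: $\|\mathcal L_\omega^{(n)}h\|_{1,1}\le De^{-\lambda' n}\|h\|_{1,1}$ if $h(1)=0$; $\|\mathcal L_\omega^{(n)}h\|_{0,2}\le B\|h\|_{0,2}$; $\|\mathcal L_\omega^{(n)}h\|_{1,1}\le Ba^n\|h\|_{1,1}+B\|h\|_{0,2}$. $(h^0_\omega)$ is the unique measurable family in $\mathcal B^{1,1}$ with $\mathcal L_\omega h^0_\omega=h^0_{\sigma\omega}$, $h^0_\omega\ge0$, $h^0_\omega(1)=1$ a.e. and $\operatorname{ess\,sup}_\omega\|h^0_\omega\|_{1,1}<\infty$; $h_\omega^0$ is a probability measure on $X$, denoted $\mu_\omega$, and $\mu_\omega\circ T_\omega^{-1}=\mu_{\sigma\omega}$. $\mu$ is the measure on $\Omega\times X$ with $\mu(A\times B)=\int_A\mu_\omega(B)\,d\mathbb P(\omega)$, invariant under $\tau(\omega,x)=(\sigma\omega,T_\omega x)$. Observable. $g:\Omega\times X\to\mathbb R$ is measurable, $g(\omega,\cdot)\in C^r$,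 $\operatorname{ess\,sup}_\omega\|g(\omega,\cdot)\|_{C^r}<\infty$, and $\int_Xg(\omega,x)\,d\mu_\omega(x)=0$ for a.e. $\omega$. $S_ng(\omega,x)=\sum_{i=0}^{n-1}g(\tau^i(\omega,x))=\sum_{i=0}^{n-1}g(\sigma^i\omega,T_\omega^{(i)}x)$. Variance. $\Sigma^2=\int_{\Omega\times X}g^2\,d\mu+2\sum_{n=1}^\infty\int_{\Omega\times X}g\cdot(g\circ\tau^n)\,d\mu\ge0$. *)

(* Defs.v *)
From HB Require Import structures.
From mathcomp Require Import all_boot all_order all_algebra.
From mathcomp Require Import all_classical all_reals all_analysis ess_sup_inf.
From mathcomp Require Import complex.

Set Implicit Arguments.
Unset Strict Implicit.
Unset Printing Implicit Defensive.

Import Order.TTheory GRing.Theory Num.Theory.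
Import numFieldNormedType.Exports.

Local Open Scope classical_set_scope.
Local Open Scope ring_scope.

(* Vectors are row vectors: a linear map acts by v |-> v *m J, and subspaces
   are row spaces of matrices. *)

(* [`|x|] on 'rV[R]_n is the sup norm; this is the Euclidean one. *)
Definition enorm (R : realType) (n : nat) (x : 'rV[R]_n) : R :=
  Num.sqrt (\sum_(i < n) x 0 i ^+ 2).

Definition eball (R : realType) (n : nat) (x : 'rV[R]_n) (rho : R) :
  set 'rV[R]_n := [set y | enorm (y - x) < rho].

Definition ecball (R : realType) (n : nat) (x : 'rV[R]_n) (rho : R) :
  set 'rV[R]_n := [set y | enorm (y - x) <= rho].

Definition cube (R : realType) (n : nat) (rho : R) : set 'rV[R]_n :=
  [set x | forall j, `|x 0 j| < rho].

Definition jac (R : realType) (n m : nat) (f : 'rV[R]_n -> 'rV[R]_m)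
  (x : 'rV[R]_n) : 'M[R]_(n, m) :=
  \matrix_(i, j) ('D_(delta_mx 0 i) f x) 0 j.

(* A multi-index of length p is given by the list of the p directions of
   differentiation; for functions of class C^p the order is irrelevant. *)
Definition pd (R : realType) (n m : nat) (s : seq 'I_n)
  (f : 'rV[R]_n -> 'rV[R]_m) : 'rV[R]_n -> 'rV[R]_m :=
  foldr (fun i g x => 'D_(delta_mx 0 i) g x) f s.

(* Class C^k on an open set U, k a natural number. *)
Definition Ck (R : realType) (n m k : nat) (U : set 'rV[R]_n)
  (f : 'rV[R]_n -> 'rV[R]_m) : Prop :=
  forall (s : seq 'I_n) (x : 'rV[R]_n), U x ->
    ((size s <= k)%N -> {for x, continuous (pd s f)}) /\
    ((size s < k)%N -> forall i, derivable (pd s f) x (delta_mx 0 i)).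

Definition hexp (R : realType) (q : R) : R := q - (Num.truncn q)%:R.

(* Class C^q on an open set U, q >= 0 real: C^k with k the integer part of q,
   and the derivatives of order k are locally Hoelder of exponent q - k. The
   last clause is implied by continuity when q is an integer, as a `^ 0 = 1. *)
Definition Cq (R : realType) (n m : nat) (q : R) (U : set 'rV[R]_n)
  (f : 'rV[R]_n -> 'rV[R]_m) : Prop :=
  Ck (Num.truncn q) U f /\
  forall (s : seq 'I_n) (x : 'rV[R]_n), size s = Num.truncn q -> U x ->
    exists2 V, nbhs x V & exists C : R, forall y z, V y -> V z ->
      enorm (pd s f y - pd s f z) <= C * enorm (y - z) `^ hexp q.

(* The C^q norm on U: the larger of the sup norms of the derivatives of order
   at most the integer part of q and, when q is not an integer, of the Hoelder
   seminorms of the derivatives of highest order. *)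
Definition Cnorm (R : realType) (n m : nat) (q : R) (U : set 'rV[R]_n)
  (f : 'rV[R]_n -> 'rV[R]_m) : \bar R :=
  ereal_sup
    ([set e | exists (s : seq 'I_n) (x : 'rV[R]_n),
        [/\ (size s <= Num.truncn q)%N, U x & e = (enorm (pd s f x))%:E]] `|`
     [set e | exists (s : seq 'I_n) (x y : 'rV[R]_n),
        [/\ 0 < hexp q, size s = Num.truncn q, U x /\ U y, x != y &
            e = (enorm (pd s f x - pd s f y) / enorm (x - y) `^ hexp q)%:E]]).

(* Scalar functions are treated as vector-valued ones, so that [enorm]
   becomes the absolute value, resp. the modulus. *)
Definition of_real (R : realType) (t : R) : 'rV[R]_1 := t%:M.

Definition of_complex (R : realType) (z : R[i]) : 'rV[R]_2 :=
  \row_(j < 2) if j == ord0 then complex.Re z else complex.Im z.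

Definition to_complex (R : realType) (v : 'rV[R]_2) : R[i] :=
  Complex (v 0 ord0) (v 0 ord_max).

(* Integration over R^n for Lebesgue measure, as an iterated integral; used
   only for bounded functions, continuous on and supported in a compact. *)
Fixpoint iint (R : realType) (n : nat) : ('rV[R]_n -> R) -> R :=
  match n with
  | 0%N => fun f => f 0
  | n'.+1 => fun f =>
      \int[lebesgue_measure]_t iint (fun y : 'rV[R]_n' =>
        f (row_mx (of_real t) y : 'rV[R]_(1 + n')))
  end.

Definition ciint (R : realType) (n : nat) (F : 'rV[R]_n -> R[i]) : R[i] :=
  Complex (iint (fun x => complex.Re (F x))) (iint (fun x => complex.Im (F x))).

(* A parametrization [cpar] of an open subset of X by an open subset of R^d;
   [cpar] and its inverse [ccoord] are only meaningful on [cdom], [cim]. *)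
Record chart (R : realType) (d : nat) (X : topologicalType) := Chart {
  cdom : set 'rV[R]_d;
  cpar : 'rV[R]_d -> X;
  ccoord : X -> 'rV[R]_d;
  cdom_open : open cdom;
  cim_open : open (cpar @` cdom);
  cparK : forall x, cdom x -> ccoord (cpar x) = x;
  cpar_continuous : forall x, cdom x -> {for x, continuous cpar};
  ccoord_continuous : forall x, cdom x -> {for cpar x, continuous ccoord} }.

Definition cim (R : realType) (d : nat) (X : topologicalType)
  (a : chart R d X) : set X := cpar a @` cdom a.

Definition smooth_transition (R : realType) (d : nat) (X : topologicalType)
  (a b : chart R d X) : Prop :=
  forall k, Ck k (cdom a `&` cpar a @^-1` cim b) (ccoord b \o cpar a).

(* The tangent space at p is R^d, read in the preferred chart [chart_at p]. *)
Record manifold (R : realType) (d : nat) := Manifold {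
  carrier :> ptopologicalType;
  atlas : set (chart R d carrier);
  chart_at : carrier -> chart R d carrier;
  chart_at_atlas : forall p, atlas (chart_at p);
  chart_at_mem : forall p, cim (chart_at p) p;
  atlas_smooth : forall a b, atlas a -> atlas b -> smooth_transition a b;
  carrier_hausdorff : hausdorff_space carrier;
  carrier_compact : compact [set: carrier];
  carrier_connected : connected [set: carrier] }.

Definition smooth_chart (R : realType) (d : nat) (X : manifold R d)
  (a : chart R d X) : Prop :=
  forall b, atlas b -> smooth_transition a b /\ smooth_transition b a.

(* Differential of a parametrization, from R^d to the tangent space. *)
Definition dpar (R : realType) (d : nat) (X : manifold R d)
  (a : chart R d X) (x : 'rV[R]_d) : 'M[R]_d :=
  jac (ccoord (chart_at (cpar a x)) \o cpar a) x.

(* Differential of S : X -> X at p, from T_p X to T_(S p) X. *)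
Definition tangent (R : realType) (d : nat) (X : manifold R d)
  (S : X -> X) (p : X) : 'M[R]_d :=
  jac (ccoord (chart_at (S p)) \o S \o cpar (chart_at p))
      (ccoord (chart_at p) p).

(* The matrix in the parametrization a of a family of bilinear forms on the
   tangent spaces. *)
Definition form_in (R : realType) (d : nat) (X : manifold R d)
  (G : X -> 'M[R]_d) (a : chart R d X) (x : 'rV[R]_d) : 'M[R]_d :=
  dpar a x *m G (cpar a x) *m (dpar a x)^T.

Record riemannian (R : realType) (d : nat) := Riemannian {
  rmanifold :> manifold R d;
  metric : rmanifold -> 'M[R]_d;
  metric_sym : forall p, (metric p)^T = metric p;
  metric_pos : forall p (v : 'rV[R]_d), v != 0 ->
    0 < (v *m metric p *m v^T) 0 0;
  metric_smooth : forall a, atlas a -> forall k,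
    Ck k (cdom a) (fun x => mxvec (form_in metric a x)) }.

Definition tdot (R : realType) (d : nat) (X : riemannian R d) (p : X)
  (u v : 'rV[R]_d) : R := (u *m metric p *m v^T) 0 0.

Definition tnorm (R : realType) (d : nat) (X : riemannian R d) (p : X)
  (v : 'rV[R]_d) : R := Num.sqrt (tdot p v v).

(* Riemannian normal coordinates centred at p: by the Gauss lemma they are
   characterized by g_ij(0) = delta_ij and sum_i x^i g_ij(x) = x^j. *)
Definition normal_chart (R : realType) (d : nat) (X : riemannian R d) (p : X)
  (th : chart R d X) : Prop :=
  [/\ smooth_chart th, exists2 rho, 0 < rho & cdom th = eball 0 rho,
      cpar th 0 = p, form_in (@metric R d X) th 0 = 1%:M &
      forall x, cdom th x -> x *m form_in (@metric R d X) th x = x].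

Definition CqX (R : realType) (d m : nat) (X : manifold R d) (q : R)
  (f : X -> 'rV[R]_m) : Prop :=
  forall a, atlas a -> Cq q (cdom a) (f \o cpar a).

Definition CqC (R : realType) (d : nat) (X : manifold R d) (q : R)
  (h : X -> R[i]) : Prop := CqX q (@of_complex R \o h).

Definition CqR (R : realType) (d : nat) (X : manifold R d) (q : R)
  (h : X -> R) : Prop := CqX q (@of_real R \o h).

Definition CqXX (R : realType) (d : nat) (X : manifold R d) (q : R)
  (S : X -> X) : Prop :=
  continuous S /\
  forall a b, atlas a -> atlas b ->
    Cq q (cdom a `&` (S \o cpar a) @^-1` cim b) (ccoord b \o S \o cpar a).

(* C^q norm of a function on X, read in the finitely many charts psi. *)
Definition CnormX (R : realType) (d m N : nat) (X : manifold R d)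
  (psi : 'I_N -> chart R d X) (q : R) (f : X -> 'rV[R]_m) : \bar R :=
  ereal_sup [set Cnorm q (cdom (psi i)) (f \o cpar (psi i)) | i in [set: 'I_N]].

(* A C^q distance on the maps of class C^q of X to itself. *)
Definition dC (R : realType) (d N : nat) (X : manifold R d)
  (psi : 'I_N -> chart R d X) (q : R) (S S' : X -> X) : \bar R :=
  ereal_sup [set CnormX psi q (fun x => of_real (f (S x) - f (S' x))) |
    f in [set f : X -> R | (forall k : nat, CqR k%:R f) /\
                           (CnormX psi (q + 1) (@of_real R \o f) <= 1)%E]].

Definition borel (X : ptopologicalType) := g_sigma_algebraType (@open X).

(* The Riemannian volume: sqrt(det g) dx in every chart of the atlas. *)
Definition riemannian_volume (R : realType) (d : nat) (X : riemannian R d)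
  (vol : {finite_measure set (borel X) -> \bar R}) : Prop :=
  forall (a : chart R d X) (K : set 'rV[R]_d) (f : X -> R),
    atlas a -> compact K -> K `<=` cdom a -> continuous f ->
    (forall p, ~ (cpar a @` K) p -> f p = 0) ->
    \int[vol]_p f p =
    iint (fun x => \1_(cdom a) x *
            (f (cpar a x) * Num.sqrt (\det (form_in (@metric R d X) a x)))).

Definition diffeo (R : realType) (d : nat) (X : manifold R d) (q : R)
  (S : X -> X) : Prop :=
  CqXX q S /\ exists S', [/\ cancel S S', cancel S' S & CqXX q S'].

Definition hyperbolic_splitting (R : realType) (d : nat) (X : riemannian R d)
  (S : X -> X) (Es Eu : X -> 'M[R]_d) : Prop :=
  [/\ forall p, mxdirect (Es p + Eu p) /\ row_full (Es p + Eu p)%MS,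
      forall p, (Es p *m tangent S p == Es (S p))%MS,
      forall p, (Eu p *m tangent S p == Eu (S p))%MS &
      exists C theta : R, [/\ 0 < C, 0 < theta < 1,
        forall n p (v : 'rV[R]_d), (v <= Es p)%MS ->
          tnorm (iter n S p) (v *m tangent (iter n S) p)
            <= C * theta ^+ n * tnorm p v &
        forall n p (v : 'rV[R]_d), (v <= Eu p)%MS ->
          tnorm p v <= C * theta ^+ n *
            tnorm (iter n S p) (v *m tangent (iter n S) p)]].

Definition anosov (R : realType) (d : nat) (X : riemannian R d) (q : R)
  (S : X -> X) : Prop :=
  diffeo q S /\ exists Es Eu, hyperbolic_splitting S Es Eu.

Definition topologically_transitive (X : topologicalType) (S : X -> X) :=
  forall U V : set X, open U -> open V -> U !=set0 -> V !=set0 ->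
    exists n, (iter n S @` U) `&` V !=set0.

(* A topologically transitive Anosov diffeomorphism of class C^(r+1) for which
   the metric is adapted; eta bounds the cosines of the angles between stable
   and unstable vectors. *)
Record adapted_anosov (R : realType) (ds du : nat)
  (X : riemannian R (ds + du)) (r nu lambda eta : R) (T : X -> X)
  (Es Eu : X -> 'M[R]_(ds + du)) : Prop := AdaptedAnosov {
  aa_diffeo : diffeo (r + 1) T;
  aa_transitive : topologically_transitive T;
  aa_splitting : hyperbolic_splitting T Es Eu;
  aa_rank_s : forall p, \rank (Es p) = ds;
  aa_rank_u : forall p, \rank (Eu p) = du;
  aa_const : [/\ 0 < nu < 1, 1 < lambda & 0 < eta < 1];
  aa_contract : forall p (v : 'rV[R]_(ds + du)), (v <= Es p)%MS -> v != 0 ->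
    tnorm (T p) (v *m tangent T p) < nu * tnorm p v;
  aa_expand : forall p (v : 'rV[R]_(ds + du)), (v <= Eu p)%MS -> v != 0 ->
    lambda * tnorm p v < tnorm (T p) (v *m tangent T p);
  aa_angle : forall p (u v : 'rV[R]_(ds + du)),
    (u <= Es p)%MS -> (v <= Eu p)%MS ->
    `|tdot p u v| <= eta * tnorm p u * tnorm p v }.

Definition cone (R : realType) (ds du : nat) (c : R) :
  set 'rV[R]_(ds + du) :=
  [set w | enorm (rsubmx w) <= c * enorm (lsubmx w)].

Definition stable_cone_field (R : realType) (d : nat) (X : riemannian R d)
  (nu : R) (T : X -> X) (Es : X -> 'M[R]_d) (C : X -> set 'rV[R]_d) : Prop :=
  [/\ forall p v t, C p v -> C p (t *: v),
      forall p, closed (C p),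
      forall p v, (v <= Es p)%MS -> C p v &
      forall p v, C (T p) (v *m tangent T p) ->
        C p v /\ tnorm (T p) (v *m tangent T p) <= nu * tnorm p v].

(* The charts psi_i. The C^(r+1) size of psi_i and of its inverse is measured
   in normal coordinates at psi_i(0). *)
Record adapted_charts (R : realType) (ds du N : nat)
  (X : riemannian R (ds + du)) (r nu kappa : R) (T : X -> X)
  (Es : X -> 'M[R]_(ds + du)) (psi : 'I_N -> chart R (ds + du) X)
  (rad c : 'I_N -> R) : Prop := AdaptedCharts {
  ac_kappa : 0 < kappa;
  ac_rad : forall i, 0 < rad i;
  ac_smooth : forall i, smooth_chart (psi i);
  ac_dom : forall i, cdom (psi i) = cube (rad i);
  ac_cover : forall p, exists i, exists2 x, cube (rad i / 2) x &
    cpar (psi i) x = p;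
  ac_stable : forall i,
    (row_mx 1%:M 0 *m dpar (psi i) 0 == Es (cpar (psi i) 0))%MS;
  ac_size : forall i, exists th : chart R (ds + du) X,
    [/\ normal_chart (cpar (psi i) 0) th, cim (psi i) `<=` cim th,
        (Cnorm (r + 1) (cdom (psi i)) (ccoord th \o cpar (psi i))
           <= (1 + kappa)%:E)%E &
        (Cnorm (r + 1) (cdom th `&` cpar th @^-1` cim (psi i))
           (ccoord (psi i) \o cpar th) <= (1 + kappa)%:E)%E];
  ac_c : forall i, 0 < c i < 1;
  ac_cone : exists2 C, stable_cone_field nu T Es C &
    forall i x v, cdom (psi i) x -> cone (c i) v ->
      C (cpar (psi i) x) (v *m dpar (psi i) x) }.

(* chi : \bar B(x, A delta) -> (-2 rho/3, 2 rho/3)^du is an admissible graph,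
   for rho = r_i and c = c_i. Only the values of chi on the closed ball matter;
   being C^(r+1) on it means having a C^(r+1) extension to a neighbourhood. *)
Definition admissible (R : realType) (ds du : nat) (r K A delta rho c : R)
  (x : 'rV[R]_ds) (chi : 'rV[R]_ds -> 'rV[R]_du) : Prop :=
  [/\ ecball x (A * delta) `<=` cube (2 * rho / 3),
      forall y, ecball x (A * delta) y -> cube (2 * rho / 3) (chi y),
      exists V, [/\ open V, ecball x (A * delta) `<=` V & Cq (r + 1) V chi],
      (Cnorm (r + 1) (eball x (A * delta)) chi <= K%:E)%E &
      forall y v, ecball x (A * delta) y ->
        enorm (v *m jac chi y) <= c * enorm v].

(* phi in C^q_0(\bar B(x, delta), C), extended by zero to R^ds. *)
Definition test_fun (R : realType) (ds : nat) (q delta : R) (x : 'rV[R]_ds)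
  (phi : 'rV[R]_ds -> R[i]) : Prop :=
  [/\ Cq q setT (@of_complex R \o phi),
      exists2 rho, rho < delta & forall y, rho < enorm (y - x) -> phi y = 0 &
      (Cnorm q setT (@of_complex R \o phi) <= 1)%E].

Definition seminorm_pq (R : realType) (ds du N : nat)
  (X : riemannian R (ds + du)) (psi : 'I_N -> chart R (ds + du) X)
  (rad c : 'I_N -> R) (r K A delta : R) (p : nat) (q : R) (h : X -> R[i]) :
  \bar R :=
  ereal_sup [set e | exists (i : 'I_N) (s : seq 'I_(ds + du)) (x : 'rV[R]_ds)
      (chi : 'rV[R]_ds -> 'rV[R]_du) (phi : 'rV[R]_ds -> R[i]),
    [/\ size s = p, admissible r K A delta (rad i) (c i) x chi,
        test_fun q delta x phi &
        e = (complex.Re `|ciint (fun y =>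
              to_complex (pd s (@of_complex R \o h \o cpar (psi i))
                             (row_mx y (chi y))) * phi y)|)%:E]].

Definition norm_pq (R : realType) (ds du N : nat)
  (X : riemannian R (ds + du)) (psi : 'I_N -> chart R (ds + du) X)
  (rad c : 'I_N -> R) (r K A delta : R) (p : nat) (q : R) (h : X -> R[i]) :
  \bar R :=
  ereal_sup [set seminorm_pq psi rad c r K A delta k (q + k%:R) h |
             k in [set k | (k <= p)%N]].

(* The real-valued norm of a complex normed space (whose `|_| is in R[i]). *)
Definition rnorm (R : realType) (B : normedModType R[i]) (b : B) : R :=
  complex.Re `|b|.

(* B, with the inclusion iota of C^r(X, C), is the completion of C^r(X, C) for
   the norm norm11 (iota is irrelevant outside C^r(X, C)). *)
Record is_completion (R : realType) (d : nat) (X : manifold R d) (r : R)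
  (norm11 : (X -> R[i]) -> \bar R) (B : completeNormedModType R[i])
  (iota : (X -> R[i]) -> B) : Prop := IsCompletion {
  ic_linear : forall (z : R[i]) h h', CqC r h -> CqC r h' ->
    iota (fun x => z * h x + h' x) = z *: iota h + iota h';
  ic_isometry : forall h, CqC r h -> (rnorm (iota h))%:E = norm11 h;
  ic_dense : dense (iota @` [set h | CqC r h]) }.

(* [pair b phi] is the value b(phi) of b, seen as a distribution, at a C^1
   function phi: the continuous extension of the integral of h phi. *)
Record is_pairing (R : realType) (d N : nat) (X : riemannian R d)
  (psi : 'I_N -> chart R d X) (r : R)
  (vol : {finite_measure set (borel X) -> \bar R})
  (B : completeNormedModType R[i]) (iota : (X -> R[i]) -> B)
  (pair : B -> (X -> R[i]) -> R[i]) : Prop := IsPairing {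
  ip_linear : forall (z : R[i]) b b' phi, CqC 1 phi ->
    pair (z *: b + b') phi = z * pair b phi + pair b' phi;
  ip_bound : exists C : R, forall b phi, CqC 1 phi ->
    ((complex.Re `|pair b phi|)%:E <=
       (C * rnorm b)%:E * CnormX psi 1 (@of_complex R \o phi))%E;
  ip_integral : forall h phi, CqC r h -> CqC 1 phi ->
    pair (iota h) phi =
      Complex (\int[vol]_x complex.Re (h x * phi x))
              (\int[vol]_x complex.Im (h x * phi x)) }.

(* b >= 0 as a distribution; 0 <= z in R[i] means that z is a real >= 0. *)
Definition nonneg_dist (R : realType) (d : nat) (X : manifold R d)
  (B : completeNormedModType R[i]) (pair : B -> (X -> R[i]) -> R[i]) (b : B) :
  Prop :=
  forall phi : X -> R, CqR 1 phi -> (forall x, 0 <= phi x) ->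
    0 <= pair b (fun x => (phi x)%:C%C).

(* Omega is, up to isomorphism, a Borel subset of a separable complete metric
   space, with its Borel sigma-algebra. *)
Definition borel_base (R : realType) (dO : measure_display)
  (Omega : measurableType dO) : Prop :=
  exists (Y : completePseudoMetricType R) (j : Omega -> Y),
    [/\ hausdorff_space Y, exists2 D : set Y, countable D & dense D,
        injective j, <<s @open Y >> (range j) &
        forall E : set Omega, measurable E <->
          exists2 F, <<s @open Y >> F & E = j @^-1` F].

Record ergodic_system (R : realType) (dO : measure_display)
  (Omega : measurableType dO) (P : probability Omega R)
  (sigma : Omega -> Omega) : Prop := ErgodicSystem {
  es_measurable : measurable_fun setT sigma;
  es_invertible : exists sigma', [/\ cancel sigma sigma', cancel sigma' sigma &
    measurable_fun setT sigma'];
  es_invariant : forall E, measurable E -> P (sigma @^-1` E) = P E;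
  es_ergodic : forall E, measurable E -> sigma @^-1` E = E ->
    P E = 0%E \/ P E = 1%E }.

Definition near_anosov (R : realType) (d N : nat) (X : riemannian R d)
  (psi : 'I_N -> chart R d X) (r eps : R) (T : X -> X) : set (X -> X) :=
  [set S | anosov (r + 1) S /\ (dC psi (r + 1) S T < eps%:E)%E].

(* Measurability of omega |-> T_omega in M_epsilon(T), for the Borel
   sigma-algebra of the distance dC. *)
Definition measurable_cocycle (R : realType) (d N : nat) (X : riemannian R d)
  (psi : 'I_N -> chart R d X) (r : R) (M : set (X -> X))
  (dO : measure_display) (Omega : measurableType dO) (T_ : Omega -> X -> X) :
  Prop :=
  (forall w, M (T_ w)) /\
  forall U : set (X -> X),
    (forall S, M S -> U S -> exists2 e : R, 0 < e &
      forall S', M S' -> (dC psi (r + 1) S S' < e%:E)%E -> U S') ->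
    measurable (T_ @^-1` U).

Fixpoint Lcocycle (Omega B : Type) (sigma : Omega -> Omega)
  (L : Omega -> B -> B) (n : nat) (w : Omega) (b : B) : B :=
  if n is m.+1 then L (iter m sigma w) (Lcocycle sigma L m w b) else b.

(* L_omega is the transfer operator of T_omega on B = B^(1,1); norm02 is
   || . ||_(0,2) on C^r(X, C), and N02 its continuous extension to B. *)
Record transfer_cocycle (R : realType) (d : nat) (X : manifold R d) (r : R)
  (Omega : Type) (sigma : Omega -> Omega) (T_ : Omega -> X -> X)
  (B : completeNormedModType R[i]) (iota : (X -> R[i]) -> B)
  (pair : B -> (X -> R[i]) -> R[i]) (norm02 : (X -> R[i]) -> \bar R)
  (N02 : B -> R) (L : Omega -> {linear B -> B}) : Prop := TransferCocycle {
  tc_N02_continuous : continuous N02;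
  tc_N02 : forall h, CqC r h -> (N02 (iota h))%:E = norm02 h;
  tc_transfer : forall w b phi, CqC 1 phi ->
    pair (L w b) phi = pair b (phi \o T_ w);
  tc_decay : exists D lambda' : R, [/\ 0 < D, 0 < lambda' &
    forall w n b, pair b (fun=> 1) = 0 ->
      rnorm (Lcocycle sigma L n w b) <= D * expR (- lambda' * n%:R) * rnorm b];
  tc_lasota_yorke : exists a C : R, [/\ 0 < a < 1, 0 < C,
    forall w n b, N02 (Lcocycle sigma L n w b) <= C * N02 b &
    forall w n b, rnorm (Lcocycle sigma L n w b) <=
      C * a ^+ n * rnorm b + C * N02 b] }.

(* The equivariant family h^0, the probability measures mu_omega it is
   identified with, and the measure mu on Omega x X. *)
Record equivariant_family (R : realType) (d : nat) (X : manifold R d)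
  (dO : measure_display) (Omega : measurableType dO) (P : probability Omega R)
  (sigma : Omega -> Omega) (B : completeNormedModType R[i])
  (pair : B -> (X -> R[i]) -> R[i]) (L : Omega -> {linear B -> B})
  (h0 : Omega -> B) (mu_ : R.-pker Omega ~> borel X)
  (mu : probability (Omega * borel X)%type R) : Prop := EquivariantFamily {
  ef_measurable : forall U : set B, open U -> measurable (h0 @^-1` U);
  ef_equivariant : {ae P, forall w, L w (h0 w) = h0 (sigma w)};
  ef_nonneg : {ae P, forall w, nonneg_dist pair (h0 w)};
  ef_one : {ae P, forall w, pair (h0 w) (fun=> 1) = 1};
  ef_bounded : (ess_sup P (fun w => (rnorm (h0 w))%:E) < +oo)%E;
  ef_measure : {ae P, forall w, forall phi : X -> R, CqR 1 phi ->
    pair (h0 w) (fun x => (phi x)%:C%C) = (\int[mu_ w]_x phi x)%:C%C};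
  ef_disintegration : forall (E : set Omega) (F : set (borel X)),
    measurable E -> measurable F ->
    mu (E `*` F) = (\int[P]_(w in E) mu_ w F)%E }.

Record observable (R : realType) (d N : nat) (X : manifold R d)
  (psi : 'I_N -> chart R d X) (r : R) (dO : measure_display)
  (Omega : measurableType dO) (P : probability Omega R)
  (mu_ : R.-pker Omega ~> borel X) (g : Omega * borel X -> R) : Prop :=
  Observable {
  ob_measurable : measurable_fun setT g;
  ob_regular : forall w, CqR r (fun x : X => g (w, x));
  ob_bounded : (ess_sup P (fun w =>
    CnormX psi r (fun x : X => of_real (g (w, x)))) < +oo)%E;
  ob_centered : {ae P, forall w, \int[mu_ w]_x g (w, x) = 0} }.

Definition skew_product (Omega X : Type) (sigma : Omega -> Omega)
  (T_ : Omega -> X -> X) (z : Omega * X) : Omega * X :=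
  (sigma z.1, T_ z.1 z.2).

Definition birkhoff_sum (R : realType) (Z : Type) (tau : Z -> Z) (g : Z -> R)
  (n : nat) (z : Z) : R := \sum_(i < n) g (iter i tau z).

Definition variance_series (R : realType) (dZ : measure_display)
  (Z : measurableType dZ) (mu : probability Z R) (tau : Z -> Z) (g : Z -> R) :
  R :=
  \int[mu]_z (g z ^+ 2) +
  2 * limn (fun m => \sum_(1 <= n < m) \int[mu]_z (g z * g (iter n tau z))).

(* Main.v *)
(** Fix a realization w and put t = theta / sqrt n. Let L_k be the transfer
    operator at sigma^k w, M_k the multiplication by g (sigma^k w, .) and
    h_k = h^0_(sigma^k w). Instead of twisting L_k by exp (i t g) one twists it
    by the second order Taylor polynomial in t: set b_0 = h_0 and
    b_(k+1) = L_k (b_k + i t M_k b_k - (t^2 / 2) M_k^2 b_k). Then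
    a_n = b_n (1) is the integral of the product of the Taylor polynomials along
    the orbit, which differs from the integral of exp (i t S_n g) by O(n |t|^3).
    Since L contracts the distributions of mass 0 exponentially, b_k stays
    within O(t^2) of a_k (h_k + i t z_k), where z_(k+1) = L_k (z_k + M_k h_k);
    comparing masses, a_(k+1) = a_k (1 - t^2 v_k) + O(|t|^3), where v_k is half
    the second moment of g (sigma^k w, .) plus its correlations with the past.
    By Birkhoff's theorem the averages of v_k tend to Sigma^2 / 2 almost surely,
    hence a_n tends to exp (- theta^2 Sigma^2 / 2), and Levy's theorem applies.

    Multiplication by g is bounded on C^r (X) for the norm ||.||_(1,1) by the
    Leibniz rule. The pairing with a C^1 function is bounded on B because every
    C^1 function has a finite norm in the charts psi_i, which are only compared
    with normal coordinates; this requires a bound on the derivatives of normal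
    coordinates up to the boundary of their domain. *)

Require Import Defs.
From HB Require Import structures.
From mathcomp Require Import all_boot all_order all_algebra.
From mathcomp Require Import all_classical all_reals all_analysis ess_sup_inf.
From mathcomp Require Import measurable_realfun.
From mathcomp Require Import complex ring lra.

Set Implicit Arguments.
Unset Strict Implicit.
Unset Printing Implicit Defensive.

Import Order.TTheory GRing.Theory Num.Theory.
Import numFieldNormedType.Exports.

Local Open Scope classical_set_scope.
Local Open Scope ring_scope.

(** * Calculus in several variables *)

Section calculus.
Context {R : realType}.

(** Twisting by polynomials keeps every perturbation step algebraic in the operators L_k and M_k.
    Only uniform decay on distributions of mass 0 and uniform bounds enter, with constants that do
    not depend on w. The realization matters only through the averages of v_k: one Birkhoff limit
    serves all theta at once, so a single null set suffices for the whole characteristic function.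

    v_k is not a function of sigma^k w alone, as it only sees the correlations back to time 0.
    Regrouped by the earlier of the two times, these are truncations of one convergent series, and
    the truncation errors add up to a bounded amount.

    Another obstacle is measurability. The assumption on omega |-> T_omega concerns the distance
    [dC], which tests maps only against functions of bounded norm in the charts psi_i. Joint
    measurability of (omega, x) |-> T_omega x has to be recovered from bump functions placed away
    from the edges of these charts; without it the correlations over the skew product could not be
    disintegrated. *)

Lemma derive_scale_dir (V : normedModType R) (f : V -> R) (x v : V) (c : R) :
  derivable f x v -> is_derive x (c *: v) f (c * 'D_v f x).
Proof.
move=> df; have [->|c0] := eqVneq c 0; first by rewrite scale0r mul0r; exact: is_derive0.
have h : (fun h : R => h^-1 *: ((f \o shift x) (h *: (c *: v)) - f x)) @ 0^' -->
    c * 'D_v f x.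
  apply/cvgrPdist_lt => e e0.
  have := df => /cvgrPdist_lt /(_ (e / `|c|)).
  rewrite divr_gt0 ?normr_gt0 // => /(_ isT); rewrite !near_withinE.
  move=> /nbhs_ballP [d /= d0 H]; apply/nbhs_ballP; exists (d / `|c|).
    by rewrite /= divr_gt0 ?normr_gt0.
  move=> h; rewrite /ball /= sub0r normrN ltr_pdivlMr ?normr_gt0 // => hd h0.
  have hc0 : h * c != 0 by rewrite mulf_neq0.
  have hb : ball (0:R) d (h * c) by rewrite /ball /= sub0r normrN normrM.
  have := H _ hb hc0; rewrite /= ltr_pdivlMr ?normr_gt0 //.
  rewrite -normrM mulrC mulrBr scalerA; apply: le_lt_trans.
  rewrite (_ : h^-1 *: _ = c * ((h * c)^-1 *: (f ((h * c) *: v + x) - f x))) //.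
  rewrite -[(h * c)^-1 *: _]/((h * c)^-1 * _) -[h^-1 *: _]/(h^-1 * _).
  by rewrite mulrA; congr (_ * _); field; rewrite c0 h0.
by split; [apply/cvg_ex; eexists; exact: h | exact: cvg_lim h].
Qed.

Lemma diff_eps (V W : normedModType R) (f : V -> W) (l : {linear V -> W}) x :
  continuous l ->
  (forall e : R, 0 < e -> \forall h \near (0:V), `|f (h + x) - f x - l h| <= e * `|h|) ->
  differentiable f x /\ 'd f x = l :> (V -> W).
Proof.
move=> lc H.
have E : f \o shift x = cst (f x) + l +o_ (0:V) id.
  apply/eqaddoP => e e0; near=> h.
  rewrite /= !fctE /= opprD addrA.
  by near: h; exact: H.
have D : 'd f x = l :> (V -> W) by exact: diff_unique.
split=> //; apply/diff_locallyP; rewrite D; split=> //.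
Unshelve. all: by end_near.
Qed.

Lemma mvt_dir (V : normedModType R) (f : V -> R) (a v : V) :
  (forall s : R, 0 <= s <= 1 -> derivable f (a + s *: v) v) ->
  exists2 t : R, 0 <= t <= 1 & f (a + v) - f a = 'D_v f (a + t *: v).
Proof.
move=> df; pose g (s : R) := f (a + s *: v).
have dg (s : R) : 0 <= s <= 1 -> is_derive s 1 g ('D_v f (a + s *: v)).
  move=> s01; have ds := df s s01.
  have e : (fun h : R => h^-1 *: ((g \o shift s) (h *: 1) - g s)) =
      (fun h : R => h^-1 *: ((f \o shift (a + s *: v)) (h *: v) - f (a + s *: v))).
    apply/funext => h; congr (_ *: (_ - _)) => /=; rewrite /g; congr f.
    by rewrite [h%:A]mulr1 scalerDl addrCA.
  by split; rewrite /derivable /derive e.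
have [|||c c01] := @MVT R g (fun s => 'D_v f (a + s *: v)) 0 1.
- exact: ltr01.
- by move=> x; rewrite in_itv /= => /andP[x0 x1]; apply: dg; rewrite !ltW.
- apply: derivable_within_continuous => x; rewrite in_itv /= => x01.
  by case: (dg x x01).
- rewrite /g scale1r scale0r addr0 subr0 mulr1 => E; exists c => //.
  by move: c01; rewrite in_itv /= => /andP[x0 x1]; rewrite !ltW.
Qed.

End calculus.

Notation "'e_ i" := (delta_mx 0 i) (at level 8, i at level 2, format "''e_' i").

(** * Mean value theorem on boxes and C^1 functions *)

Section box.
Context {R : realType} {n : nat}.
Implicit Types (f g : 'rV[R]_n -> R) (U V : set 'rV[R]_n) (x y z : 'rV[R]_n).

Definition segment (a b t : R) : Prop := exists s : R, 0 <= s <= 1 /\ t = a + s * (b - a).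

(** Change one coordinate at a time: [hyb k] has the first k coordinates of y and the others of x,
    and the one-dimensional theorem applies on each edge. This uses partial derivatives on the box
    only, not differentiability. *)
Lemma box_mvt f x y :
  (forall z, (forall j, segment (x 0 j) (y 0 j) (z 0 j)) ->
     forall i, derivable f z 'e_i) ->
  exists xi : 'I_n -> 'rV[R]_n,
    (forall i j, segment (x 0 j) (y 0 j) (xi i 0 j)) /\
    f y - f x = \sum_i 'D_('e_i) f (xi i) * (y 0 i - x 0 i).
Proof.
move=> df; pose hyb k : 'rV[R]_n := \row_j if (j < k)%N then y 0 j else x 0 j.
have hyb0 : hyb 0%N = x by apply/rowP => j; rewrite mxE.
have hybn : hyb n = y by apply/rowP => j; rewrite mxE ltn_ord.
have hybS (i : 'I_n) : hyb i.+1 = hyb i + (y 0 i - x 0 i) *: 'e_i.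
  apply/rowP => j; rewrite !mxE eqxx /= ltnS leq_eqVlt.
  have [->|ji] := eqVneq j i; first by rewrite eqxx ltnn /= mulr1 addrC subrK.
  by rewrite -val_eqE in ji; rewrite /= (negbTE ji) /= mulr0 addr0.
have S (i : 'I_n) : exists xi : 'rV[R]_n, (forall j, segment (x 0 j) (y 0 j) (xi 0 j)) /\
   f (hyb i.+1) - f (hyb i) = 'D_('e_i) f xi * (y 0 i - x 0 i).
  have hb (s : R) : 0 <= s <= 1 -> forall j,
      segment (x 0 j) (y 0 j) ((hyb i + s *: ((y 0 i - x 0 i) *: 'e_i)) 0 j).
    move=> s01 j; rewrite !mxE eqxx /=.
    have [->|ji] := eqVneq j i.
      by rewrite ltnn; exists s; split=> //; rewrite mulr1.
    rewrite !mulr0 addr0; case: ifP => _.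
      by exists 1; split; [rewrite ler01 lexx | rewrite mul1r addrC subrK].
    by exists 0; split; [rewrite ler01 lexx | rewrite mul0r addr0].
  have [|t t01 E] := @mvt_dir R _ f (hyb i) ((y 0 i - x 0 i) *: 'e_i).
    move=> s s01; have [] := derive_scale_dir (y 0 i - x 0 i) (df _ (hb s s01) i).
    by [].
  exists (hyb i + t *: ((y 0 i - x 0 i) *: 'e_i)); split; first exact: hb.
  rewrite hybS E; have [_ ->] := derive_scale_dir (y 0 i - x 0 i) (df _ (hb t t01) i).
  by rewrite mulrC.
have [xi Hxi] := choice S; exists xi; split; first by move=> i; exact: (Hxi i).1.
rewrite -{1}hybn -{1}hyb0 -(telescope_sumr (fun k => f (hyb k)) (leq0n n)).
by rewrite big_mkord; apply: eq_bigr => i _; exact: (Hxi i).2.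
Qed.

Lemma coord_le (x : 'rV[R]_n) j : `|x 0 j| <= `|x|.
Proof.
rewrite [leRHS]mx_normrE.
exact: (le_bigmax _ (fun i : 'I_1 * 'I_n => `|x i.1 i.2|) (0, j)).
Qed.

Lemma norm_row_le (x : 'rV[R]_n) (M : R) : 0 <= M -> (forall j, `|x 0 j| <= M) -> `|x| <= M.
Proof.
move=> M0 H; rewrite [leLHS]mx_normrE bigmax_le //= => -[i j] _ /=.
by rewrite (ord1 i).
Qed.

Lemma norm_e (i : 'I_n) : `|'e_i : 'rV[R]_n| <= 1.
Proof.
apply: norm_row_le => // j; rewrite !mxE eqxx /=.
by case: eqP => _; rewrite ?normr1 ?normr0.
Qed.

Lemma segment_dist a b t (c e : R) : segment a b t -> `|a - c| <= e -> `|b - c| <= e ->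
  `|t - c| <= e.
Proof.
move=> [s [/andP[s0 s1] ->]]; rewrite !ler_norml => /andP[a1 a2] /andP[b1 b2].
by apply/andP; split; nra.
Qed.

Lemma segment_ball x y z w (e : R) : 0 <= e -> (forall j, segment (x 0 j) (y 0 j) (z 0 j)) ->
  `|x - w| <= e -> `|y - w| <= e -> `|z - w| <= e.
Proof.
move=> e0 H hx hy; apply: norm_row_le => // j; rewrite !mxE.
apply: segment_dist (H j) _ _.
  by have := le_trans (coord_le (x - w) j) hx; rewrite !mxE.
by have := le_trans (coord_le (y - w) j) hy; rewrite !mxE.
Qed.

Definition lincomb (c : 'I_n -> R) (h : 'rV[R]_n) : R := \sum_i h 0 i * c i.

Fact lincomb_is_linear c : linear (lincomb c).
Proof.
move=> k u v; rewrite /lincomb scaler_sumr -big_split /=.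
by apply: eq_bigr => i _; rewrite !mxE mulrDl -[k *: (_ * _)]/(k * (_ * _)) mulrA.
Qed.
HB.instance Definition _ c :=
  GRing.isLinear.Build R 'rV[R]_n R _ (lincomb c) (lincomb_is_linear c).

Lemma cvg_sumr (T I : Type) (F : set_system T) (r : seq I) (Pr : pred I)
    (u : I -> T -> R) (l : I -> R) : Filter F ->
  (forall i, Pr i -> u i x @[x --> F] --> l i) ->
  (\sum_(i <- r | Pr i) u i x) @[x --> F] --> \sum_(i <- r | Pr i) l i.
Proof.
move=> FF H; elim: r => [|i r IH].
  by rewrite big_nil; under eq_fun do rewrite big_nil; exact: cvg_cst.
rewrite big_cons; under eq_fun do rewrite big_cons.
by case: ifP => // Pi; apply: cvgD => //; exact: H.
Qed.

Lemma lincomb_continuous c : continuous (lincomb c).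
Proof.
move=> h; apply: (@cvg_sumr _ _ (nbhs h)) => i _.
by apply: cvgM; [exact: coord_continuous | exact: cvg_cst].
Qed.

Lemma C1_differentiable f x :
  (forall i, \forall z \near x, derivable f z 'e_i) ->
  (forall i, {for x, continuous ('D_('e_i) f)}) ->
  differentiable f x /\ forall v, 'D_v f x = \sum_i v 0 i * 'D_('e_i) f x.
Proof.
move=> df cf.
have [] := @diff_eps R _ _ f (lincomb (fun i => 'D_('e_i) f x)) x.
- exact: lincomb_continuous.
- move=> e e0.
  (* Each coordinate direction may cost e / n.+1; n.+1 instead of n covers dimension 0. *)
  have N0 : 0 < n.+1%:R :> R by rewrite ltr0n.
  have H (i : 'I_n) : \forall z \near x, derivable f z 'e_i /\
     `|'D_('e_i) f x - 'D_('e_i) f z| < e / n.+1%:R.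
    near=> z; split; first by near: z; exact: df.
    near: z; have /cvgrPdist_lt := cf i; apply; exact: divr_gt0.
  have := filter_forall (nbhs_filter x) H.
  move=> /nbhs_ballP [d /= d0 Hd].
  have : \forall h \near (0 : 'rV[R]_n), `|h| < d.
    apply/nbhs_ballP; exists d => // h; rewrite -ball_normE /= sub0r normrN.
    by [].
  apply: filterS => h hd.
  have inb z : (forall j, segment (x 0 j) ((h + x) 0 j) (z 0 j)) -> ball x d z.
    move=> sz; rewrite -ball_normE /= distrC; apply: le_lt_trans hd.
    by apply: segment_ball sz _ _; rewrite ?addrK ?subrr ?normr0.
  have [|xi [xiP ->]] := @box_mvt f x (h + x).
    by move=> z /inb /Hd Hz i; have [] := Hz i.
  rewrite /= /lincomb -sumrB.
  apply: (@le_trans _ _ (\sum_(i < n) (e / n.+1%:R * `|h|))).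
    apply: le_trans (ler_norm_sum _ _ _) _; apply: ler_sum => i _.
    rewrite mxE addrK [h 0 i * _]mulrC -mulrBl normrM ler_pM //.
      by have [_ /ltW] := Hd _ (inb _ (xiP i)) i; rewrite distrC.
    exact: coord_le.
  rewrite sumr_const card_ord -mulrnAl ler_wpM2r // -[leLHS]mulr_natr -mulrA.
  by rewrite ler_piMr ?(ltW e0) // mulrC ler_pdivrMr // mul1r ler_nat.
- move=> dfx E; split=> // v; rewrite deriveE // E //.
Unshelve. all: by end_near.
Qed.

End box.

Section enorm.
Context {R : realType} {n : nat}.
Implicit Types x : 'rV[R]_n.

Lemma enorm_ge0 x : 0 <= enorm x.
Proof. exact: sqrtr_ge0. Qed.

Lemma coord_le_enorm x j : `|x 0 j| <= enorm x.
Proof.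
rewrite -sqrtr_sqr; apply: ler_wsqrtr; rewrite (bigD1 j) //= lerDl.
by apply: sumr_ge0 => i _; exact: sqr_ge0.
Qed.

Lemma norm_le_enorm x : `|x| <= enorm x.
Proof. by apply: norm_row_le; [exact: enorm_ge0 | exact: coord_le_enorm]. Qed.

Lemma enorm_le_sum x : enorm x <= \sum_j `|x 0 j|.
Proof.
rewrite -[leRHS]ger0_norm; last by apply: sumr_ge0.
rewrite -sqrtr_sqr; apply: ler_wsqrtr.
suff H (r : seq 'I_n) : \sum_(i <- r) x 0 i ^+ 2 <= (\sum_(i <- r) `|x 0 i|) ^+ 2 by exact: H.
elim: r => [|a r IH]; first by rewrite !big_nil expr0n.
rewrite !big_cons sqrrD -addrA [_ *+ 2 + _]addrC addrA.
rewrite -[`|x 0 a| ^+ 2]ger0_norm ?sqr_ge0 // normrX normr_id -normrX ger0_norm ?sqr_ge0 //.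
rewrite -[leLHS]addr0 lerD ?lerD2l //.
by rewrite mulrn_wge0 // mulr_ge0 // sumr_ge0.
Qed.

Lemma enorm_le_norm x : enorm x <= n%:R * `|x|.
Proof.
apply: le_trans (enorm_le_sum x) _.
rewrite mulr_natl -[X in `|x| *+ X]card_ord -sumr_const; apply: ler_sum => i _.
exact: coord_le.
Qed.

Lemma enorm0 : enorm (0 : 'rV[R]_n) = 0.
Proof.
by rewrite /enorm big1 ?sqrtr0 // => i _; rewrite mxE expr0n.
Qed.

Lemma enorm_continuous : continuous (@enorm R n).
Proof.
move=> x; rewrite /enorm.
apply: (@continuous_comp _ _ _ (fun x : 'rV[R]_n => \sum_i x 0 i ^+ 2) Num.sqrt); last exact: sqrt_continuous.
apply: (@cvg_sumr _ _ _ (nbhs x)) => i _.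
by apply: cvgM; apply: coord_continuous.
Qed.

End enorm.

Lemma near_continuous (T S : topologicalType) (f g : T -> S) (x : T) :
  (\forall y \near x, f y = g y) -> {for x, continuous f} -> {for x, continuous g}.
Proof.
move=> h; rewrite /prop_for /continuous_at -(nbhs_singleton h).
by apply: cvg_trans; apply: near_eq_cvg; apply: filterS h => y ->.
Qed.

Lemma row_continuous (R : realType) m (T : topologicalType) (G : T -> 'rV[R]_m) (x : T) :
  (forall j, {for x, continuous (fun y => G y 0 j)}) -> {for x, continuous G}.
Proof.
move=> H; apply/cvgrPdist_le => e e0.
have h (j : 'I_m) : \forall y \near x, `|G x 0 j - G y 0 j| <= e.
  by have /cvgrPdist_le := H j; apply.
have := filter_forall (nbhs_filter x) h; apply: filterS => y hy.
by apply: norm_row_le; [exact: ltW | move=> j; rewrite !mxE].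
Qed.

(** * Calculus of Hoelder regularity classes *)

Section reg.
Context {R : realType} {n : nat}.
Implicit Types (f g : 'rV[R]_n -> R) (U V : set 'rV[R]_n) (x y z v : 'rV[R]_n).

Definition hold (th : R) f x := exists2 V, nbhs x V &
  exists C : R, forall y z, V y -> V z -> `|f y - f z| <= C * enorm (y - z) `^ th.

(* [Cq] for scalar functions, in recursive form. *)
Fixpoint Reg (th : R) (k : nat) U f : Prop :=
  (forall x, U x -> {for x, continuous f}) /\
  match k with
  | 0%N => forall x, U x -> hold th f x
  | k'.+1 => forall i, (forall x, U x -> derivable f x 'e_i) /\ Reg th k' U ('D_('e_i) f)
  end.

Lemma Reg_cont th k U f x : Reg th k U f -> U x -> {for x, continuous f}.
Proof. by case: k => [|k] [H _]; exact: H. Qed.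

Lemma Reg_sub th k U V f : U `<=` V -> Reg th k V f -> Reg th k U f.
Proof.
move=> UV; elim: k f => [|k IH] f [c H]; split; try by move=> x /UV; auto.
move=> i; have [d r] := H i; split; first by move=> x /UV; auto.
exact: IH.
Qed.

Lemma open_near_eq U f g x : open U -> U x -> (forall y, U y -> f y = g y) ->
  \forall y \near x, f y = g y.
Proof. by move=> oU Ux H; apply: filterS (open_nbhs_nbhs (conj oU Ux)). Qed.

Lemma Reg_ext th k U f g : open U -> (forall y, U y -> f y = g y) ->
  Reg th k U f -> Reg th k U g.
Proof.
move=> oU; elim: k f g => [|k IH] f g E [c H];
  (split; first by move=> x Ux; exact: near_continuous (open_near_eq oU Ux E) (c x Ux)).
- move=> x Ux; have [V nV [C HC]] := H x Ux.
  exists (V `&` U); first by apply: filterI => //; exact: open_nbhs_nbhs (conj oU Ux).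
  by exists C => y z [Vy Uy] [Vz Uz]; rewrite -!E //; exact: HC.
- move=> i; have [d r] := H i; split.
    move=> x Ux; apply: near_eq_derivable (d x Ux).
    exact: open_near_eq oU Ux E.
  apply: IH r => y Uy; apply: near_eq_derive.
  exact: open_near_eq oU Uy E.
Qed.

(** Every clause of [Reg] at a point concerns f on a full neighbourhood of that point, so V need be
    neither open nor contained in U. *)
Lemma Reg_loc th k U f :
  (forall x, U x -> exists2 V, V x & Reg th k V f) -> Reg th k U f.
Proof.
elim: k f => [|k IH] f H; split; try by move=> x /H [V Vx [c r]]; auto.
move=> i; split; first by move=> x /H [V Vx [c r]]; have [d _] := r i; exact: d.
by apply: IH => x /H [V Vx [c r]]; have [_ d] := r i; exists V.
Qed.

Lemma C1_lip f x : (forall i, \forall z \near x, derivable f z 'e_i) ->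
  (forall i, {for x, continuous ('D_('e_i) f)}) ->
  exists2 d : R, 0 < d & exists2 C : R, 0 <= C &
    forall y z, `|y - x| <= d -> `|z - x| <= d -> `|f y - f z| <= C * `|y - z|.
Proof.
move=> df cf.
have H (i : 'I_n) : \forall z \near x, derivable f z 'e_i /\
    `|'D_('e_i) f x - 'D_('e_i) f z| < 1.
  near=> z; split; first by near: z; exact: df.
  by near: z; have /cvgrPdist_lt := cf i; apply.
have /nbhs_ballP [d /= d0 Hd] := filter_forall (nbhs_filter x) H.
exists (d / 2); first by rewrite divr_gt0.
exists (\sum_i (`|'D_('e_i) f x| + 1)); first by apply: sumr_ge0 => i _; rewrite addr_ge0.
move=> y z hy hz.
have inb (w : 'rV[R]_n) : (forall j, segment (z 0 j) (y 0 j) (w 0 j)) -> ball x d w.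
  move=> sw; rewrite -ball_normE /= distrC; apply: (@le_lt_trans _ _ (d / 2)).
    by apply: segment_ball sw hz hy; rewrite ltW // divr_gt0.
  by rewrite ltr_pdivrMr // ltr_pMr // ltr1n.
have [|xi [xiP ->]] := @box_mvt R n f z y.
  by move=> w /inb /Hd Hz i; have [] := Hz i.
rewrite mulr_suml; apply: le_trans (ler_norm_sum _ _ _) _; apply: ler_sum => i _.
rewrite normrM ler_pM //; last by have := coord_le (y - z) i; rewrite !mxE.
have [_ /ltW h] := Hd _ (inb _ (xiP i)) i.
rewrite -lerBlDl; apply: le_trans h; rewrite distrC; exact: lerB_dist.
Unshelve. all: by end_near.
Qed.

Lemma lip_hold (th d C : R) f x : 0 <= th <= 1 -> 0 < d -> 0 <= C ->
  (forall y z, `|y - x| <= d -> `|z - x| <= d -> `|f y - f z| <= C * `|y - z|) ->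
  hold th f x.
Proof.
(* Radius at most 1/2 keeps |y - z| <= 1, where the power with exponent th <= 1 dominates the
   identity. *)
move=> /andP[th0 th1] d0 C0 H; pose r := Num.min d (1 / 2).
have r0 : 0 < r by rewrite /r lt_min d0 divr_gt0.
exists (ball x r); first exact: nbhsx_ballx.
exists C => y z; rewrite -ball_normE /= => hy hz.
have hr : r <= d /\ r <= 1 / 2 by rewrite /r !ge_min !lexx orbT.
apply: le_trans (H _ _ _ _) _.
- by rewrite distrC (le_trans (ltW hy)) // hr.1.
- by rewrite distrC (le_trans (ltW hz)) // hr.1.
rewrite ler_wpM2l //.
have h1 : `|y - z| <= 1.
  rewrite -(subrKA x); apply: le_trans (ler_normD _ _) _.
  by rewrite distrC; move: hy hz hr; lra.
apply: (@le_trans _ _ (`|y - z| `^ th)).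
  have [->|yz0] := eqVneq `|y - z| 0; first exact: powR_ge0.
  rewrite -{1}[`|y - z|]powRr1 //; apply: ger_powR => //.
  by rewrite h1 andbT lt_neqAle eq_sym yz0 normr_ge0.
by apply: ge0_ler_powR => //; rewrite ?nnegrE ?enorm_ge0 // norm_le_enorm.
Qed.

Lemma hold_continuous f x : {for x, continuous f} -> hold 0 f x.
Proof.
move=> /cvgrPdist_lt /(_ 1 ltr01) H; exists [set y | `|f x - f y| < 1] => //.
exists 2 => y z /= hy hz; rewrite powRr0 mulr1 -(subrKA (f x)).
by apply: le_trans (ler_normD _ _) _; rewrite distrC; move: hy hz; lra.
Qed.

Section fixed.
Variables (th : R) (U : set 'rV[R]_n).
Hypotheses (th01 : 0 <= th <= 1) (oU : open U).

Let near_U x (Q : set 'rV[R]_n) : U x -> (forall y, U y -> Q y) -> nbhs x Q.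
Proof. by move=> Ux H; apply: filterS (open_nbhs_nbhs (conj oU Ux)). Qed.

Lemma RegS_hold k f x : Reg th k.+1 U f -> U x -> hold th f x.
Proof.
move=> [c H] Ux.
have [||d d0 [C C0 HC]] := @C1_lip f x.
- by move=> i; apply: near_U Ux _ => y; exact: (H i).1.
- by move=> i; exact: Reg_cont (H i).2 Ux.
exact: lip_hold d0 C0 HC.
Qed.

(** The content is in the last stage: a C^1 function is locally Lipschitz, hence locally Hoelder for
    every exponent in [0, 1]. *)
Lemma RegW k f : Reg th k.+1 U f -> Reg th k U f.
Proof.
elim: k f => [|k IH] f H.
  by split; [case: H | move=> x Ux; exact: RegS_hold H Ux].
have [c r] := H; split=> // i; have [d r'] := r i; split=> //; exact: IH.
Qed.

Lemma Reg_le k l f : (l <= k)%N -> Reg th k U f -> Reg th l U f.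
Proof.
move=> lk; rewrite -(subnKC lk); elim: (k - l)%N => [|m IH]; first by rewrite addn0.
by rewrite addnS => /RegW.
Qed.

Lemma RegD k f g : Reg th k U f -> Reg th k U g -> Reg th k U (fun x => f x + g x).
Proof.
elim: k f g => [|k IH] f g [cf Hf] [cg Hg];
  (split; first by move=> x Ux; exact: (cvgD (cf x Ux) (cg x Ux))).
  move=> x Ux; have [V nV [C HC]] := Hf x Ux; have [W nW [D HD]] := Hg x Ux.
  exists (V `&` W); first exact: filterI.
  exists (C + D) => y z [Vy Wy] [Vz Wz]; rewrite mulrDl opprD addrACA.
  by apply: le_trans (ler_normD _ _) _; rewrite lerD // ?HC ?HD.
move=> i; have [df rf] := Hf i; have [dg rg] := Hg i; split.
  by move=> x Ux; apply: derivableD; auto.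
apply: Reg_ext (IH _ _ rf rg) => // x Ux.
by rewrite -deriveD //; auto.
Qed.

Lemma derive_cst_fun (a : R) x v : 'D_v (fun=> a) x = 0.
Proof. exact: derive_cst. Qed.

Lemma Reg_cst k (a : R) : Reg th k U (fun=> a).
Proof.
elim: k a => [|k IH] a; (split; first by move=> x Ux; exact: (@cst_continuous _ _ a x)).
  move=> x Ux; exists setT; first exact: filterT.
  by exists 0 => y z _ _; rewrite subrr normr0 mul0r.
move=> i; split; first by move=> x Ux; exact: derivable_cst.
by apply: Reg_ext (IH 0) => // x Ux; rewrite derive_cst_fun.
Qed.

Lemma RegM k f g : Reg th k U f -> Reg th k U g -> Reg th k U (fun x => f x * g x).
Proof.
elim: k f g => [|k IH] f g Rf Rg; have [cf Hf] := Rf; have [cg Hg] := Rg;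
  (split; first by move=> x Ux; exact: (cvgM (cf x Ux) (cg x Ux))).
  move=> x Ux; have [V nV [C HC]] := Hf x Ux; have [W nW [D HD]] := Hg x Ux.
  have bd (h : 'rV[R]_n -> R) : {for x, continuous h} -> nbhs x [set y | `|h y| <= `|h x| + 1].
    move=> /cvgrPdist_lt /(_ 1 ltr01); apply: filterS => y /=; rewrite distrC => /ltW.
    by move=> hy; rewrite -lerBlDl; apply: le_trans hy; exact: lerB_dist.
  exists (V `&` W `&` ([set y | `|f y| <= `|f x| + 1] `&` [set y | `|g y| <= `|g x| + 1])).
    by do 2?apply: filterI => //; apply: bd; auto.
  exists ((`|f x| + 1) * D + (`|g x| + 1) * C) => y z [[Vy Wy] [/= fy gy]] [[Vz Wz] [fz gz]].
  rewrite (_ : _ - _ = f y * (g y - g z) + g z * (f y - f z)); last by ring.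
  apply: le_trans (ler_normD _ _) _; rewrite mulrDl -!mulrA !normrM.
  by rewrite lerD // ler_pM // ?HC ?HD.
move=> i; have [df rf] := Hf i; have [dg rg] := Hg i; split.
  by move=> x Ux; apply: derivableM; auto.
apply: (@Reg_ext _ _ _ (fun x => f x * 'D_('e_i) g x + g x * 'D_('e_i) f x)) => //.
  by move=> x Ux; rewrite -[RHS]/('D_('e_i) (f * g) x) deriveM //; auto.
by apply: RegD; apply: IH => //; exact: RegW.
Qed.

Lemma RegZ k (a : R) f : Reg th k U f -> Reg th k U (fun x => a * f x).
Proof. by move=> H; apply: RegM => //; exact: Reg_cst. Qed.

Lemma RegN k f : Reg th k U f -> Reg th k U (fun x => - f x).
Proof. by move=> /(RegZ (-1)); apply: Reg_ext => // y _; rewrite mulN1r. Qed.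

Lemma RegB k f g : Reg th k U f -> Reg th k U g -> Reg th k U (fun x => f x - g x).
Proof. by move=> Hf /RegN; exact: RegD. Qed.

Lemma Reg_sum k (I : Type) (r : seq I) (F : I -> 'rV[R]_n -> R) :
  (forall i, Reg th k U (F i)) -> Reg th k U (fun x => \sum_(i <- r) F i x).
Proof.
move=> H; elim: r => [|i r IH].
  by apply: Reg_ext (Reg_cst k 0) => // y _; rewrite big_nil.
by apply: Reg_ext (RegD (H i) IH) => // y _; rewrite big_cons.
Qed.

Lemma Reg_prod k (I : Type) (r : seq I) (F : I -> 'rV[R]_n -> R) :
  (forall i, Reg th k U (F i)) -> Reg th k U (fun x => \prod_(i <- r) F i x).
Proof.
move=> H; elim: r => [|i r IH].
  by apply: Reg_ext (Reg_cst k 1) => // y _; rewrite big_nil.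
by apply: Reg_ext (RegM (H i) IH) => // y _; rewrite big_cons.
Qed.

Lemma is_derive_coord x v j : is_derive x v (fun y : 'rV[R]_n => y 0 j) (v 0 j).
Proof.
have hl : linear (fun y : 'rV[R]_n => y 0 j) by move=> k y z; rewrite !mxE.
pose l : {linear 'rV[R]_n -> R} :=
  HB.pack (fun y : 'rV[R]_n => y 0 j) (GRing.isLinear.Build R 'rV[R]_n R _ _ hl).
have cl : continuous l by exact: coord_continuous.
have dl : differentiable l x by exact: linear_differentiable.
rewrite -[fun y => _]/(l : _ -> _); split; first exact: diff_derivable.
by rewrite deriveE // diff_lin.
Qed.

Lemma Reg_coord k j : Reg th k U (fun x => x 0 j).
Proof.
elim: k => [|k IH]; (split; first by move=> x _; exact: coord_continuous).
  move=> x Ux; apply: (@lip_hold th 1 1) => // y z _ _; rewrite mul1r.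
  by have := coord_le (y - z) j; rewrite !mxE.
move=> i; split; first by move=> x Ux; have [] := is_derive_coord x 'e_i j.
apply: Reg_ext (Reg_cst k (('e_i : 'rV[R]_n) 0 j)) => // x Ux.
by have [_ ->] := is_derive_coord x 'e_i j.
Qed.

(** The derivative of 1/f is - (1/f)^2 Df, so the induction hypothesis is used for 1/f itself, one
    order lower. *)
Lemma RegV k f : (forall x, U x -> f x != 0) -> Reg th k U f -> Reg th k U (fun x => (f x)^-1).
Proof.
move=> f0; elim: k => [|k IH] Rf; have [cf Hf] := Rf;
  (split; first by move=> x Ux; exact: (cvgV (f0 x Ux) (cf x Ux))).
  move=> x Ux; have [V nV [C HC]] := Hf x Ux.
  have bd : nbhs x [set y | `|f x| / 2 <= `|f y|].
    have fx0 : 0 < `|f x| / 2 by rewrite divr_gt0 // normr_gt0 f0.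
    have /cvgrPdist_lt /(_ _ fx0) := cf x Ux; apply: filterS => y /= /ltW h.
    have := le_trans (lerB_dist (f x) (f y)) h; lra.
  exists (V `&` [set y | `|f x| / 2 <= `|f y|] `&` U).
    by do 2?apply: filterI => //; exact: open_nbhs_nbhs (conj oU Ux).
  exists ((`|f x| / 2)^-1 ^+ 2 * C) => y z [[Vy /= by_] Uy] [[Vz bz] Uz].
  have fx0 : 0 < `|f x| / 2 by rewrite divr_gt0 // normr_gt0 f0.
  rewrite (_ : _ - _ = ((f y)^-1 * (f z)^-1) * (f z - f y)); last first.
    by field; rewrite !f0.
  rewrite normrM -mulrA ler_pM //; last by rewrite distrC HC.
  rewrite normrM !normfV expr2 ler_pM ?invr_ge0 // lef_pV2 // posrE //.
    exact: lt_le_trans by_.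
  exact: lt_le_trans bz.
move=> i; have [df rf] := Hf i; split.
  by move=> x Ux; apply: derivableV; auto.
apply: (@Reg_ext _ _ _ (fun x => - ((f x)^-1 * (f x)^-1 * 'D_('e_i) f x))) => //.
  move=> x Ux; rewrite deriveV ?f0 //; last by apply: df.
  by rewrite -exprVn expr2 scaleNr.
have h : Reg th k U (fun x => (f x)^-1) by apply: IH; exact: RegW.
by apply: RegN; apply: RegM => //; exact: RegM.
Qed.

Lemma RegS_differentiable k f x : Reg th k.+1 U f -> U x ->
  differentiable f x /\ forall v, 'D_v f x = \sum_i v 0 i * 'D_('e_i) f x.
Proof.
move=> [c H] Ux; apply: C1_differentiable.
- by move=> i; apply: near_U Ux _ => y; exact: (H i).1.
- by move=> i; exact: Reg_cont (H i).2 Ux.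
Qed.

End fixed.
End reg.

Section compose.
Context {R : realType} {n m : nat}.

(** G is only derivable in the direction v, so the chain rule is applied to the curve h |-> G (h v +
    x): for a curve, derivability and differentiability coincide. *)
Lemma is_derive_chain (f : 'rV[R]_m -> R) (G : 'rV[R]_n -> 'rV[R]_m) (x v : 'rV[R]_n) :
  (forall j, derivable (fun y => G y 0 j) x v) -> differentiable f (G x) ->
  is_derive x v (f \o G) ('D_('D_v G x) f (G x)).
Proof.
move=> dG df.
have dGv : derivable G x v by apply/derivable_mxP => i j; rewrite (ord1 i).
pose c (h : R) : 'rV[R]_m := G (h *: v + x).
have c0 : c 0 = G x by rewrite /c scale0r add0r.
have dc : differentiable c 0 := (derivable1_diffP c 0).1 ((derivable1P G x v).1 dGv).
have dfc : differentiable f (c 0) by rewrite c0.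
have dcomp := differentiable_comp dc dfc.
have dfG : derivable (f \o G) x v.
  by apply: (derivable1P (f \o G) x v).2; exact: (derivable1_diffP (f \o c) 0).2.
split=> //.
have E (W : normedModType R) (k : 'rV[R]_n -> W) :
    'D_v k x = 'D_1 (fun h : R => k (h *: v + x)) 0.
  rewrite /derive; set g1 := fun h => h^-1 *: _; set g2 := fun h => h^-1 *: _.
  suff -> : g1 = g2 by [].
  by rewrite funeqE /g1 /g2 => h /=; rewrite addr0 scale0r add0r [h%:A]mulr1.
rewrite (E _ (f \o G)) (E _ G) -/c -[fun h => _]/(f \o c).
by rewrite deriveE // diff_comp //= -c0 deriveE // deriveE.
Qed.

Lemma derive_coord (G : 'rV[R]_n -> 'rV[R]_m) x v j :
  (forall j, derivable (fun y => G y 0 j) x v) ->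
  ('D_v G x) 0 j = 'D_v (fun y => G y 0 j) x.
Proof.
move=> dG; have dGv : derivable G x v by apply/derivable_mxP => i j'; rewrite (ord1 i).
by rewrite derive_mx // mxE.
Qed.

(** For exponent 0 the Hoelder clause of the composition follows from its continuity, so the
    induction only has to handle the derivatives. *)
Lemma Reg_comp k (U : set 'rV[R]_n) (V : set 'rV[R]_m) f (G : 'rV[R]_n -> 'rV[R]_m) :
  open U -> open V -> (forall x, U x -> V (G x)) ->
  Reg 0 k V f -> (forall j, Reg 0 k U (fun x => G x 0 j)) -> Reg 0 k U (f \o G).
Proof.
move=> oU oV UV; have th01 : (0:R) <= 0 <= (1:R) by rewrite lexx ler01.
elim: k f => [|k IH] f Rf RG; have [cf Hf] := Rf.
all: have cG x : U x -> {for x, continuous (f \o G)} by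
  move=> Ux; apply: continuous_comp; [apply: row_continuous => j; exact: Reg_cont (RG j) Ux
    | apply: cf; exact: UV].
all: split=> //.
  by move=> x Ux; apply: hold_continuous; exact: cG.
have D x i : U x -> is_derive x 'e_i (f \o G)
    (\sum_j 'D_('e_i) (fun y => G y 0 j) x * 'D_('e_j) f (G x)).
  move=> Ux; have dG j : derivable (fun y => G y 0 j) x 'e_i.
    by have [_ /(_ i) [+ _]] := RG j; apply.
  have [df Ef] := RegS_differentiable oV Rf (UV x Ux).
  have := is_derive_chain dG df; rewrite Ef.
  by under eq_bigr => j _ do rewrite derive_coord //.
move=> i; split; first by move=> x Ux; have [] := D x i Ux.
apply: (@Reg_ext _ _ _ _ _ (fun x => \sum_j 'D_('e_i) (fun y => G y 0 j) x * ('D_('e_j) f \o G) x)) => //.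
  by move=> x Ux; have [_ ->] := D x i Ux.
apply: Reg_sum => // j; apply: RegM => //.
  by have [_ /(_ i) [_ r]] := RG j.
apply: IH; first by have [_ r] := Hf j.
by move=> j'; exact: RegW (RG j').
Qed.

End compose.

Section pd_scalar.
Context {R : realType} {n : nat}.
Implicit Types (f g : 'rV[R]_n -> R) (U V : set 'rV[R]_n) (x y z v : 'rV[R]_n).

Definition pds (s : seq 'I_n) f : 'rV[R]_n -> R := foldr (fun i g x => 'D_('e_i) g x) f s.

(** [foldr] differentiates first in the last direction of the list, and this first derivative is the
    one that [Reg] and [Bd] peel off; inductions on lists therefore go through [rcons]. *)
Lemma pds_rcons s i f : pds (rcons s i) f = pds s ('D_('e_i) f).
Proof. by rewrite /pds foldr_rcons. Qed.

Lemma Reg_pds th k U f s x : Reg th k U f -> U x ->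
  [/\ (size s <= k)%N -> {for x, continuous (pds s f)},
      (size s < k)%N -> forall i, derivable (pds s f) x 'e_i &
      size s = k -> hold th (pds s f) x].
Proof.
move=> Rf Ux; elim: k f s Rf => [|k IH] f s; case/lastP: s => [|s j] [cf Hf].
- by split=> // _; [exact: cf | exact: Hf].
- by split; rewrite size_rcons.
- by split=> // [_|_ i]; [exact: cf | exact: (Hf i).1].
- rewrite pds_rcons size_rcons; have [h1 h2 h3] := IH _ s (Hf j).2.
  by split=> //; move=> [] //.
Qed.

Lemma pds_Reg th k U f :
  (forall s x, U x ->
    [/\ (size s <= k)%N -> {for x, continuous (pds s f)},
      (size s < k)%N -> forall i, derivable (pds s f) x 'e_i &
      size s = k -> hold th (pds s f) x]) -> Reg th k U f.
Proof.
elim: k f => [|k IH] f H; split; do ?by move=> x Ux; have [h1 h2 h3] := H [::] x Ux; auto.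
move=> i; split; first by move=> x Ux; have [h1 h2 h3] := H [::] x Ux; exact: h2.
apply: IH => s x Ux; have := H (rcons s i) x Ux; rewrite pds_rcons size_rcons.
by case=> h1 h2 h3; split=> // E; apply: h3; rewrite E.
Qed.

Fixpoint Bd (k : nat) U (C : R) f : Prop :=
  (forall x, U x -> `|f x| <= C) /\
  match k with 0%N => True | k'.+1 => forall i, Bd k' U C ('D_('e_i) f) end.

Lemma Bd0 k U C f x : Bd k U C f -> U x -> `|f x| <= C.
Proof. by case: k => [|k] [H _]; exact: H. Qed.

Lemma Bd_pdsP k U C f : Bd k U C f <->
  (forall s x, (size s <= k)%N -> U x -> `|pds s f x| <= C).
Proof.
elim: k f => [|k IH] f; split.
- by move=> [H _] [|//] x _; exact: H.
- by move=> H; split=> // x; exact: (H [::]).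
- move=> [H r] s x; case/lastP: s => [|s i]; first by move=> _; exact: H.
  by rewrite size_rcons pds_rcons => h; apply: (IH _).1; [exact: r|].
- move=> H; split; first by move=> x; exact: (H [::]).
  by move=> i; apply: (IH _).2 => s x hs; rewrite -pds_rcons; apply: H; rewrite size_rcons.
Qed.

Lemma Bd_le k l U V C D f : (l <= k)%N -> V `<=` U -> C <= D -> Bd k U C f -> Bd l V D f.
Proof.
move=> lk VU CD /Bd_pdsP H; apply/Bd_pdsP => s x hs Vx.
by apply: le_trans CD; apply: H; [exact: leq_trans lk | exact: VU].
Qed.

Lemma Bd_ext k U C f g : open U -> (forall y, U y -> f y = g y) -> Bd k U C f -> Bd k U C g.
Proof.
move=> oU; elim: k f g => [|k IH] f g E [H r];
  (split; first by move=> x Ux; rewrite -E //; exact: H) => //.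
move=> i; apply: IH (r i) => y Uy; apply: near_eq_derive.
exact: open_near_eq oU Uy E.
Qed.

Section fixed.
Variables (th : R) (U : set 'rV[R]_n).
Hypotheses (th01 : 0 <= th <= 1) (oU : open U).

Lemma BdD k C D f g : Reg th k U f -> Reg th k U g -> Bd k U C f -> Bd k U D g ->
  Bd k U (C + D) (fun x => f x + g x).
Proof.
elim: k f g => [|k IH] f g [_ Rf] [_ Rg] [bf Bf] [bg Bg];
  (split; first by move=> x Ux; apply: le_trans (ler_normD _ _) _; rewrite lerD // ?bf ?bg) => //.
move=> i; have [df rf] := Rf i; have [dg rg] := Rg i.
apply: Bd_ext (IH _ _ rf rg (Bf i) (Bg i)) => // x Ux.
by rewrite -deriveD //; auto.
Qed.

Lemma Bd_cst k C (a : R) : `|a| <= C -> Bd k U C (fun=> a).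
Proof.
elim: k a => [|k IH] a aC; (split; first by []) => //.
move=> i; apply: Bd_ext (IH 0 _) => //; last by rewrite normr0 (le_trans _ aC).
by move=> x Ux; rewrite derive_cst_fun.
Qed.

(** Each differentiation doubles the number of Leibniz terms, whence 2 ^+ k. *)
Lemma BdM k C D f g : Reg th k U f -> Reg th k U g -> Bd k U C f -> Bd k U D g ->
  Bd k U (2 ^+ k * (C * D)) (fun x => f x * g x).
Proof.
elim: k C D f g => [|k IH] C D f g Rf Rg Bf Bg; have [cf Hf] := Rf; have [cg Hg] := Rg;
  have [bf Hbf] := Bf; have [bg Hbg] := Bg.
  split=> // x Ux; rewrite mul1r normrM ler_pM ?bf ?bg //.
have pos x : U x -> 0 <= C * D.
  by move=> Ux; apply: mulr_ge0; [apply: le_trans (bf x Ux) | apply: le_trans (bg x Ux)].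
split.
  move=> x Ux; rewrite normrM; apply: (@le_trans _ _ (C * D)); first by rewrite ler_pM ?bf ?bg.
  by rewrite ler_peMl ?(pos x) // exprn_ege1 // ler1n.
move=> i; have [df rf] := Hf i; have [dg rg] := Hg i.
have h1 := IH _ _ _ _ (RegW th01 oU Rf) rg (Bd_le (leqnSn _) (@subset_refl _ _) (lexx _) Bf) (Hbg i).
have h2 := IH _ _ _ _ (RegW th01 oU Rg) rf (Bd_le (leqnSn _) (@subset_refl _ _) (lexx _) Bg) (Hbf i).
have r1 := RegM th01 oU (RegW th01 oU Rf) rg.
have r2 := RegM th01 oU (RegW th01 oU Rg) rf.
have := BdD r1 r2 h1 h2.
rewrite [D * C]mulrC -mulr2n -[X in Bd _ _ X]mulr_natl mulrA -exprS.
apply: Bd_ext => // x Ux.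
by rewrite -[RHS]/('D_('e_i) (f * g) x) deriveM //; auto.
Qed.

Lemma Bd_sum k m (F : 'I_m -> 'rV[R]_n -> R) (C : R) :
  (forall i, Reg th k U (F i)) -> (forall i, Bd k U C (F i)) ->
  Bd k U (m%:R * C) (fun x => \sum_i F i x).
Proof.
move=> RF BF.
suff H (r : seq 'I_m) : Bd k U ((size r)%:R * C) (fun x => \sum_(i <- r) F i x).
  by have := H (enum 'I_m); rewrite size_enum_ord; apply: Bd_ext => // y _; rewrite big_enum.
elim: r => [|i r IH].
  by apply: Bd_ext (Bd_cst k (a := 0) (C := 0 * C) _) => // [y _|];
    rewrite ?big_nil // normr0 mul0r.
rewrite /= -natr1 mulrDl mul1r addrC.
have rs : Reg th k U (fun x => \sum_(i <- r) F i x) by exact: Reg_sum.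
by apply: Bd_ext (BdD (RF i) rs (BF i) IH) => // y _; rewrite big_cons.
Qed.

End fixed.
End pd_scalar.

Section chain_rule.
Context {R : realType} {n m : nat}.
Implicit Types (U : set 'rV[R]_n) (V : set 'rV[R]_m).

Lemma is_derive_comp_Reg U V (f : 'rV[R]_m -> R) (G : 'rV[R]_n -> 'rV[R]_m) k x i :
  open V -> V (G x) -> Reg 0 k.+1 V f -> (forall j, Reg 0 k.+1 U (fun x => G x 0 j)) -> U x ->
  is_derive x 'e_i (f \o G) (\sum_j 'D_('e_i) (fun y => G y 0 j) x * 'D_('e_j) f (G x)).
Proof.
move=> oV VG Rf RG Ux; have dG j : derivable (fun y => G y 0 j) x 'e_i.
  by have [_ /(_ i) [+ _]] := RG j; apply.
have [df Ef] := RegS_differentiable oV Rf VG.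
have := is_derive_chain dG df; rewrite Ef.
by under eq_bigr => j _ do rewrite derive_coord //.
Qed.

(** The constant is chosen before the sets and the functions: later it has to serve all admissible
    graphs at once. *)
Lemma Bd_comp k (C D : R) : exists E : R, forall U V (f : 'rV[R]_m -> R) (G : 'rV[R]_n -> 'rV[R]_m),
  open U -> open V -> (forall x, U x -> V (G x)) ->
  Reg 0 k V f -> (forall j, Reg 0 k U (fun x => G x 0 j)) ->
  Bd k V C f -> (forall j, Bd k U D (fun x => G x 0 j)) -> Bd k U E (f \o G).
Proof.
have th01 : (0:R) <= 0 <= (1:R) by rewrite lexx ler01.
elim: k => [|k [E IH]].
  by exists C => U V f G oU oV UV Rf RG [bf _] _; split=> // x /UV; exact: bf.
exists (Num.max C (m%:R * (2 ^+ k * (D * E)))) => U V f G oU oV UV Rf RG Bf BG.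
split; first by move=> x /UV Vx; rewrite le_max (Bd0 Bf Vx).
move=> i.
pose F := fun j x => 'D_('e_i) (fun y => G y 0 j) x * ('D_('e_j) f \o G) x.
have RG' j : Reg 0 k U (fun x => G x 0 j) by exact: RegW (RG j).
have Rf' j : Reg 0 k V ('D_('e_j) f) by have [_ /(_ j) []] := Rf.
have Rc j : Reg 0 k U ('D_('e_j) f \o G) by exact: Reg_comp (Rf' j) RG'.
have Rd j : Reg 0 k U ('D_('e_i) (fun y => G y 0 j)) by have [_ /(_ i) []] := RG j.
apply: (@Bd_ext _ _ _ _ _ (fun x => \sum_j F j x)) => //.
  by move=> x Ux; have [_ ->] := is_derive_comp_Reg i oV (UV x Ux) Rf RG Ux.
apply: (@Bd_le _ _ k k U U (m%:R * (2 ^+ k * (D * E)))) => //.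
  by rewrite le_max lexx orbT.
have RF j : Reg 0 k U (F j) by exact: RegM.
suff BF j : Bd k U (2 ^+ k * (D * E)) (F j) by exact: (Bd_sum oU RF BF).
apply: (BdM th01 oU) => //; first by have [_ /(_ i)] := BG j.
apply: (IH U V) => //; first by have [_ /(_ j)] := Bf.
by move=> j'; exact: Bd_le (leqnSn k) (@subset_refl _ _) (lexx _) (BG j').
Qed.

(** Passage from the vector-valued derivatives [pd] to scalar ones. The two agree on U only, so all
    equalities are carried through neighbourhoods inside the open set U. *)
Lemma Cq_Reg (q : R) U (f : 'rV[R]_n -> 'rV[R]_m) j : open U -> Cq q U f ->
  Reg (hexp q) (Num.truncn q) U (fun x => f x 0 j) /\
  (forall s x, (size s <= Num.truncn q)%N -> U x -> pd s f x 0 j = pds s (fun x => f x 0 j) x).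
Proof.
move=> oU [CkU HU]; set k := Num.truncn q in CkU HU *.
have E s x : (size s <= k)%N -> U x -> pd s f x 0 j = pds s (fun x => f x 0 j) x.
  elim: s x => [|i s IH] x //= hs Ux.
  have [_ /(_ hs i) d] := CkU s x Ux.
  rewrite derive_mx // mxE; apply: near_eq_derive.
  by apply: filterS (open_nbhs_nbhs (conj oU Ux)) => y Uy; rewrite IH // ltnW.
have N s x : (size s <= k)%N -> U x -> \forall y \near x, pd s f y 0 j = pds s (fun x => f x 0 j) y.
  by move=> hs Ux; apply: filterS (open_nbhs_nbhs (conj oU Ux)) => y Uy; exact: E.
split=> //; apply: pds_Reg => s x Ux; have [c d] := CkU s x Ux; split.
- move=> hs; apply: near_continuous (N s x hs Ux) _.
  apply: (@continuous_comp _ _ _ (pd s f) (fun y => y 0 j)); first exact: c.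
  exact: coord_continuous.
- move=> hs i; apply: near_eq_derivable (N s x (ltnW hs) Ux) _.
  exact: ((derivable_mxP _ _ _).1 (d hs i)).
- move=> hs; have [V nV [C HC]] := HU s x hs Ux.
  exists (V `&` U); first by apply: filterI => //; exact: open_nbhs_nbhs (conj oU Ux).
  exists C => y z [Vy Uy] [Vz Uz]; rewrite -!E ?hs //.
  by apply: le_trans (HC y z Vy Vz); have := coord_le_enorm (pd s f y - pd s f z) j; rewrite !mxE.
Qed.

Lemma Reg_Cq (q : R) U (f : 'rV[R]_n -> 'rV[R]_m) : open U ->
  (forall j, Reg (hexp q) (Num.truncn q) U (fun x => f x 0 j)) -> Cq q U f.
Proof.
move=> oU H; rewrite /Cq; set k := Num.truncn q in H *.
have E s x : (size s <= k)%N -> U x -> forall j, pd s f x 0 j = pds s (fun x => f x 0 j) x.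
  elim: s x => [|i s IH] x //= hs Ux j.
  have N j' : \forall y \near x, pds s (fun x => f x 0 j') y = pd s f y 0 j'.
    by apply: filterS (open_nbhs_nbhs (conj oU Ux)) => y Uy; rewrite IH // ltnW.
  have d : derivable (pd s f) x 'e_i.
    apply/derivable_mxP => i' j'; rewrite (ord1 i').
    apply: near_eq_derivable (N j') _; have [_ + _] := Reg_pds s (H j') Ux; exact.
  rewrite derive_mx // mxE; apply: near_eq_derive.
  by apply: filterS (N j) => y ->.
have N s x j : (size s <= k)%N -> U x -> \forall y \near x, pds s (fun x => f x 0 j) y = pd s f y 0 j.
  by move=> hs Ux; apply: filterS (open_nbhs_nbhs (conj oU Ux)) => y Uy; rewrite E.
split.
  move=> s x Ux; split.
    move=> hs; apply: row_continuous => j; apply: near_continuous (N s x j hs Ux) _.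
    by have [+ _ _] := Reg_pds s (H j) Ux; exact.
  move=> hs i; apply/derivable_mxP => i' j; rewrite (ord1 i').
  by apply: near_eq_derivable (N s x j (ltnW hs) Ux) _; have [_ + _] := Reg_pds s (H j) Ux; exact.
move=> s x hs Ux.
have S j : exists C : R, \forall p \near (x, x), `|pd s f p.1 0 j - pd s f p.2 0 j| <= C * enorm (p.1 - p.2) `^ hexp q.
  have [_ _ /(_ hs) [V nV [C HC]]] := Reg_pds s (H j) Ux.
  have nVU : nbhs x (V `&` U) by apply: filterI => //; exact: open_nbhs_nbhs (conj oU Ux).
  exists C; exists (V `&` U, V `&` U) => //= -[y z] /= [[Vy Uy] [Vz Uz]].
  by rewrite !E ?hs //; exact: HC.
have [C HC] := choice S.
have [[V W] /= [nV nW] VW] := filter_forall (nbhs_filter (x, x)) HC.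
exists (V `&` W); first exact: filterI.
exists (\sum_j C j) => y z [Vy Wy] [Vz Wz].
apply: le_trans (enorm_le_sum _) _; rewrite mulr_suml; apply: ler_sum => j _.
by rewrite !mxE; exact: (VW (y, z)).
Qed.

Lemma Bd_Cnorm (q C : R) U (f : 'rV[R]_n -> 'rV[R]_m) : open U -> hexp q = 0 -> 0 <= C -> Cq q U f ->
  (forall j, Bd (Num.truncn q) U C (fun x => f x 0 j)) -> (Cnorm q U f <= (m%:R * C)%:E)%E.
Proof.
move=> oU q0 C0 cf H; apply: ge_ereal_sup => e [|].
  move=> [s [x [hs Ux ->]]]; rewrite lee_fin; apply: le_trans (enorm_le_sum _) _.
  rewrite mulr_natl -[X in _ *+ X]card_ord -sumr_const; apply: ler_sum => j _.
  by have [_ ->//] := Cq_Reg j oU cf; have /Bd_pdsP := H j; apply.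
by move=> [s [x [y []]]]; rewrite q0 ltxx.
Qed.
End chain_rule.

Section integer_order.
Context {R : realType}.

Lemma truncn_nat k : Num.truncn (k%:R : R) = k.
Proof. exact: natrK. Qed.

Lemma hexp_nat k : hexp (k%:R : R) = 0.
Proof. by rewrite /hexp truncn_nat subrr. Qed.

Lemma hexp_itv (q : R) : 0 <= q -> 0 <= hexp q <= 1.
Proof.
move=> q0; have /andP[h1 h2] := truncn_itv q0; rewrite /hexp subr_ge0 h1 /=.
by rewrite lerBlDl natr1 ltW.
Qed.

End integer_order.

(** * Geodesics in normal coordinates *)

Section schwarz.
Context {R : realType} {n : nat}.
Implicit Types (f : 'rV[R]_n -> R) (x y z v : 'rV[R]_n).

Lemma Reg_derive th k (U : set 'rV[R]_n) f i : Reg th k.+1 U f -> Reg th k U ('D_('e_i) f).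
Proof. by case=> _ H; exact: (H i).2. Qed.

Lemma Reg_derivable th k (U : set 'rV[R]_n) f i x : Reg th k.+1 U f -> U x -> derivable f x 'e_i.
Proof. by case=> _ H; exact: (H i).1. Qed.

Lemma derive_shift_fun f x v a : 'D_v (fun y => f (y + a)) x = 'D_v f (x + a).
Proof.
rewrite /derive; set g1 := fun h => h^-1 *: _; set g2 := fun h => h^-1 *: _.
suff -> : g1 = g2 by [].
by rewrite funeqE /g1 /g2 => h /=; rewrite addrA.
Qed.

Lemma derivable_shift_fun f x v a : derivable f (x + a) v -> derivable (fun y => f (y + a)) x v.
Proof.
rewrite /derivable; set g1 := fun h => h^-1 *: _; set g2 := fun h => h^-1 *: _.
suff -> : g1 = g2 by [].
by rewrite funeqE /g1 /g2 => h /=; rewrite addrA.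
Qed.

(** The mean value theorem in direction i for y |-> f (y + h e_j) - f y, then in direction j for D_i
    f. The left-hand side is symmetric in i and j, so evaluating it in both orders compares the two
    mixed derivatives. *)
Lemma second_difference f x (i j : 'I_n) (r h : R) : 0 < h -> 2 * h < r ->
  (forall z, `|z - x| < r -> derivable f z 'e_i) ->
  (forall z, `|z - x| < r -> derivable ('D_('e_i) f) z 'e_j) ->
  exists2 z, `|z - x| < r & f (x + h *: 'e_i + h *: 'e_j) - f (x + h *: 'e_i) - f (x + h *: 'e_j) + f x
    = h ^+ 2 * 'D_('e_j) ('D_('e_i) f) z.
Proof.
move=> h0 hr di dj.
have inb (s t : R) : 0 <= s <= 1 -> 0 <= t <= 1 ->
    `|x + s *: (h *: 'e_i) + t *: (h *: 'e_j) - x| < r.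
  move=> /andP[s0 s1] /andP[t0 t1]; apply: le_lt_trans hr.
  have -> : forall a b e : 'rV[R]_n, a + b + e - a = b + e by move=> a b e; rewrite addrC !addrA addNr add0r.
  apply: le_trans (ler_normD _ _) _.
  have hn (u : R) (k : 'I_n) : 0 <= u -> u <= 1 -> `|u *: (h *: 'e_k : 'rV[R]_n)| <= h.
    move=> u0 u1; rewrite !normrZ (ger0_norm u0) (ger0_norm (ltW h0)).
    apply: le_trans (ler_piMl _ u1) _; first by rewrite mulr_ge0 // ltW.
    by rewrite ler_piMr ?norm_e // ltW.
  by rewrite mulrDl mul1r lerD ?hn.
pose F y := f (y + h *: 'e_j) - f y.
have i01 (s : R) : 0 <= s <= 1 -> derivable f (x + s *: (h *: 'e_i)) 'e_i.
  move=> s01; apply: di; have := inb s 0 s01; rewrite lexx ler01 => /(_ isT).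
  by rewrite scale0r addr0.
have i11 (s : R) : 0 <= s <= 1 -> derivable f (x + s *: (h *: 'e_i) + h *: 'e_j) 'e_i.
  move=> s01; apply: di; have := inb s 1 s01; rewrite lexx ler01 => /(_ isT).
  by rewrite scale1r.
have dF (s : R) : 0 <= s <= 1 -> is_derive (x + s *: (h *: 'e_i)) 'e_i F
   ('D_('e_i) f (x + s *: (h *: 'e_i) + h *: 'e_j) - 'D_('e_i) f (x + s *: (h *: 'e_i))).
  move=> s01; split; first by apply: derivableB; [apply: derivable_shift_fun; exact: i11 | exact: i01].
  rewrite -[F]/((fun y => f (y + h *: 'e_j)) - f) deriveB; last exact: i01.
    by rewrite derive_shift_fun.
  by apply: derivable_shift_fun; exact: i11.
have [|t t01] := @mvt_dir R _ F x (h *: 'e_i).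
  by move=> s /dF [/(derive_scale_dir h) []].
have [dt E] := dF t t01.
have [_ ->] := derive_scale_dir h dt; rewrite E => EF.
have -> : f (x + h *: 'e_i + h *: 'e_j) - f (x + h *: 'e_i) - f (x + h *: 'e_j) + f x = F (x + h *: 'e_i) - F x.
  by rewrite /F; ring.
rewrite EF.
have [|t' t'01] := @mvt_dir R _ ('D_('e_i) f) (x + t *: (h *: 'e_i)) (h *: 'e_j).
  by move=> s s01; have [] := derive_scale_dir h (dj _ (inb t s t01 s01)).
have [_ ->] := derive_scale_dir h (dj _ (inb t t' t01 t'01)) => ->.
by exists (x + t *: (h *: 'e_i) + t' *: (h *: 'e_j)); [exact: inb | rewrite mulrA -expr2].
Qed.

Lemma two_limits (k a b c d A B E F e : R) : k != 0 ->
  a - b - c + d = k * E -> a - c - b + d = k * F ->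
  `|B - E| < e / 2 -> `|A - F| < e / 2 -> `|A - B| <= e.
Proof.
move=> k0 h1 h2; have -> : E = F by apply: (mulfI k0); rewrite -h1 -h2; ring.
move=> h3 h4; rewrite (_ : A - B = (A - F) - (B - F)); last by ring.
by apply: le_trans (ler_normB _ _) _; move: h3 h4; lra.
Qed.

Lemma derive_comm th (U : set 'rV[R]_n) f x (i j : 'I_n) : open U -> Reg th 2 U f -> U x ->
  'D_('e_i) ('D_('e_j) f) x = 'D_('e_j) ('D_('e_i) f) x.
Proof.
move=> oU Rf Ux.
have cont k l : {for x, continuous ('D_('e_k) ('D_('e_l) f))}.
  exact: Reg_cont (Reg_derive k (Reg_derive l Rf)) Ux.
apply/eqP; rewrite -subr_eq0 -normr_le0; apply/ler_addgt0Pr => e e0; rewrite add0r.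
have e20 : 0 < e / 2 by rewrite divr_gt0.
have N1 : \forall z \near x, `|'D_('e_i) ('D_('e_j) f) x - 'D_('e_i) ('D_('e_j) f) z| < e / 2.
  by have /cvgrPdist_lt := cont i j; apply.
have N2 : \forall z \near x, `|'D_('e_j) ('D_('e_i) f) x - 'D_('e_j) ('D_('e_i) f) z| < e / 2.
  by have /cvgrPdist_lt := cont j i; apply.
have : \forall z \near x, [/\ U z, `|'D_('e_i) ('D_('e_j) f) x - 'D_('e_i) ('D_('e_j) f) z| < e / 2 &
    `|'D_('e_j) ('D_('e_i) f) x - 'D_('e_j) ('D_('e_i) f) z| < e / 2].
  apply: filterS (filterI (open_nbhs_nbhs (conj oU Ux)) (filterI N1 N2)) => z [Uz [h1 h2]].
  exact: (And3 Uz h1 h2).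
move=> /nbhs_ballP [r /= r0 Hr].
have inr z : `|z - x| < r -> ball x r z by rewrite -ball_normE /= distrC.
have rr : 2 * (r / 4) < r by lra.
have r4 : 0 < r / 4 by rewrite divr_gt0.
have d1 k z : `|z - x| < r -> derivable f z 'e_k.
  by move=> /inr /Hr [Uz _ _]; exact: (Reg_derivable Rf Uz).
have d2 k l z : `|z - x| < r -> derivable ('D_('e_k) f) z 'e_l.
  by move=> /inr /Hr [Uz _ _]; exact: (Reg_derivable (Reg_derive k Rf) Uz).
have [z hz Ez] := second_difference r4 rr (d1 i) (d2 i j).
have [z' hz' Ez'] := second_difference r4 rr (d1 j) (d2 j i).
rewrite [x + _ + _]addrAC in Ez'.
have h0 : (r / 4) ^+ 2 != 0 by rewrite expf_eq0 /= gt_eqF.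
have [_ _ h1] := Hr z (inr _ hz); have [_ h2 _] := Hr z' (inr _ hz').
exact: two_limits h0 Ez Ez' h1 h2.
Qed.

End schwarz.

Section matrix_derivative.
Context {R : realType} {n : nat}.
Implicit Types (x y v : 'rV[R]_n).

Definition dm m k v (F : 'rV[R]_n -> 'M[R]_(m, k)) y : 'M[R]_(m, k) :=
  \matrix_(i, j) 'D_v (fun z => F z i j) y.

Definition mderivable m k v (F : 'rV[R]_n -> 'M[R]_(m, k)) y : Prop :=
  forall i j, derivable (fun z => F z i j) y v.

Lemma is_derive_addr (f g : 'rV[R]_n -> R) y v df dg :
  is_derive y v f df -> is_derive y v g dg -> is_derive y v (fun z => f z + g z) (df + dg).
Proof. by move=> [d1 <-] [d2 <-]; split; [exact: (derivableD d1 d2) | exact: (deriveD d1 d2)]. Qed.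

Lemma is_derive_mulr (f g : 'rV[R]_n -> R) y v df dg :
  is_derive y v f df -> is_derive y v g dg ->
  is_derive y v (fun z => f z * g z) (df * g y + f y * dg).
Proof.
move=> [d1 <-] [d2 <-]; split; first exact: (derivableM d1 d2).
by rewrite addrC [_ * g y]mulrC; exact: (deriveM d1 d2).
Qed.

Lemma is_derive_sumr (I : Type) (r : seq I) (F : I -> 'rV[R]_n -> R) y v (dF : I -> R) :
  (forall i, is_derive y v (F i) (dF i)) ->
  is_derive y v (fun z => \sum_(i <- r) F i z) (\sum_(i <- r) dF i).
Proof.
move=> H; elim: r => [|i r IH].
  rewrite big_nil (_ : (fun z => _) = fun=> 0); last by apply/funext => z; rewrite big_nil.
  exact: is_derive_cst.
rewrite big_cons (_ : (fun z => _) = (fun z => F i z + \sum_(i <- r) F i z)); last first.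
  by apply/funext => z; rewrite big_cons.
exact: (is_derive_addr (H i) IH).
Qed.

Lemma mderivableM m k l v (F : 'rV[R]_n -> 'M[R]_(m, k)) (G : 'rV[R]_n -> 'M[R]_(k, l)) y :
  mderivable v F y -> mderivable v G y ->
  mderivable v (fun z => F z *m G z) y /\
  dm v (fun z => F z *m G z) y = dm v F y *m G y + F y *m dm v G y.
Proof.
move=> dF dG.
have E i j : is_derive y v (fun z => (F z *m G z) i j)
   (\sum_a ('D_v (fun z => F z i a) y * G y a j + F y i a * 'D_v (fun z => G z a j) y)).
  rewrite (_ : (fun z => _) = (fun z => \sum_a F z i a * G z a j)); last first.
    by apply/funext => z; rewrite mxE.
  apply: is_derive_sumr => a.
  exact: (is_derive_mulr (DeriveDef (dF i a) erefl) (DeriveDef (dG a j) erefl)).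
split; first by move=> i j; have [] := E i j.
apply/matrixP => i j; rewrite !mxE; have [_ ->] := E i j.
by rewrite -big_split /=; apply: eq_bigr => a _; rewrite !mxE.
Qed.

Lemma mderivableT m k v (F : 'rV[R]_n -> 'M[R]_(m, k)) y : mderivable v F y ->
  mderivable v (fun z => (F z)^T) y /\ dm v (fun z => (F z)^T) y = (dm v F y)^T.
Proof.
move=> dF; split.
  move=> i j; rewrite (_ : (fun z => _) = (fun z => F z j i)) //.
  by apply/funext => z; rewrite mxE.
apply/matrixP => i j; rewrite !mxE; congr ('D_v _ y).
by apply/funext => z; rewrite mxE.
Qed.

Lemma dm_ext m k v (F G : 'rV[R]_n -> 'M[R]_(m, k)) (U : set 'rV[R]_n) y : open U -> U y ->
  (forall z, U z -> F z = G z) -> dm v F y = dm v G y.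
Proof.
move=> oU Uy E; apply/matrixP => i j; rewrite !mxE; apply: near_eq_derive.
by apply: filterS (open_nbhs_nbhs (conj oU Uy)) => z Uz; rewrite E.
Qed.

Lemma dm_id v y : dm v id y = v.
Proof.
apply/matrixP => i j; rewrite mxE (ord1 i).
by have [_ ->] := is_derive_coord y v j.
Qed.

Lemma mderivable_id v y : mderivable v id y.
Proof. by move=> i j; rewrite (ord1 i); have [] := is_derive_coord y v j. Qed.

End matrix_derivative.

(** Entrywise variant of [jac], which matches the coordinatewise form of [Reg]; the two agree where
    the coordinates are derivable, see [jac_jacm]. *)
Definition jacm (R : realType) d (c : 'rV[R]_d -> 'rV[R]_d) (y : 'rV[R]_d) : 'M[R]_d :=
  \matrix_(i, j) 'D_('e_i) (fun z => c z 0 j) y.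

Lemma jacmE (R : realType) d (c : 'rV[R]_d -> 'rV[R]_d) y i j :
  jacm c y i j = 'D_('e_i) (fun z => c z 0 j) y.
Proof. exact: mxE. Qed.

Lemma dmE (R : realType) n m k v (F : 'rV[R]_n -> 'M[R]_(m, k)) y i j :
  dm v F y i j = 'D_v (fun z => F z i j) y.
Proof. exact: mxE. Qed.

Opaque dm jacm.

(** With H the inverse metric, this is twice the partial derivative in x_k of the geodesic
    Hamiltonian (1/2) p H(x) p^T. *)
Definition hess (R : realType) d (H : 'rV[R]_d -> 'M[R]_d) (p x : 'rV[R]_d) (k : 'I_d) : R :=
  (p *m dm 'e_k H x *m p^T) 0 0.

(** * Hamilton's equations along the rays of normal coordinates *)

Section radial_flow.
Context {R : realType} {d : nat}.
Variables (U W : set 'rV[R]_d) (c : 'rV[R]_d -> 'rV[R]_d) (g H : 'rV[R]_d -> 'M[R]_d).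
Hypotheses (oU : open U) (oW : open W) (UW : forall y, U y -> W (c y)).
Hypothesis Rc : forall j, Reg 0 3 U (fun y => c y 0 j).
Hypothesis Rg : forall i j, Reg 0 2 W (fun x => g x i j).
Hypothesis RH : forall i j, Reg 0 2 W (fun x => H x i j).
Hypothesis gT : forall x, W x -> (g x)^T = g x.
Hypothesis HT : forall x, W x -> (H x)^T = H x.
Hypothesis gH : forall x, W x -> g x *m H x = 1%:M.

Local Notation M := (jacm c).
Hypothesis Mu : forall y, U y -> M y \in unitmx.
Hypothesis gauss : forall y, U y -> y *m (M y *m g (c y) *m (M y)^T) = y.

(** The ray s |-> c (s y) has velocity y M(y) at s = 1; lowering it by the metric g gives this
    covector. By the Gauss lemma it pulls back to y itself, see [momentum_dual]. *)
Definition momentum (y : 'rV[R]_d) : 'rV[R]_d := y *m M y *m g (c y).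

Lemma th01 : (0:R) <= 0 <= (1:R). Proof. by rewrite lexx ler01. Qed.

Lemma RM i j : Reg 0 2 U (fun y => M y i j).
Proof.
by apply: (Reg_ext oU _ (Reg_derive i (Rc j))) => y _; rewrite jacmE.
Qed.

Lemma Rc2 j : Reg 0 2 U (fun y => c y 0 j).
Proof. exact: (RegW th01 oU (Rc j)). Qed.

Lemma Rgc i j : Reg 0 2 U (fun y => g (c y) i j).
Proof. exact: (Reg_comp (f := fun x => g x i j) oU oW UW (Rg i j) Rc2). Qed.

Lemma RHc i j : Reg 0 2 U (fun y => H (c y) i j).
Proof. exact: (Reg_comp (f := fun x => H x i j) oU oW UW (RH i j) Rc2). Qed.

Lemma Reg_mulmx (k : nat) m a b (F : 'rV[R]_d -> 'M[R]_(m, a)) (G : 'rV[R]_d -> 'M[R]_(a, b)) :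
  (forall i j, Reg 0 k U (fun y => F y i j)) -> (forall i j, Reg 0 k U (fun y => G y i j)) ->
  forall i j, Reg 0 k U (fun y => (F y *m G y) i j).
Proof.
move=> RF RG i j; apply: (@Reg_ext _ _ _ _ _ (fun y => \sum_l F y i l * G y l j)) => //.
  by move=> y _; rewrite mxE.
by apply: (Reg_sum oU) => l; exact: (RegM th01 oU).
Qed.

Lemma Reg_momentum i : Reg 0 2 U (fun y => momentum y 0 i).
Proof.
apply: (@Reg_mulmx 2 1 d d (fun y => y *m M y) (fun y => g (c y)) _ Rgc 0 i) => a b.
apply: (@Reg_mulmx 2 1 d d id M _ RM a b) => a' b'.
by rewrite (ord1 a'); exact: (Reg_coord th01).
Qed.

Lemma Reg_mderivable k m a (F : 'rV[R]_d -> 'M[R]_(m, a)) i y :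
  (forall i j, Reg 0 k.+1 U (fun y => F y i j)) -> U y -> mderivable 'e_i F y.
Proof. by move=> RF Uy a' b; refine (Reg_derivable (RF a' b) Uy). Qed.

Lemma momentum_velocity y : U y -> y *m M y = momentum y *m H (c y).
Proof. by move=> Uy; rewrite /momentum -mulmxA gH ?mulmx1 //; exact: UW. Qed.

Lemma momentum_dual y : U y -> momentum y *m (M y)^T = y.
Proof. by move=> Uy; have := gauss Uy; rewrite /momentum !mulmxA. Qed.

Lemma momentum_energy y : U y -> momentum y *m H (c y) *m (momentum y)^T = y *m y^T.
Proof.
move=> Uy; rewrite -momentum_velocity // -mulmxA; congr (_ *m _).
by have := congr1 trmx (momentum_dual Uy); rewrite trmx_mul trmxK.
Qed.

Opaque momentum.

Lemma dm_comm y (a b l : 'I_d) : U y -> dm 'e_b M y a l = dm 'e_a M y b l.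
Proof.
move=> Uy.
have E (i k : 'I_d) : 'D_('e_i) (fun z => M z k l) y = 'D_('e_i) ('D_('e_k) (fun z => c z 0 l)) y.
  by have -> : (fun z => M z k l) = 'D_('e_k) (fun z => c z 0 l) by apply/funext => z; exact: jacmE.
refine (etrans (dmE 'e_b M y a l) _); refine (etrans _ (esym (dmE 'e_a M y b l))).
refine (etrans (E b a) _); refine (etrans _ (esym (E a b))).
exact: (derive_comm _ _ oU (RegW th01 oU (Rc l)) Uy).
Qed.

Lemma dm_H y b : U y -> dm 'e_b (fun z => H (c z)) y = \sum_k M y b k *: dm 'e_k H (c y).
Proof.
move=> Uy; apply/matrixP => i j; rewrite dmE summxE.
have [_ E] := @is_derive_comp_Reg R d d U W (fun x => H x i j) c 1 y b oW (UW Uy) (RH i j)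
  (fun j' => RegW th01 oU (Rc j')) Uy.
rewrite [LHS]E; apply: eq_bigr => k _.
by rewrite mxE dmE jacmE.
Qed.

(** Two identities are differentiated in direction b. From p M^T = y, after pairing with y, one gets
    S + X = y_b; from p H p^T = y y^T one gets 2 S + Q = 2 y_b, with S, Q, X as in the proof.
    Eliminating S, the only term with derivatives of p, leaves X = Q / 2. *)
Lemma radial_term y b : U y ->
  (momentum y *m (dm 'e_b M y)^T *m y^T) 0 0 = 2^-1 * \sum_k M y b k * hess H (momentum y) (c y) k.
Proof.
move=> Uy.
have mp : mderivable 'e_b momentum y.
  by apply: (@Reg_mderivable 1) => // i j; rewrite (ord1 i); exact: Reg_momentum.
have mM : mderivable 'e_b M y := Reg_mderivable (k := 1) RM Uy.
have mH : mderivable 'e_b (fun y => H (c y)) y := Reg_mderivable (k := 1) RHc Uy.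
have [mMT dMT] := mderivableT mM.
have [mpT dpT] := mderivableT mp.
have [_ d1] := mderivableM mp mMT.
have [mpH d2] := mderivableM mp mH.
have [_ d3] := mderivableM mpH mpT.
have [miT diT] := mderivableT (@mderivable_id R d 'e_b y).
have [_ d4] := mderivableM (@mderivable_id R d 'e_b y) miT.
have e1 : dm 'e_b momentum y *m (M y)^T + momentum y *m (dm 'e_b M y)^T = 'e_b.
  rewrite -dMT -d1 -[RHS](dm_id 'e_b y).
  by apply: (dm_ext _ oU Uy) => z Uz; rewrite momentum_dual.
have e3 : dm 'e_b (fun z => momentum z *m H (c z) *m (momentum z)^T) y = dm 'e_b (fun z => z *m z^T) y.
  by apply: (dm_ext _ oU Uy) => z Uz; rewrite momentum_energy.
have HMy : H (c y) *m (momentum y)^T = (M y)^T *m y^T.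
  have := congr1 trmx (momentum_velocity Uy).
  rewrite [(y *m _)^T]trmx_mul [(momentum y *m _)^T]trmx_mul HT //; exact: UW.
have sym1 : momentum y *m H (c y) *m (dm 'e_b momentum y)^T = dm 'e_b momentum y *m H (c y) *m (momentum y)^T.
  rewrite -[LHS]trmxK [(_ *m (dm 'e_b momentum y)^T)^T]trmx_mul trmxK [(momentum y *m _)^T]trmx_mul HT; last exact: UW.
  by rewrite mulmxA; apply/matrixP => i j; rewrite (ord1 i) (ord1 j) mxE.
move: e3; rewrite d3 d2 d4 dpT diT !dm_id sym1 => e3.
pose S := dm 'e_b momentum y *m H (c y) *m (momentum y)^T.
pose Q := momentum y *m dm 'e_b (fun z => H (c z)) y *m (momentum y)^T.
pose X := momentum y *m (dm 'e_b M y)^T *m y^T.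
have sym2 : y *m ('e_b : 'rV[R]_d)^T = 'e_b *m y^T.
  by apply/matrixP => i j; rewrite (ord1 i) (ord1 j) !mxE; apply: eq_bigr => k _; rewrite !mxE mulrC.
have E3 : S + Q + S = 'e_b *m y^T + 'e_b *m y^T.
  by rewrite /S /Q -mulmxDl e3; congr (_ + _).
have E1 : S + X = 'e_b *m y^T.
  transitivity ((dm 'e_b momentum y *m (M y)^T + momentum y *m (dm 'e_b M y)^T) *m y^T).
    by rewrite mulmxDl; congr (_ + _); rewrite /S -(mulmxA (dm 'e_b momentum y)) HMy mulmxA.
  by rewrite e1.
have EX : X 0 0 = 2^-1 * Q 0 0.
  have h1 := congr1 (fun A : 'M[R]_1 => A 0 0) E3; have h2 := congr1 (fun A : 'M[R]_1 => A 0 0) E1.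
  rewrite mxE in h2; rewrite mxE [in LHS]mxE [in RHS]mxE in h1.
  by move: h1 h2; move: (S 0 0) (Q 0 0) (X 0 0) (('e_b *m y^T) 0 0) => a1 a2 a3 a4; lra.
rewrite -/X EX; congr (_ * _); rewrite /Q dm_H // mulmx_sumr mulmx_suml summxE.
by apply: eq_bigr => k _; rewrite -scalemxAr -scalemxAl; exact: mxE.
Qed.

(** Hamilton's equation for the momentum. The extra summand [momentum y] is due to scaling: p (t y)
    is t times the momentum of the ray at time t. Differentiating [momentum_dual] along y and
    exchanging the derivatives of M by [dm_comm] leads to [radial_term], and M is invertible. *)
Lemma radial_momentum y k : U y ->
  'D_y (fun z => momentum z 0 k) y = momentum y 0 k - 2^-1 * hess H (momentum y) (c y) k.
Proof.
move=> Uy.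
pose D : 'rV[R]_d := \sum_a y 0 a *: dm 'e_a momentum y.
have DE j : 'D_y (fun z => momentum z 0 j) y = D 0 j.
  have [_ ->] := RegS_differentiable oU (Reg_momentum j) Uy.
  by rewrite /D summxE; apply: eq_bigr => a _; rewrite mxE dmE.
pose Kv : 'rV[R]_d := \row_k hess H (momentum y) (c y) k.
suff E : D = momentum y - 2^-1 *: Kv by rewrite DE E !mxE.
suff E : D *m (M y)^T = (momentum y - 2^-1 *: Kv) *m (M y)^T.
  by apply: (can_inj (mulmxK _)) E; rewrite unitmx_tr Mu.
apply/rowP => b; rewrite mulmxBl momentum_dual //.
have e1 a : dm 'e_a momentum y *m (M y)^T + momentum y *m (dm 'e_a M y)^T = 'e_a.
  have mp : mderivable 'e_a momentum y.
    by apply: (@Reg_mderivable 1) => // i j; rewrite (ord1 i); exact: Reg_momentum.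
  have mM : mderivable 'e_a M y := Reg_mderivable (k := 1) RM Uy.
  have [mMT dMT] := mderivableT mM.
  have [_ d1] := mderivableM mp mMT.
  rewrite -dMT -d1 -[RHS](dm_id 'e_a y).
  by apply: (dm_ext _ oU Uy) => z Uz; rewrite momentum_dual.
have yE : y = \sum_a y 0 a *: 'e_a by rewrite -row_sum_delta.
have -> : D *m (M y)^T = y - \sum_a y 0 a *: (momentum y *m (dm 'e_a M y)^T).
  transitivity (\sum_a (y 0 a *: 'e_a - y 0 a *: (momentum y *m (dm 'e_a M y)^T))).
    rewrite /D mulmx_suml; apply: eq_bigr => a _.
    by rewrite -scalemxAl -scalerBr; congr (_ *: _); exact: (canRL (addrK _) (e1 a)).
  by rewrite sumrB -yE.
rewrite [LHS]mxE [RHS]mxE; congr (_ + _); rewrite [LHS]mxE [RHS]mxE; congr (- _).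
rewrite summxE -scalemxAl [RHS]mxE [(Kv *m _) 0 b]mxE.
under [in RHS]eq_bigr => k' _ do rewrite mxE [(M y)^T _ _]mxE mulrC.
rewrite -radial_term // [RHS]mxE; apply: eq_bigr => a _.
rewrite mxE [y^T _ _]mxE mulrC; congr (_ * _).
have Er : (momentum y *m (dm 'e_a M y)^T) 0 b = (momentum y *m (dm 'e_b M y)^T) 0 a.
  rewrite [LHS]mxE [RHS]mxE; apply: eq_bigr => l _; congr (_ * _).
  refine (etrans (mxE _ _ _ _) _); refine (etrans _ (esym (mxE _ _ _ _))).
  exact: (dm_comm b a l Uy).
exact: Er.
Qed.

End radial_flow.

(** * Gronwall's lemma and derivatives along rays *)

Section one_variable.
Context {R : realType}.

(** The function f (t) exp (- C t) has nonpositive derivative; neither f nor C needs a sign. *)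
Lemma gronwall (f df : R -> R) (a b C : R) : a <= b ->
  (forall t : R, a <= t <= b -> is_derive t 1 f (df t)) ->
  (forall t, a <= t <= b -> df t <= C * f t) -> f b <= expR (C * (b - a)) * f a.
Proof.
rewrite le_eqVlt => /orP[/eqP <-|ab] Df le; first by rewrite subrr mulr0 expR0 mul1r.
pose e t := expR (- (C * t)).
have De (t : R) : is_derive t 1 e (- C * e t).
  have [d1 E1] : is_derive t 1 (fun s : R => - C * s) (- C).
    have [d1 E1] := is_derive_id t (1 : R).
    have [d2 E2] := is_derive_cst (- C) t (1 : R).
    have -> : (fun s : R => - C * s) = cst (- C) * id by [].
    split; first exact: (derivableM d2 d1).
    have -> : 'D_1 (cst (- C) * id) t = cst (- C) t *: 'D_1 id t + id t *: 'D_1 (cst (- C)) t by exact: (deriveM d2 d1).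
    by rewrite E1 E2 scaler0 addr0 /GRing.scale /= mulr1.
  have e' : e = expR \o (fun s : R => - C * s) by apply/funext => s; rewrite /e /= mulNr.
  rewrite e'; apply: is_derive_eq (is_derive1_comp (is_derive_expR _) (DeriveDef d1 E1)) _.
  by rewrite mulrC.
pose F t := f t * e t.
have DF (t : R) : a <= t <= b -> is_derive t 1 F (df t * e t + f t * (- C * e t)).
  move=> /Df [d1 E1]; have [d2 E2] := De t; split; first exact: (derivableM d1 d2).
  have -> : 'D_1 F t = f t *: 'D_1 e t + e t *: 'D_1 f t by exact: (deriveM d1 d2).
  by rewrite E1 E2 addrC [_ *: df t]mulrC.
have [||c cab E] := @MVT R F (fun t => df t * e t + f t * (- C * e t)) a b ab.
- by move=> x; rewrite in_itv /= => /andP[x0 x1]; apply: DF; rewrite !ltW.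
- apply: derivable_within_continuous => x; rewrite in_itv /= => x01.
  by case: (DF x x01).
have {}cab : a <= c <= b by move: cab; rewrite in_itv /= => /andP[? ?]; rewrite !ltW.
have ec0 : 0 < e c by exact: expR_gt0.
have : F b <= F a.
  rewrite -subr_le0 E pmulr_lle0 ?subr_gt0 //.
  have := le c cab; nra.
rewrite /F /e => h.
have eb : 0 < expR (C * b) by exact: expR_gt0.
have := ler_wpM2l (ltW eb) h.
rewrite mulrCA -expRD subrr expR0 mulr1 => h2; apply: (le_trans h2).
by rewrite mulrCA -expRD mulrC -mulrBr.
Qed.

Lemma mvt_bound (f df : R -> R) (a b V : R) : a <= b ->
  (forall t : R, a <= t <= b -> is_derive t 1 f (df t)) ->
  (forall t, a <= t <= b -> `|df t| <= V) -> `|f b - f a| <= V * (b - a).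
Proof.
move=> ab Df bV.
have [||c cab ->] := @MVT_segment R f df a b ab.
- by move=> x; rewrite in_itv /= => /andP[x0 x1]; apply: Df; rewrite !ltW.
- apply: derivable_within_continuous => x; rewrite in_itv /= => x01.
  by case: (Df x x01).
rewrite normrM (ger0_norm (x := b - a)) ?subr_ge0 // ler_wpM2r ?subr_ge0 //.
by apply: bV; move: cab; rewrite in_itv.
Qed.

Lemma is_derive_sum1 (I : Type) (r : seq I) (F : I -> R -> R) (y : R) (dF : I -> R) :
  (forall i, is_derive y 1 (F i) (dF i)) ->
  is_derive y 1 (fun z => \sum_(i <- r) F i z) (\sum_(i <- r) dF i).
Proof.
move=> H; elim: r => [|i r IH].
  rewrite big_nil (_ : (fun z => _) = fun=> 0); last by apply/funext => z; rewrite big_nil.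
  exact: is_derive_cst.
rewrite big_cons (_ : (fun z => _) = (fun z => F i z + \sum_(i <- r) F i z)); last first.
  by apply/funext => z; rewrite big_cons.
have [d1 <-] := H i; have [d2 <-] := IH.
by split; [exact: (derivableD d1 d2) | exact: (deriveD d1 d2)].
Qed.

Lemma is_derive_sqrB (f g : R -> R) (t df dg : R) : is_derive t 1 f df -> is_derive t 1 g dg ->
  is_derive t 1 (fun s => (f s - g s) ^+ 2) (2 * (f t - g t) * (df - dg)).
Proof.
move=> [d1 <-] [d2 <-].
have [d3 E3] : is_derive t 1 (f - g) ('D_1 f t - 'D_1 g t).
  by split; [exact: (derivableB d1 d2) | exact: (deriveB d1 d2)].
rewrite (_ : (fun s => _) = (f - g) * (f - g)); last by apply/funext => s; rewrite expr2.
split; first exact: (derivableM d3 d3).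
have -> : 'D_1 ((f - g) * (f - g)) t = (f - g) t *: 'D_1 (f - g) t + (f - g) t *: 'D_1 (f - g) t.
  exact: (deriveM d3 d3).
by rewrite E3 -mulr2n -[in LHS]mulr_natl -mulrA.
Qed.

Lemma is_derive_ray n (f : 'rV[R]_n -> R) (y : 'rV[R]_n) (t : R) :
  derivable f (t *: y) y -> is_derive t 1 (fun s => f (s *: y)) ('D_y f (t *: y)).
Proof.
move=> dfy.
have e : (fun h : R => h^-1 *: (((fun s => f (s *: y)) \o shift t) (h *: 1) - f (t *: y))) =
    (fun h : R => h^-1 *: ((f \o shift (t *: y)) (h *: y) - f (t *: y))).
  apply/funext => h; congr (_ *: (_ - _)) => /=; congr f.
  by rewrite [h%:A]mulr1 scalerDl.
by split; rewrite /derivable /derive e.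
Qed.

End one_variable.

Section quadratic.
Context {R : realType} {d : nat}.

Definition quad (A : 'M[R]_d) (v : 'rV[R]_d) : R := (v *m A *m v^T) 0 0.

Lemma quadE A v : quad A v = \sum_i \sum_j v 0 i * A i j * v 0 j.
Proof.
rewrite /quad mxE exchange_big /=; apply: eq_bigr => j _.
by rewrite !mxE mulr_suml; apply: eq_bigr => i _; rewrite ?mxE.
Qed.

Lemma quad_continuous A : continuous (quad A).
Proof.
move=> v; rewrite (_ : quad A = fun v => \sum_i \sum_j v 0 i * A i j * v 0 j); last first.
  by apply/funext => w; rewrite quadE.
apply: (@cvg_sumr _ _ _ (nbhs v)) => i _; apply: (@cvg_sumr _ _ _ (nbhs v)) => j _.
by apply: cvgM; [apply: cvgM; [exact: coord_continuous|exact: cvg_cst]|exact: coord_continuous].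
Qed.

Lemma quadZ A (a : R) v : quad A (a *: v) = a ^+ 2 * quad A v.
Proof.
rewrite !quadE mulr_sumr; apply: eq_bigr => i _; rewrite mulr_sumr; apply: eq_bigr => j _.
by rewrite !mxE; ring.
Qed.

Lemma posdef_lower A : (forall v, v != 0 -> 0 < quad A v) ->
  exists2 m : R, 0 < m & forall v, m * `|v| ^+ 2 <= quad A v.
Proof.
move=> pos; pose S := [set v : 'rV[R]_d | `|v| = 1].
(* An empty unit sphere means dimension 0, where any m will do; otherwise the minimum on the compact
   sphere is the constant. *)
have [S0|/set0P S0] := eqVneq S set0.
  exists 1 => // v; have [->|v0] := eqVneq v 0.
    by rewrite normr0 expr0n mulr0 /quad mul0mx mul0mx mxE.
  exfalso; have : S (`|v|^-1 *: v).
    by rewrite /S /= normrZ normfV normr_id mulVf // normr_eq0.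
  by rewrite S0.
have cS : compact S.
  apply: bounded_closed_compact.
    by exists 1; split => // x x1 v /= ->; exact: ltW.
  have -> : S = (fun v : 'rV[R]_d => `|v|) @^-1` [set 1] by [].
  by apply: closed_comp => [v _|]; [exact: norm_continuous | exact: closed_eq].
have [v0 Sv0 H] := @EVT_min_rV R d (quad A) S S0 cS (continuous_subspaceT (@quad_continuous A)).
have v00 : v0 != 0 by move: Sv0; rewrite inE /S /= => Sv0; rewrite -normr_eq0 Sv0 oner_eq0.
exists (quad A v0); first exact: pos.
move=> v; have [->|vn0] := eqVneq v 0.
  by rewrite normr0 expr0n mulr0 /quad mul0mx mul0mx mxE.
have nv : `|v| != 0 by rewrite normr_eq0.
have -> : v = `|v| *: (`|v|^-1 *: v) by rewrite scalerA mulfV // scale1r.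
rewrite quadZ normrZ normr_id normrZ normfV normr_id mulVf // mulr1 mulrC.
rewrite ler_wpM2l ?sqr_ge0 //; apply: H.
by rewrite /S inE /= normrZ normfV normr_id mulVf.
Qed.

Lemma quad_perturb (A A' : 'M[R]_d) (e : R) v : (forall i j, `|A i j - A' i j| <= e) ->
  `|quad A v - quad A' v| <= e * (d%:R * `|v|) ^+ 2.
Proof.
move=> H; rewrite !quadE -sumrB.
have -> : e * (d%:R * `|v|) ^+ 2 = \sum_(i < d) \sum_(j < d) (e * `|v| ^+ 2).
  by rewrite !sumr_const !card_ord -mulrnA -[RHS]mulr_natr natrM; ring.
apply: le_trans (ler_norm_sum _ _ _) _; apply: ler_sum => i _; rewrite -sumrB.
apply: le_trans (ler_norm_sum _ _ _) _; apply: ler_sum => j _.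
have -> : v 0 i * A i j * v 0 j - v 0 i * A' i j * v 0 j = (A i j - A' i j) * (v 0 i * v 0 j) by ring.
by rewrite normrM ler_pM // normrM expr2 ler_pM // coord_le.
Qed.

End quadratic.

Section local_bounds.
Context {R : realType} {d : nat}.

Lemma local_bounds (I : finType) (F : I -> 'rV[R]_d -> R) (W : set 'rV[R]_d) x0 :
  open W -> W x0 -> (forall i, Reg 0 1 W (F i)) ->
  exists2 C : R, 0 <= C & \forall e \near (0:R)^'+, forall i x x', `|x - x0| <= e -> `|x' - x0| <= e ->
    [/\ W x, `|F i x| <= C & `|F i x - F i x'| <= C * `|x - x'|].
Proof.
move=> oW Wx0 RF.
have S i : exists p : R * R, [/\ 0 < p.1, 0 <= p.2 & forall y z, `|y - x0| <= p.1 -> `|z - x0| <= p.1 ->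
   `|F i y - F i z| <= p.2 * `|y - z|].
  have [||d0 d00 [C C0 H]] := @C1_lip R d (F i) x0.
  - move=> j; apply: filterS (open_nbhs_nbhs (conj oW Wx0)) => z Wz.
    exact: Reg_derivable (RF i) Wz.
  - by move=> j; exact: Reg_cont (Reg_derive j (RF i)) Wx0.
  by exists (d0, C).
have [p Hp] := choice S.
pose C := \sum_i (`|F i x0| + (p i).2 * ((p i).1 + 1)).
have pos i : 0 <= `|F i x0| + (p i).2 * ((p i).1 + 1).
  by have [h1 h2 _] := Hp i; rewrite addr_ge0 // mulr_ge0 // addr_ge0 // ltW.
have leC i : `|F i x0| + (p i).2 * ((p i).1 + 1) <= C.
  by rewrite /C (bigD1 i) //= lerDl sumr_ge0.
exists C; first by rewrite sumr_ge0.
have [r /= r0 Hr] : exists2 r : R, 0 < r & forall x, `|x - x0| <= r -> W x.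
  have := open_nbhs_nbhs (conj oW Wx0); move=> /nbhs_ballP [r /= r0 Hr].
  exists (r / 2); first by rewrite divr_gt0.
  move=> x hx; apply: Hr; rewrite -ball_normE /= distrC (le_lt_trans hx) //.
  by rewrite ltr_pdivrMr // ltr_pMr // ltr1n.
have N : \forall e \near (0:R)^'+, forall i, e <= (p i).1.
  by apply: filter_forall => i; apply: nbhs_right_le; have [] := Hp i.
near=> e => i x x' hx hx'.
have er : e <= r by near: e; exact: nbhs_right_le.
have ep : e <= (p i).1 by move: i {hx hx'}; near: e; exact: N.
have [p1 p2 H] := Hp i; split.
- by apply: Hr; exact: le_trans er.
- apply: le_trans (leC i).
  have h := H x x0 (le_trans hx ep); rewrite subrr normr0 in h.
  have {}h := h (ltW p1).
  rewrite -[F i x](subrK (F i x0)); apply: le_trans (ler_normD _ _) _.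
  rewrite addrC lerD2l; apply: le_trans h _; rewrite ler_wpM2l //.
  by apply: le_trans hx _; apply: le_trans ep _; rewrite lerDl.
- apply: le_trans (H _ _ (le_trans hx ep) (le_trans hx' ep)) _; rewrite ler_wpM2r //.
  apply: le_trans (leC i).
  by apply: ler_wpDl => //; rewrite ler_peMr // lerDr ltW.
Unshelve. all: by end_near.
Qed.

End local_bounds.

Lemma double_sum_le (R : realType) d (x x' : 'I_d -> 'I_d -> R) (K : R) :
  (forall a b, `|x a b - x' a b| <= K) ->
  `|\sum_a \sum_b x a b - \sum_a \sum_b x' a b| <= d%:R * d%:R * K.
Proof.
move=> H; rewrite -sumrB.
have -> : d%:R * d%:R * K = \sum_(a < d) \sum_(b < d) K.
  by rewrite !sumr_const !card_ord -mulrnA -natrM mulr_natl.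
apply: le_trans (ler_norm_sum _ _ _) _; apply: ler_sum => a _; rewrite -sumrB.
by apply: le_trans (ler_norm_sum _ _ _) _; apply: ler_sum => b _.
Qed.

Lemma growth_constants_ge0 (R : realType) (D G P : R) : 0 <= D -> 0 <= G -> 0 <= P ->
  0 <= D * (G + P * G) /\ 0 <= 2^-1 * (D * D * (P * G + (G + P * G) * P)).
Proof.
move=> D0 G0 P0; split; first by rewrite mulr_ge0 // addr_ge0 // mulr_ge0.
by rewrite mulr_ge0 ?invr_ge0 // mulr_ge0 ?mulr_ge0 // addr_ge0 ?mulr_ge0 // addr_ge0 ?mulr_ge0.
Qed.

(* Along the rays of a normal chart c, position and momentum solve Hamilton's
   equations, and so do the derivatives of c with respect to the initial
   velocity. Gronwall's lemma bounds these derivatives up to the boundary of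
   the ball, near every limit point x0, where the definition of a normal chart
   gives no information. *)
Section ray.
Context {R : realType} {d : nat}.
Variables (U W : set 'rV[R]_d) (c : 'rV[R]_d -> 'rV[R]_d) (g H : 'rV[R]_d -> 'M[R]_d).
Hypotheses (oU : open U) (oW : open W) (UW : forall y, U y -> W (c y)).
Hypothesis Rc : forall j, Reg 0 3 U (fun y => c y 0 j).
Hypothesis Rg : forall i j, Reg 0 2 W (fun x => g x i j).
Hypothesis RH : forall i j, Reg 0 2 W (fun x => H x i j).
Hypothesis gT : forall x, W x -> (g x)^T = g x.
Hypothesis HT : forall x, W x -> (H x)^T = H x.
Hypothesis gH : forall x, W x -> g x *m H x = 1%:M.
Hypothesis Mu : forall y, U y -> jacm c y \in unitmx.
Hypothesis gauss : forall y, U y -> y *m (jacm c y *m g (c y) *m (jacm c y)^T) = y.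
Variables (rho : R) (x0 : 'rV[R]_d).
Hypothesis U_ball : forall y, U y -> enorm y < rho.
Hypothesis Wx0 : W x0.
Hypothesis gpos : forall v, v != 0 -> 0 < quad (g x0) v.
Let S (del : R) : set 'rV[R]_d := [set y | U y /\ `|c y - x0| <= del].
Variable del0 : R.
Hypothesis del00 : 0 < del0.
Hypothesis S_closed : forall del, 0 < del < del0 -> forall y, enorm y < rho -> closure (S del) y -> S del y.

Local Notation p := (momentum c g).
Let vel (y : 'rV[R]_d) : 'rV[R]_d := y *m jacm c y.

Lemma vel_momentum y : U y -> vel y = p y *m H (c y).
Proof. by move=> Uy; rewrite /vel (momentum_velocity UW gH Uy). Qed.

Lemma momentum_vel y : p y = vel y *m g (c y).
Proof. by []. Qed.

Lemma quad_vel y : U y -> quad (g (c y)) (vel y) = enorm y ^+ 2.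
Proof.
move=> Uy; rewrite /quad -momentum_vel /vel trmx_mul mulmxA.
rewrite (momentum_dual gauss Uy) mxE /enorm sqr_sqrtr; last by apply: sumr_ge0 => i _; exact: sqr_ge0.
by apply: eq_bigr => i _; rewrite mxE expr2.
Qed.

Lemma derive_c_radial y j : U y -> 'D_y (fun z => c z 0 j) y = vel y 0 j.
Proof.
move=> Uy; have [_ ->] := RegS_differentiable oU (Rc j) Uy.
by rewrite /vel mxE; apply: eq_bigr => i _; rewrite jacmE.
Qed.

Lemma constants : exists (del G m : R), [/\ 0 < del, del < del0, 0 <= G, 0 < m &
  forall x x', `|x - x0| <= del -> `|x' - x0| <= del ->
  [/\ W x, (forall i j, `|g x i j| <= G),
     (forall i j, `|H x i j| <= G /\ `|H x i j - H x' i j| <= G * `|x - x'|),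
     (forall k i j, `|dm 'e_k H x i j| <= G /\ `|dm 'e_k H x i j - dm 'e_k H x' i j| <= G * `|x - x'|) &
     (forall v, m * `|v| ^+ 2 <= quad (g x) v)]].
Proof.
have th01 : (0:R) <= 0 <= (1:R) by rewrite lexx ler01.
have [m m0 Hm] := posdef_lower gpos.
have [Cg Cg0 Ng] := @local_bounds R d ('I_d * 'I_d)%type (fun ij x => g x ij.1 ij.2) W x0 oW Wx0
  (fun ij => RegW th01 oW (Rg ij.1 ij.2)).
have [CH CH0 NH] := @local_bounds R d ('I_d * 'I_d)%type (fun ij x => H x ij.1 ij.2) W x0 oW Wx0
  (fun ij => RegW th01 oW (RH ij.1 ij.2)).
have RD (i : 'I_d * 'I_d * 'I_d) : Reg 0 1 W (fun x => dm 'e_i.2 H x i.1.1 i.1.2).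
  apply: (Reg_ext oW _ (Reg_derive i.2 (RH i.1.1 i.1.2))) => y _; exact: (esym (dmE _ _ _ _ _)).
have [CD CD0 ND] := @local_bounds R d ('I_d * 'I_d * 'I_d)%type _ W x0 oW Wx0 RD.
have [CW CW0 NW] := @local_bounds R d unit (fun _ _ => 0) W x0 oW Wx0 (fun _ => Reg_cst 0 oW 1 0).
pose G := Cg + CH + CD.
have hg : Cg <= G by rewrite /G -addrA lerDl addr_ge0.
have hH : CH <= G by rewrite /G addrAC lerDr addr_ge0.
have hD : CD <= G by rewrite /G lerDr addr_ge0.
(* If the entries of g move by at most (m / 2) / (d + 1)^2, the quadratic form moves by at most (m /
   2) |v|^2, so half of the ellipticity at x0 survives. *)
have e0 : 0 < m / 2 / (Cg + 1) / (d.+1%:R ^+ 2).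
  by rewrite !divr_gt0 // ?exprn_gt0 // ltr_wpDl.
have : \forall del \near (0:R)^'+, [/\ 0 < del, del < del0 &
  forall x x', `|x - x0| <= del -> `|x' - x0| <= del ->
  [/\ W x, (forall i j, `|g x i j| <= G),
     (forall i j, `|H x i j| <= G /\ `|H x i j - H x' i j| <= G * `|x - x'|),
     (forall k i j, `|dm 'e_k H x i j| <= G /\ `|dm 'e_k H x i j - dm 'e_k H x' i j| <= G * `|x - x'|) &
     (forall v, m / 2 * `|v| ^+ 2 <= quad (g x) v)]].
  near=> del; split.
  - by near: del; exact: nbhs_right_gt.
  - by near: del; exact: nbhs_right_lt.
  have dele : del <= m / 2 / (Cg + 1) / (d.+1%:R ^+ 2) by near: del; exact: nbhs_right_le.
  have dpos : 0 < del by near: del; exact: nbhs_right_gt.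
  have Ng1 : forall i x x', `|x - x0| <= del -> `|x' - x0| <= del ->
    [/\ W x, `|g x i.1 i.2| <= Cg & `|g x i.1 i.2 - g x' i.1 i.2| <= Cg * `|x - x'|] by near: del.
  have NW1 : forall (i : unit) x x', `|x - x0| <= del -> `|x' - x0| <= del ->
    [/\ W x, `|0 : R| <= CW & `|(0:R) - 0| <= CW * `|x - x'|] by near: del.
  have NH1 : forall i x x', `|x - x0| <= del -> `|x' - x0| <= del ->
    [/\ W x, `|H x i.1 i.2| <= CH & `|H x i.1 i.2 - H x' i.1 i.2| <= CH * `|x - x'|] by near: del.
  have ND1 : forall i x x', `|x - x0| <= del -> `|x' - x0| <= del ->
    [/\ W x, `|dm 'e_i.2 H x i.1.1 i.1.2| <= CD &
        `|dm 'e_i.2 H x i.1.1 i.1.2 - dm 'e_i.2 H x' i.1.1 i.1.2| <= CD * `|x - x'|] by near: del.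
  move=> x x' hx hx'; split.
  - by have [] := NW1 tt x x' hx hx'.
  - by move=> i j; have [_ h _] := Ng1 (i, j) x x' hx hx'; exact: le_trans hg.
  - move=> i j; have [_ h h'] := NH1 (i, j) x x' hx hx'; split; first exact: le_trans hH.
    by apply: le_trans h' _; rewrite ler_wpM2r.
  - move=> k i j; have [_ h h'] := ND1 (i, j, k) x x' hx hx'; split; first exact: le_trans hD.
    by apply: le_trans h' _; rewrite ler_wpM2r.
  - move=> v; have e1 : forall i j, `|g x i j - g x0 i j| <= m / 2 / (d.+1%:R ^+ 2).
      move=> i j; have [|_ _ h] := Ng1 (i, j) x x0 hx _; first by rewrite subrr normr0 ltW.
      apply: le_trans h _; apply: (@le_trans _ _ (Cg * (m / 2 / (Cg + 1) / (d.+1%:R ^+ 2)))).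
        by rewrite ler_wpM2l // (le_trans hx).
      have C1 : 0 < Cg + 1 by rewrite ltr_wpDl.
      rewrite mulrA ler_wpM2r ?invr_ge0 ?exprn_ge0 // mulrA ler_pdivrMr // mulrC ler_wpM2l //.
        by rewrite divr_ge0 // ltW.
      by rewrite lerDl.
    have h2 : m / 2 / d.+1%:R ^+ 2 * (d%:R * `|v|) ^+ 2 <= m / 2 * `|v| ^+ 2.
      rewrite exprMn mulrA ler_wpM2r ?sqr_ge0 // -mulrA ler_piMr ?divr_ge0 ?(ltW m0) //.
      rewrite mulrC ler_pdivrMr ?exprn_gt0 // mul1r lerXn2r ?nnegrE // ler_nat; exact: leqnSn.
    have := le_trans (quad_perturb v e1) h2; have := Hm v.
    move: (quad (g x) v) (quad (g x0) v) => q1 q2 h1; rewrite ler_norml => /andP[h3 _].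
    apply: le_trans (_ : q2 - m / 2 * `|v| ^+ 2 <= _); last by rewrite lerBlDr -lerBlDl -lerN2 opprB.
    by rewrite lerBrDr -mulrDl -splitr.
move=> /filter_ex [del [h1 h2 h3]]; exists del, G, (m / 2); split=> //; last exact: divr_gt0.
by rewrite /G !addr_ge0.
Unshelve. all: by end_near.
Qed.

Lemma ray_derive k (f : 'rV[R]_d -> R) y (t : R) : Reg 0 k.+1 U f -> U (t *: y) -> t != 0 ->
  is_derive t 1 (fun s => f (s *: y)) (t^-1 * 'D_(t *: y) f (t *: y)).
Proof.
move=> Rf Uty t0; have [df Ef] := RegS_differentiable oU Rf Uty.
have -> : t^-1 * 'D_(t *: y) f (t *: y) = 'D_y f (t *: y).
  rewrite !Ef mulr_sumr; apply: eq_bigr => i _.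
  by rewrite [(t *: y) 0 i]mxE !mulrA mulVf // mul1r.
by apply: is_derive_ray; apply: diff_derivable.
Qed.

Section fixed_constants.
Variables (del G m : R).
Hypotheses (del_gt0 : 0 < del) (deldel0 : del < del0) (G0 : 0 <= G) (m0 : 0 < m).
Hypothesis HC : forall x x', `|x - x0| <= del -> `|x' - x0| <= del ->
  [/\ W x, (forall i j, `|g x i j| <= G),
     (forall i j, `|H x i j| <= G /\ `|H x i j - H x' i j| <= G * `|x - x'|),
     (forall k i j, `|dm 'e_k H x i j| <= G /\ `|dm 'e_k H x i j - dm 'e_k H x' i j| <= G * `|x - x'|) &
     (forall v, m * `|v| ^+ 2 <= quad (g x) v)].
(** By [quad_vel], m |vel y|^2 <= |y|^2 < rho^2 on [S del], so Q bounds the velocity. Pb bounds the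
    momentum divided by t for t >= 1/2, whence its factor 2. *)
Let Q := Num.sqrt (rho ^+ 2 / m).
Let Pb := 2 * (d%:R * (Q * G)).

Lemma Q_ge0 : 0 <= Q. Proof. exact: sqrtr_ge0. Qed.

Lemma Pb_ge0 : 0 <= Pb.
Proof. by rewrite /Pb mulr_ge0 // mulr_ge0 // mulr_ge0 // Q_ge0. Qed.

Lemma vel_bound y : S del y -> `|vel y| <= Q.
Proof.
move=> [Uy hy]; have [_ _ _ _ /(_ (vel y))] := HC hy hy.
rewrite quad_vel // => h; rewrite -[leLHS]ger0_norm // -sqrtr_sqr; apply: ler_wsqrtr.
rewrite ler_pdivlMr // mulrC; apply: le_trans h _.
by rewrite lerXn2r ?nnegrE ?enorm_ge0 ?(ltW (U_ball Uy)) // (le_trans (enorm_ge0 y)) // ltW // U_ball.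
Qed.

Lemma momentum_bound y k : S del y -> `|p y 0 k| <= d%:R * (Q * G).
Proof.
move=> Sy; have [Uy hy] := Sy; have [_ gb _ _ _] := HC hy hy.
rewrite momentum_vel mxE; apply: le_trans (ler_norm_sum _ _ _) _.
rewrite mulr_natl -[X in _ *+ X]card_ord -sumr_const; apply: ler_sum => i _.
by rewrite normrM ler_pM // (le_trans (coord_le _ _)) // vel_bound.
Qed.

Lemma S_le a b y : a <= b -> S a y -> S b y.
Proof. by move=> ab [Uy h]; split=> //; exact: le_trans ab. Qed.

(** Continuity argument run backwards from time 1, with s the supremum of the bad times. At s the
    point is still in [S] by closedness, and the speed bound places it within 5/8 del of x0; by
    continuity times slightly below s are good as well, which contradicts the choice of s. *)
Lemma ray_stays y tau : U y -> `|c y - x0| < del / 2 -> 1 / 2 <= tau <= 1 -> 2 * Q * (1 - tau) <= del / 8 ->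
  forall t, tau <= t <= 1 -> S (3 / 4 * del) (t *: y).
Proof.
move=> Uy hy /andP[tau12 tau1] htau t /andP[t0 t1].
apply: contrapT => nSt.
pose B := [set t | tau <= t <= 1 /\ ~ S (3 / 4 * del) (t *: y)].
have Bt : B t by split=> //; rewrite t0 t1.
have supB : has_sup B by split; [exists t | exists 1 => u [/andP[]]].
set s := sup B.
have st : t <= s by apply: sup_upper_bound.
have s1 : s <= 1 by apply: sup_le_ub => [|u [/andP[]]]; first by exists t.
have above u : s < u -> u <= 1 -> S (3 / 4 * del) (u *: y).
  move=> su u1; apply: contrapT => nS.
  have : u <= s by apply: sup_upper_bound => //; split=> //; rewrite u1 andbT (le_trans t0) // (le_trans st) // ltW.
  by rewrite leNgt su.
have S1 : S (3 / 4 * del) (1 *: y).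
  by rewrite scale1r; split=> //; apply: (le_trans (ltW hy)); move: del_gt0; lra.
have rho_y u : 0 <= u <= 1 -> enorm (u *: y) < rho.
  move=> /andP[u0 u1]; apply: le_lt_trans (U_ball Uy).
  rewrite /enorm; apply: ler_wsqrtr; apply: ler_sum => i _.
  rewrite mxE exprMn ler_piMl ?sqr_ge0 // exprn_ile1 //.
have s12 : 1 / 2 <= s by apply: le_trans st; apply: le_trans t0.
(* All times in (s, 1] are good, so s y is a limit of points of [S] inside the open ball. *)
have Ss : S (3 / 4 * del) (s *: y).
  have [s1'|] := eqVneq s 1; first by rewrite s1'.
  move=> sn1; have slt1 : s < 1 by rewrite lt_neqAle sn1.
  apply: S_closed; first by apply/andP; split; move: del_gt0 deldel0; lra.
    by apply: rho_y; rewrite s1 andbT (le_trans _ s12).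
  move=> N nN.
  have cs : (fun u : R => u *: y) @ s --> s *: y.
    by apply: cvgZr_tmp; exact: cvg_id.
  have /nbhs_ballP [e /= e0 He] := cs N nN.
  pose u := Num.min 1 (s + e / 2).
  have su : s < u by rewrite /u lt_min slt1 ltrDl divr_gt0.
  have u1 : u <= 1 by rewrite /u ge_min lexx.
  exists (u *: y); split; first exact: above.
  apply: He; rewrite /ball /= distrC ger0_norm ?subr_ge0 ?(ltW su) //.
  rewrite ltrBlDl; apply: (@le_lt_trans _ _ (s + e / 2)); first by rewrite /u ge_min lexx orbT.
  by rewrite ltrD2l ltr_pdivrMr // ltr_pMr // ltr1n.
have Sall u : s <= u -> u <= 1 -> S (3 / 4 * del) (u *: y).
  by rewrite le_eqVlt => /orP[/eqP <-//|]; exact: above.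
have [Us hs] := Ss.
(* From time 1 down to s the position moves at speed at most 2 Q (the factor u^-1 is at most 2),
   hence by at most del / 8 in each coordinate. *)
have close : `|c (s *: y) - x0| <= 5 / 8 * del.
  apply: norm_row_le; first by rewrite mulr_ge0 // ltW.
  move=> j; have H1 : `|c (1 *: y) 0 j - c (s *: y) 0 j| <= 2 * Q * (1 - s).
    apply: (@mvt_bound R (fun u => c (u *: y) 0 j) (fun u => u^-1 * vel (u *: y) 0 j)) => // u /andP[su u1].
      have Uu := (Sall u su u1).1; have u0 : u != 0 by rewrite gt_eqF //; move: su s12; lra.
      by have := ray_derive (Rc j) Uu u0; rewrite derive_c_radial.
    have u12 : 1 / 2 <= u by apply: le_trans su.
    have u0 : 0 < u by move: u12; lra.
    rewrite normrM ler_pM //.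
      by rewrite normfV gtr0_norm // -[2]invrK lef_pV2 ?posrE //; move: u12; lra.
    apply: le_trans (coord_le _ _) _; apply: vel_bound; apply: S_le (Sall u su u1).
    by move: del_gt0; lra.
  rewrite scale1r in H1.
  have H2 : `|(c y - x0) 0 j| <= del / 2 by apply: le_trans (coord_le _ _) _; exact: ltW.
  have H3 : 2 * Q * (1 - s) <= del / 8.
    by apply: le_trans htau; rewrite ler_wpM2l ?mulr_ge0 ?Q_ge0 // lerB // (le_trans t0).
  move: H1 H2 H3; rewrite !mxE !ler_norml => /andP[a1 a2] /andP[a3 a4] a5.
  by apply/andP; split; lra.
have cs : {for s, continuous (fun u : R => u *: y)}.
  by apply: cvgZr_tmp; exact: cvg_id.
have cU : \forall z \near (s *: y), U z by exact: open_nbhs_nbhs (conj oU Us).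
have cc : {for s *: y, continuous c}.
  by apply: row_continuous => j; exact: Reg_cont (Rc j) Us.
have e80 : 0 < del / 8 by rewrite divr_gt0.
have /cvgrPdist_lt /(_ _ e80) N := cc.
have /nbhs_ballP [e /= e0 He] : nbhs s (fun u : R => U (u *: y) /\ `|c (s *: y) - c (u *: y)| < del / 8).
  exact: cs _ (filterI cU N).
have [u Bu hu] := sup_adherent e0 supB.
have [_ nSu] := Bu; apply: nSu.
have us : u <= s by apply: sup_upper_bound.
have [|Uu {}hu] := He u; last first.
  split=> //; have := ler_normD (c (u *: y) - c (s *: y)) (c (s *: y) - x0).
  rewrite addrA subrK => h; rewrite distrC in hu; apply: le_trans h _; move: hu close; lra.
by rewrite /ball /= ger0_norm ?subr_ge0 // ltrBlDr -ltrBlDl addrC; move: hu; rewrite -/s; lra.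
Qed.

(** The momentum at time t of the geodesic t |-> c (t y): its velocity is vel (t y) / t. *)
Let pi (y : 'rV[R]_d) (t : R) : 'rV[R]_d := t^-1 *: p (t *: y).

Lemma hessZ (a : R) (v x : 'rV[R]_d) k : hess H (a *: v) x k = a ^+ 2 * hess H v x k.
Proof. exact: quadZ. Qed.

Lemma position_ode y (t : R) j : U (t *: y) -> t != 0 ->
  is_derive t 1 (fun s => c (s *: y) 0 j) (\sum_i pi y t 0 i * H (c (t *: y)) i j).
Proof.
move=> Uty t0; have := ray_derive (Rc j) Uty t0; rewrite derive_c_radial // vel_momentum //.
rewrite mxE mulr_sumr; congr (is_derive _ _ _ _); apply: eq_bigr => i _.
by rewrite /pi [in RHS]mxE mulrA.
Qed.

Lemma momentum_ode y (t : R) k : U (t *: y) -> t != 0 ->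
  is_derive t 1 (fun s => pi y s 0 k) (- (2^-1 * hess H (pi y t) (c (t *: y)) k)).
Proof.
move=> Uty t0.
have [d1 E1] := ray_derive (Reg_momentum oU oW UW Rc Rg k) Uty t0.
have [d2 E2] : is_derive t 1 (fun s : R => s^-1) (- (t ^- 2)).
  have [d3 E3] := is_derive_id t (1 : R).
  split; first exact: (derivableV t0 d3).
  have -> : 'D_1 (fun s : R => s^-1) t = - t ^- 2 *: 'D_1 id t by exact: (deriveV t0 d3).
  by rewrite E3 /GRing.scale /= mulr1.
have -> : (fun s => pi y s 0 k) = (fun s : R => s^-1) * (fun s : R => p (s *: y) 0 k).
  by apply/funext => s; rewrite /pi mxE.
split; first exact: (derivableM d2 d1).
have -> : 'D_1 ((fun s : R => s^-1) * (fun s : R => p (s *: y) 0 k)) t =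
   t^-1 *: 'D_1 (fun s : R => p (s *: y) 0 k) t + p (t *: y) 0 k *: 'D_1 (fun s : R => s^-1) t.
  exact: (deriveM d2 d1).
rewrite E1 E2 (radial_momentum oU oW UW Rc Rg RH HT gH Mu gauss k Uty) /pi hessZ.
by rewrite /GRing.scale /=; field.
Qed.

(** Lipschitz constant of the Hamiltonian vector field near x0: the first summand is for the
    position equation, the second for the momentum equation. *)
Let Cgr := d%:R * (G + Pb * G) + 2^-1 * (d%:R * d%:R * (Pb * G + (G + Pb * G) * Pb)).

Lemma pi_bound y t k : 1 / 2 <= t -> S del (t *: y) -> `|pi y t 0 k| <= Pb.
Proof.
move=> t12 Sy; rewrite /pi mxE normrM /Pb.
have t0 : 0 < t by move: t12; lra.
apply: ler_pM => //; last exact: momentum_bound.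
by rewrite normfV gtr0_norm // -[2]invrK lef_pV2 ?posrE //; move: t12; lra.
Qed.

Lemma prod_diff (a a' b b' A B n : R) : `|a'| <= A -> `|b| <= B -> `|a - a'| <= n ->
  `|b - b'| <= G * n -> `|a * b - a' * b'| <= (B + A * G) * n.
Proof.
move=> h1 h2 h3 h4; have -> : a * b - a' * b' = (a - a') * b + a' * (b - b') by ring.
apply: le_trans (ler_normD _ _) _; rewrite !normrM mulrDl [B * n]mulrC -mulrA.
by rewrite lerD // ler_pM.
Qed.

(** Gronwall for the squared phase-space distance psi of two rays on [tau, 1]. Each of the 2 d terms
    of its derivative is at most 2 n (Cgr n) with n^2 = psi t, which gives the rate 4 d Cgr; the
    length 1 - tau is at most 1. *)
Lemma separation y y' tau : U y -> U y' -> `|c y - x0| < del / 2 -> `|c y' - x0| < del / 2 ->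
  1 / 2 <= tau <= 1 -> 2 * Q * (1 - tau) <= del / 8 ->
  forall j, (c y 0 j - c y' 0 j) ^+ 2 <= expR (4 * d%:R * Cgr) *
    (\sum_k (c (tau *: y) 0 k - c (tau *: y') 0 k) ^+ 2 + \sum_k (pi y tau 0 k - pi y' tau 0 k) ^+ 2).
Proof.
move=> Uy Uy' hy hy' htau hQ j.
have tau1 : tau <= 1 by case/andP: htau.
have st := ray_stays Uy hy htau hQ; have st' := ray_stays Uy' hy' htau hQ.
have toS z : S (3 / 4 * del) z -> S del z by apply: S_le; move: del_gt0; lra.
pose X t k := c (t *: y) 0 k; pose X' t k := c (t *: y') 0 k.
pose psi t := \sum_k (X t k - X' t k) ^+ 2 + \sum_k (pi y t 0 k - pi y' t 0 k) ^+ 2.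
pose v z t k := \sum_i pi z t 0 i * H (c (t *: z)) i k.
pose w z t k := - (2^-1 * hess H (pi z t) (c (t *: z)) k).
pose dpsi t := \sum_k 2 * (X t k - X' t k) * (v y t k - v y' t k) +
   \sum_k 2 * (pi y t 0 k - pi y' t 0 k) * (w y t k - w y' t k).
have Cgr0 : 0 <= Cgr.
  have P0 := Pb_ge0; have G0' := G0.
  by have [c1 c2] := growth_constants_ge0 (ler0n R d) G0' P0; exact: addr_ge0.
have := @gronwall R psi dpsi tau 1 (4 * d%:R * Cgr) tau1.
have h1 t : tau <= t <= 1 -> is_derive t 1 psi (dpsi t).
  move=> ht; have Ut := (st t ht).1; have Ut' := (st' t ht).1.
  have t0 : t != 0 by case/andP: ht => a b; case/andP: htau => a' b'; rewrite gt_eqF //; move: a a'; lra.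
  have [d1 E1] : is_derive t 1 (fun s => \sum_k (X s k - X' s k) ^+ 2) (\sum_k 2 * (X t k - X' t k) * (v y t k - v y' t k)).
    by apply: is_derive_sum1 => k; apply: is_derive_sqrB; exact: position_ode.
  have [d2 E2] : is_derive t 1 (fun s => \sum_k (pi y s 0 k - pi y' s 0 k) ^+ 2)
     (\sum_k 2 * (pi y t 0 k - pi y' t 0 k) * (w y t k - w y' t k)).
    by apply: is_derive_sum1 => k; apply: is_derive_sqrB; exact: momentum_ode.
  rewrite /dpsi -E1 -E2; split; [exact: (derivableD d1 d2) | exact: (deriveD d1 d2)].
have h2 t : tau <= t <= 1 -> dpsi t <= 4 * d%:R * Cgr * psi t.
  move=> ht; have St := st t ht; have St' := st' t ht.
  have t12 : 1 / 2 <= t by case/andP: ht => a b; case/andP: htau => a' b'; exact: le_trans a.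
  have [Ut bt] := toS _ St; have [Ut' bt'] := toS _ St'.
  pose n := Num.sqrt (psi t).
  have psi0 : 0 <= psi t by rewrite addr_ge0 // sumr_ge0 // => k _; exact: sqr_ge0.
  have nX k : `|X t k - X' t k| <= n.
    rewrite -sqrtr_sqr; apply: ler_wsqrtr; rewrite /psi (bigD1 k) //= -addrA lerDl.
    by rewrite addr_ge0 // sumr_ge0 // => k' _; exact: sqr_ge0.
  have nP k : `|pi y t 0 k - pi y' t 0 k| <= n.
    rewrite -sqrtr_sqr; apply: ler_wsqrtr; rewrite /psi [X in _ <= _ + X](bigD1 k) //= addrCA lerDl.
    by rewrite addr_ge0 // sumr_ge0 // => k' _; exact: sqr_ge0.
  have n0 : 0 <= n by exact: sqrtr_ge0.
  have nc : `|c (t *: y) - c (t *: y')| <= n.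
    by apply: norm_row_le => // k; rewrite !mxE; exact: nX.
  have [_ _ bH bD _] := HC bt bt'.
  have piy k : `|pi y t 0 k| <= Pb by apply: pi_bound => //; exact: toS.
  have piy' k : `|pi y' t 0 k| <= Pb by apply: pi_bound => //; exact: toS.
  have scal (z : R) : `|z| <= G * `|c (t *: y) - c (t *: y')| -> `|z| <= G * n.
    by move=> h; apply: le_trans h _; rewrite ler_wpM2l.
  have bv k : `|v y t k - v y' t k| <= Cgr * n.
    apply: (@le_trans _ _ (d%:R * (G + Pb * G) * n)); last first.
      rewrite ler_wpM2r // /Cgr lerDl; have P0 := Pb_ge0; have G0' := G0.
      by have [c1 c2] := growth_constants_ge0 (ler0n R d) G0' P0.
    rewrite /v -sumrB -mulrA mulr_natl -[X in _ *+ X]card_ord -sumr_const.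
    apply: le_trans (ler_norm_sum _ _ _) _; apply: ler_sum => i _.
    by have [h3 h4] := bH i k; apply: prod_diff => //; exact: scal.
  have bw k : `|w y t k - w y' t k| <= Cgr * n.
    apply: (@le_trans _ _ (2^-1 * (d%:R * d%:R * (Pb * G + (G + Pb * G) * Pb)) * n)); last first.
      rewrite ler_wpM2r // /Cgr lerDr; have P0 := Pb_ge0; have G0' := G0.
      by have [c1 c2] := growth_constants_ge0 (ler0n R d) G0' P0.
    have -> : w y t k - w y' t k = - (2^-1 * (hess H (pi y t) (c (t *: y)) k - hess H (pi y' t) (c (t *: y')) k)).
      by rewrite /w; ring.
    rewrite normrN normrM [X in X * _]ger0_norm ?invr_ge0 // -mulrA ler_wpM2l ?invr_ge0 //.
    rewrite /hess -!/(quad _ _) !quadE -(mulrA (d%:R * d%:R) _ n); apply: double_sum_le => a b.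
    have [h3 h4] := bD k a b; have {}h4 := scal _ h4.
    set A := dm _ _ _ _ _ in h3 h4 *; set A' := dm _ _ _ _ _ in h4 *.
    have e1 : `|pi y t 0 a * A - pi y' t 0 a * A'| <= (G + Pb * G) * n.
      by apply: prod_diff.
    have -> : pi y t 0 a * A * pi y t 0 b - pi y' t 0 a * A' * pi y' t 0 b =
       (pi y t 0 a * A - pi y' t 0 a * A') * pi y' t 0 b + pi y t 0 a * A * (pi y t 0 b - pi y' t 0 b) by ring.
    apply: le_trans (ler_normD _ _) _; rewrite !normrM.
    rewrite mulrDl addrC; apply: lerD; first by rewrite ler_pM // ler_pM.
    by rewrite mulrAC; apply: ler_pM => //; exact: piy'.
  have -> : 4 * d%:R * Cgr * psi t = d%:R * (2 * n * (Cgr * n)) + d%:R * (2 * n * (Cgr * n)).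
    by rewrite -[psi t]sqr_sqrtr // -/n; ring.
  rewrite /dpsi !mulr_natl -[X in _ *+ X + _ *+ X]card_ord -!sumr_const; apply: lerD; apply: ler_sum => k _.
    apply: le_trans (ler_norm _) _; rewrite !normrM [`|2|]ger0_norm // ler_pM ?mulr_ge0 //.
    by rewrite -[n *+ 2]mulr_natl ler_wpM2l.
  apply: le_trans (ler_norm _) _; rewrite !normrM [`|2|]ger0_norm // ler_pM ?mulr_ge0 //.
  by rewrite -[n *+ 2]mulr_natl ler_wpM2l.
move=> /(_ h1 h2) h; apply: (@le_trans _ _ (psi 1)).
  rewrite /psi /X /X' !scale1r (bigD1 j) //= -addrA lerDl.
  by rewrite addr_ge0 // sumr_ge0 // => k' _; exact: sqr_ge0.
apply: le_trans h _; rewrite ler_wpM2r //.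
  by rewrite addr_ge0 // sumr_ge0 // => k _; exact: sqr_ge0.
rewrite ler_expR ler_piMr ?mulr_ge0 //.
by case/andP: htau => a _; move: a; lra.
Qed.

End fixed_constants.

Lemma compact_bound (K : set 'rV[R]_d) (f : 'rV[R]_d -> R) : compact K ->
  (forall z, K z -> {for z, continuous f}) -> exists C : R, forall z, K z -> `|f z| <= C.
Proof.
move=> cK cf.
have cfK : {within K, continuous f} by apply: continuous_in_subspaceT => z /[!inE] Kz; exact: cf.
have := compact_bounded (continuous_compact cfK cK).
move=> [M [_ HM]]; exists (M + 1) => z Kz.
by apply: (HM (M + 1)); [rewrite ltrDl | exists z].
Qed.

(** Take y' = y + h e_i in [separation], divide by h^2 and let h tend to 0: the derivative of c at y
    is controlled by those of c and of the momentum at tau y. The latter point ranges over a compact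
    subset of U, however close y is to the boundary sphere. *)
Lemma derivative_bound : exists2 r : R, 0 < r & exists C : R,
  forall y, U y -> `|c y - x0| < r -> forall i j, `|'D_('e_i) (fun z => c z 0 j) y| <= C.
Proof.
have [del [G [m [d0 dd0 G0 m0 HC]]]] := constants.
exists (del / 2); first by rewrite divr_gt0.
set Q := Num.sqrt (rho ^+ 2 / m).
have Q0 : 0 <= Q by exact: sqrtr_ge0.
(* The bound 1/2 on 1 - tau keeps the factors t^-1 below 2; the other term of the minimum makes a
   ray move by at most del / 8 between tau and 1. *)
have [tau htau hQ] : exists2 tau : R, 1 / 2 <= tau < 1 & 2 * Q * (1 - tau) <= del / 8.
  exists (1 - Num.min (1 / 2) (del / 8 / (2 * Q + 1))).
    rewrite lerBrDr -lerBrDl ltrBlDr ltrDl; apply/andP; split.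
      by rewrite ge_min; apply/orP; left; lra.
    by rewrite lt_min !divr_gt0 // ltr_wpDl // mulr_ge0.
  rewrite opprB addrCA subrr addr0.
  have q1 : 0 < 2 * Q + 1 by rewrite ltr_wpDl // mulr_ge0.
  apply: (@le_trans _ _ (2 * Q * (del / 8 / (2 * Q + 1)))).
    by rewrite ler_wpM2l ?mulr_ge0 // ge_min lexx orbT.
  rewrite mulrA ler_pdivrMr // [leRHS]mulrC ler_wpM2r ?divr_ge0 ?(ltW d0) //.
  by rewrite lerDl.
have tau0 : 0 < tau by case/andP: htau => a _; move: a; lra.
have tau1 : tau < 1 by case/andP: htau.
have htau' : 1 / 2 <= tau <= 1 by case/andP: htau => -> /ltW ->.
have dd : 0 < 3 / 4 * del < del0 by apply/andP; split; move: d0 dd0; lra.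
(* The condition |z| <= tau rho keeps K away from the sphere of radius rho, so [S_closed] applies to
   its limit points and K is compact. *)
pose K := [set z | S (3 / 4 * del) z /\ enorm z <= tau * rho].
have cK : compact K.
  apply: bounded_closed_compact.
    exists (tau * rho); split; first exact: num_real.
    move=> x hx z [_ hz]; apply: ltW; apply: le_lt_trans hx; exact: le_trans (norm_le_enorm z) hz.
  move=> z cz.
  have hz : enorm z <= tau * rho.
    have cl : closed [set z : 'rV[R]_d | enorm z <= tau * rho].
      by apply: (@closed_comp _ _ (@enorm R d) [set u | u <= tau * rho]);
        [move=> w _; exact: enorm_continuous | exact: closed_le].
    apply: cl => B nB; have [w [[_ hw] Bw]] := cz B nB; by exists w.
  split=> //; apply: S_closed => //.
    have rho0 : 0 < rho.
      have [w [[[Uw _] _] _]] := cz setT filterT.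
      by apply: le_lt_trans (U_ball Uw); exact: enorm_ge0.
    by apply: le_lt_trans hz _; rewrite gtr_pMl.
  by move=> B nB; have [w [[Sw _] Bw]] := cz B nB; exists w.
have KU z : K z -> U z by move=> [[]].
have Rp k : Reg 0 2 U (fun y => p y 0 k) := Reg_momentum oU oW UW Rc Rg k.
have bc (ij : 'I_d * 'I_d) : exists C : R, forall z, K z -> `|'D_('e_ij.1) (fun z => c z 0 ij.2) z| <= C.
  by apply: compact_bound => // z /KU Uz; exact: Reg_cont (Reg_derive _ (Rc ij.2)) Uz.
have bp (ij : 'I_d * 'I_d) : exists C : R, forall z, K z -> `|'D_('e_ij.1) (fun z => p z 0 ij.2) z| <= C.
  by apply: compact_bound => // z /KU Uz; exact: Reg_cont (Reg_derive _ (Rp ij.2)) Uz.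
have [Bc Hc] := choice bc; have [Bp Hp] := choice bp.
have [E [E0 sep]] : exists E : R, 0 <= E /\ forall y y', U y -> U y' -> `|c y - x0| < del / 2 -> `|c y' - x0| < del / 2 ->
   forall j, (c y 0 j - c y' 0 j) ^+ 2 <= E *
    (\sum_k (c (tau *: y) 0 k - c (tau *: y') 0 k) ^+ 2 + \sum_k ((tau^-1 *: p (tau *: y)) 0 k - (tau^-1 *: p (tau *: y')) 0 k) ^+ 2).
  eexists; split; last first.
    by move=> y y' Uy Uy' hy hy'; exact: (separation d0 dd0 G0 m0 HC Uy Uy' hy hy' htau' hQ).
  exact: expR_ge0.
pose D := \sum_ij (Bc ij) ^+ 2 + \sum_ij (Bp ij) ^+ 2.
exists (Num.sqrt (E * D)) => y Uy hy i j.
have KtY : K (tau *: y).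
  have stay := ray_stays d0 dd0 m0 HC Uy hy htau' hQ.
  split; first by apply: stay; rewrite lexx ltW.
  rewrite /enorm.
  have -> : \sum_(l < d) (tau *: y) 0 l ^+ 2 = tau ^+ 2 * \sum_(l < d) y 0 l ^+ 2.
    by rewrite mulr_sumr; apply: eq_bigr => l _; rewrite mxE exprMn.
  by rewrite sqrtrM ?sqr_ge0 // sqrtr_sqr gtr0_norm // ler_wpM2l ?(ltW tau0) // ltW // U_ball.
have UtY := KU _ KtY.
have Df (f : 'rV[R]_d -> R) z : derivable f z 'e_i ->
    (fun h : R => h^-1 * (f (h *: 'e_i + z) - f z)) @ 0^' --> 'D_('e_i) f z.
  by move=> df; exact: df.
have Dt (f : 'rV[R]_d -> R) : derivable f (tau *: y) 'e_i ->
    (fun h : R => h^-1 * (f (tau *: (h *: 'e_i + y)) - f (tau *: y))) @ 0^' --> tau * 'D_('e_i) f (tau *: y).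
  move=> df; have [dft <-] := derive_scale_dir tau df.
  apply: cvg_trans (dft); apply: near_eq_cvg; apply: nearW => h.
  have -> : tau *: (h *: 'e_i + y) = h *: (tau *: 'e_i) + tau *: y by rewrite scalerDr !scalerA mulrC.
  by [].
have lhs : (fun h : R => (h^-1 * (c (h *: 'e_i + y) 0 j - c y 0 j)) ^+ 2) @ 0^' --> ('D_('e_i) (fun z => c z 0 j) y) ^+ 2.
  have h1 := Df (fun z => c z 0 j) y (Reg_derivable (Rc j) Uy).
  by apply: cvgM.
have rhs : (fun h : R => E * (\sum_k (h^-1 * (c (tau *: (h *: 'e_i + y)) 0 k - c (tau *: y) 0 k)) ^+ 2 +
    \sum_k (tau^-1 * (h^-1 * (p (tau *: (h *: 'e_i + y)) 0 k - p (tau *: y) 0 k))) ^+ 2)) @ 0^' -->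
    E * (\sum_k (tau * 'D_('e_i) (fun z => c z 0 k) (tau *: y)) ^+ 2 +
     \sum_k (tau^-1 * (tau * 'D_('e_i) (fun z => p z 0 k) (tau *: y))) ^+ 2).
  apply: cvgM; first exact: cvg_cst.
  apply: cvgD; apply: cvg_sumr => k _.
    have h1 := Dt (fun z => c z 0 k) (Reg_derivable (Rc k) UtY).
    by apply: cvgM.
  have h1 := Dt (fun z => p z 0 k) (Reg_derivable (Rp k) UtY).
  by apply: cvgM; (apply: cvgM; first exact: cvg_cst); exact: h1.
have le : 'D_('e_i) (fun z => c z 0 j) y ^+ 2 <= E * (\sum_k (tau * 'D_('e_i) (fun z => c z 0 k) (tau *: y)) ^+ 2 +
     \sum_k (tau^-1 * (tau * 'D_('e_i) (fun z => p z 0 k) (tau *: y))) ^+ 2).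
  apply: ler_cvg_to lhs rhs _.
  have cc : {for y, continuous c} by apply: row_continuous => j'; exact: Reg_cont (Rc j') Uy.
  have /cvgrPdist_lt /(_ (del / 2 - `|c y - x0|)) := cc; rewrite subr_gt0 => /(_ hy) N.
  have cs : {for (0:R), continuous (fun h : R => h *: 'e_i + y)}.
    by apply: cvgD; [apply: cvgZr_tmp; exact: cvg_id | exact: cvg_cst].
  have : nbhs (0:R) (fun h : R => U (h *: 'e_i + y) /\ `|c y - c (h *: 'e_i + y)| < del / 2 - `|c y - x0|).
    have NU : \forall z \near y, U z by exact: open_nbhs_nbhs (conj oU Uy).
    move: cs; rewrite /prop_for /continuous_at scale0r add0r => cs; exact: cs _ (filterI NU N).
  move=> N0; near=> h.
  have h0 : h != 0 by near: h; exact: nbhs_dnbhs_neq.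
  have [Uh hh] : U (h *: 'e_i + y) /\ `|c y - c (h *: 'e_i + y)| < del / 2 - `|c y - x0|.
    by near: h; exact: nbhs_dnbhs.
  have hy' : `|c (h *: 'e_i + y) - x0| < del / 2.
    have := ler_normD (c (h *: 'e_i + y) - c y) (c y - x0).
    by rewrite addrA subrK => h1; apply: le_lt_trans h1 _; rewrite -ltrBrDr distrC.
  have := sep _ _ Uh Uy hy' hy j.
  set s1 := \sum_k (c _ 0 k - _) ^+ 2; set s2 := \sum_k (_ - _) ^+ 2 => hs.
  have -> : \sum_k (h^-1 * (c (tau *: (h *: 'e_i + y)) 0 k - c (tau *: y) 0 k)) ^+ 2 = h^-1 ^+ 2 * s1.
    by rewrite mulr_sumr; apply: eq_bigr => k _; rewrite exprMn.
  have -> : \sum_k (tau^-1 * (h^-1 * (p (tau *: (h *: 'e_i + y)) 0 k - p (tau *: y) 0 k))) ^+ 2 = h^-1 ^+ 2 * s2.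
    rewrite mulr_sumr; apply: eq_bigr => k _; rewrite -exprMn; congr (_ ^+ 2).
    by rewrite [(tau^-1 *: p (tau *: (_ + _))) 0 k]mxE [(tau^-1 *: p (tau *: y)) 0 k]mxE; ring.
  by rewrite exprMn -mulrDr [leRHS]mulrCA; apply: ler_wpM2l => //; exact: sqr_ge0.
rewrite -sqrtr_sqr; apply: ler_wsqrtr; apply: le_trans le _; rewrite ler_wpM2l // /D.
have big_le (F : 'I_d * 'I_d -> R) : (forall ij, 0 <= F ij) -> \sum_k F (i, k) <= \sum_ij F ij.
  move=> F0; rewrite (eq_bigr (fun ij => (fun a b => F (a, b)) ij.1 ij.2)); last by case.
  rewrite -(pair_bigA _ (fun a b => F (a, b))) /= [leRHS](bigD1 i) //= lerDl.
  by apply: sumr_ge0 => a _; apply: sumr_ge0.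
apply: lerD.
  apply: le_trans (_ : \sum_k (Bc (i, k)) ^+ 2 <= _); last first.
    by apply: (big_le (fun ij => Bc ij ^+ 2)) => ij; exact: sqr_ge0.
  apply: ler_sum => k _; rewrite -ler_sqrt ?sqr_ge0 // !sqrtr_sqr normrM.
  have h1 := Hc (i, k) _ KtY; apply: le_trans (ler_norm _).
  by apply: le_trans h1; rewrite ler_piMl // gtr0_norm // ltW.
apply: le_trans (_ : \sum_k (Bp (i, k)) ^+ 2 <= _); last first.
  by apply: (big_le (fun ij => Bp ij ^+ 2)) => ij; exact: sqr_ge0.
apply: ler_sum => k _; rewrite mulrA mulVf ?gt_eqF // mul1r -ler_sqrt ?sqr_ge0 // !sqrtr_sqr.
by have h1 := Hp (i, k) _ KtY; apply: le_trans (ler_norm _).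
Unshelve. all: by end_near.
Qed.

End ray.

(** * Functions on a manifold *)

Section regularity_extra.
Context {R : realType} {n : nat}.

Lemma Reg_hexp0 th k (U : set 'rV[R]_n) (f : 'rV[R]_n -> R) : Reg th k U f -> Reg 0 k U f.
Proof.
elim: k f => [|k IH] f [c H]; split=> //.
  by move=> x Ux; apply: hold_continuous; exact: c.
by move=> i; have [d r] := H i; split=> //; exact: IH.
Qed.

Lemma Ck_Cq m k (U : set 'rV[R]_n) (f : 'rV[R]_n -> 'rV[R]_m) : Ck k U f -> Cq k%:R U f.
Proof.
move=> H; rewrite /Cq truncn_nat hexp_nat; split=> // s x hs Ux.
have [c _] := H s x Ux; have {}c : {for x, continuous (pd s f)} by apply: c; rewrite hs.
have /cvgrPdist_lt /(_ 1 ltr01) N := c.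
exists [set y | `|pd s f x - pd s f y| < 1] => //.
exists (m%:R * 2) => y z /= hy hz; rewrite powRr0 mulr1.
apply: le_trans (enorm_le_norm _) _; rewrite ler_wpM2l // -(subrKA (pd s f x)).
by apply: le_trans (ler_normD _ _) _; rewrite distrC; move: hy hz; lra.
Qed.

Lemma posdef_unit (A : 'M[R]_n) : (forall v, v != 0 -> 0 < quad A v) -> A \in unitmx.
Proof.
move=> pos; rewrite -row_free_unit -kermx_eq0; apply/eqP/row_matrixP => i; rewrite row0.
apply/eqP; apply: contraT => ri; have := pos _ ri.
have := mulmx_ker A => /(congr1 (row i)); rewrite row_mul row0 => E.
by rewrite /quad E mul0mx mxE ltxx.
Qed.

Section invmx.
Variables (k : nat) (U : set 'rV[R]_n).
Hypothesis oU : open U.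
Let th01 : (0:R) <= 0 <= (1:R). Proof. by rewrite lexx ler01. Qed.

Lemma Reg_det d (F : 'rV[R]_n -> 'M[R]_d) : (forall i j, Reg 0 k U (fun x => F x i j)) ->
  Reg 0 k U (fun x => \det (F x)).
Proof.
move=> RF; rewrite /determinant; apply: (Reg_sum oU) => s; apply: (RegM th01 oU).
  exact: Reg_cst.
by apply: (Reg_prod th01 oU) => i.
Qed.

Lemma Reg_invmx d (F : 'rV[R]_n -> 'M[R]_d) : (forall i j, Reg 0 k U (fun x => F x i j)) ->
  (forall x, U x -> F x \in unitmx) -> forall i j, Reg 0 k U (fun x => invmx (F x) i j).
Proof.
move=> RF Fu i j.
apply: (Reg_ext oU (f := fun x => (\det (F x))^-1 * ((-1) ^+ (j + i) * \det (row' j (col' i (F x)))))).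
  by move=> x Ux; rewrite /invmx Fu // !mxE.
apply: (RegM th01 oU).
  apply: (RegV th01 oU); last exact: Reg_det.
  by move=> x /Fu; rewrite unitmxE unitfE.
apply: (RegM th01 oU); first exact: Reg_cst.
apply: Reg_det => a b; apply: (Reg_ext oU (f := fun x => F x (lift j a) (lift i b))) => // x _.
by rewrite !mxE.
Qed.
End invmx.

End regularity_extra.

(** * Charts, transition maps and regular functions *)

Section transitions.
Context {R : realType} {d : nat} {X : manifold R d}.
Implicit Types a b e : chart R d X.

Definition tr a b (x : 'rV[R]_d) : 'rV[R]_d := ccoord b (cpar a x).
Definition trdom a b : set 'rV[R]_d := cdom a `&` cpar a @^-1` cim b.

Lemma chart_dom_open a : open (cdom a). Proof. exact: cdom_open. Qed.
Lemma chart_im_open a : open (cim a). Proof. exact: cim_open. Qed.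
Arguments chart_dom_open : clear implicits.
Arguments chart_im_open : clear implicits.

Lemma chart_open a (O : set X) : open O -> open (cdom a `&` cpar a @^-1` O).
Proof.
move=> oO; rewrite openE => x [ax Ox].
have c := cpar_continuous ax; apply: filterI; first exact: open_nbhs_nbhs (conj (chart_dom_open a) ax).
by apply: c; exact: open_nbhs_nbhs (conj oO Ox).
Qed.

Lemma trdom_open a b : open (trdom a b).
Proof. by apply: chart_open; exact: chart_im_open. Qed.

Arguments trdom_open : clear implicits.

Lemma tr_mem a b x : trdom a b x -> cdom b (tr a b x) /\ cpar b (tr a b x) = cpar a x.
Proof. by move=> [ax [z bz E]]; rewrite /tr -E cparK. Qed.

Lemma tr_comp a b e x : trdom a b x -> tr b e (tr a b x) = tr a e x.
Proof. by move=> /tr_mem [_ E]; rewrite /tr -/(tr a b x) E. Qed.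

Lemma tr_id a x : cdom a x -> tr a a x = x.
Proof. by move=> ax; rewrite /tr cparK. Qed.

Lemma trdom_tr a b e x : trdom a b x -> trdom a e x -> trdom b e (tr a b x).
Proof. by move=> ab [_ ae]; have [h1 h2] := tr_mem ab; split=> //; rewrite /preimage /= h2. Qed.

Lemma atlas_smooth_chart a : atlas a -> smooth_chart a.
Proof. by move=> ha b hb; split; exact: atlas_smooth. Qed.

Lemma Reg_trans k a b j : smooth_transition a b -> Reg 0 k (trdom a b) (fun x => tr a b x 0 j).
Proof.
move=> s; have [r _] := Cq_Reg j (trdom_open a b) (Ck_Cq (s k)).
by move: r; rewrite hexp_nat truncn_nat.
Qed.

(** [smooth_chart] compares with charts of the atlas only, so near each point the transition is
    factored through [chart_at]. *)
Lemma Reg_tr k a b j : smooth_chart a -> smooth_chart b -> Reg 0 k (trdom a b) (fun x => tr a b x 0 j).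
Proof.
move=> sa sb; apply: Reg_loc => x xab.
pose e := chart_at (cpar a x).
have he : atlas e by exact: chart_at_atlas.
have xe : trdom a e x by split; [case: xab | exact: chart_at_mem].
pose V := trdom a e `&` trdom a b.
have oV : open V by apply: openI; exact: trdom_open.
exists V; first by [].
apply: (@Reg_ext _ _ _ _ _ ((fun y => tr e b y 0 j) \o tr a e)) => //.
  by move=> y [ye yb] /=; rewrite tr_comp.
apply: (@Reg_comp _ _ _ _ V (trdom e b)) => //; first exact: trdom_open.
- by move=> y [ye yb]; exact: trdom_tr.
- by apply: Reg_trans; have [] := sb _ he.
- move=> l; apply: (@Reg_sub _ _ _ _ _ (trdom a e)); first by move=> y [].
  by apply: Reg_trans; have [] := sa _ he.
Qed.

Lemma jacm_ext (U : set 'rV[R]_d) (f g : 'rV[R]_d -> 'rV[R]_d) x : open U -> U x ->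
  (forall y, U y -> f y = g y) -> jacm f x = jacm g x.
Proof.
move=> oU Ux E; apply/matrixP => i j.
refine (etrans (jacmE _ _ _ _) _); refine (etrans _ (esym (jacmE _ _ _ _))).
by apply: near_eq_derive; apply: filterS (open_nbhs_nbhs (conj oU Ux)) => y Uy; rewrite E.
Qed.

Lemma jacm_comp k (U V : set 'rV[R]_d) (f g : 'rV[R]_d -> 'rV[R]_d) x : open V -> V (f x) -> U x ->
  (forall j, Reg 0 k.+1 U (fun y => f y 0 j)) -> (forall j, Reg 0 k.+1 V (fun y => g y 0 j)) ->
  jacm (g \o f) x = jacm f x *m jacm g (f x).
Proof.
move=> oV Vf Ux Rf Rg; apply/matrixP => i j; rewrite [RHS]mxE.
refine (etrans (jacmE _ _ _ _) _).
have [_ E] := is_derive_comp_Reg i oV Vf (Rg j) Rf Ux.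
refine (etrans E _); apply: eq_bigr => l _; by rewrite !jacmE.
Qed.

Lemma jacm_id x : jacm id x = 1%:M :> 'M[R]_d.
Proof.
apply/matrixP => i j; refine (etrans (jacmE _ _ _ _) _).
by have [_ ->] := is_derive_coord x 'e_i j; rewrite !mxE eqxx /= eq_sym.
Qed.

Lemma jacm_tr_comp a b e x : smooth_chart a -> smooth_chart b -> smooth_chart e ->
  trdom a b x -> trdom a e x -> jacm (tr a e) x = jacm (tr a b) x *m jacm (tr b e) (tr a b x).
Proof.
move=> sa sb se ab ae.
rewrite -(@jacm_comp 0 (trdom a b) (trdom b e)) //; first last.
- by move=> j; exact: Reg_tr.
- by move=> j; exact: Reg_tr.
- exact: trdom_tr.
- exact: trdom_open.
apply: (@jacm_ext (trdom a b `&` trdom a e)) => //; first by apply: openI; exact: trdom_open.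
by move=> y [yb ye] /=; rewrite tr_comp.
Qed.

Lemma jacm_tr_unit a b x : smooth_chart a -> smooth_chart b -> trdom a b x -> jacm (tr a b) x \in unitmx.
Proof.
move=> sa sb ab; have aa : trdom a a x by case: ab => ax _; split=> //; exists x.
have := jacm_tr_comp sa sb sa ab aa.
rewrite (@jacm_ext (cdom a) (tr a a) id x) //; first by rewrite jacm_id => /esym/mulmx1_unit [].
- exact: chart_dom_open.
- by case: ab.
- by move=> y ay; exact: tr_id.
Qed.

Lemma jac_jacm (f : 'rV[R]_d -> 'rV[R]_d) x : (forall i j, derivable (fun y => f y 0 j) x 'e_i) ->
  jac f x = jacm f x.
Proof.
move=> df; apply/matrixP => i j; refine (etrans _ (esym (jacmE _ _ _ _))).
by rewrite mxE; apply: derive_coord.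
Qed.

Lemma dparE a x : smooth_chart a -> cdom a x -> dpar a x = jacm (tr a (chart_at (cpar a x))) x.
Proof.
move=> sa ax; apply: jac_jacm => i j.
have tx : trdom a (chart_at (cpar a x)) x by split=> //; exact: chart_at_mem.
by apply: (Reg_derivable (Reg_tr 1 j sa (atlas_smooth_chart (chart_at_atlas _))) tx).
Qed.

Lemma dpar_tr a b x : smooth_chart a -> smooth_chart b -> trdom a b x ->
  dpar a x = jacm (tr a b) x *m dpar b (tr a b x).
Proof.
move=> sa sb ab; have [bx E] := tr_mem ab; have ax : cdom a x by case: ab.
rewrite !dparE // E; apply: jacm_tr_comp => //.
  exact: atlas_smooth_chart (chart_at_atlas _).
by split=> //; exact: chart_at_mem.
Qed.

Lemma dpar_unit a x : smooth_chart a -> cdom a x -> dpar a x \in unitmx.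
Proof.
move=> sa ax; rewrite dparE //; apply: jacm_tr_unit => //.
  exact: atlas_smooth_chart (chart_at_atlas _).
by split=> //; exact: chart_at_mem.
Qed.

Lemma CqX_Reg q m (f : X -> 'rV[R]_m) a k j : CqX q f -> smooth_chart a -> (k <= Num.truncn q)%N ->
  Reg 0 k (cdom a) (fun x => f (cpar a x) 0 j).
Proof.
move=> cf sa kq; apply: Reg_loc => x ax.
pose e := chart_at (cpar a x).
have he : atlas e by exact: chart_at_atlas.
have xe : trdom a e x by split=> //; exact: chart_at_mem.
exists (trdom a e) => //; have th01 : (0:R) <= 0 <= (1:R) by rewrite lexx ler01.
apply: (@Reg_ext _ _ _ _ _ ((fun y => f (cpar e y) 0 j) \o tr a e)); first exact: trdom_open.
  by move=> y ye /=; have [_ ->] := tr_mem ye.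
apply: (@Reg_comp _ _ _ _ (trdom a e) (cdom e)); [exact: trdom_open | exact: chart_dom_open | | |].
- by move=> y ye; have [] := tr_mem ye.
- refine (Reg_le th01 (chart_dom_open e) kq _); apply: Reg_hexp0.
  by have [r _] := Cq_Reg j (chart_dom_open e) (cf e he); exact: r.
- by move=> l; apply: Reg_tr => //; exact: atlas_smooth_chart.
Qed.

Lemma CqX_continuous q m (f : X -> 'rV[R]_m) : CqX q f -> continuous f.
Proof.
move=> cf p; pose e := chart_at p.
have he : atlas e by exact: chart_at_atlas.
have [z ez E] := chart_at_mem p.
apply: (@near_continuous _ _ ((f \o cpar e) \o ccoord e)).
  have oc := chart_im_open e; have := open_nbhs_nbhs (conj oc (chart_at_mem p)).
  by apply: filterS => y [w ew <-] /=; rewrite cparK.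
apply: continuous_comp; first by rewrite -E; exact: ccoord_continuous.
rewrite -E cparK //; apply: row_continuous => j.
by apply: Reg_cont (CqX_Reg j cf (atlas_smooth_chart he) (leq0n _)) ez.
Qed.

End transitions.

Arguments chart_dom_open {R d X} a.
Arguments chart_im_open {R d X} a.
Arguments trdom_open {R d X} a b.

Lemma closed_ball_norm (R : realType) (V : normedModType R) (x : V) (e : R) :
  closed [set w | `|w - x| <= e].
Proof.
apply: (@closed_comp _ _ (fun w : V => `|w - x|) [set u | u <= e]); last exact: closed_le.
by move=> w _; apply: cvg_norm; apply: cvgB; [exact: cvg_id | exact: cvg_cst].
Qed.

(** * The metric in charts and finiteness of C^1 norms *)

Section metric.
Context {R : realType} {d : nat} {X : riemannian R d}.
Implicit Types a b : chart R d X.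

Local Notation gm := (form_in (@metric R d X)).

Lemma form_in_sym a x : (gm a x)^T = gm a x.
Proof. by rewrite /form_in !trmx_mul trmxK Defs.metric_sym mulmxA. Qed.

Lemma form_in_pos a x v : smooth_chart a -> cdom a x -> v != 0 -> 0 < quad (gm a x) v.
Proof.
move=> sa ax v0; rewrite /quad /form_in !mulmxA -[_ *m v^T]mulmxA -trmx_mul.
apply: Defs.metric_pos; apply: contra v0 => /eqP E.
by rewrite -[v](mulmxK (dpar_unit sa ax)) E mul0mx.
Qed.

Lemma form_in_tr a b x : smooth_chart a -> smooth_chart b -> trdom a b x ->
  gm a x = jacm (tr a b) x *m gm b (tr a b x) *m (jacm (tr a b) x)^T.
Proof.
move=> sa sb ab; have [bx E] := tr_mem ab.
by rewrite /form_in (dpar_tr sa sb ab) E trmx_mul !mulmxA.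
Qed.

Lemma form_in_Reg k b i j : atlas b -> Reg 0 k (cdom b) (fun x => gm b x i j).
Proof.
move=> hb; have [r _] := Cq_Reg (mxvec_index i j) (chart_dom_open b) (Ck_Cq (Defs.metric_smooth hb k)).
move: r; rewrite hexp_nat truncn_nat; apply: Reg_ext; first exact: chart_dom_open.
by move=> y _; rewrite mxvecE.
Qed.

(** [derivative_bound] for the transition from th to the chart at q, near the coordinates x0 of q.
    The gain is a bound that holds up to the edge of the ball on which th is defined. *)
Lemma normal_chart_bound (p : X) (th : chart R d X) (q : X) : normal_chart p th ->
  exists2 O : set X, open O /\ O q & exists C : R, forall y, cdom th y -> O (cpar th y) ->
   forall i j, `|'D_('e_i) (fun z => tr th (chart_at q) z 0 j) y| <= C.
Proof.
move=> [sth [rho rho0 dth] th0 g0 gauss].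
pose b := chart_at q; have hb : atlas b by exact: chart_at_atlas.
have sb := atlas_smooth_chart hb.
have [x0 bx0 Ex0] := chart_at_mem q.
pose U := trdom th b; have oU : open U by exact: trdom_open.
have UW y : U y -> cdom b (tr th b y) by move=> /tr_mem [].
have gu x : cdom b x -> gm b x \in unitmx by move=> bx; apply: posdef_unit => v; exact: form_in_pos.
have := open_nbhs_nbhs (conj (chart_dom_open b) bx0) => /nbhs_ballP [e /= e0 He].
have := @derivative_bound R d U (cdom b) (tr th b) (gm b) (fun x => invmx (gm b x)) oU (chart_dom_open b) UW.
move=> /(_ (fun j => Reg_tr 3 j sth sb) (fun i j => form_in_Reg 2 i j hb)).
move=> /(_ (Reg_invmx (chart_dom_open b) (fun i j => form_in_Reg 2 i j hb) gu)).
have H1 x : cdom b x -> (invmx (gm b x))^T = invmx (gm b x) by move=> _; rewrite trmx_inv form_in_sym.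
have H2 x : cdom b x -> gm b x *m invmx (gm b x) = 1%:M by move=> /gu; exact: mulmxV.
have H3 y : U y -> jacm (tr th b) y \in unitmx by exact: jacm_tr_unit.
have H4 y : U y -> y *m (jacm (tr th b) y *m gm b (tr th b y) *m (jacm (tr th b) y)^T) = y.
  by move=> Uy; rewrite -form_in_tr //; apply: gauss; case: Uy.
have H5 y : U y -> enorm y < rho.
  by move=> [ty _]; move: ty; rewrite dth /eball /= subr0.
have H6 (v : 'rV[R]_d) : v != 0 -> 0 < quad (gm b x0) v by exact: form_in_pos.
move=> /(_ H1 H2 H3 H4 rho x0 H5 bx0 H6 e e0) [].
  move=> del /andP[d0 de] y hy cy.
  have ty : cdom th y by rewrite dth /eball /= subr0.
  (* F is compact, hence closed in the Hausdorff space X. A limit point y in the open ball is in the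
     domain of th, so its image is in F and y belongs to the domain of the transition: this gives
     the closedness of [S]. *)
  pose F := cpar b @` [set w | `|w - x0| <= del].
  have inb w : `|w - x0| <= del -> cdom b w.
    by move=> hw; apply: He; rewrite -ball_normE /= distrC; exact: le_lt_trans de.
  have cF : closed F.
    apply: compact_closed; first exact: carrier_hausdorff.
    apply: continuous_compact.
      by apply: continuous_in_subspaceT => w /[!inE] /inb; exact: cpar_continuous.
    apply: bounded_closed_compact.
      exists (`|x0| + del); split; first exact: num_real.
      move=> M hM w /= hw; apply: ltW; apply: le_lt_trans hM.
      by rewrite -[w](subrK x0) addrC; apply: le_trans (ler_normD _ _) _; rewrite lerD2l.
    exact: closed_ball_norm.
  have [w hw Ew] : F (cpar th y).
    apply: cF => N nN.
    have [z [[Uz hz] Nz]] := cy _ (cpar_continuous ty nN).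
    exists (cpar th z); split=> //; exists (tr th b z) => //.
    by have [_ ->] := tr_mem Uz.
  have Uy : U y by split=> //; exists w => //; exact: inb.
  by split=> //; rewrite /tr -Ew cparK //; exact: inb.
move=> r r0 [C HC].
exists (cim b `&` ccoord b @^-1` (ball x0 r)); last first.
  exists C => y ty [/= bt hb'] i j; apply: HC; first by [].
  by move: hb'; rewrite -ball_normE /= distrC.
split.
  rewrite openE => z [bz hz]; apply: filterI; first exact: open_nbhs_nbhs (conj (chart_im_open b) bz).
  have [w bw Ew] := bz; rewrite -Ew; apply: ccoord_continuous => //.
  by rewrite Ew; apply: open_nbhs_nbhs; split=> //; exact: ball_open.
by split; [exact: chart_at_mem | rewrite /preimage /= -Ex0 cparK //; exact: ballxx].
Qed.

Lemma Cnorm1_jac (q K : R) a b x l k : smooth_chart a -> smooth_chart b -> (1 <= Num.truncn q)%N ->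
  trdom a b x -> (Cnorm q (cdom a) (ccoord b \o cpar a) <= K%:E)%E -> `|jacm (tr a b) x l k| <= K.
Proof.
move=> sa sb q1 ab nK; rewrite jacmE -derive_coord; last first.
  by move=> j; exact: Reg_derivable (Reg_tr 1 j sa sb) ab.
apply: le_trans (coord_le_enorm _ _) _; rewrite -lee_fin; apply: le_trans nK.
apply: ereal_sup_ubound; left; exists [:: l], x; split=> //.
by case: ab.
Qed.

Lemma mulmx_entry_le m1 m2 m3 (A : 'M[R]_(m1, m2)) (B : 'M[R]_(m2, m3)) (K C : R) i j :
  (forall i j, `|A i j| <= K) -> (forall i j, `|B i j| <= C) -> `|(A *m B) i j| <= m2%:R * (K * C).
Proof.
move=> hA hB; rewrite mxE; apply: le_trans (ler_norm_sum _ _ _) _.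
rewrite mulr_natl -[X in _ *+ X]card_ord -sumr_const; apply: ler_sum => l _.
by rewrite normrM ler_pM.
Qed.

(** f is C^1 in the charts of the atlas, but psi_i could degenerate at the edge of its domain. The
    Jacobian from psi_i to a chart b around q0 factors through the normal chart th: the factor from
    psi_i to th is bounded by K, the one from th to b by [normal_chart_bound]. *)
Lemma CnormX_finite N (psi : 'I_N -> chart R d X) (q K : R) m (f : X -> 'rV[R]_m) :
  (1 <= Num.truncn q)%N -> (forall i, smooth_chart (psi i)) ->
  (forall i, exists p (th : chart R d X), [/\ normal_chart p th, cim (psi i) `<=` cim th &
    (Cnorm q (cdom (psi i)) (ccoord th \o cpar (psi i)) <= K%:E)%E]) ->
  CqX 1 f -> exists M : R, (CnormX psi 1 f <= M%:E)%E.
Proof.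
move=> q1 spsi hth cf.
have tr1 : Num.truncn (1 : R) = 1%N by exact: truncn1.
have fc : continuous f by exact: CqX_continuous cf.
have [C0 HC0] : exists C0 : R, forall p j, `|f p 0 j| <= C0.
  have cfX : {within [set: X], continuous f} by apply: continuous_subspaceT.
  have [M [_ HM]] := compact_bounded (continuous_compact cfX (@carrier_compact R d X)).
  exists (M + 1) => p j; apply: le_trans (coord_le _ _) _.
  by apply: (HM (M + 1)); [rewrite ltrDl | exists p].
pose P (M : R) (p : X) := forall i x, cdom (psi i) x -> cpar (psi i) x = p ->
  forall l j, `|'D_('e_l) (fun y => f (cpar (psi i) y) 0 j) x| <= M.
(* Compactness in near-covering form: for every q0 all large M work on a neighbourhood of q0, hence
   some M works on all of X. *)
have near_P : \forall M \near +oo, [set: X] `<=` P M.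
  have /compact_near_coveringP cov := @carrier_compact R d X.
  apply: cov => q0 _.
  pose b := chart_at q0; have hb : atlas b by exact: chart_at_atlas.
  have sb := atlas_smooth_chart hb.
  have [x0 bx0 Ex0] := chart_at_mem q0.
  have [D [D0 ND]] : exists D : R, 0 <= D /\ \forall y \near x0, forall lj : 'I_d * 'I_m,
      `|'D_('e_lj.1) (fun z => f (cpar b z) 0 lj.2) y| <= D.
    have Rf j : Reg 0 1 (cdom b) (fun z => f (cpar b z) 0 j).
      by apply: CqX_Reg cf sb _; rewrite tr1.
    pose D := \sum_(lj : 'I_d * 'I_m) (`|'D_('e_lj.1) (fun z => f (cpar b z) 0 lj.2) x0| + 1).
    exists D; split; first by apply: sumr_ge0 => lj _; rewrite addr_ge0.
    suff H lj : \forall y \near x0, `|'D_('e_lj.1) (fun z => f (cpar b z) 0 lj.2) y| <= D.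
      exact: (filter_forall (nbhs_filter x0) H).
    have c := Reg_cont (Reg_derive lj.1 (Rf lj.2)) bx0.
    have /cvgrPdist_lt /(_ 1 ltr01) := c; apply: filterS => y; rewrite distrC => /ltW h.
    apply: le_trans (_ : `|'D_('e_lj.1) (fun z => f (cpar b z) 0 lj.2) x0| + 1 <= _).
      by rewrite -lerBlDl; apply: le_trans (lerB_dist _ _) h.
    by rewrite /D (bigD1 lj) //= lerDl; apply: sumr_ge0 => ij _; rewrite addr_ge0.
  have HO i : exists OC : set X * R, [/\ open OC.1, OC.1 q0 & forall x, cdom (psi i) x -> OC.1 (cpar (psi i) x) ->
      cim b (cpar (psi i) x) -> forall l k, `|jacm (tr (psi i) b) x l k| <= OC.2].
    have [p [th [nth sub nF]]] := hth i.
    have [Ob [oO Oq] [C HC]] := normal_chart_bound q0 nth.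
    exists (Ob, d%:R * (K * C)); split=> //= x ix Ox bx l k.
    have sth : smooth_chart th by case: nth.
    have tth : trdom (psi i) th x by split=> //; apply: sub; exists x.
    have tb : trdom (psi i) b x by [].
    rewrite (jacm_tr_comp (spsi i) sth sb tth tb).
    have [tF EF] := tr_mem tth.
    apply: mulmx_entry_le; first by move=> l' k'; exact: (Cnorm1_jac l' k' (spsi i) sth q1 tth nF).
    by move=> l' k'; rewrite jacmE; apply: HC => //; rewrite EF.
  have [OC HOC] := choice HO.
  pose Cs := \sum_i `|(OC i).2|.
  have nO : \forall p \near q0, (forall i, (OC i).1 p) /\ (cim b p /\
       (forall lj : 'I_d * 'I_m, `|'D_('e_lj.1) (fun z => f (cpar b z) 0 lj.2) (ccoord b p)| <= D)).
    apply: filterI.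
      by apply: filter_forall => i; have [oO Oq _] := HOC i; exact: open_nbhs_nbhs (conj oO Oq).
    apply: filterI; first exact: open_nbhs_nbhs (conj (chart_im_open b) (chart_at_mem q0)).
    have cc := ccoord_continuous bx0; rewrite Ex0 in cc.
    have E0 : ccoord (chart_at q0) q0 = x0 by have := cparK bx0; rewrite Ex0.
    by rewrite -E0 in ND; exact: cc _ ND.
  exists ([set p | (forall i, (OC i).1 p) /\ (cim b p /\
       (forall lj : 'I_d * 'I_m, `|'D_('e_lj.1) (fun z => f (cpar b z) 0 lj.2) (ccoord b p)| <= D))],
     [set M | d%:R * (Cs * D) <= M]).
    by split=> /=; [exact: nO | exact: (nbhs_pinfty_ge (num_real _))].
  move=> [p M] /= [[Op [bp Dp]] hM] i x ix Ex l j.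
  have tb : trdom (psi i) b x by split=> //; rewrite /preimage /= Ex.
  have [bt Et] := tr_mem tb.
  have Rf : Reg 0 1 (cdom b) (fun z => f (cpar b z) 0 j) by apply: CqX_Reg cf sb _; rewrite tr1.
  have -> : 'D_('e_l) (fun y => f (cpar (psi i) y) 0 j) x =
     'D_('e_l) ((fun z => f (cpar b z) 0 j) \o tr (psi i) b) x.
    apply: near_eq_derive; apply: filterS (open_nbhs_nbhs (conj (trdom_open (psi i) b) tb)) => y yb /=.
    by have [_ ->] := tr_mem yb.
  have [_ ->] := is_derive_comp_Reg l (chart_dom_open b) bt Rf (fun k => Reg_tr 1 k (spsi i) sb) tb.
  apply: le_trans hM; apply: le_trans (ler_norm_sum _ _ _) _.
  rewrite mulr_natl -[X in _ *+ X]card_ord -sumr_const; apply: ler_sum => k _.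
  rewrite normrM ler_pM //.
    have [_ _ H] := HOC i; have := H x ix; rewrite Ex => /(_ (Op i) bp l k); rewrite jacmE => h.
    apply: (le_trans h); apply: le_trans (ler_norm _) _.
    by rewrite /Cs (bigD1 i) //= lerDl sumr_ge0.
  by have := Dp (k, j); rewrite /= /tr Ex.
have [M [HM M0]] := filter_ex (filterI near_P (nbhs_pinfty_ge (num_real `|C0|))).
exists (m%:R * M); apply: ge_ereal_sup => _ [i _ <-].
have M0' : 0 <= M by apply: le_trans M0.
apply: Bd_Cnorm => //.
- exact: chart_dom_open.
- by rewrite /hexp tr1 subrr.
- have th01 : (0:R) <= 0 <= (1:R) by rewrite lexx ler01.
  apply: Reg_Cq; first exact: chart_dom_open.
  by move=> j; rewrite /hexp tr1 subrr; apply: CqX_Reg cf (spsi i) _; rewrite tr1.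
- move=> j; rewrite tr1; split.
    by move=> x _; apply: le_trans (HC0 _ _) _; apply: le_trans M0; exact: ler_norm.
  move=> l; split=> // x ix.
  by apply: (HM (cpar (psi i) x)).
Qed.

End metric.

(** * Multiplication operators for the anisotropic norm *)

Section compactly_supported.
Context {R : realType}.

Lemma compact_support_integrable (M : R) (f : R -> R) : continuous f ->
  (forall t, M < `|t| -> f t = 0) ->
  (@lebesgue_measure R).-integrable [set: R] (EFin \o f) /\
  \int[lebesgue_measure]_t f t = \int[lebesgue_measure]_(t in `[- M, M]) f t.
Proof.
move=> cf f0.
have e t : (f \_ `[- M, M]) t = f t.
  rewrite patchE; case: ifPn => // /negP h; rewrite f0 // ltNge ler_norml.
  by apply/negP => ?; apply: h; rewrite inE /= in_itv.
split; last by rewrite [RHS]Rintegral_mkcond; apply: eq_Rintegral => t _; rewrite e.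
have mI : measurable (`[- M, M]%classic : set (measurableTypeR R)) by exact: measurable_itv.
have i := (@continuous_compact_integrable R f `[- M, M]%classic (@segment_compact _ _ _)
  (continuous_subspaceT cf)).
have := (integrable_mkcond _ mI).1 i.
suff -> : (EFin \o f) \_ `[- M, M]%classic = EFin \o f by [].
by apply/funext => t; rewrite -[X in _ = X]/((f t)%:E) -e !patchE; case: ifP.
Qed.

Lemma compact_support_integral_le (M e : R) (f : R -> R) : 0 <= M -> continuous f ->
  (forall t, M < `|t| -> f t = 0) -> (forall t, `|f t| <= e) ->
  `|\int[lebesgue_measure]_t f t| <= 2 * M * e.
Proof.
move=> M0 cf f0 fe.
have [_ ->] := compact_support_integrable cf f0.
have mI : measurable (`[- M, M]%classic : set (measurableTypeR R)) by exact: measurable_itv.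
have cI (h : R -> R) : continuous h -> (@lebesgue_measure R).-integrable `[- M, M]%classic (EFin \o h).
  move=> ch; apply: (@continuous_compact_integrable R h) => //; first exact: segment_compact.
  exact: continuous_subspaceT.
apply: le_trans (le_normr_Rintegral mI (cI _ cf)) _.
apply: (@le_trans _ _ (\int[lebesgue_measure]_(t in `[- M, M]) e)).
  apply: le_Rintegral => //; first exact: (cI (fun t => `|f t|) (fun t => continuous_comp (cf t) (@norm_continuous _ _ _))).
  exact: (cI (fun=> e) (@cst_continuous _ _ e)).
have e0 : 0 <= e by exact: le_trans (fe 0).
rewrite Rintegral_cst // mulrC; apply: ler_wpM2r => //.
have -> : fine ((@lebesgue_measure R) `[- M, M]%classic) = if - M < M then M - - M else 0.
  by rewrite lebesgue_measure_itv /= lte_fin; case: ifP.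
by case: ifP => _; lra.
Qed.

Definition csupp n (M : R) (F : 'rV[R]_n -> R) := continuous F /\
  (forall x : 'rV[R]_n, (exists j, M < `|x 0 j|) -> F x = 0).

Lemma csuppD n M (F G : 'rV[R]_n -> R) : csupp M F -> csupp M G -> csupp M (fun x : 'rV[R]_n => F x + G x).
Proof.
move=> [cF F0] [cG G0]; split; first by move=> x; apply: (@continuousD _ _ _ F G); [exact: cF|exact: cG].
by move=> x h; rewrite F0 // G0 // addr0.
Qed.

Lemma csuppM n M (F G : 'rV[R]_n -> R) : continuous F -> csupp M G -> csupp M (fun x : 'rV[R]_n => F x * G x).
Proof.
move=> cF [cG G0]; split; first by move=> x; apply: (@continuousM _ _ F G); [exact: cF|exact: cG].
by move=> x h; rewrite G0 // mulr0.
Qed.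

Lemma csuppZ n M (a : R) F : csupp M F -> csupp M (fun x : 'rV[R]_n => a * F x).
Proof. by apply: csuppM => x; exact: cst_continuous. Qed.

Lemma row_mx_continuous n (T : topologicalType) (a : T -> R) (b : T -> 'rV[R]_n) p :
  {for p, continuous a} -> {for p, continuous b} ->
  {for p, continuous (fun q => row_mx (of_real (a q)) (b q) : 'rV[R]_(1 + n))}.
Proof.
move=> ca cb; apply: row_continuous => j; rewrite -(splitK j); case: (fintype.split j) => k /=.
- apply: (@near_continuous _ _ a); last exact: ca.
  by near=> q; rewrite row_mxEl mxE (ord1 k) eqxx mulr1n.
- apply: (@near_continuous _ _ ((fun y : 'rV[R]_n => y 0 k) \o b)).
    by near=> q; rewrite row_mxEr.
  apply: continuous_comp; first exact: cb.
  exact: coord_continuous.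
Unshelve. all: by end_near. Qed.

Lemma csupp_slice n M (F : 'rV[R]_(1 + n) -> R) (t : R) :
  csupp M F -> csupp M (fun y : 'rV[R]_n => F (row_mx (of_real t) y)).
Proof.
move=> [cF F0]; split.
  move=> y; apply: (@continuous_comp _ _ _ (fun y => row_mx (of_real t) y)); last exact: cF.
  by apply: (@row_mx_continuous n _ (fun=> t) id); [exact: cst_continuous | exact: cvg_id].
by move=> y [j h]; apply: F0; exists (rshift 1 j); rewrite row_mxEr.
Qed.

(** Compactness of the ball of radius M makes continuity in the first variable uniform in the
    remaining ones; outside that ball both values are 0. *)
Lemma csupp_slice_near n M (F : 'rV[R]_(1 + n) -> R) (t e : R) : 0 <= M -> csupp M F -> 0 < e ->
  \forall s \near t, forall y : 'rV[R]_n,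
    `|F (row_mx (of_real t) y) - F (row_mx (of_real s) y)| <= e.
Proof.
move=> M0 [cF F0] e0.
pose Kc := [set y : 'rV[R]_n | `|y| <= M].
have cK : compact Kc.
  apply: bounded_closed_compact.
    by exists M; split; [exact: num_real | move=> m Mm y hy; apply: le_trans hy (ltW Mm)].
  apply: (@closed_comp _ _ (fun y : 'rV[R]_n => `|y|) [set x | x <= M]); last exact: closed_le.
  by move=> y _; exact: norm_continuous.
have := (compact_near_coveringP Kc).1 cK _ (nbhs t)
  (fun s y => `|F (row_mx (of_real t) y) - F (row_mx (of_real s) y)| <= e) _.
move=> /(_ _) H.
have : \forall s \near t, (Kc `<=` fun y => `|F (row_mx (of_real t) y) - F (row_mx (of_real s) y)| <= e).
  apply: H => y _.
  have c : {for (y, t), continuous (fun q : 'rV[R]_n * R => F (row_mx (of_real q.2) q.1))}.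
    apply: (@continuous_comp _ _ _ (fun q : 'rV[R]_n * R => row_mx (of_real q.2) q.1)); last exact: cF.
    by apply: (@row_mx_continuous n _ snd fst); [exact: cvg_snd | exact: cvg_fst].
  have c' : {for (y, t), continuous (fun q : 'rV[R]_n * R => F (row_mx (of_real t) q.1))}.
    apply: (@continuous_comp _ _ _ fst (fun y => F (row_mx (of_real t) y))); first exact: cvg_fst.
    by have [cs _] := @csupp_slice n M F t (conj cF F0); exact: cs.
  have := @continuousB _ _ _ _ _ _ c' c.
  move=> /cvgrPdist_le /(_ e e0).
  rewrite -[nbhs (y, t)]/(filter_prod _ _) /=.
  apply: filterS => -[y' s] /=; rewrite !fctE /= subrr sub0r normrN.
  exact.
apply: filterS => s h y; have [yK|yK] := boolP (`|y| <= M); first exact: h.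
suff [j hj] : exists j, M < `|y 0 j|.
  have z u : F (row_mx (of_real u) y) = 0 by apply: F0; exists (rshift 1 j); rewrite row_mxEr.
  by rewrite !z subr0 normr0 ltW.
apply: contrapT => hn; move/negP: yK; apply.
by apply: norm_row_le => // j; rewrite leNgt; apply/negP => hj; apply: hn; exists j.
Qed.

Lemma iint0 n : iint (fun _ : 'rV[R]_n => 0) = 0.
Proof.
elim: n => [//|n IH] /=; rewrite (_ : (fun t : R => _) = cst 0) //; last by apply/funext => t; exact: IH.
have := @compact_support_integral_le 0 0 (cst 0) (lexx _) (@cst_continuous _ _ 0).
rewrite mulr0 normr_le0 => H; apply/eqP; apply: H => t //.
by rewrite normr0.
Qed.

(** The three claims need each other: linearity and the bound in dimension n make the inner integral
    a continuous function of the outer variable, hence integrable, and this is what linearity in the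
    next dimension requires. *)
Lemma iint_linear n M : 0 <= M ->
  [/\ forall F G : 'rV[R]_n -> R, csupp M F -> csupp M G -> iint (fun x => F x + G x) = iint F + iint G,
      forall a (F : 'rV[R]_n -> R), csupp M F -> iint (fun x => a * F x) = a * iint F &
      forall (e : R) (F : 'rV[R]_n -> R), csupp M F -> (forall x, `|F x| <= e) ->
        `|iint F| <= (2 * M) ^+ n * e].
Proof.
move=> M0; elim: n => [|n [IHD IHZ IHb]]; first by split=> //= e F _ h; rewrite mul1r.
have M0' : 0 <= (2 * M) ^+ n by rewrite exprn_ge0 // mulr_ge0.
pose S (F : 'rV[R]_(1 + n) -> R) t := iint (fun y : 'rV[R]_n => F (row_mx (of_real t) y)).
have S0 F t : csupp M F -> M < `|t| -> S F t = 0.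
  move=> [cF F0] ht; rewrite /S (_ : (fun y => _) = fun=> 0); first exact: iint0.
  apply/funext => y; apply: F0; exists (lshift n ord0).
  by rewrite row_mxEl mxE eqxx mulr1n.
have cS F : csupp M F -> continuous (S F).
  move=> cF t; apply/cvgrPdist_le => e e0.
  have e'0 : 0 < e / ((2 * M) ^+ n + 1) by rewrite divr_gt0 // ltr_pwDr.
  have := csupp_slice_near t M0 cF e'0; apply: filterS => s h.
  have cs u := csupp_slice u cF.
  have -> : S F t - S F s = iint (fun y => F (row_mx (of_real t) y) + -1 * F (row_mx (of_real s) y)).
    rewrite IHD //; last exact: csuppZ.
    by rewrite IHZ // mulN1r.
  apply: le_trans (IHb (e / ((2 * M) ^+ n + 1)) _ _ _) _.
  - by apply: csuppD => //; exact: csuppZ.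
  - by move=> y; rewrite mulN1r.
  - rewrite mulrCA ler_piMr //; first exact: ltW.
    by rewrite ler_pdivrMr ?ltr_pwDr // mul1r lerDl.
have iS F (cF : csupp M F) := (compact_support_integrable (cS F cF) (fun t => S0 F t cF)).1.
split=> /=.
- move=> F G cF cG; rewrite -RintegralD //; [|exact: (iS F)|exact: (iS G)].
  by apply: eq_Rintegral => t _; rewrite IHD //; exact: csupp_slice.
- move=> a F cF; rewrite -RintegralZl //; last exact: (iS F).
  by apply: eq_Rintegral => t _; rewrite IHZ //; exact: csupp_slice.
- move=> e F cF h; rewrite exprS -mulrA.
  apply: compact_support_integral_le => //; [exact: cS | by move=> t; exact: S0|].
  by move=> t; apply: IHb => [|y]; [exact: csupp_slice | exact: h].
Qed.

End compactly_supported.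

Section restriction.
Context {R : realType} {n m : nat}.
Implicit Types (U V : set 'rV[R]_n) (f : 'rV[R]_n -> 'rV[R]_m).

Lemma Cnorm_Bd_le (q C : R) k U f j : open U -> (k <= Num.truncn q)%N -> Cq k%:R U f ->
  (Cnorm q U f <= C%:E)%E -> Bd k U C (fun x => f x 0 j).
Proof.
move=> oU kq cf nf; apply/Bd_pdsP => s x hs Ux.
have [_ <- //] := Cq_Reg j oU cf; last by rewrite truncn_nat.
apply: le_trans (coord_le_enorm _ _) _; rewrite -lee_fin; apply: le_trans nf.
by apply: ereal_sup_ubound; left; exists s, x; split=> //; exact: leq_trans kq.
Qed.

Lemma Reg_Cq_nat k U f : open U -> (forall j, Reg 0 k U (fun x => f x 0 j)) -> Cq k%:R U f.
Proof. by move=> oU H; apply: Reg_Cq => // j; rewrite truncn_nat hexp_nat. Qed.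

Lemma Cq_Reg_le (q : R) k U f j : open U -> (k <= Num.truncn q)%N -> Cq q U f ->
  Reg 0 k U (fun x => f x 0 j).
Proof.
move=> oU kq cf; have [r _] := Cq_Reg j oU cf.
by apply: (Reg_le _ oU kq (Reg_hexp0 r)); rewrite lexx ler01.
Qed.

End restriction.

Lemma eball_open (R : realType) n (x : 'rV[R]_n) rho : open (eball x rho).
Proof.
apply: (@open_comp _ _ (fun y : 'rV[R]_n => enorm (y - x)) [set t | t < rho]); last exact: open_lt.
move=> y _; apply: (@continuous_comp _ _ _ (fun y : 'rV[R]_n => y - x) (@enorm R n)); last exact: enorm_continuous.
by apply: (@continuousB _ _ _ id (cst x)); [exact: cvg_id | exact: cst_continuous].
Qed.

Lemma ecball_compl_open (R : realType) n (x : 'rV[R]_n) rho : open [set y : 'rV[R]_n | rho < enorm (y - x)].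
Proof.
apply: (@open_comp _ _ (fun y : 'rV[R]_n => enorm (y - x)) [set t | rho < t]); last exact: open_gt.
move=> y _; apply: (@continuous_comp _ _ _ (fun y : 'rV[R]_n => y - x) (@enorm R n)); last exact: enorm_continuous.
by apply: (@continuousB _ _ _ id (cst x)); [exact: cvg_id | exact: cst_continuous].
Qed.

Lemma Bd_coord (R : realType) n k (U : set 'rV[R]_n) (C : R) j : open U -> 1 <= C ->
  (forall x, U x -> `|x 0 j| <= C) -> Bd k U C (fun x => x 0 j).
Proof.
move=> oU C1 H; case: k => [|k]; split=> // i.
apply: (@Bd_ext _ _ _ _ _ (fun=> (i == j)%:R)) => //.
  by move=> y Uy; have [_ ->] := is_derive_coord y ('e_i : 'rV[R]_n) j; rewrite mxE eqxx eq_sym.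
apply: Bd_cst => //; apply: le_trans C1; by case: (_ == _); rewrite ?normr1 ?normr0.
Qed.

(** * Weights on test functions along admissible graphs *)

Section test_weight.
Context {R : realType} {ds du : nat}.
Variables (r K A delta : R).
Hypotheses (r2 : 2 < r) (hA : 1 < A) (hdelta : 0 < delta).

Let th01 : (0:R) <= 0 <= (1:R). Proof. by rewrite lexx ler01. Qed.

Lemma cube_open n (rho : R) : open (@cube R n rho).
Proof.
rewrite openE => x xc; rewrite /interior.
have H j : \forall y \near x, `|(y : 'rV[R]_n) 0 j| < rho.
  have c : {for x, continuous (fun y : 'rV[R]_n => `|y 0 j|)}.
    apply: (@continuous_comp _ _ _ (fun y : 'rV[R]_n => y 0 j) (fun t => `|t|)); last exact: norm_continuous.
    exact: coord_continuous.
  exact: (c [set t | t < rho] (open_nbhs_nbhs (conj (@open_lt R rho) (xc j)))).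
exact: (filter_forall (nbhs_filter x) H).
Qed.

Lemma cube_sub n (rho : R) : 0 < rho -> @cube R n (2 * rho / 3) `<=` cube rho.
Proof. by move=> r0 x xc j; apply: lt_trans (xc j) _; move: r0; lra. Qed.

Definition graph (chi : 'rV[R]_ds -> 'rV[R]_du) y : 'rV[R]_(ds + du) := row_mx y (chi y).

Lemma graph_in_cube rho c x chi y : 0 < rho -> admissible r K A delta rho c x chi ->
  eball x (A * delta) y -> cube rho (graph chi y).
Proof.
move=> rho0 [b1 b2 _ _ _] /ltW xy j; rewrite /graph -(splitK j); case: (fintype.split j) => k /=.
  by rewrite row_mxEl; apply: cube_sub (b1 y xy) k.
by rewrite row_mxEr; apply: cube_sub (b2 y xy) k.
Qed.

Let k_r1 k : (k <= 2)%N -> (k <= Num.truncn (r + 1))%N.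
Proof.
move=> k2; apply: leq_trans k2 _; rewrite truncn_ge_nat; first by move: r2; lra.
by move: r2; lra.
Qed.

Lemma graph_Reg k rho c x chi j : (k <= 2)%N -> admissible r K A delta rho c x chi ->
  Reg 0 k (eball x (A * delta)) (fun y => graph chi y 0 j).
Proof.
move=> k2 [_ _ [V [oV xV cV]] _ _]; rewrite /graph -(splitK j); case: (fintype.split j) => l /=.
  apply: (@Reg_ext _ _ _ _ _ (fun y => y 0 l)); [exact: eball_open | by move=> y _; rewrite row_mxEl |].
  by apply: Reg_coord => //; exact: eball_open.
apply: (@Reg_ext _ _ _ _ _ (fun y => chi y 0 l)); [exact: eball_open | by move=> y _; rewrite row_mxEr |].
apply: (@Reg_sub _ _ _ _ _ V); last exact: Cq_Reg_le oV (k_r1 k2) cV.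
by move=> y /ltW; exact: xV.
Qed.

Lemma graph_Bd k rho D c x chi j : (k <= 2)%N -> 0 < rho -> rho <= D -> 1 <= D -> K <= D ->
  admissible r K A delta rho c x chi ->
  Bd k (eball x (A * delta)) D (fun y => graph chi y 0 j).
Proof.
move=> k2 rho0 rD D1 KD ad; have [b1 b2 [V [oV xV cV]] nchi _] := ad.
have oB := @eball_open R ds x (A * delta).
rewrite /graph -(splitK j); case: (fintype.split j) => l /=.
  apply: (@Bd_ext _ _ _ _ _ (fun y => y 0 l)) => //; first by move=> y _; rewrite row_mxEl.
  apply: Bd_coord => // y /ltW xy; apply: le_trans rD; apply: ltW.
  exact: cube_sub (b1 y xy) l.
apply: (@Bd_ext _ _ _ _ _ (fun y => chi y 0 l)) => //; first by move=> y _; rewrite row_mxEr.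
apply: (Bd_le (leqnn k) (@subset_refl _ _) KD).
apply: (Cnorm_Bd_le l oB (k_r1 k2) _ nchi).
apply: Reg_Cq_nat => // i; apply: (@Reg_sub _ _ _ _ _ V); last exact: Cq_Reg_le oV (k_r1 k2) cV.
by move=> y /ltW; exact: xV.
Qed.

(** Weighting a test function costs a factor E uniform over graphs, centres and weights, and allows
    the order to drop from l to k. The weight is controlled on V only, the ball over which the graph
    is given; on W the product vanishes with phi, and V and W cover the space since delta < A
    delta. *)
Lemma test_weight k (C0 P : R) : (k <= 2)%N ->
  exists2 E : R, 0 < E & forall l rho c x chi phi (be : 'rV[R]_(ds + du) -> R),
    (k <= l)%N -> 0 < rho <= P -> admissible r K A delta rho c x chi ->
    test_fun l%:R delta x phi -> Reg 0 k (cube rho) be -> Bd k (cube rho) C0 be ->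
    exists2 phi', test_fun k%:R delta x phi' &
      forall y, (be (graph chi y))%:C%C * phi y = E%:C%C * phi' y.
Proof.
move=> k2; pose D := Num.max (Num.max P 1) K.
have [E0 HE0] := @Bd_comp R ds (ds + du) k C0 D.
pose E := 2 * (2 ^+ k * (2 ^+ k * (`|E0| + 1))).
have E00 : 0 < `|E0| + 1 by rewrite ltr_wpDl.
have Egt0 : 0 < E by rewrite /E !mulr_gt0 // exprn_gt0.
exists E => // l rho c x chi phi be kl /andP[rho0 rhoP] ad [cphi [rho' rd phi0] nphi] Rbe Bbe.
pose V := eball x (A * delta); pose W := [set y | rho' < enorm (y - x)].
have oV : open V by exact: eball_open.
have oW : open W by exact: ecball_compl_open.
have dA : delta < A * delta by rewrite ltr_pMl.
have VW y : V y \/ W y.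
  by case: (ltP (enorm (y - x)) (A * delta)) => h; [left | right; apply: lt_le_trans h; exact: lt_trans dA].
pose b y := be (graph chi y).
have gV y : V y -> cube rho (graph chi y) by exact: graph_in_cube ad.
have RG j : Reg 0 k V (fun y => graph chi y 0 j) by exact: graph_Reg ad.
have Rb : Reg 0 k V b by exact: Reg_comp oV (@cube_open _ _) gV Rbe RG.
have Bb : Bd k V (`|E0| + 1) b.
  apply: (@Bd_le _ _ k k V V E0) => //; first by apply: le_trans (ler_norm _) _; rewrite lerDl.
  apply: (HE0 V (cube rho)) => //; first exact: cube_open.
  move=> j; apply: graph_Bd ad => //; rewrite /D !le_max ?rhoP ?lexx ?orbT //.
pose f j y := of_complex (phi y) 0 j.
have Rf j : Reg 0 k V (f j).
  by apply: (@Reg_sub _ _ _ _ _ setT) => //; apply: Cq_Reg_le cphi => //; [exact: openT | rewrite truncn_nat].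
have Bf j : Bd k V 1 (f j).
  apply: (@Bd_le _ _ k k setT V 1) => //; apply: (Cnorm_Bd_le j openT _ _ nphi); first by rewrite truncn_nat.
  apply: Reg_Cq_nat; first exact: openT.
  by move=> i; apply: Cq_Reg_le cphi => //; [exact: openT | rewrite truncn_nat].
pose h j y := E^-1 * (b y * f j y).
have RhV j : Reg 0 k V (h j) by apply: RegZ => //; exact: RegM.
have BhV j : Bd k V 2^-1 (h j).
  have := BdM th01 oV (Reg_cst 0 oV k E^-1) (RegM th01 oV Rb (Rf j))
    (Bd_cst oV (a := E^-1) (C := E^-1) k _) (BdM th01 oV Rb (Rf j) Bb (Bf j)).
  have -> : 2 ^+ k * (E^-1 * (2 ^+ k * ((`|E0| + 1) * 1))) = 2^-1.
    rewrite /E; field; rewrite !expf_neq0 ?lt0r_neq0 //=.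
  by apply; rewrite ger0_norm // ltW // invr_gt0.
pose phi' y : R[i] := E^-1%:C%C * ((b y)%:C%C * phi y).
have phi'E j y : of_complex (phi' y) 0 j = h j y.
  rewrite /phi' /h /f !mxE; case: (phi y) => u v; case: ifP => _ /=; ring.
have h0 j y : W y -> h j y = 0.
  by move=> Wy; rewrite /h /f phi0 //= mxE /=; case: ifP => _; rewrite !mulr0.
have Rh j : Reg 0 k setT (h j).
  apply: Reg_loc => y _; case: (VW y) => hy; first by exists V.
  exists W => //; apply: (@Reg_ext _ _ _ _ _ (fun=> 0)) => //; last exact: Reg_cst.
  by move=> z /h0 ->.
have Bh j : Bd k setT 2^-1 (h j).
  apply/Bd_pdsP => s y hs _; case: (VW y) => hy; first by have /Bd_pdsP := BhV j; apply.
  have : Bd k W 2^-1 (h j).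
    apply: (@Bd_ext _ _ _ _ _ (fun=> 0)) => //; first by move=> z /h0 ->.
    by apply: Bd_cst => //; rewrite normr0 invr_ge0.
  by move/Bd_pdsP; apply.
have cphi' : Cq k%:R setT (@of_complex R \o phi').
  apply: Reg_Cq_nat; first exact: openT.
  by move=> j; apply: (Reg_ext openT _ (Rh j)) => y _; rewrite -phi'E.
exists phi'; last by move=> y; rewrite /phi' mulrA -[E%:C%C * _]rmorphM mulfV ?lt0r_neq0 // mul1r.
split=> //.
  by exists rho' => // y hy; rewrite /phi' phi0 // !mulr0.
have -> : 1%E = (2%:R * 2^-1)%:E :> \bar R by rewrite mulfV.
apply: (Bd_Cnorm openT (hexp_nat k) _ cphi') => [|j]; first by rewrite invr_ge0.
by rewrite truncn_nat; apply: (Bd_ext openT _ (Bh j)) => y _; rewrite -phi'E.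
Qed.

End test_weight.

Section complex_integral.
Context {R : realType}.

Lemma Re_normE (V : normedZmodType R[i]) (v : V) : `|v| = (complex.Re `|v|)%:C%C.
Proof. by rewrite RRe_real // ger0_real. Qed.

Lemma Re_norm_ge0 (V : normedZmodType R[i]) (v : V) : 0 <= complex.Re `|v|.
Proof. by have := normr_ge0 v; rewrite [X in 0 <= X]Re_normE ler0c. Qed.

Lemma Re_normD (V : normedZmodType R[i]) (v w : V) :
  complex.Re `|v + w| <= complex.Re `|v| + complex.Re `|w|.
Proof. by rewrite -lecR rmorphD /= -!Re_normE ler_normD. Qed.

Lemma Re_normM (z w : R[i]) : complex.Re `|z * w| = complex.Re `|z| * complex.Re `|w|.
Proof. have e := etrans (esym (Re_normE (z * w))) (etrans (normrM z w) (f_equal2 *%R (Re_normE z) (Re_normE w))).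
by apply: complexI; refine (etrans e _); rewrite -rmorphM. Qed.

Lemma Re_norm_real (a : R) : complex.Re `|a%:C%C| = `|a|.
Proof. by rewrite normc_def /= expr0n addr0 sqrtr_sqr. Qed.

Definition ccsupp n M (F : 'rV[R]_n -> R[i]) :=
  csupp M (fun x => complex.Re (F x)) /\ csupp M (fun x => complex.Im (F x)).

Lemma ccsuppZ n M a (F : 'rV[R]_n -> R[i]) : ccsupp M F -> ccsupp M (fun x => a%:C%C * F x).
Proof.
move=> [cr ci]; split.
- have := csuppZ a cr; congr (csupp _ _); apply/funext => x; case: (F x) => u v /=; ring.
- have := csuppZ a ci; congr (csupp _ _); apply/funext => x; case: (F x) => u v /=; ring.
Qed.

Lemma ciintD n M (F G : 'rV[R]_n -> R[i]) : 0 <= M -> ccsupp M F -> ccsupp M G ->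
  ciint (fun x => F x + G x) = ciint F + ciint G.
Proof.
move=> M0 [Fr Fi] [Gr Gi]; have [iD _ _] := iint_linear n M0.
rewrite /ciint -[RHS]/(Complex (_ + _) (_ + _)) -!iD //.
by congr Complex; congr iint; apply/funext => x; case: (F x) => u v; case: (G x).
Qed.

Lemma ciintZ n M a (F : 'rV[R]_n -> R[i]) : 0 <= M -> ccsupp M F ->
  ciint (fun x => a%:C%C * F x) = a%:C%C * ciint F.
Proof.
move=> M0 [Fr Fi]; have [_ iZ _] := iint_linear n M0.
rewrite /ciint; have -> : a%:C%C * (Complex (iint (fun x => complex.Re (F x))) (iint (fun x => complex.Im (F x))))
   = Complex (a * iint (fun x => complex.Re (F x))) (a * iint (fun x => complex.Im (F x))).
  by apply/eqP; rewrite eq_complex /= !mul0r subr0 addr0 !eqxx.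
rewrite -!iZ //.
by congr Complex; congr iint; apply/funext => x; case: (F x) => u v /=; ring.
Qed.

End complex_integral.

Section leibniz.
Context {R : realType} {ds du : nat}.
Variables (r K A delta : R).
Hypotheses (r2 : 2 < r) (hA : 1 < A) (hdelta : 0 < delta).

Let th01 : (0:R) <= 0 <= (1:R). Proof. by rewrite lexx ler01. Qed.

(** The graph is controlled over the ball of radius A delta only. The support of phi lies strictly
    inside it, so the integrand is continuous near every point, either as a composition or because
    it vanishes around it. *)
Lemma graph_csupp rho c x chi q (phi : 'rV[R]_ds -> R[i]) (w : 'rV[R]_(ds + du) -> R[i]) :
  0 < rho -> admissible r K A delta rho c x chi -> test_fun q delta x phi ->
  (forall z, cube rho z -> {for z, continuous (fun z => complex.Re (w z))} /\
                            {for z, continuous (fun z => complex.Im (w z))}) ->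
  ccsupp rho (fun y => w (graph chi y) * phi y).
Proof.
move=> rho0 ad [cphi [rho' rd phi0] _] cw.
have dA : delta < A * delta by rewrite ltr_pMl.
have [b1 _ _ _ _] := ad.
pose f j y := of_complex (phi y) 0 j.
have cf j : continuous (f j).
  by move=> y; apply: (@Reg_cont _ _ 0 0 setT) => //; apply: Cq_Reg_le cphi => //; exact: openT.
have f0E y : f ord0 y = complex.Re (phi y) by rewrite /f mxE.
have f1E y : f ord_max y = complex.Im (phi y) by rewrite /f mxE.
suff H (u v : 'rV[R]_(ds + du) -> R) : (forall z, cube rho z -> {for z, continuous u} /\ {for z, continuous v}) ->
    csupp rho (fun y => u (graph chi y) * f ord0 y + v (graph chi y) * f ord_max y).
  split.
  - have := H (fun z => complex.Re (w z)) (fun z => - complex.Im (w z)) _.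
    rewrite (_ : (fun y => _) = (fun y => complex.Re (w (graph chi y) * phi y))).
      apply => z /cw [c1 c2]; split=> //; exact: (@continuousN _ _ _ (fun z => complex.Im (w z)) _ c2).
    by apply/funext => y; rewrite f0E f1E; case: (w _) => p q'; case: (phi y) => p' q'' /=; ring.
  - have := H (fun z => complex.Im (w z)) (fun z => complex.Re (w z)) _.
    rewrite (_ : (fun y => _) = (fun y => complex.Im (w (graph chi y) * phi y))).
      by apply => z /cw [c1 c2].
    by apply/funext => y; rewrite f0E f1E; case: (w _) => p q'; case: (phi y) => p' q'' /=; ring.
move=> cuv.
suff H j (t : 'rV[R]_(ds + du) -> R) : (forall z, cube rho z -> {for z, continuous t}) ->
    csupp rho (fun y => t (graph chi y) * f j y).
  by apply: csuppD; apply: H => z /cuv [].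
move=> ct; split; last first.
  move=> y [l hl]; rewrite /f phi0 ?mxE /=; first by case: ifP; rewrite mulr0.
  apply: lt_trans rd _; apply: lt_trans dA _; rewrite ltNge; apply/negP => h.
  by have := lt_trans hl (cube_sub rho0 (b1 y h) l); rewrite ltxx.
move=> y; case: (ltP (enorm (y - x)) (A * delta)) => hy.
  apply: (@continuousM _ _ (fun y => t (graph chi y)) (f j)); last exact: cf.
  apply: (@continuous_comp _ _ _ (graph chi) t); last by apply: ct; exact: graph_in_cube ad hy.
  apply: row_continuous => l; apply: (Reg_cont (U := eball x (A * delta))); last exact: hy.
  exact: (graph_Reg r2 l (isT : (0 <= 2)%N) ad).
apply: (@near_continuous _ _ (fun=> 0)); last exact: cst_continuous.
have oW := @ecball_compl_open R ds x rho'.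
have Wy : rho' < enorm (y - x) by apply: lt_le_trans hy; exact: lt_trans dA.
apply: filterS (open_nbhs_nbhs (conj oW Wy)) => z zW.
by rewrite /f phi0 // mxE /=; case: ifP; rewrite mulr0.
Qed.

Lemma of_complexK (z : R[i]) : to_complex (of_complex z) = z.
Proof. by case: z => u v; rewrite /to_complex !mxE. Qed.

Variables (N : nat) (X : riemannian R (ds + du)) (psi : 'I_N -> chart R (ds + du) X).
Variables (rad c : 'I_N -> R).
Hypotheses (spsi : forall i, smooth_chart (psi i)) (rad0 : forall i, 0 < rad i).
Hypothesis dom : forall i, cdom (psi i) = cube (rad i).

Lemma seminorm_le k q h n i s x chi phi : norm_pq psi rad c r K A delta 1 q h = n%:E ->
  (k <= 1)%N -> size s = k -> admissible r K A delta (rad i) (c i) x chi ->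
  test_fun (q + k%:R) delta x phi ->
  complex.Re `|ciint (fun y => to_complex (pd s (@of_complex R \o h \o cpar (psi i)) (graph chi y)) * phi y)| <= n.
Proof.
move=> hn k1 hs ad tphi; rewrite -lee_fin -hn; apply: (@le_trans _ _ (seminorm_pq psi rad c r K A delta k (q + k%:R) h)).
  by apply: ereal_sup_ubound; exists i, s, x, chi, phi.
by apply: ereal_sup_ubound; exists k.
Qed.

Lemma norm11_mul (M : R) : exists C : R, 0 < C /\ forall (g : X -> R) h n m,
  CqR r g -> (CnormX psi r (@of_real R \o g) <= M%:E)%E -> CqC r h ->
  norm_pq psi rad c r K A delta 1 1 h = n%:E ->
  norm_pq psi rad c r K A delta 1 1 (fun x => (g x)%:C%C * h x) = m%:E -> m <= C * n.
Proof.
pose P := \sum_i rad i.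
have radP i : 0 < rad i <= P.
  by rewrite rad0 /P (bigD1 i) //= lerDl; apply: sumr_ge0 => j _; exact: ltW.
have [E1 E10 HE1] := @test_weight R ds du r K A delta r2 hA hdelta 1 M P isT.
have [E2 E20 HE2] := @test_weight R ds du r K A delta r2 hA hdelta 2 M P isT.
exists (E1 + E2); split; first by rewrite addr_gt0.
move=> g h n m cg ng ch hn hm; rewrite -lee_fin -hm.
have r2' : (2 <= Num.truncn r)%N by rewrite truncn_ge_nat; [apply: ltW | apply: ltW; apply: lt_trans r2].
pose gam i z := g (cpar (psi i) z).
pose f i := @of_complex R \o h \o cpar (psi i).
have Rgam i : Reg 0 2 (cube (rad i)) (gam i).
  rewrite -dom; apply: (Reg_ext (chart_dom_open (psi i)) _ (CqX_Reg 0 cg (spsi i) r2')) => z _.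
  by rewrite /= mxE eqxx mulr1n.
have Bgam i : Bd 2 (cube (rad i)) M (gam i).
  rewrite -dom; have od := chart_dom_open (psi i).
  apply: (@Bd_ext _ _ _ _ _ (fun z => ((@of_real R \o g) \o cpar (psi i)) z 0 0)) => //.
    by move=> z _; rewrite /= mxE eqxx mulr1n.
  apply: (Cnorm_Bd_le 0 od r2') => //.
    by apply: Reg_Cq_nat => // j; exact: CqX_Reg cg (spsi i) r2'.
  by apply: le_trans ng; apply: ereal_sup_ubound; exists i.
have Rf i j : Reg 0 2 (cube (rad i)) (fun z => f i z 0 j).
  by rewrite -dom; exact: (CqX_Reg j ch (spsi i) r2').
have oc i : open (@cube R (ds + du) (rad i)) by exact: cube_open.
have pdf i l z j : cube (rad i) z -> pd [:: l] (f i) z 0 j = 'D_('e_l) (fun z => f i z 0 j) z.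
  move=> zc; have [_ H] := Cq_Reg j (oc i) (Reg_Cq_nat (oc i) (Rf i)).
  by apply: (H [:: l]) => //; rewrite truncn_nat.
have cw i (s : seq 'I_(ds + du)) : (size s <= 1)%N -> forall z, cube (rad i) z ->
  {for z, continuous (fun z => complex.Re (to_complex (pd s (f i) z)))} /\
  {for z, continuous (fun z => complex.Im (to_complex (pd s (f i) z)))}.
  move=> hs z zc /=.
  suff H j : {for z, continuous (fun z => pd s (f i) z 0 j)} by split; exact: H.
  have [_ H] := Cq_Reg j (oc i) (Reg_Cq_nat (oc i) (Rf i)).
  apply: (@near_continuous _ _ (pds s (fun z => f i z 0 j))).
    apply: filterS (open_nbhs_nbhs (conj (oc i) zc)) => y yc; rewrite H // truncn_nat.
    by apply: leq_trans hs _.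
  by have [+ _ _] := Reg_pds s (Rf i j) zc; apply; apply: leq_trans hs _.
apply: ge_ereal_sup => e [k /= k1 <-]; apply: ge_ereal_sup => e' [i [s [x [chi [phi [hs ad tphi ->]]]]]].
rewrite lee_fin.
have phi0 y : ~ eball x (A * delta) y -> phi y = 0.
  have [_ [rho' rd H] _] := tphi; move/negP; rewrite -leNgt => hy; apply: H.
  by apply: lt_le_trans hy; apply: lt_trans rd _; rewrite ltr_pMl.
have gc y : eball x (A * delta) y -> cube (rad i) (graph chi y).
  by exact: graph_in_cube ad.
have Pk q : test_fun (1 + q%:R : R) delta x phi = test_fun q.+1%:R delta x phi by rewrite -natr1 addrC.
case: k k1 hs tphi => [|[|//]] _ hs; rewrite Pk => tphi.
- have [phi1 tphi1 Ephi1] := HE1 1%N _ _ _ _ _ _ (leqnn 1) (radP i) ad tphi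
    (Reg_le th01 (oc i) (isT : (1 <= 2)%N) (Rgam i))
    (Bd_le (isT : (1 <= 2)%N) (@subset_refl _ _) (lexx _) (Bgam i)).
  case: s hs => // _.
  have -> : (fun y => to_complex (pd [::] (@of_complex R \o (fun x => (g x)%:C%C * h x) \o cpar (psi i))
       (row_mx y (chi y))) * phi y) = fun y => E1%:C%C * (to_complex (f i (graph chi y)) * phi1 y).
    apply/funext => y; rewrite mulrCA -Ephi1 mulrA; congr (_ * _).
    by rewrite /f /gam /graph /= !of_complexK mulrC.
  have cs : ccsupp (rad i) (fun y => to_complex (f i (graph chi y)) * phi1 y).
    by apply: (graph_csupp (w := fun z => to_complex (f i z)) (rad0 i) ad tphi1); exact: (cw i [::]).
  rewrite (ciintZ _ (ltW (rad0 i)) cs) Re_normM Re_norm_real gtr0_norm // .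
  have le1 : complex.Re `|ciint (fun y => to_complex (f i (graph chi y)) * phi1 y)| <= n.
    have t1 : test_fun (1 + 0%:R) delta x phi1 by rewrite addr0.
    exact: (@seminorm_le 0 1 h n i [::] x chi phi1 hn isT erefl ad t1).
  have n0 := le_trans (Re_norm_ge0 _) le1.
  by rewrite mulrDl; apply: le_trans (ler_wpM2l (ltW E10) le1) _; rewrite lerDl mulr_ge0 // ltW.
- case: s hs => [//|l [|//]] _.
  have [phi1 tphi1 Ephi1] := HE1 2%N _ _ _ _ _ _ (isT : (1 <= 2)%N) (radP i) ad tphi
    (Reg_derive l (Rgam i)) ((Bgam i).2 l).
  have [phi2 tphi2 Ephi2] := HE2 2%N _ _ _ _ _ _ (leqnn 2) (radP i) ad tphi (Rgam i) (Bgam i).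
  have -> : (fun y => to_complex (pd [:: l] (@of_complex R \o (fun x => (g x)%:C%C * h x) \o cpar (psi i))
       (row_mx y (chi y))) * phi y) = fun y => E1%:C%C * (to_complex (f i (graph chi y)) * phi1 y)
          + E2%:C%C * (to_complex (pd [:: l] (f i) (graph chi y)) * phi2 y).
    apply/funext => y; rewrite ![E1%:C%C * _]mulrCA ![E2%:C%C * _]mulrCA -Ephi1 -Ephi2.
    case: (pselect (eball x (A * delta) y)) => hy; last by rewrite phi0 // !mulr0 addr0.
    rewrite !mulrA -mulrDl; congr (_ * _).
    have zc := gc y hy; set z := graph chi y in zc *.
    rewrite -/(graph chi y) -/z.
    set G := _ \o cpar (psi i).
    have GE j y' : G y' 0 j = gam i y' * f i y' 0 j.
      by rewrite /G /f /gam /= !mxE; case: (h _) => u v; case: ifP => _ /=; rewrite mul0r ?subr0 ?addr0.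
    have RG j : Reg 0 2 (cube (rad i)) (fun z => G z 0 j).
      apply: (Reg_ext (oc i) _ (RegM th01 (oc i) (Rgam i) (Rf i j))) => y' _.
      by rewrite GE.
    have dG j : pd [:: l] G z 0 j = 'D_('e_l) (gam i) z * f i z 0 j + gam i z * pd [:: l] (f i) z 0 j.
      have [_ H] := Cq_Reg j (oc i) (Reg_Cq_nat (oc i) RG).
      refine (etrans (H [:: l] z _ zc) _); first by rewrite truncn_nat.
      rewrite pdf //; have -> : pds [:: l] (fun z => G z 0 j) z = 'D_('e_l) (gam i * (fun z => f i z 0 j)) z.
        by rewrite /=; congr ('D_('e_l) _ z); apply/funext => y'; rewrite GE.
      have d1 : derivable (gam i) z 'e_l by exact: Reg_derivable (Rgam i) zc.
      have d2 : derivable (fun z => f i z 0 j) z 'e_l by exact: Reg_derivable (Rf i j) zc.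
      refine (etrans (deriveM d1 d2) _).
      by refine (etrans (addrC _ _) _); congr (_ + _); exact: mulrC.
    apply/eqP; rewrite eq_complex; apply/andP; split; apply/eqP.
    - refine (etrans (dG ord0) _); rewrite /to_complex /=; ring.
    - refine (etrans (dG ord_max) _); rewrite /to_complex /=; ring.
  have cs1 : ccsupp (rad i) (fun y => to_complex (f i (graph chi y)) * phi1 y).
    by apply: (graph_csupp (w := fun z => to_complex (f i z)) (rad0 i) ad tphi1); exact: (cw i [::]).
  have cs2 : ccsupp (rad i) (fun y => to_complex (pd [:: l] (f i) (graph chi y)) * phi2 y).
    by apply: (graph_csupp (w := fun z => to_complex (pd [:: l] (f i) z)) (rad0 i) ad tphi2); exact: (cw i [:: l]).
  rewrite (ciintD (ltW (rad0 i))); [|exact: ccsuppZ..].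
  rewrite !(ciintZ _ (ltW (rad0 i))) //; apply: le_trans (Re_normD _ _) _.
  rewrite !Re_normM !Re_norm_real !(gtr0_norm E10) !(gtr0_norm E20) mulrDl.
  apply: lerD; apply: ler_wpM2l; try exact: ltW.
  - have t1 : test_fun (1 + 0%:R) delta x phi1 by rewrite addr0.
    exact: (@seminorm_le 0 1 h n i [::] x chi phi1 hn isT erefl ad t1).
  - exact: (@seminorm_le 1 1 h n i [:: l] x chi phi2 hn isT erefl ad tphi2).
Qed.

End leibniz.

(** * Distributions *)

Section rnorm.
Context {R : realType} {B : normedModType R[i]}.
Implicit Types b : B.

Lemma rnormE b : `|b| = (rnorm b)%:C%C. Proof. exact: Re_normE. Qed.

Lemma rnorm_ge0 b : 0 <= rnorm b. Proof. exact: Re_norm_ge0. Qed.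

Lemma rnormD b c : rnorm (b + c) <= rnorm b + rnorm c. Proof. exact: Re_normD. Qed.

Lemma rnormZ (z : R[i]) b : rnorm (z *: b) = complex.Re `|z| * rnorm b.
Proof.
apply: complexI; refine (etrans (esym (rnormE _)) _); rewrite rmorphM.
by refine (etrans (normrZ z b) (f_equal2 *%R (Re_normE z) (rnormE b))).
Qed.

Lemma rnormN b : rnorm (- b) = rnorm b. Proof. by rewrite /rnorm normrN. Qed.

Lemma rnormB b c : rnorm (b - c) <= rnorm b + rnorm c.
Proof. by rewrite -(rnormN c); exact: rnormD. Qed.

Lemma rnormBC b c : rnorm (b - c) = rnorm (c - b). Proof. by rewrite -rnormN opprB. Qed.

Lemma rnorm0 : rnorm (0 : B) = 0. Proof. by rewrite /rnorm normr0. Qed.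

Lemma rnorm_eq0 b : rnorm b <= 0 -> b = 0.
Proof. by move=> h; apply/eqP; rewrite -normr_le0 rnormE lecR. Qed.

Lemma dense_rnorm (S : set B) b (e : R) : dense S -> 0 < e -> exists2 c, S c & rnorm (b - c) < e.
Proof.
move=> dS e0; have e0' : (0 : R[i]) < e%:C%C by rewrite ltcR.
have [c [cb Sc]] := dS (ball b e%:C%C) (ex_intro _ b (ballxx b e0')) (@ball_open _ B b e%:C%C).
by exists c => //; move: cb; rewrite -ball_normE /ball_ /= rnormE ltcR.
Qed.

End rnorm.

(** * Extension of bounded linear relations by density *)

Section extension.
Context {R : realType} {B : completeNormedModType R[i]}.
Variables (G : B -> B -> Prop) (C : R).
Hypotheses (C0 : 0 <= C) (Glin : forall z b b' c c', G b b' -> G c c' -> G (z *: b + c) (z *: b' + c')).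
Hypotheses (Gb : forall b b', G b b' -> rnorm b' <= C * rnorm b).
Hypothesis dG : dense [set b | exists b', G b b'].

(** Closure of the relation G. A relation is extended instead of a map because multiplication is
    given on functions h and not on their classes iota h; the bound [Gb], applied to differences,
    makes the closure single-valued. *)
Let Gcl b b' := forall e : R, 0 < e -> exists c c', [/\ G c c', rnorm (b - c) < e & rnorm (b' - c') < e].

Lemma Gcl_sub b b' : G b b' -> Gcl b b'.
Proof. by move=> g e e0; exists b, b'; rewrite !subrr !rnorm0. Qed.

Lemma Gcl_bound b b' : Gcl b b' -> rnorm b' <= C * rnorm b.
Proof.
move=> g; apply/ler_addgt0Pr => e e0.
have e1 : 0 < e / (C + 1) by rewrite divr_gt0 // ltr_wpDl.
have [c [c' [gc hc hc']]] := g _ e1.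
have h1 : rnorm b' <= rnorm (b' - c') + rnorm c' by apply: le_trans (rnormD _ _); rewrite subrK.
have h2 : rnorm c <= rnorm (b - c) + rnorm b.
  by rewrite rnormBC; apply: le_trans (rnormD _ _); rewrite subrK.
have h3 := Gb gc.
have h4 : C * rnorm c <= C * (e / (C + 1) + rnorm b).
  by rewrite ler_wpM2l //; apply: le_trans h2 _; rewrite lerD2r ltW.
have -> : e = e / (C + 1) + C * (e / (C + 1)) by field; rewrite lt0r_neq0 // ltr_wpDl.
move: h1 h3 h4 hc'; lra.
Qed.

Lemma Gcl_lin z b b' c c' : Gcl b b' -> Gcl c c' -> Gcl (z *: b + c) (z *: b' + c').
Proof.
move=> gb gc e e0; set n := complex.Re `|z|; have n0 : 0 <= n by exact: Re_norm_ge0.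
have e1 : 0 < e / (n + 1) by rewrite divr_gt0 // ltr_wpDl.
have e2 : 0 < e / (n + 1) / 2 by rewrite divr_gt0.
have [u [u' [gu hu hu']]] := gb _ e2; have [v [v' [gv hv hv']]] := gc _ e2.
exists (z *: u + v), (z *: u' + v').
have H (x y a w : B) : rnorm (x - a) < e / (n + 1) / 2 -> rnorm (y - w) < e / (n + 1) / 2 ->
    rnorm (z *: x + y - (z *: a + w)) < e.
  move=> h1 h2; rewrite opprD addrACA -scalerBr.
  apply: le_lt_trans (rnormD _ _) _; rewrite rnormZ -/n.
  have h3 : n * rnorm (x - a) <= n * (e / (n + 1) / 2) by rewrite ler_wpM2l // ltW.
  have : n * (e / (n + 1) / 2) + e / (n + 1) / 2 = e / 2 by field; rewrite lt0r_neq0 // ltr_wpDl.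
  move: h2 h3 e0; lra.
by split; [exact: Glin | exact: H | exact: H].
Qed.

(** Approximants of b within 1 / (n + 1) have partners under G that form a Cauchy sequence, by
    linearity and [Gb]. *)
Lemma Gcl_total b : exists b', Gcl b b'.
Proof.
have /choice [p hp] : forall n : nat, exists p, G p.1 p.2 /\ rnorm (b - p.1) < n.+1%:R^-1.
  move=> n; have n0 : (0 : R) < n.+1%:R^-1 by [].
  by have [c [c' gc] hc] := dense_rnorm b dG n0; exists (c, c').
pose u n := (p n).2.
have hu n m k : (k <= n)%N -> (k <= m)%N -> rnorm (u n - u m) <= (2 * C) / k.+1%:R.
  move=> kn km.
  have := Gb (Glin (-1) (hp m).1 (hp n).1); rewrite !scaleN1r ![- _ + _]addrC => /le_trans; apply.
  rewrite [2 * C]mulrC -mulrA ler_wpM2l //.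
  have -> : (p n).1 - (p m).1 = - (b - (p n).1) + (b - (p m).1) by rewrite opprB addrA subrK.
  apply: le_trans (rnormD _ _) _; rewrite rnormN mulrDl !mul1r; apply: lerD.
  - by apply: ltW; apply: lt_le_trans (hp n).2 _; rewrite lef_pV2 ?posrE // ler_nat.
  - by apply: ltW; apply: lt_le_trans (hp m).2 _; rewrite lef_pV2 ?posrE // ler_nat.
have small (e : R) : 0 < e -> exists k : nat, (2 * C + 1) / k.+1%:R < e.
  move=> e0; have C1 : 0 < 2 * C + 1 by rewrite ltr_wpDl // mulr_ge0.
  have [k _ hk] := near_infty_natSinv_lt (PosNum (divr_gt0 e0 C1)).
  exists k; have := hk k (leqnn k); rewrite /= ltr_pdivlMr // mulrC; exact.
have cu : cvgn u.
  apply: cauchy_cvg; apply: cauchy_exP => e e0.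
  have eE : e = (complex.Re e)%:C%C by rewrite RRe_real // gtr0_real.
  have e0' : 0 < complex.Re e by move: e0; rewrite eE ltcR.
  have [k hk] := small _ e0'.
  exists (u k); exists k => // n /= kn; rewrite -ball_normE /ball_ /= rnormE eE ltcR.
  apply: le_lt_trans (hu k n k (leqnn k) kn) _; apply: le_lt_trans hk.
  by rewrite ler_wpM2r // lerDl.
exists (limn u) => e e0.
have e0c : (0 : R[i]) < (e / 2)%:C%C by rewrite ltcR divr_gt0.
have /cvgrPdist_lt /(_ _ e0c) [n1 _ hn1] := cu.
have [k hk] : exists k : nat, k.+1%:R^-1 < e.
  by have [k _ h] := near_infty_natSinv_lt (PosNum e0); exists k; exact: (h k (leqnn k)).
pose n := maxn n1 k.
exists (p n).1, (p n).2; split; first by have [] := hp n.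
  apply: lt_trans (hp n).2 _; apply: le_lt_trans hk; rewrite lef_pV2 ?posrE // ler_nat ltnS.
  exact: leq_maxr.
have := hn1 n (leq_maxl _ _); rewrite rnormE ltcR => h; apply: lt_trans h _; move: e0; lra.
Qed.

Lemma extend_bounded : exists F : B -> B, [/\ forall z b c, F (z *: b + c) = z *: F b + F c,
  forall b, rnorm (F b) <= C * rnorm b,
  forall b b', G b b' -> F b = b' &
  forall b (e : R), 0 < e -> exists c c', [/\ G c c', rnorm (b - c) < e & rnorm (F b - c') < e]].
Proof.
have [F HF] := choice Gcl_total.
have uniq b b' b'' : Gcl b b' -> Gcl b b'' -> b' = b''.
  move=> h1 h2; have := Gcl_bound (Gcl_lin (-1) h2 h1).
  rewrite !scaleN1r addNr rnorm0 mulr0 => /rnorm_eq0 /eqP.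
  by rewrite addrC subr_eq0 => /eqP.
exists F; split=> //.
- by move=> z b c; apply: uniq (HF _) _; exact: Gcl_lin.
- by move=> b; exact: Gcl_bound.
- by move=> b b' g; apply: uniq (HF _) _; exact: Gcl_sub.
Qed.

End extension.

(** * Algebra of C^q functions on a manifold *)

Section regular_functions.
Context {R : realType} {d : nat} {X : manifold R d}.
Implicit Types (f g : X -> R) (h phi : X -> R[i]).

Lemma CqRP q f : CqR q f <->
  forall a, atlas a -> Reg (hexp q) (Num.truncn q) (cdom a) (f \o cpar a).
Proof.
split=> H a aa; have od := chart_dom_open a.
  have [r _] := Cq_Reg 0 od (H a aa); apply: (Reg_ext od _ r) => y _.
  by rewrite /= mxE eqxx mulr1n.
apply: Reg_Cq => // j; apply: (Reg_ext od _ (H a aa)) => y _.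
by rewrite /= mxE (ord1 j) eqxx mulr1n.
Qed.

Lemma CqCP q h : CqC q h <-> CqR q (fun x => complex.Re (h x)) /\ CqR q (fun x => complex.Im (h x)).
Proof.
split=> [H|[/CqRP H1 /CqRP H2] a aa].
  split; apply/CqRP => a aa; have od := chart_dom_open a.
    have [r _] := Cq_Reg ord0 od (H a aa); apply: (Reg_ext od _ r) => y _.
    by rewrite /= mxE.
  have [r _] := Cq_Reg ord_max od (H a aa); apply: (Reg_ext od _ r) => y _.
  by rewrite /= mxE.
have od := chart_dom_open a; apply: Reg_Cq => // j; case: (eqVneq j ord0) => hj.
  by apply: (Reg_ext od _ (H1 a aa)) => y _; rewrite /= mxE hj.
by apply: (Reg_ext od _ (H2 a aa)) => y _; rewrite /= mxE (negbTE hj).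
Qed.

Lemma CqR_cst q (t : R) : @CqR R d X q (fun=> t).
Proof. by apply/CqRP => a aa; apply: Reg_cst; exact: chart_dom_open. Qed.

Lemma CqRD q f g : CqR q f -> CqR q g -> CqR q (fun x => f x + g x).
Proof. by move=> /CqRP H1 /CqRP H2; apply/CqRP => a aa; exact: (@RegD _ _ _ _ (chart_dom_open a) _ (f \o cpar a) (g \o cpar a) (H1 a aa) (H2 a aa)). Qed.

Lemma CqRM q f g : 0 <= q -> CqR q f -> CqR q g -> CqR q (fun x => f x * g x).
Proof.
move=> q0 /CqRP H1 /CqRP H2; apply/CqRP => a aa.
exact: (@RegM _ _ _ _ (hexp_itv q0) (chart_dom_open a) _ (f \o cpar a) (g \o cpar a) (H1 a aa) (H2 a aa)).
Qed.

Lemma CqRZ q (t : R) f : 0 <= q -> CqR q f -> CqR q (fun x => t * f x).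
Proof. by move=> q0; apply: CqRM => //; exact: CqR_cst. Qed.

Lemma CqRB q f g : 0 <= q -> CqR q f -> CqR q g -> CqR q (fun x => f x - g x).
Proof.
move=> q0 cf cg; have := CqRD cf (CqRZ (-1) q0 cg); congr CqR.
by apply/funext => x; rewrite mulN1r.
Qed.

Lemma CqR_le q k f : (k <= Num.truncn q)%N -> CqR q f -> CqR k%:R f.
Proof.
move=> kq cf a aa; apply: Reg_Cq_nat; first exact: chart_dom_open.
by move=> j; exact: CqX_Reg cf (atlas_smooth_chart aa) kq.
Qed.

Lemma CqR_continuous q f : CqR q f -> continuous f.
Proof.
move=> /CqX_continuous cf x; have := continuous_comp (cf x) (@coord_continuous _ _ _ 0 0 _).
by apply: near_continuous; near=> y; rewrite /= mxE eqxx mulr1n.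
Unshelve. all: by end_near. Qed.

Lemma CqC_lin q z phi phi' : 0 <= q -> CqC q phi -> CqC q phi' -> CqC q (fun x => z * phi x + phi' x).
Proof.
case: z => u v q0 /CqCP [p1 p2] /CqCP [p3 p4]; apply/CqCP; split.
  have := CqRD (CqRB q0 (CqRZ u q0 p1) (CqRZ v q0 p2)) p3; congr CqR.
  by apply/funext => x; case: (phi x); case: (phi' x).
have := CqRD (CqRD (CqRZ u q0 p2) (CqRZ v q0 p1)) p4; congr CqR.
by apply/funext => x; case: (phi x); case: (phi' x).
Qed.

Lemma CqC_mul q g phi : 0 <= q -> CqR q g -> CqC q phi -> CqC q (fun x => (g x)%:C%C * phi x).
Proof.
move=> q0 cg /CqCP [p1 p2]; apply/CqCP; split.
  have := CqRM q0 cg p1; congr CqR; apply/funext => x; case: (phi x) => a b /=; ring.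
have := CqRM q0 cg p2; congr CqR; apply/funext => x; case: (phi x) => a b /=; ring.
Qed.

Lemma CqC_real q f : CqR q f -> CqC q (fun x => (f x)%:C%C).
Proof. by move=> cf; apply/CqCP; split=> //=; exact: CqR_cst. Qed.

End regular_functions.

Section continuous_integrable.
Context {R : realType} {d : nat} {X : manifold R d}.

Lemma continuous_measurable_borel (f : X -> R) : continuous f ->
  measurable_fun [set: borel X] f.
Proof.
move=> /continuousP cf _; apply: (measurability _ (measurable_realfun.RGenOpens.measurableE R)) => //.
move=> _ [_ [x [y ->]] <-]; rewrite setTI; apply: sub_sigma_algebra.
by apply: cf; exact: interval_open.
Qed.

Lemma continuous_bounded_compact (f : X -> R) : continuous f -> exists M, forall x, `|f x| <= M.
Proof.
move=> cf; have cfX : {within [set: X], continuous f} by exact: continuous_subspaceT.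
have [M [_ HM]] := compact_bounded (continuous_compact cfX (@carrier_compact R d X)).
by exists (M + 1) => p; apply: (HM (M + 1)); [rewrite ltrDl | exists p].
Qed.

Lemma continuous_integrable (nu : {finite_measure set (borel X) -> \bar R}) (f : X -> R) :
  continuous f -> nu.-integrable [set: borel X] (EFin \o f).
Proof.
move=> cf; apply: measurable_bounded_integrable => //.
- exact: fin_num_fun_lty.
- exact: continuous_measurable_borel.
- have [M HM] := continuous_bounded_compact cf.
  by exists M; split; [exact: num_real | move=> y My x _; apply: le_trans (HM x) (ltW My)].
Qed.

End continuous_integrable.

Section distributions.
Context {R : realType} {ds du : nat} {X : riemannian R (ds + du)}.
Variables (r nu kappa K A delta : R) (T : X -> X) (Es : X -> 'M[R]_(ds + du)).
Hypothesis hr : 2 < r.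
Variables (N : nat) (psi : 'I_N -> chart R (ds + du) X) (rad c : 'I_N -> R).
Hypothesis hpsi : adapted_charts r nu kappa T Es psi rad c.
Hypotheses (hA : 1 < A) (hdelta : 0 < delta).
Variable vol : {finite_measure set (borel X) -> \bar R}.
Variables (B : completeNormedModType R[i]) (iota : (X -> R[i]) -> B).
Hypothesis hB : is_completion r (norm_pq psi rad c r K A delta 1 1) iota.
Variable pair : B -> (X -> R[i]) -> R[i].
Hypothesis hpair : is_pairing psi r vol iota pair.

Let r0 : 0 <= r. Proof. by move: hr; lra. Qed.
Let r1 : (1 <= Num.truncn r)%N. Proof. by rewrite truncn_ge_nat //; move: hr; lra. Qed.

Lemma CnormX1_finite (phi : X -> R[i]) : CqC 1 phi ->
  exists M : R, 0 <= M /\ CnormX psi 1 (@of_complex R \o phi) = M%:E.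
Proof.
move=> cphi; have q1 : (1 <= Num.truncn (r + 1))%N.
  by rewrite truncn_ge_nat; move: hr; lra.
have [|M HM] := @CnormX_finite R (ds + du) X N psi (r + 1) (1 + kappa) 2 (@of_complex R \o phi)
    q1 (ac_smooth hpsi) _ cphi.
  by move=> i; have [th [h1 h2 h3 _]] := ac_size hpsi i; exists (cpar (psi i) 0), th.
have [i [x xc _]] := ac_cover hpsi point.
have h0 : (0 <= CnormX psi 1 (@of_complex R \o phi))%E.
  apply: (@le_trans _ _ (Cnorm 1 (cdom (psi i)) ((@of_complex R \o phi) \o cpar (psi i)))).
    apply: (@le_trans _ _ (enorm ((@of_complex R \o phi) (cpar (psi i) x)))%:E).
      by rewrite lee_fin enorm_ge0.
    apply: ereal_sup_ubound; left; exists [::], x; split=> //.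
    rewrite (ac_dom hpsi) => j; apply: lt_trans (xc j) _.
    by have := ac_rad hpsi i; lra.
  by apply: ereal_sup_ubound; exists i.
have fin : CnormX psi 1 (@of_complex R \o phi) \is a fin_num.
  by rewrite ge0_fin_numE // (le_lt_trans HM) // ltry.
by exists (fine (CnormX psi 1 (@of_complex R \o phi))); rewrite fineK // fine_ge0.
Qed.

(** [ip_bound] has no content when the norm of phi in the charts psi_i is infinite; [CnormX1_finite]
    excludes this. *)
Lemma pair_bound phi : CqC 1 phi ->
  exists2 C : R, 0 <= C & forall b, complex.Re `|pair b phi| <= C * rnorm b.
Proof.
move=> cphi; have [M [M0 EM]] := CnormX1_finite cphi; have [C HC] := ip_bound hpair.
exists (`|C| * M); first by rewrite mulr_ge0.
move=> b; have := HC b phi cphi; rewrite EM -EFinM lee_fin => /le_trans; apply.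
by rewrite -!mulrA [rnorm b * M]mulrC ler_wpM2r ?ler_norm // mulr_ge0 // rnorm_ge0.
Qed.

Lemma iota_dense b (e : R) : 0 < e -> exists2 h, CqC r h & rnorm (b - iota h) < e.
Proof. by move=> e0; have [_ [h ch <-] hc] := dense_rnorm b (ic_dense hB) e0; exists h. Qed.

(** Both maps are bounded, so agreement on the dense image of the C^r functions propagates to B. *)
Lemma eq_on_iota (u v : B -> R[i]) (C : R) :
  (forall b b', u (b - b') = u b - u b') -> (forall b b', v (b - b') = v b - v b') ->
  (forall b, complex.Re `|u b| <= C * rnorm b) -> (forall b, complex.Re `|v b| <= C * rnorm b) ->
  (forall h, CqC r h -> u (iota h) = v (iota h)) -> u =1 v.
Proof.
move=> lu lv bu bv e b; apply/eqP; rewrite -subr_eq0 -normr_le0 (Re_normE (u b - v b)) lecR.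
apply/ler_addgt0Pr => eps eps0; rewrite add0r.
have C1 : 0 < 2 * `|C| + 1 by rewrite ltr_wpDl // mulr_ge0.
have [h ch hh] := iota_dense b (divr_gt0 eps0 C1).
have -> : u b - v b = u (b - iota h) - v (b - iota h).
  by rewrite lu lv e // opprB addrA subrK.
apply: le_trans (Re_normD _ _) _; rewrite normrN.
apply: (@le_trans _ _ (2 * `|C| * rnorm (b - iota h))).
  rewrite -mulrA mulrDl !mul1r; apply: lerD; [apply: le_trans (bu _) _ | apply: le_trans (bv _) _];
  by rewrite ler_wpM2r ?rnorm_ge0 // ler_norm.
have h1 : 2 * `|C| * rnorm (b - iota h) <= 2 * `|C| * (eps / (2 * `|C| + 1)).
  by rewrite ler_wpM2l ?mulr_ge0 // ltW.
apply: le_trans h1 _; rewrite mulrCA ler_piMr // ?ltW //.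
by rewrite ltr_pdivrMr // mul1r ltrDl.
Qed.

Lemma pairB phi : CqC 1 phi -> forall b b', pair (b - b') phi = pair b phi - pair b' phi.
Proof.
by move=> cphi b b'; rewrite addrC -[- b']scaleN1r (ip_linear hpair) // mulN1r addrC.
Qed.

Definition cint (F : X -> R[i]) : R[i] :=
  Complex (\int[vol]_x complex.Re (F x)) (\int[vol]_x complex.Im (F x)).

Lemma cint_lin z (F G : X -> R[i]) : CqC 1 F -> CqC 1 G ->
  cint (fun x => z * F x + G x) = z * cint F + cint G.
Proof.
move=> /CqCP [f1 f2] /CqCP [g1 g2]; case: z => u v.
have iC (f : X -> R) : CqR 1 f -> vol.-integrable [set: borel X] (EFin \o f).
  by move=> cf; apply: continuous_integrable; exact: CqR_continuous cf.
have q0 : (0 : R) <= 1 by [].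
have L (a b : R) (p1 p2 p3 : X -> R) : CqR 1 p1 -> CqR 1 p2 -> CqR 1 p3 ->
    \int[vol]_x (a * p1 x + b * p2 x + p3 x) = a * (\int[vol]_x p1 x) + b * (\int[vol]_x p2 x) + \int[vol]_x p3 x.
  move=> c1 c2 c3; rewrite (RintegralD measurableT (iC _ (CqRD (CqRZ a q0 c1) (CqRZ b q0 c2))) (iC _ c3)).
  rewrite (RintegralD measurableT (iC _ (CqRZ a q0 c1)) (iC _ (CqRZ b q0 c2))).
  by rewrite !RintegralZl //; exact: iC.
rewrite /cint; apply/eqP; rewrite eq_complex /=; apply/andP; split; apply/eqP.
- have := L u (- v) _ _ _ f1 f2 g1; rewrite mulNr => <-.
  by apply: eq_Rintegral => x _; case: (F x); case: (G x) => ? ? ? ? /=; rewrite mulNr.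
- have := L u v _ _ _ f2 f1 g2 => <-.
  by apply: eq_Rintegral => x _; case: (F x); case: (G x).
Qed.

Lemma CqC1 (h : X -> R[i]) : CqC r h -> CqC 1 h.
Proof. by move=> /CqCP [h1 h2]; apply/CqCP; split; exact: (CqR_le r1). Qed.

Lemma CqC_mulC q (h phi : X -> R[i]) : 0 <= q -> CqC q h -> CqC q phi -> CqC q (fun x => h x * phi x).
Proof.
move=> q0 /CqCP [h1 h2] cphi; have c1 := CqC_mul q0 h1 cphi; have c2 := CqC_mul q0 h2 cphi.
have := CqC_lin (Complex 0 1) q0 c2 c1; congr CqC; apply/funext => x.
case: (h x) => a b; case: (phi x) => a' b'; apply/eqP; rewrite eq_complex /=.
by apply/andP; split; apply/eqP; ring.
Qed.

(** [is_pairing] provides linearity in the distribution. In the test function it holds for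
    integrals, and passes to B by density. *)
Lemma pair_linr z b phi phi' : CqC 1 phi -> CqC 1 phi' ->
  pair b (fun x => z * phi x + phi' x) = z * pair b phi + pair b phi'.
Proof.
move=> c1 c2; have c3 := CqC_lin z ler01 c1 c2.
have [C1 C10 b1] := pair_bound c1; have [C2 C20 b2] := pair_bound c2; have [C3 C30 b3] := pair_bound c3.
have n0 := Re_norm_ge0 z; set n := complex.Re `|z| in n0.
apply: (@eq_on_iota (fun b => pair b (fun x => z * phi x + phi' x)) (fun b => z * pair b phi + pair b phi') (C3 + (n * C1 + C2))).
- exact: pairB.
- move=> p q; rewrite !pairB //; ring.
- move=> p; apply: le_trans (b3 p) _; rewrite ler_wpM2r ?rnorm_ge0 // lerDl.
  by rewrite addr_ge0 // mulr_ge0.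
- move=> p; apply: le_trans (Re_normD _ _) _; rewrite Re_normM.
  apply: (@le_trans _ _ ((n * C1 + C2) * rnorm p)); last first.
    by rewrite ler_wpM2r ?rnorm_ge0 // lerDr.
  by rewrite mulrDl -mulrA; apply: lerD => //; rewrite ler_wpM2l.
- move=> h ch; rewrite !(ip_integral hpair) // -!/(cint _).
  have ch1 := CqC1 ch.
  rewrite -cint_lin; [|exact: CqC_mulC..]; congr cint; apply/funext => x; ring.
Qed.

(** C depends on the bound M alone, so one constant serves the observable at all times of all
    realizations. *)
Lemma mul_operator (M : R) : exists C : R, 0 <= C /\ forall g : X -> R, CqR r g ->
  (CnormX psi r (@of_real R \o g) <= M%:E)%E ->
  exists F : B -> B, [/\ forall z b b', F (z *: b + b') = z *: F b + F b',
    forall b, rnorm (F b) <= C * rnorm b &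
    forall b phi, CqC 1 phi -> pair (F b) phi = pair b (fun x => (g x)%:C%C * phi x)].
Proof.
have [C [C0 HC]] := @norm11_mul R ds du r K A delta hr hA hdelta N X psi rad c
  (ac_smooth hpsi) (ac_rad hpsi) (ac_dom hpsi) M.
exists C; split; first exact: ltW.
move=> g cg ng.
pose G b b' := exists2 h, CqC r h & b = iota h /\ b' = iota (fun x => (g x)%:C%C * h x).
have [|||F [F1 F2 F3 F4]] := @extend_bounded R B G C (ltW C0).
- move=> z b b' e e' [h ch [-> ->]] [h' ch' [-> ->]].
  exists (fun x => z * h x + h' x); first exact: CqC_lin.
  rewrite !(ic_linear hB) //; split=> //.
  rewrite -(ic_linear hB); [|exact: CqC_mul..].
  by congr iota; apply/funext => x; ring.
- move=> b b' [h ch [-> ->]].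
  apply: (HC g h) => //; first by rewrite (ic_isometry hB).
  by rewrite (ic_isometry hB) //; exact: CqC_mul.
- move=> O O0 oO; have [b [Ob [h ch hb]]] := ic_dense hB O0 oO.
  by exists b; split=> //; exists (iota (fun x => (g x)%:C%C * h x)); exists h.
exists F; split=> // b phi cphi.
have cgphi : CqC 1 (fun x => (g x)%:C%C * phi x) by apply: CqC_mul => //; exact: (CqR_le r1).
have [C1 C10 b1] := pair_bound cphi; have [C2 C20 b2] := pair_bound cgphi.
apply: (@eq_on_iota (fun b => pair (F b) phi) (fun b => pair b (fun x => (g x)%:C%C * phi x)) (C1 * C + C2)).
- move=> p q; rewrite -pairB //; congr pair.
  by rewrite addrC -scaleN1r F1 scaleN1r addrC.
- exact: pairB.
- move=> p; apply: le_trans (b1 _) _; rewrite mulrDl -mulrA.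
  apply: (@le_trans _ _ (C1 * (C * rnorm p))); first by rewrite ler_wpM2l.
  by rewrite lerDl mulr_ge0 // rnorm_ge0.
- move=> p; apply: le_trans (b2 _) _; rewrite mulrDl lerDr !mulr_ge0 ?rnorm_ge0 //; exact: ltW.
- move=> h ch; rewrite (F3 (iota h) (iota (fun x => (g x)%:C%C * h x))); last by exists h.
  rewrite !(ip_integral hpair) //; last exact: CqC_mul.
  by rewrite -!/(cint _); congr cint; apply/funext => x; ring.
Qed.

End distributions.

(** * Joint measurability of the cocycle *)

Section bump.
Context {R : realType}.

(** The functions t^(-k) exp (- 1 / t), extended by 0: derivatives of members of this family are
    combinations of members, so all of them are smooth. *)
Definition flat (k : nat) (t : R) : R := if 0 < t then t^-1 ^+ k * expR (- t^-1) else 0.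

(** From exp u >= u^(k+2) / (k+2)! at u = 1 / t. A quadratic bound is what makes the derivative at 0
    vanish. *)
Lemma flat_le k t : 0 <= flat k t <= k.+2`!%:R * t ^+ 2.
Proof.
rewrite /flat; case: ifPn => t0; last by rewrite lexx mulr_ge0 // sqr_ge0.
have u0 : 0 < t^-1 by rewrite invr_gt0.
rewrite mulr_ge0 ?expR_ge0 ?exprn_ge0 ?(ltW u0) //=.
have h : t^-1 ^+ k.+2 / k.+2`!%:R <= expR t^-1.
  by apply: le_trans (expR_ge1Dxn k.+1 (ltW u0)); rewrite lerDr.
have f0 : (0 : R) < k.+2`!%:R by rewrite ltr0n fact_gt0.
rewrite expRN ler_pdivrMr ?expR_gt0 //.
have -> : t^-1 ^+ k = t ^+ 2 * k.+2`!%:R * (t^-1 ^+ k.+2 / k.+2`!%:R).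
  rewrite !exprS !expr0 mulr1; field; rewrite lt0r_neq0 //=; exact: lt0r_neq0.
by rewrite [_%:R * t ^+ 2]mulrC ler_wpM2l // mulr_ge0 ?sqr_ge0 // ltW.
Qed.

Lemma is_derive_flat k (t : R) : is_derive t (1 : R) (flat k) (flat k.+2 t - k%:R * flat k.+1 t).
Proof.
have [t0|t0|->] := ltgtP t 0.
- have z j : flat j t = 0 by rewrite /flat ltNge (ltW t0).
  rewrite !z mulr0 subr0; refine (@near_eq_is_derive _ _ _ _ _ _ _ _ _ (is_derive_cst (0 : R) t (1 : R))).
  have := open_nbhs_nbhs (conj (@open_lt R 0) t0); apply: filterS => s /= s0.
  by rewrite /flat ltNge (ltW s0).
- apply: (@near_eq_is_derive _ _ _ ((fun s : R => s^-1) ^+ k * (expR \o (fun s : R => - s^-1)))).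
    have := open_nbhs_nbhs (conj (@open_gt R 0) t0); apply: filterS => s /= s0.
    by rewrite /flat s0 fctE exprfctE.
  have dV : is_derive t (1 : R) (fun s : R => s^-1) (- t ^- 2).
    apply: DeriveDef; first by apply: derivableV => //; exact: lt0r_neq0.
    by rewrite deriveV ?lt0r_neq0 // derive_id scaler1.
  have dN : is_derive t (1 : R) (fun s : R => - s^-1) (t ^- 2).
    by have := is_deriveN dV; rewrite opprK.
  have dE : is_derive t (1 : R) (expR \o (fun s : R => - s^-1)) (expR (- t^-1) * t ^- 2).
    have d1 : derivable (fun s : R => - s^-1) t 1 by exact: ex_derive.
    have d2 : derivable expR (- t^-1 : R) 1 by exact: ex_derive.
    apply: DeriveDef.
      by apply/derivable1_diffP; apply: differentiable_comp; exact/derivable1_diffP.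
    have := @derive1_comp _ (fun s : R => - s^-1) expR t d1 d2.
    by rewrite !derive1E !derive_val.
  apply: is_derive_eq.
  rewrite /flat t0 exprfctE /= /GRing.scale /=.
  have t1 : t != 0 by exact: lt0r_neq0.
  case: k => [|k].
    by rewrite !exprS !expr0 /=; field.
  by rewrite /= !exprS; field.
- have z j : flat j 0 = 0 by rewrite /flat ltxx.
  rewrite !z mulr0 subr0.
  suff c : (fun h => h^-1 *: ((flat k \o shift 0) (h *: (1 : R)) - flat k 0)) @ 0^' --> (0 : R).
    by apply: DeriveDef; [apply/cvg_ex; exists 0 | exact: cvg_lim c].
  apply/cvgr0Pnorm_le => e e0; have f0 : (0 : R) < k.+2`!%:R by rewrite ltr0n fact_gt0.
  near=> h; rewrite /= z subr0 addr0 /GRing.scale /= mulr1 normrM normfV.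
  have h0 : 0 < `|h| by rewrite normr_gt0; near: h; exact: nbhs_dnbhs_neq.
  have /andP[p1 p2] := flat_le k h.
  rewrite ler_pdivrMl // ger0_norm //; apply: le_trans p2 _.
  rewrite -[h ^+ 2]real_normK ?num_real // expr2 mulrA mulrC ler_pM2l //.
  rewrite mulrC -ler_pdivlMr //; near: h; apply: dnbhs0_le; exact: divr_gt0.
Unshelve. all: by end_near. Qed.

Lemma derive_coord0 (f : R -> R) (v : 'rV[R]_1) i df :
  is_derive (v 0 0) 1 f df -> is_derive v 'e_i (fun w : 'rV[R]_1 => f (w 0 0)) df.
Proof.
move=> [d e].
have E : (fun h : R => h^-1 *: (((fun w : 'rV[R]_1 => f (w 0 0)) \o shift v) (h *: 'e_i) - f (v 0 0))) =
    (fun h : R => h^-1 *: ((f \o shift (v 0 0)) (h *: 1) - f (v 0 0))).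
  by apply/funext => h; rewrite /= !mxE (ord1 i) eqxx.
by apply: DeriveDef; [rewrite /derivable E | rewrite -e /derive E].
Qed.

Lemma Reg_flat m k : Reg 0 m setT (fun v : 'rV[R]_1 => flat k (v 0 0)).
Proof.
have cf j : continuous (fun v : 'rV[R]_1 => flat j (v 0 0)).
  move=> v; apply: (@continuous_comp _ _ _ (fun v : 'rV[R]_1 => v 0 0) (flat j)); first exact: coord_continuous.
  apply: differentiable_continuous; apply/derivable1_diffP.
  by have [] := is_derive_flat j (v 0 0).
elim: m k => [|m IH] k; split; try by move=> v _; exact: cf.
  by move=> v _; apply: hold_continuous; exact: cf.
move=> i; have D (v : 'rV[R]_1) := derive_coord0 i (is_derive_flat k (v 0 0)).
split; first by move=> v _; have [] := D v.
apply: (Reg_ext openT (f := fun v : 'rV[R]_1 => flat k.+2 (v 0 0) - k%:R * flat k.+1 (v 0 0))).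
  by move=> v _; have [_ ->] := D v.
have th01 : (0:R) <= 0 <= (1:R) by rewrite lexx ler01.
by apply: (RegB th01 openT); [exact: IH | apply: (RegZ th01 openT); exact: IH].
Qed.

Definition smooth_bump n (y0 : 'rV[R]_n) (rho : R) (y : 'rV[R]_n) :=
  flat 0 (rho ^+ 2 - \sum_j (y 0 j - y0 0 j) ^+ 2).

Lemma bump_pos n (y0 : 'rV[R]_n) rho : 0 < rho -> 0 < smooth_bump y0 rho y0.
Proof.
move=> r0; rewrite /smooth_bump big1; last by move=> j _; rewrite subrr expr0n.
by rewrite subr0 /flat exprn_gt0 // mul1r expR_gt0.
Qed.

Lemma bump0 n (y0 : 'rV[R]_n) rho y : 0 < rho -> rho < enorm (y - y0) -> smooth_bump y0 rho y = 0.
Proof.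
move=> r0 h; rewrite /smooth_bump /flat ltNge; case: negP => // h'; exfalso; apply: h'.
have s0 : 0 <= \sum_j ((y - y0) 0 j) ^+ 2 by apply: sumr_ge0 => j _; exact: sqr_ge0.
have -> : \sum_j (y 0 j - y0 0 j) ^+ 2 = enorm (y - y0) ^+ 2.
  by rewrite /enorm sqr_sqrtr //; apply: eq_bigr => j _; rewrite !mxE.
by rewrite subr_le0 ler_sqr ?nnegrE ?enorm_ge0 // ltW.
Qed.

Lemma Reg_bump n m (y0 : 'rV[R]_n) rho : Reg 0 m setT (smooth_bump y0 rho).
Proof.
have th01 : (0:R) <= 0 <= (1:R) by rewrite lexx ler01.
pose G (y : 'rV[R]_n) : 'rV[R]_1 := of_real (rho ^+ 2 - \sum_j (y 0 j - y0 0 j) ^+ 2).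
apply: (Reg_ext openT (f := (fun v : 'rV[R]_1 => flat 0 (v 0 0)) \o G)).
  by move=> y _; rewrite /= /G mxE eqxx mulr1n.
apply: (Reg_comp openT openT) => //; first exact: Reg_flat.
move=> j; apply: (Reg_ext openT (f := fun y => rho ^+ 2 - \sum_j (y 0 j - y0 0 j) ^+ 2)).
  by move=> y _; rewrite /G mxE (ord1 j) eqxx mulr1n.
apply: (RegB th01 openT); first exact: (Reg_cst 0 openT).
apply: (Reg_sum openT) => l; rewrite -[X in Reg _ _ _ X]/(fun y : 'rV[R]_n => (y 0 l - y0 0 l) * (y 0 l - y0 0 l)).
have rl : Reg 0 m setT (fun y : 'rV[R]_n => y 0 l - y0 0 l).
  by apply: (RegB th01 openT); [exact: (Reg_coord th01 openT) | exact: (Reg_cst 0 openT)].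
exact: (RegM th01 openT rl rl).
Qed.

(** On the bounded convex cube one more derivative controls the Hoelder seminorm: the mean value
    theorem gives a Lipschitz bound, and |x - y| <= De |x - y|^th with De >= 1 a bound for the
    diameter. *)
Lemma Cnorm_cube n (q rho : R) : 0 <= q -> 0 < rho -> exists2 C : R, 0 < C &
  forall (f : 'rV[R]_n -> R) M, Reg 0 (Num.truncn q).+1 (cube rho) f ->
    Bd (Num.truncn q).+1 (cube rho) M f -> (Cnorm q (cube rho) (@of_real R \o f) <= (C * M)%:E)%E.
Proof.
move=> q0 rho0; pose De : R := n%:R * (2 * rho) + 1; pose C := 1 + n%:R * De.
have De1 : 1 <= De by rewrite lerDr mulr_ge0 // mulr_ge0 // ltW.
have C1 : 1 <= C by rewrite lerDl mulr_ge0 // (le_trans ler01).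
exists C; first exact: lt_le_trans C1.
move=> f M Rf Bf; have oU := @cube_open R n rho.
have Rf' j : Reg 0 (Num.truncn q).+1 (cube rho) (fun x => (@of_real R \o f) x 0 j).
  by apply: (Reg_ext oU _ Rf) => x _; rewrite /= mxE (ord1 j) eqxx mulr1n.
have pdE (s : seq 'I_n) x : (size s <= (Num.truncn q).+1)%N -> cube rho x ->
    pd s (@of_real R \o f) x 0 0 = pds s f x.
  move=> hs xc; have [_ H] := Cq_Reg 0 oU (Reg_Cq_nat oU Rf').
  rewrite H // ?truncn_nat //; congr (pds s _ x).
  by apply/funext => y; rewrite /= mxE eqxx mulr1n.
have /Bd_pdsP B := Bf.
have en (v : 'rV[R]_1) : enorm v <= `|v 0 0|.
  by apply: le_trans (enorm_le_sum _) _; rewrite big_ord1.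
apply: ge_ereal_sup => e [].
  move=> [s [x [hs xc ->]]]; rewrite lee_fin; apply: le_trans (en _) _.
  have h := B s x (leq_trans hs (leqnSn _)) xc; rewrite pdE //; last exact: leq_trans hs _.
  have M0 := le_trans (normr_ge0 _) h.
  by apply: le_trans h _; rewrite ler_peMl.
move=> [s [x [y [th0 hs [xc yc] xy ->]]]]; rewrite lee_fin.
have M0 : 0 <= M by apply: le_trans (normr_ge0 _) (B [::] x _ xc).
have e0 : 0 < enorm (x - y).
  rewrite lt_neqAle enorm_ge0 andbT eq_sym; apply/negP => /eqP h; move/negP: xy; apply.
  by rewrite -subr_eq0 -normr_le0 -h norm_le_enorm.
have /andP[_ th1] := hexp_itv q0.
rewrite ler_pdivrMr ?powR_gt0 //; apply: le_trans (en _) _.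
rewrite mxE [X in _ + X]mxE !pdE ?hs //.
have inc (z : 'rV[R]_n) : (forall j, segment (y 0 j) (x 0 j) (z 0 j)) -> cube rho z.
  move=> sz j; have := sz j; have := xc j; have := yc j; rewrite !ltr_norml.
  move=> /andP[a1 a2] /andP[a3 a4] [u [/andP[u0 u1] ->]].
  have [xy'|/ltW xy'] := leP (x 0 j) (y 0 j).
    have h1 : u * (x 0 j - y 0 j) <= 0 by rewrite mulr_ge0_le0 // subr_le0.
    have h2 : 0 <= (1 - u) * (y 0 j - x 0 j) by rewrite mulr_ge0 // subr_ge0.
    by apply/andP; split; move: h1 h2; lra.
  have h1 : 0 <= u * (x 0 j - y 0 j) by rewrite mulr_ge0 // subr_ge0.
  have h2 : 0 <= (1 - u) * (x 0 j - y 0 j) by rewrite mulr_ge0 // subr_ge0.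
  by apply/andP; split; move: h1 h2; lra.
have [|xi [xiP ->]] := @box_mvt R n (pds s f) y x.
  by move=> z /inc zc i; have [_ + _] := Reg_pds s Rf zc; apply; rewrite hs.
apply: (@le_trans _ _ (n%:R * (M * enorm (x - y)))).
  apply: le_trans (ler_norm_sum _ _ _) _.
  rewrite mulr_natl -[X in _ *+ X]card_ord -sumr_const; apply: ler_sum => i _.
  rewrite normrM; apply: ler_pM => //; last by have := coord_le_enorm (x - y) i; rewrite !mxE.
  by have := B (i :: s) (xi i); apply; [rewrite /= hs | exact: inc].
have eD : enorm (x - y) <= De.
  apply: le_trans (enorm_le_norm _) _; rewrite /De -[leLHS]addr0 lerD // ler_wpM2l //.
  apply: norm_row_le; first by rewrite mulr_ge0 // ltW.
  move=> j; rewrite !mxE; apply: le_trans (ler_normB _ _) _.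
  by have := xc j; have := yc j; lra.
have h : enorm (x - y) <= De * enorm (x - y) `^ hexp q.
  have E : enorm (x - y) = enorm (x - y) `^ (1 - hexp q) * enorm (x - y) `^ hexp q.
    by rewrite -powRD ?subrK ?powRr1 ?enorm_ge0 // oner_eq0.
  rewrite [leLHS]E ler_wpM2r ?powR_ge0 //.
  apply: (@le_trans _ _ (De `^ (1 - hexp q))).
    by apply: ge0_ler_powR; rewrite ?nnegrE ?enorm_ge0 ?subr_ge0 // (le_trans _ De1).
  by apply: ler1_powR => //; rewrite lerBlDr lerDl ltW.
apply: (@le_trans _ _ (n%:R * (M * (De * enorm (x - y) `^ hexp q)))).
  by rewrite !ler_wpM2l.
rewrite -subr_ge0; set p := _ `^ _.
have -> : C * M * p - n%:R * (M * (De * p)) = M * p by rewrite /C; ring.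
by rewrite mulr_ge0 // powR_ge0.
Qed.
End bump.

(** * Bump functions on the manifold *)

Section manifold_bump.
Context {R : realType} {d : nat} {X : manifold R d}.
Variables (N : nat) (psi : 'I_N -> chart R d X) (rad : 'I_N -> R).
Hypotheses (spsi : forall i, smooth_chart (psi i)) (rad0 : forall i, 0 < rad i).
Hypotheses (dom : forall i, cdom (psi i) = cube (rad i)).
Hypothesis cover : forall p, exists i, exists2 x, cube (rad i / 2) x & cpar (psi i) x = p.

(* The distance dC only sees functions of finite C^(r+2) norm in the charts psi;
   bump functions of this kind exist at every point outside the frontier. *)
Definition frontier : set X := [set p | exists i, closure (cim (psi i)) p /\ ~ cim (psi i) p].

Lemma closed_frontier : closed frontier.
Proof.
have -> : frontier = \bigcup_(i in [set: 'I_N]) (closure (cim (psi i)) `&` ~` cim (psi i)).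
  by apply/seteqP; split=> p; [move=> [i h]; exists i | move=> [i _ h]; exists i].
apply: closed_bigcup; first exact: finite_finset.
by move=> i _; apply: closedI; [exact: closed_closure | apply: open_closedC; exact: chart_im_open].
Qed.

(** Shrink U once per chart: if the current open set meets the image of psi_i, intersect with that
    image; otherwise it already misses the closure of the image. *)
Lemma frontier_nowhere (U : set X) : open U -> U !=set0 -> U `\` frontier !=set0.
Proof.
move=> oU U0.
suff H (s : seq 'I_N) : exists V : set X, [/\ open V, V `<=` U, V !=set0 &
    forall i p, i \in s -> V p -> ~ (closure (cim (psi i)) p /\ ~ cim (psi i) p)].
  have [V [oV VU [p Vp] hV]] := H (enum 'I_N).
  by exists p; split; [exact: VU | move=> [j]; apply: hV Vp; rewrite mem_enum].
elim: s => [|i s [V [oV VU [p Vp] hV]]]; first by exists U; split.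
have [[q [Vq iq]]|h] := pselect (exists q, V q /\ cim (psi i) q).
  exists (V `&` cim (psi i)); split.
  - by apply: openI => //; exact: chart_im_open.
  - by move=> z [/VU].
  - by exists q.
  - move=> j z; rewrite inE => /orP[/eqP ->|js] [Vz iz]; first by move=> [_]; apply.
    exact: hV.
exists V; split=> //; first by exists p.
move=> j z; rewrite inE => /orP[/eqP -> Vz [cz _]|]; last exact: hV.
have [z' [iz' Vz']] := cz V (open_nbhs_nbhs (conj oV Vz)).
by apply: h; exists z'.
Qed.

Lemma chart_box (p : X) (W : set X) : open W -> W p -> exists i y rho, [/\ 0 < rho,
  cube (rad i / 2) y, cpar (psi i) y = p &
  forall z, enorm (z - y) <= rho -> cdom (psi i) z /\ W (cpar (psi i) z)].
Proof.
move=> oW Wp; have [i [y yc yp]] := cover p.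
have yd : cdom (psi i) y.
  by rewrite dom => j; apply: lt_trans (yc j) _; have := rad0 i; lra.
have o := @chart_open _ _ _ (psi i) _ oW.
have n : nbhs y (cdom (psi i) `&` cpar (psi i) @^-1` W).
  by apply: open_nbhs_nbhs; split=> //; split=> //=; rewrite yp.
have /nbhs_ballP [e /= e0 He] := n.
exists i, y, (e / 2); split=> //; first by rewrite divr_gt0.
move=> z hz; apply: He; rewrite -ball_normE /= distrC; apply: le_lt_trans (norm_le_enorm _) _.
by apply: le_lt_trans hz _; rewrite ltr_pdivrMr // ltr_pMr // ltr1n.
Qed.

Lemma ecball_compact n (y : 'rV[R]_n) rho : compact (ecball y rho).
Proof.
apply: bounded_closed_compact.
  exists (`|y| + rho); split; first exact: num_real.
  move=> M hM z hz; apply: le_trans (ltW hM); rewrite -(subrK y z) addrC.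
  apply: le_trans (ler_normD _ _) _; rewrite lerD2l; exact: le_trans (norm_le_enorm _) hz.
have -> : ecball y rho = ~` [set z | rho < enorm (z - y)].
  apply/seteqP; split=> z; rewrite /ecball /= => h; first by apply/negP; rewrite -leNgt.
  by rewrite leNgt; apply/negP.
by apply: open_closedC; exact: ecball_compl_open.
Qed.

Lemma chart_image_compact a (K : set 'rV[R]_d) : K `<=` cdom a -> compact K -> compact (cpar a @` K : set X).
Proof.
move=> Kd; apply: continuous_compact; apply: continuous_in_subspaceT => x; rewrite inE => Kx.
exact: cpar_continuous (Kd _ Kx).
Qed.

(** The derivatives vanish on the open set U minus L too, so at every order only the compact L has
    to be bounded. *)
Lemma Bd_compact_support n k (U L : set 'rV[R]_n) (F : 'rV[R]_n -> R) :
  open U -> compact L -> L `<=` U -> Reg 0 k U F ->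
  (forall w, U w -> ~ L w -> F w = 0) -> exists2 M : R, 0 <= M & Bd k U M F.
Proof.
move=> oU cL La; have clL : closed L by apply: compact_closed cL; exact: norm_hausdorff.
have bd0 (G : 'rV[R]_n -> R) : (forall w, U w -> {for w, continuous G}) ->
    (forall w, U w -> ~ L w -> G w = 0) -> exists2 M : R, 0 <= M & forall w, U w -> `|G w| <= M.
  move=> cG G0.
  have cGL : {within L, continuous G}.
    by apply: continuous_in_subspaceT => w; rewrite inE => /La /cG.
  have [M [_ HM]] := compact_bounded (continuous_compact cGL cL).
  exists (`|M| + 1); first by rewrite addr_ge0.
  move=> w aw; have [Lw|nLw] := pselect (L w); last by rewrite G0 // normr0 addr_ge0.
  apply: (HM (`|M| + 1)); last by exists w.
  by apply: le_lt_trans (ler_norm _) _; rewrite ltrDl.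
elim: k F => [|k IH] F [cF HF] F0; have [M0 M00 HM0] := bd0 F cF F0.
  by exists M0 => //; split.
have oaL : open (U `\` L) by apply: openI oU (closed_openC clL).
have H i : exists M : R, 0 <= M /\ Bd k (U) M ('D_('e_i) F).
  have [|M M0' BM] := IH ('D_('e_i) F) (HF i).2; last by exists M.
  move=> w aw nLw; rewrite -(derive_cst_fun (0 : R) w ('e_i)).
  apply: near_eq_derive; apply: filterS (open_nbhs_nbhs (conj oaL (conj aw nLw))) => z [az nz].
  exact: F0.
have [M HM] := choice H; exists (M0 + \sum_i M i).
  by rewrite addr_ge0 // sumr_ge0 // => i _; exact: (HM i).1.
split.
  move=> w aw; apply: le_trans (HM0 w aw) _; rewrite lerDl sumr_ge0 // => i _; exact: (HM i).1.
move=> i; apply: (Bd_le _ _ _ (HM i).2) => //.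
rewrite (bigD1 i) //= addrCA lerDl addr_ge0 // sumr_ge0 // => j _; exact: (HM j).1.
Qed.

Section one_bump.
Variables (p : X) (W : set X) (q : R).
Hypotheses (oW : open W) (Wp : W p) (Wf : forall z, W z -> ~ frontier z) (q0 : 0 <= q).

(** Off the frontier, p lies in the image of psi_i or outside its closure, and [good i] is the
    corresponding open set. A bump supported in all of them, read in psi_i, either has compact
    support in the open domain or vanishes; its norm is therefore finite, and S rescales it to at
    most 1. *)
Lemma exists_bump : exists f : X -> R, [/\ forall k : nat, CqR k%:R f,
  (CnormX psi q (@of_real R \o f) <= 1)%E, 0 < f p & forall z, ~ W z -> f z = 0].
Proof.
pose good i := if `[< cim (psi i) p >] then cim (psi i) else ~` closure (cim (psi i)).
have goodp i : good i p.
  rewrite /good; case: asboolP => // h hc; apply: (Wf Wp); by exists i.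
have goodo i : open (good i).
  rewrite /good; case: asboolP => _; first exact: chart_im_open.
  exact: closed_openC (@closed_closure _ _).
pose V := W `&` \bigcap_(i in [set: 'I_N]) good i.
have oV : open V.
  apply: openI => //; rewrite openE => z hz.
  have H i : nbhs z (good i) by apply: open_nbhs_nbhs; split=> //; exact: hz.
  by have := filter_forall (nbhs_filter z) H; apply: filterS => w hw i _.
have Vp : V p by split.
have [i0 [y [rho [rho0 _ yp Ky]]]] := chart_box oV Vp.
set b := psi i0 in yp Ky.
pose Kx := cpar b @` ecball y rho.
have Kd : ecball y rho `<=` cdom b by move=> z /Ky [].
have cK : compact (Kx : set X) by apply: chart_image_compact => //; exact: ecball_compact.
have clK : closed (Kx : set X) by apply: compact_closed cK; exact: carrier_hausdorff.
pose f0 z := if `[< cim b z >] then smooth_bump y rho (ccoord b z) else 0.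
have f0K z : ~ Kx z -> f0 z = 0.
  move=> nK; rewrite /f0; case: asboolP => // -[w bw wz]; rewrite -wz cparK //.
  apply: bump0 => //; rewrite ltNge; apply/negP => h; apply: nK.
  by exists w.
have th01 : (0:R) <= 0 <= (1:R) by rewrite lexx ler01.
have Rf0 a k : smooth_chart a -> Reg 0 k (cdom a) (f0 \o cpar a).
  move=> sa; apply: Reg_loc => w aw; have [bw|nbw] := pselect (cim b (cpar a w)).
    exists (trdom a b) => //; apply: (@Reg_ext _ _ _ _ _ (smooth_bump y rho \o tr a b)).
    - exact: trdom_open.
    - by move=> z [az bz]; rewrite /= /f0; case: asboolP.
    - apply: (Reg_comp (trdom_open a b) openT) => //; first exact: Reg_bump.
      by move=> j; exact: (Reg_tr k j sa (spsi i0)).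
  have oc := @chart_open _ _ _ a _ (closed_openC clK).
  exists (cdom a `&` cpar a @^-1` (~` Kx)).
    by split=> // -[z yz wz]; apply: nbw; exists z => //; exact: Kd.
  apply: (@Reg_ext _ _ _ _ _ (fun=> 0)) => //; last exact: Reg_cst.
  by move=> z [az nz]; rewrite /= f0K.
pose k := (Num.truncn q).+1.
have HM i : exists M : R, 0 <= M /\ Bd k (cdom (psi i)) M (f0 \o cpar (psi i)).
  have [ip|nip] := pselect (cim (psi i) p).
    have Ki : Kx `<=` cim (psi i).
      move=> z [w /Ky [_ [_ gw]] <-]; have := gw i I; rewrite /good; case: asboolP => //.
    have cL : compact (ccoord (psi i) @` Kx).
      apply: continuous_compact cK; apply: continuous_in_subspaceT => z; rewrite inE => /Ki [w iw <-].
      exact: ccoord_continuous.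
    have [||M M0 BM] := @Bd_compact_support _ k _ _ _ (chart_dom_open (psi i)) cL _ (Rf0 (psi i) k (spsi i)); last by exists M.
      by move=> z [w /Ki [w' iw' <-] <-]; rewrite cparK.
    move=> w iw nL; apply: f0K => Kw; apply: nL; exists (cpar (psi i) w) => //.
    exact: cparK.
  exists 0; split=> //; apply: (@Bd_ext _ _ _ _ _ (fun=> 0)).
  - exact: chart_dom_open.
  - move=> w iw; rewrite /= f0K // => -[z /Ky [_ [_ /(_ i I)]]]; rewrite /good; case: asboolP => // _ h e.
    by apply: h; apply: subset_closure; rewrite e; exists w.
  - by apply: Bd_cst; [exact: chart_dom_open | rewrite normr0].
have [M HM'] := choice HM.
have HC i : exists C : R, 0 < C /\ forall (f : 'rV[R]_d -> R) M, Reg 0 k (cube (rad i)) f ->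
    Bd k (cube (rad i)) M f -> (Cnorm q (cube (rad i)) (@of_real R \o f) <= (C * M)%:E)%E.
  by have [C C0 H] := @Cnorm_cube R d q (rad i) q0 (rad0 i); exists C.
have [C HC'] := choice HC.
pose S := 1 + \sum_i C i * (2 ^+ k * M i).
have CM0 i : 0 <= C i * (2 ^+ k * M i).
  by rewrite !mulr_ge0 // ?exprn_ge0 //; [apply: ltW; exact: (HC' i).1 | exact: (HM' i).1].
have S1 : 1 <= S by rewrite lerDl sumr_ge0.
have S0 : 0 < S by exact: lt_le_trans S1.
exists (fun z => S^-1 * f0 z); split.
- move=> l a aa; apply: Reg_Cq_nat; first exact: chart_dom_open.
  move=> j; apply: (Reg_ext (chart_dom_open a) (f := fun w => S^-1 * (f0 \o cpar a) w)).
    by move=> w _; rewrite /= mxE (ord1 j) eqxx mulr1n.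
  by apply: (RegZ th01 (chart_dom_open a)); apply: Rf0; exact: atlas_smooth_chart.
- apply: ge_ereal_sup => e [i _ <-]; rewrite dom.
  have oc := @cube_open R d (rad i).
  have Ri : Reg 0 k (cube (rad i)) (f0 \o cpar (psi i)) by rewrite -dom; exact: Rf0.
  have Bi : Bd k (cube (rad i)) (M i) (f0 \o cpar (psi i)) by rewrite -dom; exact: (HM' i).2.
  have Si : `|S^-1| <= S^-1 by rewrite ger0_norm // invr_ge0 ltW.
  have := (HC' i).2 _ _ (RegM th01 oc (Reg_cst 0 oc k S^-1) Ri)
    (BdM th01 oc (Reg_cst 0 oc k S^-1) Ri (Bd_cst oc k Si) Bi).
  move=> /le_trans; apply; rewrite lee_fin.
  rewrite [leLHS](_ : _ = (C i * (2 ^+ k * M i)) / S); last by ring.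
  rewrite ler_pdivrMr // mul1r /S (bigD1 i) //= addrCA lerDl addr_ge0 // sumr_ge0 //.
- rewrite mulr_gt0 ?invr_gt0 // /f0; case: asboolP => [_|].
    by rewrite -yp cparK ?bump_pos //; apply: Kd; rewrite /ecball /= subrr enorm0 ltW.
  by case; exists y => //; apply: Kd; rewrite /ecball /= subrr enorm0 ltW.
- move=> z nW; rewrite f0K ?mulr0 // => -[w /Ky [_ [h _]] wz]; apply: nW; rewrite -wz; exact: h.
Qed.

End one_bump.
End manifold_bump.

(** * Joint measurability of the skew product *)

Section joint_measurability.
Context {R : realType} {d : nat} {X : riemannian R d}.
Variables (N : nat) (psi : 'I_N -> chart R d X) (rad : 'I_N -> R).
Hypotheses (spsi : forall i, smooth_chart (psi i)) (rad0 : forall i, 0 < rad i).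
Hypotheses (dom : forall i, cdom (psi i) = cube (rad i)).
Hypothesis cover : forall p, exists i, exists2 x, cube (rad i / 2) x & cpar (psi i) x = p.

Lemma cover_le q (F : X -> R) p : (`|F p|%:E <= CnormX psi q (fun x => of_real (F x)))%E.
Proof.
have [i [x xc xp]] := cover p.
have xd : cdom (psi i) x.
  by rewrite dom => j; apply: lt_trans (xc j) _; have := rad0 i; lra.
apply: (@le_trans _ _ (Cnorm q (cdom (psi i)) ((fun x => of_real (F x)) \o cpar (psi i)))).
  apply: (@le_trans _ _ (enorm (of_real (F (cpar (psi i) x))))%:E); last first.
    by apply: ereal_sup_ubound; left; exists [::], x.
  by rewrite lee_fin xp; have := coord_le_enorm (of_real (F p)) 0; rewrite mxE eqxx mulr1n.
by apply: ereal_sup_ubound; exists i.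
Qed.

(** The maps S with S x in W form an open set for [dC]. Take a bump f at S x supported in W: if S' x
    is not in W, then f distinguishes S from S' at x by f (S x), so [dC] is at least f (S x). *)
Lemma point_measurable r (M : set (X -> X)) (dO : measure_display) (Omega : measurableType dO)
  (T_ : Omega -> X -> X) x W : 0 <= r + 1 + 1 -> measurable_cocycle psi r M T_ ->
  open W -> (forall z, W z -> ~ frontier psi z) -> measurable [set w | W (T_ w x)].
Proof.
move=> r0 [_ H] oW Wf; apply: (H [set S | W (S x)]) => S MS /= WS.
have [f [cf nf fp f0]] := @exists_bump R d X N psi rad spsi rad0 dom cover (S x) W (r + 1 + 1) oW WS Wf r0.
exists (f (S x)) => // S' MS' h; apply: contrapT => nW.
have h1 : (`|f (S x) - f (S' x)|%:E <= dC psi (r + 1) S S')%E.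
  apply: (@le_trans _ _ (CnormX psi (r + 1) (fun x => of_real (f (S x) - f (S' x))))).
    exact: (cover_le _ (fun x => f (S x) - f (S' x))).
  by apply: ereal_sup_ubound; exists f.
by have := le_lt_trans h1 h; rewrite (f0 _ nW) subr0 lte_fin gtr0_norm // ltxx.
Qed.

Definition ratv (a : 'rV[rat]_d) : 'rV[R]_d := map_mx ratr a.

Lemma ratv_approx (y : 'rV[R]_d) (e : R) : 0 < e -> exists a, `|y - ratv a| <= e.
Proof.
move=> e0; have /choice [a ha] : forall j, exists a : rat, `|y 0 j - ratr a| <= e.
  move=> j; have h : y 0 j - e < y 0 j + e by lra.
  have [a] := rat_in_itvoo h; rewrite in_itv /= => /andP[h1 h2].
  by exists a; rewrite ler_norml; apply/andP; split; lra.
exists (\row_j a j); apply: norm_row_le; first exact: ltW.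
by move=> j; rewrite !mxE.
Qed.

(** Rational centres and radii make these sets countably many; [obox_basis] shows that they form a
    base of the topology. *)
Definition obox (j : 'I_N * 'rV[rat]_d * rat) : set X :=
  cpar (psi j.1.1) @` (cdom (psi j.1.1) `&` ball (ratv j.1.2) (ratr j.2)).

Definition cbox (j : 'I_N * 'rV[rat]_d * rat) : set 'rV[R]_d :=
  [set z | `|z - ratv j.1.2| <= ratr j.2].

Lemma chart_image_open a (O : set 'rV[R]_d) : open O -> open (cpar a @` (cdom a `&` O) : set X).
Proof.
move=> oO; rewrite openE => z [w [aw Ow] <-].
have c := ccoord_continuous aw.
have n1 : nbhs (cpar a w) (ccoord a @^-1` (cdom a `&` O)).
  apply: c; rewrite cparK //; apply: open_nbhs_nbhs; split=> //; apply: openI => //; exact: chart_dom_open.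
have n2 : nbhs (cpar a w) (cim a).
  by apply: open_nbhs_nbhs; split; [exact: chart_im_open | exists w].
apply: filterS (filterI n1 n2) => z' [/= h [w' aw' E]]; exists w' => //.
by move: h; rewrite -E /= cparK.
Qed.

Lemma obox_open j : open (obox j).
Proof. by apply: chart_image_open; exact: ball_open. Qed.

Lemma cbox_compact j : compact (cbox j).
Proof.
apply: bounded_closed_compact; last exact: closed_ball_norm.
exists (`|ratv j.1.2| + ratr j.2); split; first exact: num_real.
move=> M hM z hz; apply: le_trans (ltW hM); rewrite -(subrK (ratv j.1.2) z) addrC.
by apply: le_trans (ler_normD _ _) _; rewrite lerD2l.
Qed.

Lemma obox_basis p W : open W -> W p -> exists j, [/\ obox j p, cdom (psi j.1.1) (ratv j.1.2),
  obox j (cpar (psi j.1.1) (ratv j.1.2)), cbox j `<=` cdom (psi j.1.1) & cpar (psi j.1.1) @` cbox j `<=` W].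
Proof.
move=> oW Wp; have [i [y [rho [rho0 yc yp H]]]] := chart_box rad0 dom cover oW Wp.
(* Then d (2 de) <= rho, so the sup-norm ball of radius 2 de around y lies in the Euclidean ball of
   radius rho. *)
pose de := rho / (2 * (d%:R + 1)).
have d1 : (0 : R) < 2 * (d%:R + 1) by rewrite mulr_gt0 // ltr_wpDl.
have de0 : 0 < de by rewrite divr_gt0.
have de2 : de / 2 < de by rewrite ltr_pdivrMr // ltr_pMr // ltr1n.
have [e] := rat_in_itvoo de2.
rewrite in_itv /= => /andP[e1 e2].
have [a ha] : exists a, `|y - ratv a| <= de / 2 by apply: ratv_approx; rewrite divr_gt0.
have yd : cdom (psi i) y.
  by apply: (H y _).1; rewrite subrr enorm0 ltW.
have inb z : `|z - ratv a| <= ratr e -> enorm (z - y) <= rho.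
  move=> hz; apply: le_trans (enorm_le_norm _) _.
  have hzy : `|z - y| <= 2 * de.
    rewrite -(subrKA (ratv a)); apply: le_trans (ler_normD _ _) _.
    by rewrite [X in _ + X]distrC; move: hz ha e2; lra.
  apply: (@le_trans _ _ (d%:R * (2 * de))); first by rewrite ler_wpM2l.
  rewrite /de [leLHS](_ : _ = rho * (d%:R / (d%:R + 1))).
    by apply: ler_piMr; [exact: ltW | rewrite ler_pdivrMr ?ltr_wpDl // mul1r lerDl].
  by field; rewrite lt0r_neq0 // ltr_wpDl.
have e0 : 0 < ratr e :> R by apply: lt_trans e1; rewrite divr_gt0.
have aa : cdom (psi i) (ratv a) by apply: (H _ _).1; apply: inb; rewrite subrr normr0 ltW.
exists (i, a, e); split=> //=.
- exists y; last exact: yp.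
  by split=> //; rewrite -ball_normE /ball_ /= distrC; apply: le_lt_trans ha e1.
- by exists (ratv a) => //; split=> //; exact: ballxx.
- by move=> z hz; exact: (H z (inb z hz)).1.
- by move=> _ [z hz <-]; exact: (H z (inb z hz)).2.
Qed.

(** T_w x lies in U iff there are boxes j containing x and m with image C m inside U such that T_w
    maps no rational point of box j into the part of the complement of C m off the frontier. For
    fixed boxes this is a countable condition on w, so the set is a countable union of measurable
    rectangles. *)
Lemma joint_measurable (dO : measure_display) (Omega : measurableType dO) (T_ : Omega -> X -> X) :
  (forall w, continuous (T_ w)) ->
  (forall w, exists S', [/\ cancel (T_ w) S', cancel S' (T_ w) & continuous S']) ->
  (forall x W, open W -> (forall z, W z -> ~ frontier psi z) -> measurable [set w | W (T_ w x)]) ->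
  measurable_fun [set: Omega * borel X] (fun z => T_ z.1 z.2 : borel X).
Proof.
move=> cT iT mT.
suff H (U : set X) : open U -> measurable ([set z | U (T_ z.1 z.2)] : set (Omega * borel X)).
  move=> _; apply: (@measurability _ _ _ (borel X) setT (fun z : Omega * borel X => T_ z.1 z.2 : borel X) (@open X) erefl) => //.
  by move=> _ [U oU <-]; rewrite setTI; exact: H.
move=> oU.
pose J := ('I_N * 'rV[rat]_d * rat)%type.
pose C (m : J) := cpar (psi m.1.1) @` cbox m.
(* The frontier is removed because [mT] covers only open sets that avoid it. *)
pose W (m : J) := ~` C m `\` frontier psi.
pose ok (m : J) := cbox m `<=` cdom (psi m.1.1) /\ C m `<=` U.
pose Q (jm : J * J) (w : Omega) := ok jm.2 /\
  forall k : J, cdom (psi k.1.1) (ratv k.1.2) -> obox jm.1 (cpar (psi k.1.1) (ratv k.1.2)) ->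
    ~ W jm.2 (T_ w (cpar (psi k.1.1) (ratv k.1.2))).
have cC m : ok m -> closed (C m).
  move=> [h _]; apply: compact_closed; first exact: carrier_hausdorff.
  by apply: chart_image_compact => //; exact: cbox_compact.
have oW m : ok m -> open (W m).
  move=> okm; apply: openI; first exact: closed_openC (cC m okm).
  exact: closed_openC (@closed_frontier _ _ _ _ psi).
have -> : [set z | U (T_ z.1 z.2)] = \bigcup_(jm in [set: J * J]) ([set w | Q jm w] `*` (obox jm.1 : set (borel X))).
  apply/seteqP; split=> -[w x] /=.
    move=> Ux; have [m [pm _ _ dm Cm]] := obox_basis oU Ux.
    have oV : open (T_ w @^-1` obox m) by have /continuousP := cT w; apply; exact: obox_open.
    have [j [xj _ _ dj Vj]] := obox_basis oV pm.
    exists (j, m) => //; split=> //=; split=> // k kd kj [nC _]; apply: nC.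
    have [z [jz bz] zE] := kj.
    have : obox m (T_ w (cpar (psi k.1.1) (ratv k.1.2))).
      apply: Vj; exists z => //; move: bz; rewrite -ball_normE /ball_ /cbox /= distrC; exact: ltW.
    move=> [y [my by_] <-]; exists y => //; move: by_; rewrite -ball_normE /ball_ /cbox /= distrC; exact: ltW.
  move=> [[j m] _ [[okm h] /= xj]]; apply: contrapT => nU.
  have nC : ~ C m (T_ w x) by move=> /okm.2.
  have [S' [T1 T2 cS']] := iT w.
  (* If T_w x were outside U, the image of box j would meet the complement of C m in a nonempty open
     set, T_w being a homeomorphism. The nowhere dense frontier cannot fill it, and a nearby
     rational point contradicts the condition. *)
  pose O' := S' @^-1` obox j `&` ~` C m.
  have oO' : open O'.
    by apply: openI; [have /continuousP := cS'; apply; exact: obox_open | exact: closed_openC (cC m okm)].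
  have [y [[jy nCy] nfy]] : O' `\` frontier psi !=set0.
    apply: frontier_nowhere => //; exists (T_ w x); split=> //=; by rewrite T1.
  have oV : open (T_ w @^-1` W m `&` obox j).
    by apply: openI (obox_open j); have /continuousP := cT w; apply; exact: oW.
  have Vy : (T_ w @^-1` W m `&` obox j) (S' y) by split=> //=; rewrite /preimage /= T2.
  have [k [_ kd kk dk Vk]] := obox_basis oV Vy.
  have [z [kz bz] zE] := kk.
  have /Vk [h1 h2] : (cpar (psi k.1.1) @` cbox k) (cpar (psi k.1.1) (ratv k.1.2)).
    exists z => //; move: bz; rewrite -ball_normE /ball_ /cbox /= distrC; exact: ltW.
  exact: h h2 h1.
apply: countable_bigcupT_measurable; first exact: countableP.
move=> [j m]; apply: measurableX; last by apply: sub_sigma_algebra; exact: obox_open.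
have [okm|nok] := pselect (ok m); last first.
  rewrite (_ : [set w | _] = set0) //; apply/seteqP; split=> // w [] //.
pose D (k : J) : set Omega := if `[< cdom (psi k.1.1) (ratv k.1.2) /\ obox j (cpar (psi k.1.1) (ratv k.1.2)) >]
  then [set w | W m (T_ w (cpar (psi k.1.1) (ratv k.1.2)))] else set0.
have -> : [set w | Q (j, m) w] = ~` \bigcup_(k in [set: J]) D k.
  apply/seteqP; split=> w /=.
    by move=> [_ h] [k _]; rewrite /D; case: asboolP => // -[k1 k2] /(h k k1 k2).
  move=> h; split=> // k k1 k2 Wk; apply: h; exists k => //; rewrite /D; case: asboolP => //; by case.
apply: measurableC; apply: countable_bigcupT_measurable; first exact: countableP.
move=> k; rewrite /D; case: asboolP => _; last exact: measurable0.
by apply: mT; [exact: oW | move=> z []].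
Qed.

End joint_measurability.

(** * Birkhoff's ergodic theorem for bounded functions *)

Section bounded_measurable.
Context {R : realType} {dT : measure_display} {T : measurableType dT} (P : probability T R).
Implicit Types f g : T -> R.

Definition bm f := measurable_fun setT f /\ exists M : R, forall x, `|f x| <= M.

Lemma bm_integrable f : bm f -> P.-integrable setT (EFin \o f).
Proof.
move=> [mf [M HM]]; apply: measurable_bounded_integrable => //.
  exact: le_lt_trans (probability_le1 P measurableT) (ltry 1).
by exists M; split; [exact: num_real | move=> y My x _; apply: le_trans (HM x) (ltW My)].
Qed.

Lemma bm_cst (c : R) : bm (fun=> c). Proof. by split; [exact: measurable_cst | exists `|c|]. Qed.

Lemma bmD f g : bm f -> bm g -> bm (fun x => f x + g x).
Proof.
move=> [mf [M HM]] [mg [K HK]]; split; first exact: measurable_funD.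
by exists (M + K) => x; apply: le_trans (ler_normD _ _) _; exact: lerD.
Qed.

Lemma bmM f g : bm f -> bm g -> bm (fun x => f x * g x).
Proof.
move=> [mf [M HM]] [mg [K HK]]; split; first exact: measurable_funM.
by exists (M * K) => x; rewrite normrM; exact: ler_pM.
Qed.

Lemma bmZ (c : R) f : bm f -> bm (fun x => c * f x).
Proof. by apply: bmM; exact: bm_cst. Qed.

Lemma bmN f : bm f -> bm (fun x => - f x).
Proof. by move=> /(bmZ (-1)); congr bm; apply/funext => x; rewrite mulN1r. Qed.

Lemma bmB f g : bm f -> bm g -> bm (fun x => f x - g x).
Proof. by move=> bf bg; exact: bmD bf (bmN bg). Qed.

Lemma bm_sum n (F : nat -> T -> R) : (forall i, bm (F i)) -> bm (fun x => \sum_(i < n) F i x).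
Proof.
move=> H; elim: n => [|n IH].
  by have := bm_cst 0; congr bm; apply/funext => x; rewrite big_ord0.
by have := bmD IH (H n); congr bm; apply/funext => x; rewrite big_ord_recr.
Qed.

Lemma bm_intD f g : bm f -> bm g -> \int[P]_x (f x + g x) = \int[P]_x f x + \int[P]_x g x.
Proof. by move=> bf bg; rewrite RintegralD //; exact: bm_integrable. Qed.

Lemma bm_intZ (c : R) f : bm f -> \int[P]_x (c * f x) = c * \int[P]_x f x.
Proof. by move=> bf; rewrite RintegralZl //; exact: bm_integrable. Qed.

Lemma bm_intB f g : bm f -> bm g -> \int[P]_x (f x - g x) = \int[P]_x f x - \int[P]_x g x.
Proof. by move=> bf bg; rewrite RintegralB //; exact: bm_integrable. Qed.

Lemma bm_int_sum n (F : nat -> T -> R) : (forall i, bm (F i)) ->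
  \int[P]_x (\sum_(i < n) F i x) = \sum_(i < n) \int[P]_x F i x.
Proof.
move=> H; elim: n => [|n IH].
  rewrite big_ord0 -[RHS](mul0r (\int[P]_x 0)) -bm_intZ; last exact: bm_cst.
  by apply: eq_Rintegral => x _; rewrite big_ord0 mul0r.
rewrite big_ord_recr -IH /= -(bm_intD (bm_sum n H) (H n)).
by apply: eq_Rintegral => x _; rewrite big_ord_recr.
Qed.

Lemma prob_int_cst (c : R) : \int[P]_x c = c.
Proof.
rewrite Rintegral_cst //; have e : (P : set T -> \bar R) setT = 1%E := probability_setT P.
by rewrite (_ : fine _ = 1) ?mulr1 //; exact: (f_equal fine e).
Qed.

Lemma bm_int_le f g : bm f -> bm g -> (forall x, f x <= g x) -> \int[P]_x f x <= \int[P]_x g x.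
Proof. by move=> bf bg h; apply: le_Rintegral => //; exact: bm_integrable. Qed.

Lemma bm_int_norm f M : bm f -> (forall x, `|f x| <= M) -> `|\int[P]_x f x| <= M.
Proof.
move=> bf HM; apply: le_trans (le_normr_Rintegral _ (bm_integrable bf)) _ => //.
rewrite -[leRHS](prob_int_cst M); apply: bm_int_le; [|exact: bm_cst|exact: HM].
by case: bf => mf [K HK]; split; [exact: measurableT_comp | exists K => x; rewrite normr_id].
Qed.

Lemma bm_int_ae f g : bm f -> bm g -> {ae P, forall x, f x = g x} -> \int[P]_x f x = \int[P]_x g x.
Proof.
move=> [mf _] [mg _] h; rewrite /Rintegral; congr fine; apply: ae_eq_integral => //.
- exact/measurable_EFinP.
- exact/measurable_EFinP.
- by apply: filterS h => x -> _.
Qed.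

Lemma bounded_convergence (u : nat -> T -> R) f M : (forall n, measurable_fun setT (u n)) ->
  measurable_fun setT f -> (forall n x, `|u n x| <= M) ->
  {ae P, forall x, u ^~ x @ \oo --> f x} -> (fun n => \int[P]_x u n x) @ \oo --> \int[P]_x f x.
Proof.
move=> mu mf HM h.
have [|||||i1 _ i3] := @dominated_convergence _ T R P setT measurableT
  (fun n x => (u n x)%:E) (fun x => (f x)%:E) (fun=> M%:E).
- by move=> n; exact/measurable_EFinP.
- exact/measurable_EFinP.
- by apply: filterS h => x hx _; apply: cvg_EFin; [near=> n | exact: hx].
- exact: (bm_integrable (bm_cst M)).
- by apply: aeW => x n _; rewrite lee_fin.
have fi : (\int[P]_x (f x)%:E)%E \is a fin_num by exact: integrable_fin_num.
by apply: fine_cvg; rewrite fineK.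
Unshelve. all: by end_near. Qed.

End bounded_measurable.

Section birkhoff.
Context {R : realType} {dT : measure_display} {T : measurableType dT} (P : probability T R).
Variable sigma : T -> T.
Hypothesis hs : ergodic_system P sigma.
Implicit Type f : T -> R.

Lemma bm_comp f : bm f -> bm (f \o sigma).
Proof.
move=> [mf [M HM]]; split; last by exists M => x; exact: HM.
exact: measurableT_comp mf (es_measurable hs).
Qed.

Lemma int_invariant f : bm f -> \int[P]_x f (sigma x) = \int[P]_x f x.
Proof.
move=> bf; have [mf _] := bf; rewrite /Rintegral; congr fine.
have := @integral_pushforward _ _ T T R sigma (es_measurable hs) P setT (EFin \o f) _ _ measurableT.
rewrite preimage_setT => <-; last 2 first.
- exact/measurable_EFinP.
- exact: (bm_integrable P (bm_comp bf)).
have H := @eq_measure_integral _ T R setT P (pushforward P sigma) (EFin \o f).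
refine (H (es_measurable hs) _) => A mA _.
exact: (es_invariant hs mA).
Qed.

(** The maximum of the Birkhoff sums of lengths 1 to n + 1; the recursion splits off the first
    summand. *)
Fixpoint maxsum (f : T -> R) (n : nat) (w : T) : R :=
  if n is m.+1 then f w + Num.max 0 (maxsum f m (sigma w)) else f w.

Lemma maxsum_mono f n w : maxsum f n w <= maxsum f n.+1 w.
Proof.
elim: n w => [|n IH] w; first by rewrite /= lerDl le_max lexx.
rewrite [leRHS]/= [leLHS]/= lerD2l; have := IH (sigma w).
by rewrite ge_max !le_max lexx /= => ->; rewrite orbT.
Qed.

Lemma maxsum_le f n m w : (n <= m)%N -> maxsum f n w <= maxsum f m w.
Proof.
move=> /subnKC <-; elim: (m - n)%N => [|k IH]; first by rewrite addn0.
by rewrite addnS; apply: le_trans IH (maxsum_mono _ _ _).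
Qed.

Lemma maxsum_sum f n k w : (k <= n)%N -> \sum_(i < k.+1) f (iter i sigma w) <= maxsum f n w.
Proof.
elim: n k w => [|n IH] k w.
  by rewrite leqn0 => /eqP ->; rewrite big_ord1.
case: k => [|k] kn; first by rewrite big_ord1 /= lerDl le_max lexx.
rewrite big_ord_recl /= lerD2l; apply: le_trans (_ : maxsum f n (sigma w) <= _); last by rewrite le_max lexx orbT.
apply: le_trans (IH k (sigma w) kn); rewrite le_eqVlt; apply/orP; left; apply/eqP.
by apply: eq_bigr => i _; rewrite add0n -iterSr.
Qed.

Lemma bm_maxsum f n : bm f -> bm (maxsum f n).
Proof.
move=> bf; elim: n => [//|n IH].
apply: (bmD bf); have [mf [M HM]] := bm_comp IH; split.
  exact: (measurable_maxr (measurable_cst (0 : R)) mf).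
exists M => x; apply: le_trans (HM x); rewrite /Num.max; case: ifP => // _.
by rewrite normr0.
Qed.

(** Write M_n for [maxsum f n]. As f is bounded, unboundedness of the M_n is an invariant event, so
    by ergodicity it would hold almost surely. But G_n = M_(n+1) - M_n o sigma has nonnegative
    integral, by invariance and monotonicity, and would converge boundedly to f, against the sign of
    the integral of f. *)
Lemma maxsum_bounded f : bm f -> \int[P]_x f x < 0 ->
  {ae P, forall w, exists K : R, forall n, maxsum f n w <= K}.
Proof.
move=> bf f0; have [mf [M HM]] := bf.
pose E := [set w | forall k : nat, exists n, k%:R < maxsum f n w].
have mE : measurable E.
  rewrite (_ : E = \bigcap_(k in [set: nat]) \bigcup_(n in [set: nat]) [set w | k%:R < maxsum f n w]); last first.
    apply/seteqP; split=> w; first by move=> h k _; have [n hn] := h k; exists n.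
    by move=> h k; have [n _ hn] := h k I; exists n.
  apply: bigcapT_measurable => k; apply: bigcupT_measurable => n.
  have [m _] := bm_maxsum n bf; have := m measurableT `]k%:R, +oo[%classic (measurable_itv _).
  by rewrite setTI; congr measurable; apply/seteqP; split=> w /=; rewrite in_itv /= andbT.
have iE : sigma @^-1` E = E.
  apply/seteqP; split=> w h k /=.
    have [k' hk'] : exists k' : nat, k%:R + M < k'%:R.
      by exists (Num.truncn (k%:R + M)).+1; exact: truncnS_gt.
    have [n hn] := h k'; exists n.+1; rewrite /=.
    have h1 : maxsum f n (sigma w) <= Num.max 0 (maxsum f n (sigma w)) by rewrite le_max lexx orbT.
    by have := HM w; rewrite ler_norml => /andP[h2 _]; move: hk' hn h1 h2; lra.
  have [k' hk'] : exists k' : nat, k%:R + M < k'%:R.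
    by exists (Num.truncn (k%:R + M)).+1; exact: truncnS_gt.
  have [n hn] := h k'; exists n.
  have := lt_le_trans hn (maxsum_mono f n w); rewrite /= => h1.
  have := HM w; rewrite ler_norml => /andP[_ h2].
  have h3 : k%:R < Num.max 0 (maxsum f n (sigma w)) by move: hk' h1 h2; lra.
  by move: h3; rewrite lt_max ltNge ler0n.
have [PE0|PE1] := es_ergodic hs mE iE.
  exists E; split=> // w /= hw k; apply: contrapT => nk; apply: hw; exists k%:R => n.
  by rewrite leNgt; apply/negP => hn; apply: nk; exists n.
exfalso.
have aeE : {ae P, forall w, E w}.
  exists (~` E); split=> //; first exact: measurableC.
  have := probability_setC P mE; rewrite PE1 => ->; by rewrite subee.
pose G n w := maxsum f n.+1 w - maxsum f n (sigma w).
have bG n : bm (G n) by apply: bmB (bm_maxsum _ bf) (bm_comp (bm_maxsum _ bf)).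
have GM n w : `|G n w| <= 2 * M.
  have h0 : - M <= maxsum f n (sigma w).
    have h := @maxsum_le f 0 n (sigma w) (leq0n n); apply: le_trans h.
    by have := HM (sigma w); rewrite ler_norml => /andP[].
  rewrite /G /=; set y := maxsum f n (sigma w) in h0 *.
  have hM := HM w; apply: (@le_trans _ _ (`|f w| + `|Num.max 0 y - y|)).
    by rewrite -addrA ler_normD.
  suff : `|Num.max 0 y - y| <= M by move: hM; lra.
  have M0 := le_trans (normr_ge0 _) hM.
  case: (leP 0 y) => hy; first by rewrite subrr normr0.
  by rewrite sub0r normrN ler_norml; apply/andP; split; [exact: h0 | lra].
have GC : (fun n => \int[P]_w G n w) @ \oo --> \int[P]_w f w.
  apply: (bounded_convergence (M := 2 * M)) => //; first by move=> n; have [] := bG n.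
  apply: filterS aeE => w Ew.
  (* As soon as M_n (sigma w) >= 0, the recursion reads M_(n+1) w = f w + M_n (sigma w), so G n w =
     f w. *)
  have /(_ 0%N) [n0 hn0] : E (sigma w) by rewrite -[E _]/((sigma @^-1` E) w) iE.
  apply: cvg_near_cst; exists n0 => // n /= n0n.
  have y0 : 0 <= maxsum f n (sigma w) by apply: ltW; apply: lt_le_trans hn0 (maxsum_le _ _ n0n).
  by rewrite /G /= max_r // addrK.
have G0 n : 0 <= \int[P]_w G n w.
  rewrite (bm_intB P (bm_maxsum _ bf) (bm_comp (bm_maxsum _ bf))) subr_ge0.
  rewrite (int_invariant (bm_maxsum n bf)); apply: bm_int_le; try exact: bm_maxsum.
  exact: maxsum_mono.
have : 0 <= \int[P]_w f w.
  by apply: (cvgr_to_ge GC); near=> n; exact: G0.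
by rewrite leNgt f0.
Unshelve. all: by end_near. Qed.

(** [maxsum_bounded] applies to f - (I + 1/(m+1)) and to (I - 1/(m+1)) - f, whose means are
    negative: their sums are bounded above, so the averages of f stay within 1/(m+1) + K / n of
    I. *)
Theorem birkhoff f : bm f ->
  {ae P, forall w, (fun n => (\sum_(i < n) f (iter i sigma w)) / n%:R) @ \oo --> \int[P]_x f x}.
Proof.
move=> bf; set I := \int[P]_x f x.
have H1 m : {ae P, forall w, exists K : R, forall n, maxsum (fun x => f x - (I + m.+1%:R^-1)) n w <= K}.
  apply: maxsum_bounded; first exact: bmB bf (bm_cst _).
  rewrite (bm_intB P bf (bm_cst _)) prob_int_cst -/I opprD addrA subrr sub0r oppr_lt0.
  by rewrite invr_gt0.
have H2 m : {ae P, forall w, exists K : R, forall n, maxsum (fun x => (I - m.+1%:R^-1) - f x) n w <= K}.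
  apply: maxsum_bounded; first exact: bmB (bm_cst _) bf.
  by rewrite (bm_intB P (bm_cst _) bf) prob_int_cst -/I addrAC subrr sub0r oppr_lt0 invr_gt0.
apply: filterS2 (ae_foralln H1) (ae_foralln H2) => w h1 h2.
apply/cvgrPdist_lt => e e0.
have e20 : 0 < e / 2 by rewrite divr_gt0.
have [m _ /(_ m (leqnn m)) hm] := near_infty_natSinv_lt (PosNum e20).
have [K1 hK1] := h1 m; have [K2 hK2] := h2 m.
pose K := `|K1| + `|K2| + 1.
have K0 : 0 < K by rewrite ltr_wpDl // addr_ge0.
near=> n.
have n0 : (0 < n)%N by near: n; exact: nbhs_infty_gt.
have nR : 0 < n%:R :> R by rewrite ltr0n.
have Kn : K / n%:R < e / 2.
  rewrite ltr_pdivrMr // mulrC -ltr_pdivrMr //; near: n; exact: nbhs_infty_gtr.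
set S := \sum_(i < n) f (iter i sigma w).
have s1 : S - (I + m.+1%:R^-1) * n%:R <= K1.
  have h := maxsum_sum (fun x => f x - (I + m.+1%:R^-1)) w (leqnn n.-1); rewrite prednK // in h.
  have := le_trans h (hK1 n.-1); rewrite sumrB sumr_const card_ord -[_ *+ n]mulr_natr; exact.
have s2 : (I - m.+1%:R^-1) * n%:R - S <= K2.
  have h := maxsum_sum (fun x => (I - m.+1%:R^-1) - f x) w (leqnn n.-1); rewrite prednK // in h.
  have := le_trans h (hK2 n.-1); rewrite sumrB sumr_const card_ord -[_ *+ n]mulr_natr; exact.
have k1 : K1 <= K by rewrite /K; have := ler_norm K1; have := normr_ge0 K2; lra.
have k2 : K2 <= K by rewrite /K; have := ler_norm K2; have := normr_ge0 K1; lra.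
have hmn : m.+1%:R^-1 < e / 2 by exact: hm.
have Kn' : K < e / 2 * n%:R by rewrite -ltr_pdivrMr.
have mn : m.+1%:R^-1 * n%:R < e / 2 * n%:R by rewrite ltr_pM2r.
have -> : I - S / n%:R = (I * n%:R - S) / n%:R by field; exact: lt0r_neq0.
rewrite normrM normfV (gtr0_norm nR) ltr_pdivrMr // ltr_norml.
rewrite mulrDl in s1; rewrite mulrBl in s2.
move: s1 s2 k1 k2 Kn' mn; move: (m.+1%:R^-1 * n%:R) => p; move: (n%:R) => q s1 s2 k1 k2 Kn' mn.
by apply/andP; split; lra.
Unshelve. all: by end_near. Qed.

End birkhoff.

(** * Levy's continuity theorem *)

Section fubini_bounded.
Context {R : realType} {d1 d2 : measure_display} {T1 : measurableType d1} {T2 : measurableType d2}.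
Variables (P : probability T1 R) (Q : probability T2 R) (F : T1 * T2 -> R).
Hypothesis bF : bm F.

Let iF : (P \x Q)%E.-integrable setT (EFin \o F).
Proof. exact: (@bm_integrable R _ _ (P \x Q)%E F bF). Qed.

Lemma bm_section1 x : bm (fun y => F (x, y)).
Proof.
have [mF [M HM]] := bF; split; last by exists M => y; exact: HM.
exact: (measurableT_comp mF (measurable_pair1 x)).
Qed.

Lemma bm_section2 y : bm (fun x => F (x, y)).
Proof.
have [mF [M HM]] := bF; split; last by exists M => x; exact: HM.
exact: (measurableT_comp mF (measurable_pair2 y)).
Qed.

Let E1 x : (\int[Q]_y (F (x, y))%:E)%E = (\int[Q]_y F (x, y))%:E.
Proof. by rewrite /Rintegral fineK //; apply: integrable_fin_num => //; exact: (bm_integrable Q (bm_section1 x)). Qed.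

Let E2 y : (\int[P]_x (F (x, y))%:E)%E = (\int[P]_x F (x, y))%:E.
Proof. by rewrite /Rintegral fineK //; apply: integrable_fin_num => //; exact: (bm_integrable P (bm_section2 y)). Qed.

Lemma bm_fubini1 : bm (fun x => \int[Q]_y F (x, y)).
Proof.
have [mF [M HM]] := bF; split.
  apply/measurable_EFinP; have := measurable_fubini_F iF.
  by congr measurable_fun; apply/funext => x; rewrite /fubini_F /= E1.
by exists M => x; apply: bm_int_norm; [exact: bm_section1 | move=> y; exact: HM].
Qed.

Lemma bm_fubini : \int[P]_x \int[Q]_y F (x, y) = \int[Q]_y \int[P]_x F (x, y).
Proof.
have := Fubini iF; rewrite /fubini_F /fubini_G /= => e; apply: (f_equal fine).
rewrite (_ : (fun x => (\int[Q]_y F (x, y))%:E) = fun x => (\int[Q]_y (F (x, y))%:E)%E); last first.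
  by apply/funext => x; rewrite E1.
rewrite e; congr integral; apply/funext => y; exact: E2.
Qed.

End fubini_bounded.

(** * Gaussian measures on the line *)

Section gaussian.
Context {R : realType}.
Local Notation leb := (@lebesgue_measure R).

Definition gauss (m s : R) : probability (measurableTypeR R) R := normal_prob m s.

Lemma normal_density_integrable (m s : R) (f : measurableTypeR R -> R) : s != 0 ->
  (gauss m s).-integrable setT (EFin \o f) ->
  \int[gauss m s]_x f x = \int[leb]_x (f x * normal_pdf m s x).
Proof.
move=> s0 fi; apply: (f_equal fine).
have mf : measurable_fun setT f by apply/measurable_EFinP; exact: (measurable_int _ fi).
have dom : gauss m s `<< leb by exact: normal_prob_dominates.
rewrite -(Radon_Nikodym_change_of_variables dom measurableT fi) //=.
apply: ae_eq_integral => //.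
- apply: emeasurable_funM; first exact/measurable_EFinP.
  by apply: (measurable_int leb); exact: Radon_Nikodym_integrable.
- apply/measurable_EFinP; apply: measurable_funM => //; exact: measurable_normal_pdf.
- rewrite (_ : (fun x => (f x * normal_pdf m s x)%:E) = (fun x => (f x)%:E * (normal_pdf m s x)%:E)%E) //.
  apply: ae_eqe_mul2l => /=.
  apply: integral_ae_eq => //=.
  + exact: Radon_Nikodym_integrable.
  + by apply/measurable_EFinP; exact: measurable_normal_pdf.
  + by move=> E _ mE; rewrite -Radon_Nikodym_integral.
Qed.

Lemma normal_density (m s : R) (f : measurableTypeR R -> R) : s != 0 -> bm f ->
  \int[gauss m s]_x f x = \int[leb]_x (f x * normal_pdf m s x).
Proof. by move=> s0 bf; apply: normal_density_integrable => //; exact: (bm_integrable _ bf). Qed.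

Lemma normal_pdf_shift (h x : R) : normal_pdf h 1 x = normal_pdf 0 1 x * expR (x * h - h ^+ 2 / 2).
Proof.
rewrite !normal_pdfE ?oner_eq0 //.
change (normal_peak 1 * normal_fun h 1 x = normal_peak 1 * normal_fun 0 1 x * expR (x * h - h ^+ 2 / 2)).
rewrite /normal_fun -mulrA -expRD; congr (_ * expR _).
by field.
Qed.

(** The substitution x = m + s z is carried out for nonnegative integrands; adding the bound M
    reduces f to that case. *)
Lemma normal_scale (m s : R) (f : R -> R) : 0 < s -> continuous f -> (exists M, forall x, `|f x| <= M) ->
  \int[gauss m s]_x f x = \int[gauss 0 1]_z f (m + s * z).
Proof.
move=> s0 cf [M HM].
have cbm (g : R -> R) : continuous g -> (exists M, forall x, `|g x| <= M) -> bm (g : measurableTypeR R -> R).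
  by move=> cg Hg; split=> //; exact: continuous_measurable_fun.
have caff : continuous (fun z : R => m + s * z).
  by move=> z; apply: cvgD; [exact: cvg_cst | apply: cvgM; [exact: cvg_cst | exact: cvg_id]].
have cfa : continuous (fun z => f (m + s * z)).
  by move=> z; apply: (@continuous_comp _ _ _ (fun z : R => m + s * z) f); [exact: caff | exact: cf].
have pos (g : R -> R) : continuous g -> (forall x, 0 <= g x) -> (exists M, forall x, `|g x| <= M) ->
    \int[gauss m s]_x g x = \int[gauss 0 1]_z g (m + s * z).
  move=> cg g0 [K HK].
  have cga : continuous (fun z => g (m + s * z)).
    by move=> z; apply: (@continuous_comp _ _ _ (fun z : R => m + s * z) g); [exact: caff | exact: cg].
  rewrite (normal_density m (lt0r_neq0 s0) (cbm _ cg (ex_intro _ K HK))).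
  rewrite (normal_density 0 (oner_neq0 R) (cbm _ cga (ex_intro _ K (fun x => HK _)))).
  apply: (f_equal fine).
  have dF (z : R) : is_derive z (1 : R) (fun z : R => m + s * z) s.
    have := is_deriveD (is_derive_cst m z (1 : R)) (is_deriveZ s (is_derive_id z (1 : R))).
    by rewrite add0r /GRing.scale /= mulr1.
  have dE : derive1 (fun z : R => m + s * z) = cst s.
    by apply/funext => z; rewrite derive1E; have [_ ->] := dF z.
  rewrite (@increasing_ge0_integration_by_substitutionT R (fun z => m + s * z) (fun x => g x * normal_pdf m s x)).
  - rewrite dE; apply: eq_integral => z _; congr EFin; rewrite !fctE /= -mulrA; congr (_ * _).
    rewrite !normal_pdfE ?oner_eq0 ?lt0r_neq0 //.
    change (normal_peak s * normal_fun m s (m + s * z) * s = normal_peak 1 * normal_fun 0 1 z).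
    rewrite mulrAC; congr (_ * _).
      rewrite /normal_peak -[s ^+ 2 * pi *+ 2]mulr_natr -mulrA sqrtrM ?sqr_ge0 // sqrtr_sqr gtr0_norm //.
      by rewrite expr1n mul1r -[pi *+ 2]mulr_natr invfM mulrAC mulVf ?mul1r // lt0r_neq0.
    rewrite /normal_fun; congr expR; rewrite subr0 addrC addKr expr1n.
    by field; rewrite lt0r_neq0.
  - by move=> x y xy; rewrite ltrD2l ltr_pM2l.
  - by rewrite dE => z; exact: cst_continuous.
  - by rewrite dE; exact: is_cvg_cst.
  - by rewrite dE; exact: is_cvg_cst.
  - by move=> z; have [] := dF z.
  - apply/cvgrNyPle => A; near=> z.
    have h : z <= s^-1 * (A - m) by near: z; apply: nbhs_ninfty_le; exact: num_real.
    by rewrite -lerBrDl -ler_pdivlMl.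
  - apply/cvgryPge => A; near=> z.
    have h : s^-1 * (A - m) <= z by near: z; apply: nbhs_pinfty_ge; exact: num_real.
    by rewrite -lerBlDl -ler_pdivrMl.
  - move=> z; apply: (@continuousM _ _ g (normal_pdf m s)); first exact: cg.
    by apply: continuous_normal_pdf; exact: lt0r_neq0.
  - by move=> z; rewrite mulr_ge0 // normal_pdf_ge0.
have bf := cbm _ cf (ex_intro _ M HM).
have bfa := cbm _ cfa (ex_intro _ M (fun x => HM _)).
have h1 := pos (fun x => f x + M) _ _ _.
have : \int[gauss m s]_x (f x + M) = \int[gauss 0 1]_z (f (m + s * z) + M).
  apply: h1.
  - by move=> z; apply: cvgD; [exact: cf | exact: cvg_cst].
  - by move=> x; have := HM x; rewrite ler_norml => /andP[]; lra.
  - exists (M + M) => x; apply: le_trans (ler_normD _ _) _; apply: lerD => //.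
    by rewrite ger0_norm // (le_trans _ (HM 0)).
rewrite (bm_intD _ bf (bm_cst M)) (bm_intD _ bfa (bm_cst M)) !prob_int_cst.
exact: addIr.
Unshelve. all: by end_near. Qed.

Local Notation gam := (gauss 0 1).

Lemma cont_bm (f : R -> R) : continuous f -> (exists M, forall x, `|f x| <= M) ->
  bm (f : measurableTypeR R -> R).
Proof. by move=> cf Hf; split=> //; exact: continuous_measurable_fun. Qed.

(** Completing the square bounds the integrals of the truncations min (exp (h x), k) by exp (h^2 /
    2); monotone convergence does the rest. *)
Lemma exp_integrable (h : R) : gam.-integrable setT (EFin \o (fun x => expR (h * x))).
Proof.
have ce : continuous (fun x : R => expR (h * x)).
  move=> x; apply: (@continuous_comp _ _ _ (fun x : R => h * x) expR); last exact: continuous_expR.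
  by apply: cvgM; [exact: cvg_cst | exact: cvg_id].
have me : measurable_fun setT (fun x : measurableTypeR R => expR (h * x)).
  exact: continuous_measurable_fun.
pose f (k : nat) (x : measurableTypeR R) := Num.min (expR (h * x)) k%:R.
have mfk k : measurable_fun setT (f k) by exact: (measurable_minr me (measurable_cst (k%:R : R))).
have f0 k x : 0 <= f k x by rewrite /f le_min expR_ge0 ler0n.
have bf k : bm (f k).
  split; first exact: mfk.
  by exists k%:R => x; rewrite ger0_norm // /f ge_min lexx orbT.
have fle k : (\int[gam]_x (f k x)%:E <= (expR (h ^+ 2 / 2))%:E)%E.
  have fi := bm_integrable gam (bf k).
  have e : (\int[gam]_x (f k x)%:E)%E = (\int[gam]_x f k x)%:E.
    by rewrite /Rintegral fineK //; apply: integrable_fin_num.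
  rewrite e lee_fin (normal_density 0 (oner_neq0 R) (bf k)).
  have ip : leb.-integrable setT (EFin \o (fun x => expR (h ^+ 2 / 2) * normal_pdf h 1 x)).
    have := integrableZl measurableT (expR (h ^+ 2 / 2)) (integrable_normal_pdf h 1).
    by congr (leb.-integrable _ _); apply/funext => x.
  have pE x : expR (h * x) * normal_pdf 0 1 x = expR (h ^+ 2 / 2) * normal_pdf h 1 x.
    rewrite (normal_pdf_shift h x) mulrCA -expRD [RHS]mulrC; congr (expR _ * _).
    by rewrite [x * h]mulrC addrC subrK.
  apply: (@le_trans _ _ (\int[leb]_x (expR (h ^+ 2 / 2) * normal_pdf h 1 x))).
    apply: le_Rintegral => // [|x _]; last first.
      by rewrite -pE ler_wpM2r ?normal_pdf_ge0 // /f ge_min lexx.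
    apply: (le_integrable measurableT _ _ ip) => //.
      apply/measurable_EFinP; apply: measurable_funM; first exact: mfk.
      exact: measurable_normal_pdf.
    move=> x _; rewrite /= lee_fin -pE !ger0_norm ?mulr_ge0 ?normal_pdf_ge0 ?expR_ge0 //.
    by rewrite ler_wpM2r ?normal_pdf_ge0 // /f ge_min lexx.
  rewrite RintegralZl //; last exact: integrable_normal_pdf.
  by rewrite /Rintegral integral_normal_pdf /= mulr1.
apply/integrableP; split; first exact/measurable_EFinP.
rewrite (_ : (fun x => `|_|%E) = fun x => limn (fun k => (f k x)%:E)); last first.
  apply/funext => x; apply/esym/cvg_lim => //; rewrite /= ger0_norm ?expR_ge0 //.
  apply: cvg_near_cst; near=> k; rewrite /f min_l //; apply: ltW; near: k; exact: nbhs_infty_gtr.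
rewrite monotone_convergence //.
- apply: le_lt_trans (_ : ((expR (h ^+ 2 / 2))%:E < +oo)%E); last exact: ltry.
  apply: lime_le; last by near=> k; exact: fle.
  apply: ereal_nondecreasing_is_cvgn => k l kl; apply: ge0_le_integral => //.
  + by move=> x _; rewrite lee_fin.
  + exact/measurable_EFinP.
  + exact/measurable_EFinP.
  + by move=> x _; rewrite lee_fin /f le_min ge_min lexx /= ge_min ler_nat kl orbT.
- by move=> k; exact/measurable_EFinP.
- by move=> k x _; rewrite lee_fin.
- move=> x _ k l kl; rewrite lee_fin /f le_min ge_min lexx /= ge_min ler_nat kl orbT //.
Unshelve. all: by end_near. Qed.

Lemma expabs_integrable : gam.-integrable setT (EFin \o (fun x => expR (2 * `|x|))).
Proof.
have i := integrableD measurableT (exp_integrable 2) (exp_integrable (-2)).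
apply: (le_integrable measurableT _ _ i).
  apply/measurable_EFinP; apply: continuous_measurable_fun => x.
  apply: (@continuous_comp _ _ _ (fun x : R => 2 * `|x|) expR); last exact: continuous_expR.
  by apply: cvgM; [exact: cvg_cst | exact: norm_continuous].
move=> x _; rewrite /= lee_fin [leLHS]ger0_norm ?expR_ge0 // [leRHS]ger0_norm ?addr_ge0 ?expR_ge0 //.
have [x0|x0] := leP 0 x; first by rewrite (ger0_norm x0) lerDl expR_ge0.
by rewrite (ltr0_norm x0) mulrN mulNr lerDr expR_ge0.
Qed.

Lemma dominated_integrable_gam (f : R -> R) (c : R) : continuous f ->
  (forall x, `|f x| <= c * expR (2 * `|x|)) ->
  gam.-integrable setT (EFin \o f) /\ `|\int[gam]_x f x| <= c * \int[gam]_x expR (2 * `|x|).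
Proof.
move=> cf H; have ie := expabs_integrable.
have ic : gam.-integrable setT (EFin \o (fun x => c * expR (2 * `|x|))).
  by have := integrableZl measurableT c ie; congr (gam.-integrable _ _); apply/funext.
have i : gam.-integrable setT (EFin \o f).
  apply: (le_integrable measurableT _ _ ic); first by apply/measurable_EFinP; exact: continuous_measurable_fun.
  by move=> x _; rewrite /= lee_fin (le_trans (H x)) // ler_norm.
split=> //; apply: le_trans (le_normr_Rintegral measurableT i) _.
rewrite -RintegralZl //; apply: le_Rintegral => //.
have := integrable_abse i; congr (gam.-integrable _ _); exact/funext.
Qed.

End gaussian.

(** * Elementary bounds for sine, cosine and the exponential *)

Section trigonometry.
Context {R : realType}.
Implicit Types a b x : R.

(* The mean value theorem on [0, b] for an odd or even f, reduced to b >= 0. *)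
Lemma trig_mvt (f df g : R -> R) b : (forall x, is_derive x (1 : R) f (df x)) -> f 0 = 0 ->
  (forall x, `|f (- x)| = `|f x|) -> (forall x y, 0 <= x <= y -> `|df x| <= g y) ->
  `|f b| <= g `|b| * `|b|.
Proof.
move=> dF f0 fN H.
suff P y : 0 <= y -> `|f y| <= g y * y.
  have [b0|b0] := leP 0 b; first by rewrite (ger0_norm b0); exact: P.
  by rewrite (ltr0_norm b0) -fN; apply: P; rewrite oppr_ge0 ltW.
move=> y0.
have d x : x \in `]0, y[ -> is_derive x (1 : R) f (df x) by move=> _; exact: dF.
have cf : {within `[0, y], continuous f}.
  apply: continuous_subspaceT => x; apply: differentiable_continuous; apply/derivable1_diffP.
  by have [] := dF x.
have [c] := MVT_segment y0 d cf.
rewrite in_itv /= => /andP[c0 cy]; rewrite f0 !subr0 => ->.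
by rewrite normrM (ger0_norm y0) ler_wpM2r // H // c0.
Qed.

Lemma sin_le_norm b : `|sin b| <= `|b|.
Proof.
have := @trig_mvt sin cos (fun=> 1) b (fun x => is_derive_sin x) (@sin0 R) _ _; rewrite mul1r; apply.
- by move=> x; rewrite sinN normrN.
- by move=> x y _; exact: cos_max.
Qed.

Lemma cos_sub1 b : `|cos b - 1| <= `|b| ^+ 2.
Proof.
apply: (@trig_mvt (fun b => cos b - 1) (fun x => - sin x) id b).
- by move=> x; have := is_deriveB (is_derive_cos x) (is_derive_cst (1 : R) x (1 : R)); rewrite subr0.
- by rewrite cos0 subrr.
- by move=> x; rewrite cosN.
- move=> x y /andP[x0 xy]; rewrite normrN; apply: le_trans (sin_le_norm x) _.
  by rewrite ger0_norm.
Qed.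

Lemma cos_sub1_norm b : `|cos b - 1| <= `|b|.
Proof.
have := @trig_mvt (fun b => cos b - 1) (fun x => - sin x) (fun=> 1) b; rewrite mul1r; apply.
- by move=> x; have := is_deriveB (is_derive_cos x) (is_derive_cst (1 : R) x (1 : R)); rewrite subr0.
- by rewrite cos0 subrr.
- by move=> x; rewrite cosN.
- by move=> x y _; rewrite normrN; exact: sin_max.
Qed.

Let dsin x : is_derive x (1 : R) (fun b => sin b - b) (cos x - 1).
Proof. exact: (is_deriveB (is_derive_sin x) (is_derive_id x (1 : R))). Qed.

Let sinNb x : `|sin (- x) - - x| = `|sin x - x|.
Proof. by rewrite sinN -opprD normrN. Qed.

Lemma sin_sub b : `|sin b - b| <= `|b| ^+ 2.
Proof.
apply: (@trig_mvt (fun b => sin b - b) (fun x => cos x - 1) id b) => //; first by rewrite sin0 subr0.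
move=> x y /andP[x0 xy]; apply: le_trans (cos_sub1_norm x) _.
by rewrite ger0_norm.
Qed.

Lemma sin_sub3 b : `|sin b - b| <= `|b| ^+ 3.
Proof.
rewrite exprSr; apply: (@trig_mvt (fun b => sin b - b) (fun x => cos x - 1) (fun y => y ^+ 2) b) => //.
  by rewrite sin0 subr0.
move=> x y /andP[x0 xy]; apply: le_trans (cos_sub1 x) _.
by rewrite ger0_norm // lerXn2r ?nnegrE // (le_trans x0).
Qed.

Lemma cos_sub3 b : `|cos b - (1 - b ^+ 2 / 2)| <= `|b| ^+ 3.
Proof.
rewrite [`|b| ^+ 3]exprSr; apply: (@trig_mvt (fun b => cos b - (1 - b ^+ 2 / 2)) (fun x => - (sin x - x)) (fun y => y ^+ 2) b).
- move=> x.
  have d1 : is_derive x (1 : R) (fun b : R => b ^+ 2 / 2) x.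
    have := is_deriveZ (2^-1) (is_deriveX 2 (is_derive_id x (1 : R))).
    rewrite [X in is_derive _ _ X _](_ : _ = fun b : R => b ^+ 2 / 2); last first.
      by apply/funext => y; rewrite !fctE /GRing.scale /= mulrC.
    by rewrite /GRing.scale /= expr1 mulr1 mulrA mulVf ?mul1r.
  have -> : - (sin x - x) = - sin x - (0 - x) by ring.
  exact: (is_deriveB (is_derive_cos x) (is_deriveB (is_derive_cst (1 : R) x (1 : R)) d1)).
- by rewrite cos0 expr0n mul0r subr0 subrr.
- by move=> x; rewrite cosN sqrrN.
- move=> x y /andP[x0 xy]; rewrite normrN; apply: le_trans (sin_sub x) _.
  by rewrite ger0_norm // lerXn2r ?nnegrE // (le_trans x0).
Qed.

Lemma cosD_sub a b : `|cos (a + b) - cos a + b * sin a| <= 2 * `|b| ^+ 2.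
Proof.
have -> : cos (a + b) - cos a + b * sin a = cos a * (cos b - 1) - sin a * (sin b - b) by rewrite cosD; ring.
apply: le_trans (ler_normB _ _) _; rewrite !normrM mulrDl !mul1r.
by apply: lerD; rewrite -[leRHS]mul1r ler_pM ?cos_max ?sin_max ?cos_sub1 ?sin_sub.
Qed.

Lemma sinD_sub a b : `|sin (a + b) - sin a - b * cos a| <= 2 * `|b| ^+ 2.
Proof.
have -> : sin (a + b) - sin a - b * cos a = sin a * (cos b - 1) + cos a * (sin b - b) by rewrite sinD; ring.
apply: le_trans (ler_normD _ _) _; rewrite !normrM mulrDl !mul1r.
by apply: lerD; rewrite -[leRHS]mul1r ler_pM ?cos_max ?sin_max ?cos_sub1 ?sin_sub.
Qed.

Lemma expR_sub1 b : `|expR b - 1 - b| <= b ^+ 2 * expR `|b|.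
Proof.
have h1 := expR_ge1Dx b; have h2 := expR_ge1Dx (- b).
have e0 := expR_gt0 b.
have h3 : (1 - b) * expR b <= 1.
  by rewrite -[leRHS](expRxMexpNx_1 b) mulrC ler_wpM2l // ltW.
rewrite ger0_norm; last by move: h1; lra.
have [b0|b0] := leP 0 b.
  rewrite (ger0_norm b0); apply: (@le_trans _ _ (b * (expR b - 1))); first by move: h3; lra.
  rewrite expr2 -mulrA ler_wpM2l //; move: h3; lra.
have h4 : 1 <= expR `|b| by rewrite -expR0 ler_expR.
apply: (@le_trans _ _ (b ^+ 2)); last by rewrite ler_peMr // sqr_ge0.
apply: (@le_trans _ _ (b * (expR b - 1))); first by move: h3; lra.
rewrite expr2; apply: ler_wnM2l; [exact: ltW | by move: h1; lra].
Qed.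

Lemma quadratic_derive (f : R -> R) x a K : (forall h, `|f (x + h) - f x - h * a| <= K * `|h| ^+ 2) ->
  is_derive x (1 : R) f a.
Proof.
move=> H.
suff c : (fun h => h^-1 *: ((f \o shift x) (h *: (1 : R)) - f x)) @ 0^' --> a.
  by apply: DeriveDef; [apply/cvg_ex; exists a | exact: cvg_lim c].
apply/cvgrPdist_le => e e0; near=> h.
have h0 : 0 < `|h| by rewrite normr_gt0; near: h; exact: nbhs_dnbhs_neq.
have hK : (`|K| + 1) * `|h| <= e.
  rewrite mulrC -ler_pdivlMr ?ltr_wpDl //; near: h; apply: dnbhs0_le; rewrite divr_gt0 // ltr_wpDl //.
rewrite /GRing.scale /= mulr1 distrC.
have -> : h^-1 * (f (h + x) - f x) - a = h^-1 * (f (x + h) - f x - h * a).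
  by rewrite [h + x]addrC; field; rewrite -normr_gt0.
rewrite normrM normfV ler_pdivrMl //; apply: le_trans (H h) _.
apply: (@le_trans _ _ ((`|K| + 1) * `|h| ^+ 2)).
  by rewrite ler_wpM2r ?exprn_ge0 // (le_trans (ler_norm K)) // lerDl.
by rewrite expr2 mulrA [leRHS]mulrC ler_wpM2r // ltW.
Unshelve. all: by end_near. Qed.

Lemma quadratic_zero (d K : R) : (forall h, `|h| <= 1 -> `|h * d| <= K * `|h| ^+ 2) -> d = 0.
Proof.
move=> H; apply/eqP; rewrite -normr_le0; apply/ler_addgt0Pr => e e0; rewrite add0r.
pose h := Num.min 1 (e / (`|K| + 1)).
have K0 : 0 < `|K| + 1 by rewrite ltr_wpDl.
have h0 : 0 < h by rewrite lt_min ltr01 divr_gt0.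
have h1 : `|h| <= 1 by rewrite gtr0_norm // ge_min lexx.
have := H h h1; rewrite normrM (gtr0_norm h0) expr2 mulrCA ler_pM2l // => /le_trans; apply.
apply: (@le_trans _ _ ((`|K| + 1) * h)).
  by rewrite ler_wpM2r // ?ltW // (le_lt_trans (ler_norm K)) // ltrDl.
by rewrite mulrC -ler_pdivlMr // ge_min lexx orbT.
Qed.

End trigonometry.

(** * Characteristic function of the normal law *)

Section gaussian_characteristic.
Context {R : realType}.
Local Notation gam := (@gauss R 0 1).
Implicit Types (f : R -> R) (c h : R).

Lemma continuous_affine (a c : R) : continuous (fun x : R => a * x + c).
Proof. by move=> z; apply: cvgD; [apply: cvgM; [exact: cvg_cst | exact: cvg_id] | exact: cvg_cst]. Qed.

Lemma continuous_cos_affine (a c : R) : continuous (fun x : R => cos (a * x + c)).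
Proof.
move=> z; apply: (@continuous_comp _ _ _ (fun x : R => a * x + c) cos); first exact: continuous_affine.
exact: continuous_cos.
Qed.

Lemma continuous_sin_affine (a c : R) : continuous (fun x : R => sin (a * x + c)).
Proof.
move=> z; apply: (@continuous_comp _ _ _ (fun x : R => a * x + c) sin); first exact: continuous_affine.
exact: continuous_sin.
Qed.

Lemma continuous_xsin (a c : R) : continuous (fun x : R => x * sin (a * x + c)).
Proof. move=> z; apply: (@continuousM _ _ id (fun x : R => sin (a * x + c))); [exact: cvg_id | exact: continuous_sin_affine]. Qed.

Lemma bounded_cos_affine (a c : R) : exists M, forall x : R, `|cos (a * x + c)| <= M.
Proof. by exists 1 => x; exact: cos_max. Qed.

Lemma bounded_sin_affine (a c : R) : exists M, forall x : R, `|sin (a * x + c)| <= M.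
Proof. by exists 1 => x; exact: sin_max. Qed.

Lemma norm_le_exp (x : R) : `|x| <= expR (2 * `|x|).
Proof.
have h := expR_ge1Dx (2 * `|x|); apply: le_trans h; have := normr_ge0 x; move: `|x| => y; lra.
Qed.

Lemma sqr_le_exp (x : R) : x ^+ 2 <= expR (2 * `|x|).
Proof.
rewrite mulr_natl -[X in expR X]mulr_natl expRM_natl -real_normK ?num_real //.
rewrite lerXn2r ?nnegrE ?expR_ge0 // (le_trans _ (expR_ge1Dx _)) // lerDr ler01 //.
Qed.

(** The standard normal density shifted by h is the standard density times exp (x h - h^2 / 2). *)
Lemma cameron_martin f h : continuous f -> (exists M, forall x, `|f x| <= M) ->
  gam.-integrable setT (EFin \o (fun x => f x * expR (x * h - h ^+ 2 / 2))) /\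
  \int[gam]_x f (h + x) = \int[gam]_x (f x * expR (x * h - h ^+ 2 / 2)).
Proof.
move=> cf [M HM].
have ce : continuous (fun x : R => expR (x * h - h ^+ 2 / 2)).
  move=> x; apply: (@continuous_comp _ _ _ (fun x : R => x * h - h ^+ 2 / 2) expR); last exact: continuous_expR.
  by apply: cvgB; [apply: cvgM; [exact: cvg_id | exact: cvg_cst] | exact: cvg_cst].
have i : gam.-integrable setT (EFin \o (fun x => f x * expR (x * h - h ^+ 2 / 2))).
  have ic : gam.-integrable setT (EFin \o (fun x => M * expR (h * x))).
    by have := integrableZl measurableT M (exp_integrable h); congr (gam.-integrable _ _); apply/funext.
  apply: (le_integrable measurableT _ _ ic).
    apply/measurable_EFinP; apply: continuous_measurable_fun => x.
    by apply: (@continuousM _ _ f (fun x : R => expR (x * h - h ^+ 2 / 2))); [exact: cf | exact: ce].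
  move=> x _; rewrite /= lee_fin !normrM.
  apply: ler_pM => //; first by rewrite (le_trans (HM x)) // ler_norm.
  rewrite !ger0_norm ?expR_ge0 // ler_expR mulrC lerBlDr lerDl divr_ge0 // sqr_ge0 //.
split=> //.
have e := @normal_scale R h 1 f ltr01 cf (ex_intro _ M HM).
have -> : \int[gam]_x f (h + x) = \int[gam]_z f (h + 1 * z).
  by apply: eq_Rintegral => z _; rewrite mul1r.
rewrite -e (normal_density h (oner_neq0 R) (cont_bm cf (ex_intro _ M HM))).
rewrite (normal_density_integrable (oner_neq0 R) i).
by apply: eq_Rintegral => x _; rewrite (normal_pdf_shift h x) mulrA mulrAC.
Qed.

(** The phase c lets one computation serve cosine and sine: c = - pi / 2 turns one into the
    other. *)
Definition gcos c (t : R) : R := \int[gam]_x cos (t * x + c).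
Definition gxsin c (t : R) : R := \int[gam]_x (x * sin (t * x + c)).

Lemma integrable_cos_affine t c : gam.-integrable setT (EFin \o (fun x => cos (t * x + c))).
Proof. by apply: bm_integrable; apply: cont_bm; [exact: continuous_cos_affine | exact: bounded_cos_affine]. Qed.

Lemma integrable_sin_affine t c : gam.-integrable setT (EFin \o (fun x => sin (t * x + c))).
Proof. by apply: bm_integrable; apply: cont_bm; [exact: continuous_sin_affine | exact: bounded_sin_affine]. Qed.

Lemma integrable_xsin t c : gam.-integrable setT (EFin \o (fun x => x * sin (t * x + c))).
Proof.
have [|i _ //] := @dominated_integrable_gam R (fun x => x * sin (t * x + c)) 1 (@continuous_xsin t c) _.
move=> x; rewrite mul1r normrM -[leRHS]mulr1 ler_pM ?sin_max //; exact: norm_le_exp.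
Qed.

Lemma int_scale_xsin h t c : \int[gam]_x (h * (x * sin (t * x + c))) = h * gxsin c t.
Proof. by rewrite /gxsin -RintegralZl //; exact: integrable_xsin. Qed.

Lemma gcos_derive c t : is_derive t (1 : R) (gcos c) (- gxsin c t).
Proof.
apply: (@quadratic_derive R (gcos c) t (- gxsin c t) (2 * \int[gam]_x expR (2 * `|x|))) => h.
pose F x := cos ((t + h) * x + c) - cos (t * x + c) + h * (x * sin (t * x + c)).
have cF : continuous F.
  move=> x; apply: (@continuousD _ _ _ (fun x => cos ((t + h) * x + c) - cos (t * x + c)) (fun x => h * (x * sin (t * x + c)))).
    by apply: (@continuousB _ _ _ (fun x => cos ((t + h) * x + c)) (fun x => cos (t * x + c))); exact: continuous_cos_affine.
  by apply: (@continuousM R R (fun _ : R => h) (fun x : R => x * sin (t * x + c))); [exact: cst_continuous | exact: continuous_xsin].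
have [|_] := @dominated_integrable_gam R F (2 * `|h| ^+ 2) cF.
  move=> x; rewrite /F mulrDl mulrA.
  have -> : t * x + h * x + c = (t * x + c) + h * x by ring.
  apply: le_trans (cosD_sub _ _) _; rewrite -mulrA ler_wpM2l // normrM exprMn ler_wpM2l ?exprn_ge0 //.
  by rewrite real_normK ?num_real // sqr_le_exp.
have i1 : gam.-integrable setT (EFin \o (fun x => cos ((t + h) * x + c) - cos (t * x + c))).
  by have := integrableB measurableT (integrable_cos_affine (t + h) c) (integrable_cos_affine t c).
have i2 : gam.-integrable setT (EFin \o (fun x => h * (x * sin (t * x + c)))).
  by have := integrableZl measurableT h (integrable_xsin t c).
have -> : \int[gam]_x F x = gcos c (t + h) - gcos c t + h * gxsin c t.
  etransitivity; first exact: (RintegralD measurableT i1 i2).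
  by congr (_ + _); [exact: (RintegralB measurableT (integrable_cos_affine (t + h) c) (integrable_cos_affine t c)) | exact: int_scale_xsin].
by rewrite mulrN opprK mulrAC.
Qed.

(* Gaussian integration by parts: the first order terms in h of the two sides of
   cameron_martin for sin (t x + c). *)
Lemma gxsinE c t : gxsin c t = t * gcos c t.
Proof.
apply/esym/eqP; rewrite -subr_eq0; apply/eqP.
pose E := \int[gam]_x expR (2 * `|x|).
apply: (@quadratic_zero R _ (2 * `|t| ^+ 2 + (4 * expR 1 + 1) * E)) => h h1.
have [i cm] := @cameron_martin (fun x => sin (t * x + c)) h (@continuous_sin_affine t c) (bounded_sin_affine t c).
pose S := \int[gam]_x sin (t * x + c).
have cs : continuous (fun x => sin (t * (h + x) + c)).
  move=> x; apply: (@continuous_comp _ _ _ (fun x : R => h + x) (fun x => sin (t * x + c))); last exact: continuous_sin_affine.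
  by apply: cvgD; [exact: cvg_cst | exact: cvg_id].
have ih : gam.-integrable setT (EFin \o (fun x => sin (t * (h + x) + c))).
  by apply: bm_integrable; apply: cont_bm => //; exists 1 => x; exact: sin_max.
have e1 : `|\int[gam]_x sin (t * (h + x) + c) - S - h * (t * gcos c t)| <= 2 * `|t| ^+ 2 * `|h| ^+ 2.
  have b1 : bm ((fun x => sin (t * (h + x) + c)) : measurableTypeR R -> R).
    by apply: cont_bm => //; exists 1 => x; exact: sin_max.
  have b2 : bm ((fun x => sin (t * x + c)) : measurableTypeR R -> R).
    by apply: cont_bm; [exact: continuous_sin_affine | exact: bounded_sin_affine].
  have b3 : bm ((fun x => cos (t * x + c)) : measurableTypeR R -> R).
    by apply: cont_bm; [exact: continuous_cos_affine | exact: bounded_cos_affine].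
  rewrite mulrA -(bm_intZ gam _ b3) /S -(bm_intB gam b1 b2) -(bm_intB gam (bmB b1 b2) (bmZ _ b3)).
  apply: bm_int_norm; first exact: (bmB (bmB b1 b2) (bmZ _ b3)).
  move=> x; have -> : t * (h + x) + c = (t * x + c) + h * t by ring.
  apply: le_trans (sinD_sub _ _) _; by rewrite normrM exprMn [`|h| ^+ 2 * _]mulrC mulrA.
have e2 : `|\int[gam]_x (sin (t * x + c) * expR (x * h - h ^+ 2 / 2)) - S - h * gxsin c t| <= (4 * expR 1 + 1) * `|h| ^+ 2 * E.
  pose F x := sin (t * x + c) * expR (x * h - h ^+ 2 / 2) - sin (t * x + c) - h * (x * sin (t * x + c)).
  have cF : continuous F.
    move=> x; apply: (@continuousB _ _ _ (fun x => sin (t * x + c) * expR (x * h - h ^+ 2 / 2) - sin (t * x + c)) (fun x => h * (x * sin (t * x + c)))).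
      apply: (@continuousB _ _ _ (fun x => sin (t * x + c) * expR (x * h - h ^+ 2 / 2)) (fun x => sin (t * x + c))); last exact: continuous_sin_affine.
      apply: (@continuousM _ _ (fun x => sin (t * x + c)) (fun x => expR (x * h - h ^+ 2 / 2))); first exact: continuous_sin_affine.
      apply: (@continuous_comp _ _ _ (fun x : R => x * h - h ^+ 2 / 2) expR); last exact: continuous_expR.
      by apply: cvgB; [apply: cvgM; [exact: cvg_id | exact: cvg_cst] | exact: cvg_cst].
    by apply: (@continuousM R R (fun _ : R => h) (fun x : R => x * sin (t * x + c))); [exact: cst_continuous | exact: continuous_xsin].
  have [|_] := @dominated_integrable_gam R F ((4 * expR 1 + 1) * `|h| ^+ 2) cF.
    move=> x; pose y := x * h - h ^+ 2 / 2.
    have -> : F x = sin (t * x + c) * ((expR y - 1 - y) - h ^+ 2 / 2) by rewrite /F /y; field.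
    rewrite normrM; apply: (@le_trans _ _ (1 * ((4 * expR 1 + 1) * `|h| ^+ 2 * expR (2 * `|x|)))); last by rewrite mul1r.
    apply: ler_pM => //; first exact: sin_max.
    apply: le_trans (ler_normB _ _) _.
    have ex0 : 1 <= expR (2 * `|x|) by rewrite -expR0 ler_expR mulr_ge0.
    rewrite [X in _ <= X * _]mulrDl mulrDl; apply: lerD; last first.
      rewrite mul1r real_normK ?num_real // ger0_norm ?divr_ge0 ?sqr_ge0 //.
      apply: (@le_trans _ _ (h ^+ 2)); first by have := sqr_ge0 h; move: (h ^+ 2) => u; lra.
      by rewrite ler_peMr // sqr_ge0.
    apply: le_trans (expR_sub1 y) _.
    have yh : `|y| <= `|h| * (`|x| + 1).
      rewrite /y; have -> : x * h - h ^+ 2 / 2 = h * (x - h / 2) by field.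
      rewrite normrM ler_wpM2l //; apply: le_trans (ler_normB _ _) _; rewrite lerD2l normrM.
      by rewrite [`|2^-1|]ger0_norm ?invr_ge0 //; move: h1; move: `|h| => u; lra.
    have y1 : `|y| <= `|x| + 1.
      by apply: le_trans yh _; rewrite -[leRHS]mul1r ler_wpM2r // addr_ge0.
    (* Uses |x| + 1 <= 2 (1 + |x| / 2) <= 2 exp (|x| / 2). *)
    have y2 : y ^+ 2 <= `|h| ^+ 2 * (4 * expR `|x|).
      rewrite -real_normK ?num_real //; apply: (@le_trans _ _ ((`|h| * (`|x| + 1)) ^+ 2)).
        by rewrite lerXn2r ?nnegrE ?mulr_ge0 ?addr_ge0.
      rewrite exprMn ler_wpM2l ?exprn_ge0 //.
      have k := expR_ge1Dx (`|x| / 2).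
      have k2 : expR `|x| = expR (`|x| / 2) ^+ 2.
        by rewrite -expRM_natl; congr expR; field.
      rewrite k2; have x0 := normr_ge0 x.
      apply: (@le_trans _ _ (4 * (1 + `|x| / 2) ^+ 2)).
        have -> : (4 : R) = 2 ^+ 2 by rewrite -natrX.
        rewrite -exprMn lerXn2r ?nnegrE //; move: x0; lra.
      rewrite ler_wpM2l // lerXn2r ?nnegrE ?expR_ge0 //; move: x0; lra.
    apply: (@le_trans _ _ (`|h| ^+ 2 * (4 * expR `|x|) * expR (`|x| + 1))).
      by apply: ler_pM; rewrite ?sqr_ge0 ?expR_ge0 // ler_expR.
    rewrite [expR (_ + 1)]expRD mulr_natl expRM_natl.
    by rewrite le_eqVlt; apply/orP; left; apply/eqP; ring.
  have i1 : gam.-integrable setT (EFin \o (fun x => sin (t * x + c) * expR (x * h - h ^+ 2 / 2) - sin (t * x + c))).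
    by have := integrableB measurableT i (integrable_sin_affine t c).
  have i2 : gam.-integrable setT (EFin \o (fun x => h * (x * sin (t * x + c)))).
    by have := integrableZl measurableT h (integrable_xsin t c).
  suff -> : \int[gam]_x F x = \int[gam]_x (sin (t * x + c) * expR (x * h - h ^+ 2 / 2)) - S - h * gxsin c t by [].
  etransitivity; first exact: (RintegralB measurableT i1 i2).
  by congr (_ - _); [exact: (RintegralB measurableT i (integrable_sin_affine t c)) | exact: int_scale_xsin].
have -> : h * (t * gcos c t - gxsin c t) =
  (\int[gam]_x (sin (t * x + c) * expR (x * h - h ^+ 2 / 2)) - S - h * gxsin c t) -
  (\int[gam]_x sin (t * (h + x) + c) - S - h * (t * gcos c t)) by rewrite -cm; ring.
apply: le_trans (ler_normB _ _) _; rewrite addrC mulrDl; apply: lerD => //.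
by rewrite [X in _ <= X]mulrAC.
Qed.

(** By [gcos_derive] and [gxsinE], gcos solves u' = - t u, so u (t) exp (t^2 / 2) is constant. *)
Lemma gcosE c t : gcos c t = cos c * expR (- (t ^+ 2 / 2)).
Proof.
pose V (t : R) := gcos c t * expR (t ^+ 2 / 2).
have d1 (x : R) : is_derive x (1 : R) (fun b : R => b ^+ 2 / 2) x.
  have := is_deriveZ (2^-1) (is_deriveX 2 (is_derive_id x (1 : R))).
  rewrite [X in is_derive _ _ X _](_ : _ = fun b : R => b ^+ 2 / 2); last first.
    by apply/funext => y; rewrite !fctE /GRing.scale /= mulrC.
  by rewrite /GRing.scale /= expr1 mulr1 mulrA mulVf ?mul1r.
have d2 (x : R) : is_derive x (1 : R) (fun b : R => expR (b ^+ 2 / 2)) (x * expR (x ^+ 2 / 2)).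
  have := @is_derive1_comp R expR (fun b : R => b ^+ 2 / 2) x _ _ (is_derive_expR _) (d1 x).
  by rewrite mulrC.
have dV (x : R) : is_derive x (1 : R) V 0.
  have := is_deriveM (gcos_derive c x) (d2 x).
  rewrite [X in is_derive _ _ _ X](_ : _ = 0) //.
  by rewrite /GRing.scale /= gxsinE; ring.
have := @is_derive_0_is_cst R V t 0 dV.
rewrite /V expr0n mul0r expR0 mulr1 => e.
have -> : cos c = gcos c 0.
  rewrite /gcos -[LHS](prob_int_cst gam); apply: eq_Rintegral => x _; by rewrite mul0r add0r.
by rewrite -e -mulrA -expRD subrr expR0 mulr1.
Qed.

Lemma gauss_cos (s t : R) : 0 < s -> \int[gauss 0 s]_x cos (t * x) = expR (- ((s * t) ^+ 2 / 2)).
Proof.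
move=> s0; have H := @normal_scale R 0 s (fun x => cos (t * x)) s0 _ _.
rewrite H; last 2 first.
- by move=> x; have := @continuous_cos_affine t 0 x; congr continuous_at; apply/funext => y; rewrite addr0.
- by exists 1 => x; exact: cos_max.
rewrite -[RHS]mul1r -[X in X * _]cos0 -gcosE.
by apply: eq_Rintegral => x _; congr cos; ring.
Qed.

Lemma gauss_sin (s t : R) : 0 < s -> \int[gauss 0 s]_x sin (t * x) = 0.
Proof.
move=> s0; have H := @normal_scale R 0 s (fun x => sin (t * x)) s0 _ _.
rewrite H; last 2 first.
- by move=> x; have := @continuous_sin_affine t 0 x; congr continuous_at; apply/funext => y; rewrite addr0.
- by exists 1 => x; exact: sin_max.
transitivity (gcos (- (pi / 2)) (s * t)).
  by apply: eq_Rintegral => x _; rewrite cosBpihalf; congr sin; ring.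
by rewrite gcosE cosN cos_pihalf mul0r.
Qed.

End gaussian_characteristic.

Lemma uniform_continuity {R : realType} (f : R -> R) (rho e : R) : continuous f -> (forall u, rho < `|u| -> f u = 0) ->
  0 < e -> exists2 dl, 0 < dl & forall y z, `|z| < dl -> `|f (y + z) - f y| <= e.
Proof.
move=> cf f0 e0.
have /compact_near_coveringP cov := @segment_compact R (- (rho + 1)) (rho + 1).
have : \forall dl \near (0 : R)^'+, `[- (rho + 1), rho + 1]%classic `<=` (fun y => forall z, `|z| < dl -> `|f (y + z) - f y| <= e).
  apply: cov.
  move=> x _; have /cvgrPdist_lt /(_ (e / 2)) := cf x.
  rewrite divr_gt0 // => /(_ isT) /nbhs_ballP[dl /= dl0 H].
  have dl2 : 0 < dl / 2 by rewrite divr_gt0.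
  exists (ball x (dl / 2), [set i | i < dl / 2]) => /=.
    by split; [exact: nbhsx_ballx dl2 | exact: nbhs_right_lt].
  move=> [y i] /= [yx id] z zi.
  have h1 : `|f x - f y| < e / 2 by apply: H; apply: le_ball yx; move: dl0; lra.
  have h2 : `|f x - f (y + z)| < e / 2.
    apply: H; rewrite /ball /= opprD addrA; apply: le_lt_trans (ler_normB _ _) _.
    by rewrite [dl]splitr; apply: ltrD => //; exact: lt_trans id.
  have -> : f (y + z) - f y = (f x - f y) - (f x - f (y + z)) by ring.
  by apply: le_trans (ler_normB _ _) _; move: h1 h2; lra.
move=> near0; have [dl dl0 H] : exists2 dl : R, 0 < dl & `[- (rho + 1), rho + 1]%classic `<=` (fun y => forall z, `|z| < dl -> `|f (y + z) - f y| <= e).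
  near (0 : R)^'+ => dl; exists dl => //; near: dl; exact: near0.
exists (Num.min dl 1); first by rewrite lt_min dl0 ltr01.
move=> y z; rewrite lt_min => /andP[z1 z2].
have [yr|yr] := leP `|y| (rho + 1).
  by apply: H => //=; rewrite in_itv /= -ler_norml.
have fy : f y = 0 by apply: f0; move: yr; lra.
have fyz : f (y + z) = 0 by apply: f0; have := ler_normB (y + z) z; rewrite addrK; move: yr z2; lra.
by rewrite fy fyz subrr normr0 ltW.
Unshelve. all: by end_near. Qed.

(** * From characteristic functions to weak convergence *)

Section levy.
Context {R : realType} {dT : measure_display} {T : measurableType dT}.
Variables (Q : probability T R) (Y : nat -> T -> R) (G : probability (measurableTypeR R) R).
Hypothesis mY : forall n, measurable_fun setT (Y n).
Implicit Types f w : R -> R.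

Definition weak_at f := (fun n => \int[Q]_x f (Y n x)) @ \oo --> \int[G]_y f y.
Definition cbounded f := continuous f /\ exists M, forall x : R, `|f x| <= M.

Lemma cbounded_bm f : cbounded f -> bm (f : measurableTypeR R -> R).
Proof. by case=> cf Hf; exact: cont_bm. Qed.

Lemma cbounded_bmY f n : cbounded f -> bm (fun x => f (Y n x)).
Proof.
move=> /cbounded_bm[mf [M HM]]; split; last by exists M => x; exact: HM.
by apply: (measurableT_comp mf); exact: mY.
Qed.

(** The error w only needs a small integral under the limit law. Its own convergence transfers this
    to the laws of Y n. *)
Lemma weak_approx f : cbounded f ->
  (forall e, 0 < e -> exists p w, [/\ cbounded p, cbounded w, weak_at p, weak_at w &
     (forall x, `|f x - p x| <= w x) /\ \int[G]_y w y <= e]) -> weak_at f.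
Proof.
move=> bf H; apply/cvgrPdist_le => e e0.
have [p [w [bp bw /cvgrPdist_le cp /cvgrPdist_le cw [fpw we]]]] := H (e / 4) (divr_gt0 e0 (ltr0n _ 4)).
have e40 : 0 < e / 4 by rewrite divr_gt0.
near=> n.
have h1 : `|\int[G]_y p y - \int[Q]_x p (Y n x)| <= e / 4 by near: n; exact: cp.
have h2 : `|\int[G]_y w y - \int[Q]_x w (Y n x)| <= e / 4 by near: n; exact: cw.
have b1 : `|\int[Q]_x f (Y n x) - \int[Q]_x p (Y n x)| <= \int[Q]_x w (Y n x).
  have bf' := cbounded_bmY n bf; have bp' := cbounded_bmY n bp; have bw' := cbounded_bmY n bw.
  rewrite -bm_intB //; apply: le_trans (le_normr_Rintegral _ (bm_integrable Q (bmB bf' bp'))) _ => //.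
  apply: bm_int_le => //.
  case: (bmB bf' bp') => m [M HM]; split; first exact: measurableT_comp.
  by exists M => x; rewrite normr_id.
have b2 : `|\int[G]_y f y - \int[G]_y p y| <= \int[G]_y w y.
  have bf' := cbounded_bm bf; have bp' := cbounded_bm bp; have bw' := cbounded_bm bw.
  rewrite -bm_intB //; apply: le_trans (le_normr_Rintegral _ (bm_integrable G (bmB bf' bp'))) _ => //.
  apply: bm_int_le => //.
  case: (bmB bf' bp') => m [M HM]; split; first exact: measurableT_comp.
  by exists M => x; rewrite normr_id.
move: h1 h2 b1 b2 we; rewrite !ler_norml.
move=> /andP[? ?] /andP[? ?] /andP[? ?] /andP[? ?] ?.
by apply/andP; split; lra.
Unshelve. all: by end_near. Qed.

Lemma weak_cst (a : R) : weak_at (fun=> a).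
Proof. by rewrite /weak_at !prob_int_cst; exact: cvg_cst. Qed.

Lemma weak_lin f p (a : R) : cbounded f -> cbounded p -> weak_at f -> weak_at p -> weak_at (fun x => a * f x + p x).
Proof.
move=> bf bp cf cp; rewrite /weak_at.
have -> : (fun n => \int[Q]_x (a * f (Y n x) + p (Y n x))) = (fun n => a * \int[Q]_x f (Y n x) + \int[Q]_x p (Y n x)).
  apply/funext => n; have bf' := cbounded_bmY n bf; have bp' := cbounded_bmY n bp.
  by rewrite bm_intD //; [rewrite bm_intZ | exact: bmZ].
have bf' := cbounded_bm bf; have bp' := cbounded_bm bp.
rewrite bm_intD //; [rewrite bm_intZ // | exact: bmZ].
by apply: cvgD => //; apply: cvgM => //; exact: cvg_cst.
Qed.

(** Fubini puts the integral over u outside, and bounded convergence in u uses the convergence for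
    each F u. *)
Lemma weak_mix (H : probability (measurableTypeR R) R) (F : R -> R -> R) (ps : R -> R) :
  bm (fun z : measurableTypeR R * measurableTypeR R => F z.1 z.2) ->
  bm (ps : measurableTypeR R -> R) ->
  (forall u, weak_at (F u)) -> weak_at (fun y => \int[H]_u (ps u * F u y)).
Proof.
move=> bF bps wF; rewrite /weak_at.
have bFG : bm (fun z : measurableTypeR R * measurableTypeR R => ps z.1 * F z.1 z.2).
  apply: bmM => //; case: bps => mp [M HM]; split; last by exists M.
  exact: (measurableT_comp mp measurable_fst).
have bFQ n : bm (fun z : measurableTypeR R * T => ps z.1 * F z.1 (Y n z.2)).
  case: bFG => m [M HM]; split; last by exists M => z; exact: (HM (z.1, Y n z.2)).
  have mYs : measurable_fun setT (fun z : measurableTypeR R * T => Y n z.2).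
    by apply: (measurableT_comp (mY n)); exact: measurable_snd.
  exact: (measurableT_comp m (measurable_fun_pair measurable_fst mYs)).
have e1 n : \int[Q]_x \int[H]_u (ps u * F u (Y n x)) = \int[H]_u \int[Q]_x (ps u * F u (Y n x)).
  by rewrite -(bm_fubini H Q (bFQ n)).
have e2 : \int[G]_y \int[H]_u (ps u * F u y) = \int[H]_u \int[G]_y (ps u * F u y).
  by rewrite -(bm_fubini H G bFG).
rewrite e2; under eq_fun do rewrite e1.
case: bFG => mFG [M HM].
apply: (@bounded_convergence _ _ _ H (fun n u => \int[Q]_x (ps u * F u (Y n x))) (fun u => \int[G]_y (ps u * F u y)) M).
- by move=> n; have [] := bm_fubini1 H Q (bFQ n).
- by have [] := bm_fubini1 H G (conj mFG (ex_intro _ M HM)).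
- move=> n u; apply: bm_int_norm; first exact: (bm_section1 (bFQ n) u).
  by move=> x; exact: (HM (u, Y n x)).
- apply: aeW => u /=.
  have bu : bm (fun y : measurableTypeR R => F u y) by exact: (bm_section1 bF u).
  have bun n : bm (fun x => F u (Y n x)).
    by case: bu => m [K HK]; split; [exact: (measurableT_comp m (mY n)) | exists K => x; exact: HK].
  rewrite bm_intZ //; under eq_fun do rewrite bm_intZ //.
  by apply: cvgM; [exact: cvg_cst | exact: wF].
Qed.

Hypothesis charC : forall t, weak_at (fun y => cos (t * y)).
Hypothesis charS : forall t, weak_at (fun y => sin (t * y)).

(** A Gaussian in y is the average of cos (t (y - a)) over t with normal law of standard deviation
    s, so [weak_mix] reduces it to the hypotheses on sine and cosine. *)
Lemma weak_gauss (a s : R) : 0 < s -> weak_at (fun y => expR (- ((s * (y - a)) ^+ 2 / 2))).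
Proof.
move=> s0; pose F (t y : R) := cos (t * y + - (t * a)).
have cb t : cbounded (fun y : R => cos (t * y)).
  split; last by exists 1 => x; exact: cos_max.
  by move=> x; have := @continuous_cos_affine R t 0 x; congr continuous_at; apply/funext => y; rewrite addr0.
have sb t : cbounded (fun y : R => sin (t * y)).
  split; last by exists 1 => x; exact: sin_max.
  by move=> x; have := @continuous_sin_affine R t 0 x; congr continuous_at; apply/funext => y; rewrite addr0.
have sbZ t b : cbounded (fun y : R => b * sin (t * y)).
  have [c1 [M HM]] := sb t; split; first by move=> x; apply: (@continuousM R R (fun _ : R => b)); [exact: cst_continuous | exact: c1].
  by exists (`|b| * M) => x; rewrite normrM ler_wpM2l.
have wF t : weak_at (F t).
  have -> : F t = (fun y => cos (t * a) * cos (t * y) + (sin (t * a) * sin (t * y) + 0)).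
    by apply/funext => y; rewrite /F cosD cosN sinN; ring.
  have b0 : cbounded (fun _ : R => 0 : R) by split; [exact: cst_continuous | exists 0 => x; rewrite normr0].
  apply: weak_lin => //; last by apply: weak_lin => //; exact: weak_cst.
  have := sbZ t (sin (t * a)).
  by rewrite (_ : (fun y => sin (t * a) * sin (t * y)) = (fun y => sin (t * a) * sin (t * y) + 0)) //; apply/funext => y; rewrite addr0.
have bF : bm (fun z : measurableTypeR R * measurableTypeR R => F z.1 z.2).
  split; last by exists 1 => z; exact: cos_max.
  apply: measurableT_comp; first exact: continuous_measurable_fun (@continuous_cos R).
  apply: measurable_funD; first by apply: measurable_funM; [exact: measurable_fst | exact: measurable_snd].
  apply: measurableT_comp => //; apply: measurable_funM => //; exact: measurable_fst.
have := @weak_mix (gauss 0 s) F (fun=> 1) bF (bm_cst 1) wF.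
congr weak_at; apply/funext => y; rewrite -(gauss_cos (y - a) s0).
by apply: eq_Rintegral => t _; rewrite mul1r /F; congr cos; ring.
Qed.

(** f is uniformly close to its Gaussian smoothing p. Written as an integral over the centre u, p is
    a mixture of the Gaussians of [weak_gauss], so [weak_mix] applies to it. *)
Lemma weak_compact f (rho : R) : cbounded f -> (forall u, rho < `|u| -> f u = 0) -> weak_at f.
Proof.
move=> bf f0; have [cf [M HM]] := bf; apply: weak_approx => // e e0.
pose E := \int[gauss (0 : R) 1]_x expR (2 * `|x|).
have E1 : 1 <= E.
  have [|_] := @dominated_integrable_gam R (fun=> 1) 1 (@cst_continuous _ _ _).
    by move=> x; rewrite mul1r normr1 -expR0 ler_expR mulr_ge0.
  by rewrite prob_int_cst normr1 mul1r.
have E0 : 0 < E by exact: lt_le_trans ltr01 E1.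
pose e' := e / (2 * E).
have e'0 : 0 < e' by rewrite divr_gt0 // mulr_gt0.
have [dl dl0 Hdl] := uniform_continuity cf f0 e'0.
have M0 : 0 <= M by exact: le_trans (HM 0).
(* Where |h z| >= dl, the trivial bound 2 M is at most 2 M (h / dl)^2 z^2, hence at most e' exp (2
   |z|); where |h z| < dl, uniform continuity gives e'. *)
have [h h0 hdl] : exists2 h, 0 < h & 2 * M * (h / dl) ^+ 2 <= e'.
  have [k k0 hk] : exists2 k, 0 < k & 2 * M * k ^+ 2 <= e'.
    exists (Num.min 1 (e' / (2 * M + 1))); first by rewrite lt_min ltr01 divr_gt0 // ltr_wpDl // mulr_ge0.
    set k := Num.min _ _.
    have k0 : 0 < k by rewrite lt_min ltr01 divr_gt0 // ltr_wpDl // mulr_ge0.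
    have k1 : k <= 1 by rewrite ge_min lexx.
    have ke : k * (2 * M + 1) <= e' by rewrite -ler_pdivlMr ?ltr_wpDl ?mulr_ge0 // ge_min lexx orbT.
    apply: le_trans ke; rewrite expr2 mulrCA ler_pM2l //.
    by apply: (@le_trans _ _ (2 * M)); [rewrite ler_piMr // mulr_ge0 | rewrite lerDl].
  by exists (k * dl); [rewrite mulr_gt0 | rewrite mulfK // lt0r_neq0].
pose p (y : R) := \int[gauss (0 : R) 1]_z f (y + h * z).
have hE (y : R) : `|f y - p y| <= e.
  have cF : continuous (fun z => f y - f (y + h * z)).
    move=> z; apply: (@continuousB _ _ _ (fun _ : R => f y) (fun z => f (y + h * z))); first exact: cst_continuous.
    apply: (@continuous_comp _ _ _ (fun z : R => y + h * z) f); last exact: cf.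
    by apply: cvgD; [exact: cvg_cst | apply: cvgM; [exact: cvg_cst | exact: cvg_id]].
  have [|_] := @dominated_integrable_gam R _ (2 * e') cF.
    move=> z; rewrite distrC; have ex0 : 1 <= expR (2 * `|z|) by rewrite -expR0 ler_expR mulr_ge0.
    have [zd|zd] := ltP `|h * z| dl.
      apply: le_trans (Hdl _ _ zd) _; apply: (@le_trans _ _ (2 * e')); last by rewrite ler_peMr // mulr_ge0 // ltW.
      by move: e'0; lra.
    apply: (@le_trans _ _ (2 * M)).
      by apply: le_trans (ler_normB _ _) _; rewrite mulr_natl mulr2n; apply: lerD.
    apply: (@le_trans _ _ (2 * M * ((h / dl) ^+ 2 * z ^+ 2))).
      rewrite ler_peMr ?mulr_ge0 // -exprMn -real_normK ?num_real // expr_ge1 //.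
      by rewrite mulrAC normrM normfV (gtr0_norm dl0) ler_pdivlMr // mul1r.
    rewrite mulrA; apply: ler_pM; [|exact: sqr_ge0| |exact: sqr_le_exp].
      by apply: mulr_ge0; [exact: mulr_ge0 | exact: sqr_ge0].
    by apply: le_trans hdl _; move: e'0; lra.
  rewrite -/E.
  have bfy : bm ((fun z => f (y + h * z)) : measurableTypeR R -> R).
    apply: cont_bm; last by exists M => z; exact: HM.
    move=> z; apply: (@continuous_comp _ _ _ (fun z : R => y + h * z) f); last exact: cf.
    by apply: cvgD; [exact: cvg_cst | apply: cvgM; [exact: cvg_cst | exact: cvg_id]].
  rewrite (bm_intB (gauss 0 1) (bm_cst (f y)) bfy) prob_int_cst => /le_trans; apply.
  by rewrite /e' le_eqVlt; apply/orP; left; apply/eqP; field; rewrite lt0r_neq0.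
(* [weak_mix] integrates against a probability measure, so Lebesgue measure in u is replaced by the
   standard normal law and f divided by its density; ps stays bounded because f has compact
   support. *)
pose ps (u : R) := f u / normal_pdf 0 1 u * normal_peak h.
have pdf0 (u : R) : 0 < normal_pdf (0 : R) 1 u.
  rewrite normal_pdfE ?oner_eq0 //; apply: mulr_gt0; last exact: expR_gt0.
  by apply: normal_peak_gt0; rewrite oner_eq0.
have cps : continuous ps.
  move=> u; apply: (@continuousM R R (fun u => f u / normal_pdf 0 1 u) (fun _ : R => normal_peak h)); last exact: cst_continuous.
  apply: (@continuousM R R f (fun u : R => (normal_pdf 0 1 u)^-1)); first exact: cf.
  apply: cvgV; first exact: lt0r_neq0.
  by apply: continuous_normal_pdf; rewrite oner_eq0.
have bps : bm (ps : measurableTypeR R -> R).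
  apply: cont_bm => //.
  have [u _ Hu] : exists2 u, u \in `[- `|rho|, `|rho|] & forall t, t \in `[- `|rho|, `|rho|] -> `|ps t| <= `|ps u|.
    apply: (@EVT_max R (fun t => `|ps t|)); first by rewrite ge0_cp.
    by apply: continuous_subspaceT => t; apply: continuous_comp; [exact: cps | exact: norm_continuous].
  exists `|ps u| => t; have [tr|tr] := leP `|t| `|rho|; first by apply: Hu; rewrite in_itv /= -ler_norml.
  by rewrite {1}/ps f0 ?mul0r ?normr0 //; apply: le_lt_trans tr; exact: ler_norm.
pose F (u y : R) := expR (- ((h^-1 * (y - u)) ^+ 2 / 2)).
have wF u : weak_at (F u) by apply: weak_gauss; rewrite invr_gt0.
have bF : bm (fun z : measurableTypeR R * measurableTypeR R => F z.1 z.2).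
  split; last by exists 1 => z; rewrite ger0_norm ?expR_ge0 // -expR0 ler_expR oppr_le0 divr_ge0 // sqr_ge0.
  apply: measurableT_comp; first exact: measurable_expR.
  apply: measurableT_comp => //; apply: measurable_funM => //; apply: measurable_funX.
  apply: measurable_funM => //; apply: measurable_funB; [exact: measurable_snd | exact: measurable_fst].
have pE : p = (fun y => \int[gauss 0 1]_u (ps u * F u y)).
  apply/funext => y.
  rewrite /p -(normal_scale y h0 cf (ex_intro _ M HM)) (normal_density y (lt0r_neq0 h0) (cbounded_bm bf)).
  have b2 : bm ((fun u => ps u * F u y) : measurableTypeR R -> R) by exact: (bmM bps (bm_section2 bF y)).
  rewrite (normal_density 0 (oner_neq0 R) b2); apply: eq_Rintegral => u _.
  rewrite {1}normal_pdfE ?lt0r_neq0 //.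
  change (f u * (normal_peak h * normal_fun y h u) = ps u * F u y * normal_pdf 0 1 u).
  rewrite /ps.
  have -> : normal_fun y h u = F u y.
    by rewrite /normal_fun /F; congr expR; field; rewrite lt0r_neq0.
  by field; rewrite lt0r_neq0.
have wp : weak_at p by rewrite pE; exact: weak_mix.
have bp : cbounded p.
  split; last first.
    exists M => y; apply: bm_int_norm; last by move=> z; exact: HM.
    apply: cont_bm; last by exists M => z; exact: HM.
    move=> z; apply: (@continuous_comp _ _ _ (fun z : R => y + h * z) f); last exact: cf.
    by apply: cvgD; [exact: cvg_cst | apply: cvgM; [exact: cvg_cst | exact: cvg_id]].
  move=> y; apply/cvgrPdist_le => e1 e10.
  have [d1 d10 Hd1] := uniform_continuity cf f0 e10.
  near=> y'.
  have yy : `|y' - y| < d1 by rewrite distrC; near: y'; exists d1.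
  have bfy (y1 : R) : bm ((fun z => f (y1 + h * z)) : measurableTypeR R -> R).
    apply: cont_bm; last by exists M => z; exact: HM.
    move=> z; apply: (@continuous_comp _ _ _ (fun z : R => y1 + h * z) f); last exact: cf.
    by apply: cvgD; [exact: cvg_cst | apply: cvgM; [exact: cvg_cst | exact: cvg_id]].
  rewrite distrC -bm_intB //; apply: bm_int_norm; first exact: bmB.
  move=> z; have -> : y' + h * z = (y + h * z) + (y' - y) by ring.
  exact: Hd1.
exists p, (fun=> e); split=> //.
- by split; [exact: cst_continuous | exists `|e|].
- exact: weak_cst.
- by split=> //; rewrite prob_int_cst.
Unshelve. all: by end_near. Qed.

(** Cut off by chi k and apply [weak_compact] to f chi k and to chi k. No tightness has to be
    proved: the mass of Y n outside large intervals is 1 minus the integral of chi k, which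
    converges to its value under the limit law. *)
Theorem levy_continuity f : cbounded f -> weak_at f.
Proof.
move=> bf; have [cf [M HM]] := bf.
have M0 : 0 <= M by exact: le_trans (HM 0).
pose chi (k : nat) (y : R) := Num.max 0 (Num.min 1 (k.+1%:R - `|y|)).
have cchi k : continuous (chi k).
  move=> y; apply: (@continuous_max R R (fun _ : R => 0) (fun y : R => Num.min 1 (k.+1%:R - `|y|))); first exact: cst_continuous.
  apply: (@continuous_min R R (fun _ : R => 1) (fun y : R => k.+1%:R - `|y|)); first exact: cst_continuous.
  by apply: (@continuousB R R R (fun _ : R => k.+1%:R) (fun y : R => `|y|)); [exact: cst_continuous | exact: norm_continuous].
have chi0 k y : 0 <= chi k y by rewrite le_max lexx.
have chi1 k y : chi k y <= 1 by rewrite ge_max ler01 /= ge_min lexx.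
have chiz k y : k.+1%:R < `|y| -> chi k y = 0.
  by move=> h; apply/max_idPl; rewrite ge_min subr_le0 (ltW h) orbT.
have chiI k y : `|y| <= k%:R -> chi k y = 1.
  move=> h; rewrite /chi (min_idPl _); first by apply/max_idPr.
  by rewrite -natr1; move: h; lra.
have bchi k : cbounded (chi k) by split=> //; exists 1 => y; rewrite ger0_norm.
have bone : cbounded (fun _ : R => 1 : R) by split; [exact: cst_continuous | exists 1 => y; rewrite normr1].
have bfc k : cbounded (fun y => f y * chi k y).
  split; first by move=> y; apply: (@continuousM R R f (chi k)); [exact: cf | exact: cchi].
  by exists M => y; rewrite normrM -[leRHS]mulr1; apply: ler_pM => //; rewrite ger0_norm.
have lim : (fun k => \int[G]_y chi k y) @ \oo --> (1 : R).
  rewrite -[X in _ --> X](prob_int_cst G (1 : R)).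
  apply: (@bounded_convergence _ _ _ G _ (fun=> 1) 1).
  - by move=> k; have [] := cbounded_bm (bchi k).
  - exact: measurable_cst.
  - by move=> k y; rewrite ger0_norm.
  - apply: aeW => y /=; apply: cvg_near_cst; near=> k; apply: chiI; apply: ltW; near: k; exact: nbhs_infty_gtr.
apply: weak_approx => // e e0.
have M1 : 0 < M + 1 by rewrite ltr_wpDl.
have [k hk] : exists k, \int[G]_y chi k y >= 1 - e / (M + 1).
  have /cvgrPdist_le /(_ (e / (M + 1)) (divr_gt0 e0 M1)) [k _ H] := lim.
  exists k; have := H k (leqnn k); rewrite ler_norml => /andP[]; lra.
(* This is (M + 1) (1 - chi k), which dominates |f| (1 - chi k); M + 1 instead of M keeps the
   division above legitimate when M = 0. *)
pose w (y : R) := - (M + 1) * chi k y + (M + 1).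
have bw : cbounded w.
  split.
    move=> y; apply: (@continuousD R R R (fun y => - (M + 1) * chi k y) (fun _ : R => M + 1)); last exact: cst_continuous.
    by apply: (@continuousM R R (fun _ : R => - (M + 1)) (chi k)); [exact: cst_continuous | exact: cchi].
  exists (M + 1) => y; have h0 := chi0 k y; have h1 := chi1 k y.
  have -> : w y = (M + 1) * (1 - chi k y) by rewrite /w; ring.
  rewrite ger0_norm; last by rewrite mulr_ge0 ?subr_ge0 // ltW.
  by rewrite -[leRHS]mulr1 ler_pM2l //; move: h0; lra.
have bM : cbounded (fun _ : R => M + 1) by split; [exact: cst_continuous | exists `|M + 1|].
exists (fun y => f y * chi k y), w; split=> //.
- apply: (@weak_compact _ k.+1%:R) => // u hu; by rewrite chiz // mulr0.
- apply: weak_lin => //; last exact: weak_cst.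
  by apply: (@weak_compact _ k.+1%:R) => // u hu; exact: chiz.
- split.
    move=> y; have -> : f y - f y * chi k y = f y * (1 - chi k y) by ring.
    have -> : w y = (M + 1) * (1 - chi k y) by rewrite /w; ring.
    rewrite normrM [`|1 - _|]ger0_norm ?subr_ge0 // ler_wpM2r ?subr_ge0 // (le_trans (HM y)) // lerDl //.
  have bc := cbounded_bm (bchi k).
  rewrite /w bm_intD ?bm_intZ ?prob_int_cst //; [|exact: bmZ|exact: bm_cst].
  move: hk; rewrite lerBlDr -lerBlDl ler_pdivlMr //; move: (\int[G]_y _) => I; lra.
Unshelve. all: by end_near. Qed.

End levy.

(** * Perturbation of the transfer operators *)

Section perturbation.
Context {R : realType} {B : normedModType R[i]}.
Local Notation nm z := (complex.Re `|z|).
Variables (L M : nat -> {linear B -> B}) (l : {linear B -> R[i]^o}) (h : nat -> B).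
Variables (C D rho : R).
Hypotheses (C0 : 0 <= C) (D0 : 0 <= D) (rho0 : 0 <= rho) (rho1 : rho < 1).

Fixpoint Lc (k m : nat) (b : B) : B := if m is p.+1 then L (k + p) (Lc k p b) else b.

Hypothesis hC : forall k, rnorm (h k) <= C.
Hypothesis lC : forall b, nm (l b) <= C * rnorm b.
Hypothesis MC : forall k b, rnorm (M k b) <= C * rnorm b.
Hypothesis decay : forall k m b, l b = 0 -> rnorm (Lc k m b) <= D * rho ^+ m * rnorm b.
Hypothesis lL : forall k b, l (L k b) = l b.
Hypothesis Lh : forall k, L k (h k) = h k.+1.
Hypothesis lh : forall k, l (h k) = 1.
Hypothesis lMh : forall k, l (M k (h k)) = 0.

Lemma Lc_linear k m (b c : B) : Lc k m (b + c) = Lc k m b + Lc k m c.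
Proof. by elim: m => //= m ->; rewrite linearD. Qed.

Lemma LcS k m b : Lc k m.+1 b = Lc k.+1 m (L k b).
Proof. by elim: m => [|m IH]; rewrite /= ?addn0 //= -addSnnS -IH. Qed.

Lemma Lc0 k m : Lc k m 0 = 0.
Proof. by elim: m => //= m ->; rewrite linear0. Qed.

Let CL := D * rho * (1 + C * C) + C * C.

Let CL0 : 0 <= CL. Proof. by rewrite addr_ge0 ?mulr_ge0 // addr_ge0 // mulr_ge0. Qed.

Lemma L_bound k b : rnorm (L k b) <= CL * rnorm b.
Proof.
pose c := b - l b *: h k.
have lc : l c = 0 by rewrite /c linearB linearZ /= lh /GRing.scale /= mulr1 subrr.
have bE : b = c + l b *: h k by rewrite /c subrK.
have nb : nm (l b) * C <= C * C * rnorm b.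
  by apply: le_trans (ler_wpM2r C0 (lC b)) _; rewrite mulrAC.
rewrite {1}bE linearD linearZ /= Lh; apply: le_trans (rnormD _ _) _.
rewrite [X in _ <= X]mulrDl; apply: lerD; last first.
  by rewrite rnormZ; apply: le_trans nb; rewrite ler_wpM2l // Re_norm_ge0.
have := decay k 1 lc; rewrite /= addn0 expr1 => /le_trans; apply.
rewrite -[leRHS]mulrA ler_wpM2l ?mulr_ge0 //.
apply: le_trans (rnormB _ _) _; rewrite mulrDl mul1r lerD2l rnormZ.
by apply: le_trans nb; rewrite ler_wpM2l // Re_norm_ge0.
Qed.

(** Errors of mass 0 are forgotten at rate rho, so their sum stays bounded by a geometric series
    independent of the number of steps. The m further iterations make the induction work: one of
    them is consumed at each step. *)
Lemma duhamel (e q : nat -> B) n s : 0 <= s -> e 0%N = 0 ->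
  (forall k, (k < n)%N -> [/\ e k.+1 = L k (e k) + q k, l (q k) = 0 & rnorm (q k) <= s]) ->
  forall k m, (k <= n)%N -> rnorm (Lc k m (e k)) <= D / (1 - rho) * s * rho ^+ m.
Proof.
move=> s0 e0 H; have r1 : 0 < 1 - rho by rewrite subr_gt0.
elim=> [|k IH] m kn.
  by rewrite e0 Lc0 rnorm0 mulr_ge0 ?exprn_ge0 // mulr_ge0 // divr_ge0 // ltW.
have [-> lq qs] := H k kn; rewrite Lc_linear -LcS.
apply: le_trans (rnormD _ _) _; apply: le_trans (lerD (IH m.+1 (ltnW kn)) (decay _ _ lq)) _.
apply: (@le_trans _ _ (D / (1 - rho) * s * rho ^+ m.+1 + D * rho ^+ m * s)).
  by rewrite lerD2l ler_wpM2l // mulr_ge0 // exprn_ge0.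
rewrite le_eqVlt; apply/orP; left; apply/eqP; rewrite exprS; field; exact: lt0r_neq0.
Qed.

(* The first order term of the invariant densities of the perturbed cocycle. *)
Fixpoint zc (k : nat) : B := if k is p.+1 then L p (zc p + M p (h p)) else 0.

Lemma l_zc k : l (zc k) = 0.
Proof. by elim: k => [|k IH] /=; rewrite ?linear0 // lL linearD IH lMh addr0. Qed.

Let Cz := D / (1 - rho) * (CL * (C * C)).

Let Cz0 : 0 <= Cz.
Proof. by rewrite !mulr_ge0 // invr_ge0 subr_ge0 ltW. Qed.

Lemma zc_bound k : rnorm (zc k) <= Cz.
Proof.
have s0 : 0 <= CL * (C * C) by rewrite !mulr_ge0.
have := @duhamel zc (fun k => L k (M k (h k))) k _ s0 erefl _ k 0%N (leqnn k).
rewrite /= expr0 mulr1; apply=> j _; split; first by rewrite /= linearD.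
  by rewrite lL lMh.
apply: le_trans (L_bound _ _) _; rewrite ler_wpM2l //; apply: le_trans (MC _ _) _.
by rewrite ler_wpM2l.
Qed.

(** The coefficient of tau^2 in the ratio of successive masses, see [ac_error]. *)
Definition vc k : R[i] := l (M k (M k (h k))) / 2 + l (M k (zc k)).

Section scalar.
Variable tau : R[i].
Let n := nm tau.
Let n0 : 0 <= n. Proof. exact: Re_norm_ge0. Qed.

(* The transfer operators twisted by the second order Taylor polynomial of
   exp (tau g) are applied to h 0. *)
Fixpoint bc (k : nat) : B :=
  if k is p.+1 then L p (bc p + tau *: M p (bc p) + (tau ^+ 2 / 2) *: M p (M p (bc p))) else h 0%N.

(** bc k = ac k uc k + ec k: mass times first-order profile of mass 1, plus a remainder of mass 0.
    rc is the part of bc k.+1 that is neither ac k uc k.+1 nor L_k (ec k); it is of second order in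
    tau once ec is. *)
Definition ac k : R[i] := l (bc k).
Definition uc k := h k + tau *: zc k.
Definition ec k := bc k - ac k *: uc k.
Definition rc k := L k ((tau ^+ 2 * ac k) *: M k (zc k) + tau *: M k (ec k) + (tau ^+ 2 / 2) *: M k (M k (bc k))).

Lemma l_uc k : l (uc k) = 1.
Proof. by rewrite linearD linearZ /= l_zc scaler0 addr0 lh. Qed.

Lemma l_ec k : l (ec k) = 0.
Proof. by rewrite linearB linearZ /= l_uc /GRing.scale /= mulr1 subrr. Qed.

Lemma bcE k : bc k = ac k *: uc k + ec k.
Proof. by rewrite /ec addrC subrK. Qed.

Lemma bcS k : bc k.+1 = ac k *: uc k.+1 + L k (ec k) + rc k.
Proof.
(* The first-order profile is reproduced because zc k.+1 = L_k (zc k + M_k h_k). *)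
have uS : uc k.+1 = L k (h k + tau *: (zc k + M k (h k))).
  by rewrite linearD linearZ /= Lh.
rewrite uS /rc -linearZ -!linearD /=; congr (L k _).
have e1 : tau *: M k (bc k) = (ac k * tau) *: M k (h k) + ((tau ^+ 2 * ac k) *: M k (zc k) + tau *: M k (ec k)).
  have -> : M k (bc k) = ac k *: (M k (h k) + tau *: M k (zc k)) + M k (ec k).
    by rewrite bcE linearD linearZ /= /uc linearD linearZ.
  rewrite !scalerDr !scalerA -addrA.
  by congr (_ *: _ + (_ *: _ + _)); ring.
have e2 : ac k *: (h k + tau *: (zc k + M k (h k))) = ac k *: uc k + (ac k * tau) *: M k (h k).
  by rewrite /uc !scalerDr !scalerA !addrA.
rewrite e1 e2 {1}bcE; move: (_ *: M k (M k (bc k))) (tau *: M k (ec k)) (_ *: M k (zc k)) (_ *: M k (h k)) => q x y z.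
by move: (ac k *: uc k) (ec k) => u e; rewrite -!addrA; congr (_ + _); rewrite addrCA.

Qed.

Lemma acS k : ac k.+1 = ac k + l (rc k).
Proof. by rewrite {1}/ac bcS linearD linearD linearZ /= l_uc lL l_ec addr0 /GRing.scale /= mulr1. Qed.

Lemma ecS k : ec k.+1 = L k (ec k) + (rc k - l (rc k) *: uc k.+1).
Proof.
rewrite {1}/ec bcS acS scalerDl; set A := ac k *: _; set W := l _ *: _.
by rewrite -(addrA A) opprD addrACA subrr add0r addrA.
Qed.

(** With n = |tau|: G bounds uc, C4 n^2 g bounds rc, C1 n^2 is the relative growth of the mass in
    one step, C3 n^2 g bounds the source of mass 0 in the recursion of ec, C2 n^2 g what accumulates
    from it by [duhamel], and K is the third-order constant. The function g majorizes the masses. *)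
Let G := C + Cz.
Let G0 : 0 <= G. Proof. exact: addr_ge0. Qed.
Let C4 := CL * (C * Cz + C + C * C * (G + 1)).
Let C40 : 0 <= C4.
Proof. by rewrite mulr_ge0 //; apply: addr_ge0; [apply: addr_ge0 => //; exact: mulr_ge0 | rewrite !mulr_ge0 // addr_ge0]. Qed.
Let C1 := C * C4.
Let C3 := C4 + C * C4 * G.
Let C2 := D / (1 - rho) * C3.
Let K := C * C * C2 + C * C * C * Cz + C * C * C * C2.

Let C30 : 0 <= C3. Proof. by apply: addr_ge0 => //; apply: mulr_ge0 => //; exact: mulr_ge0. Qed.
Let C20 : 0 <= C2. Proof. by apply: mulr_ge0 => //; apply: mulr_ge0 => //; rewrite invr_ge0 subr_ge0 ltW. Qed.
Let C10 : 0 <= C1. Proof. exact: mulr_ge0. Qed.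
Let g k := (1 + C1 * n ^+ 2) ^+ k.
Let g0 k : 0 <= g k. Proof. by rewrite exprn_ge0 // addr_ge0 // mulr_ge0 // exprn_ge0. Qed.

Hypothesis n1 : n <= 1.
Hypothesis nC2 : C2 * n <= 1.

Lemma uc_bound k : rnorm (uc k) <= G.
Proof.
apply: le_trans (rnormD _ _) (lerD (hC k) _); rewrite rnormZ -[leRHS]mul1r.
by apply: ler_pM => //; [exact: rnorm_ge0 | exact: zc_bound].
Qed.

Let nm2 : nm (tau ^+ 2) = n ^+ 2.
Proof. by rewrite expr2 Re_normM -expr2. Qed.

Let nmh : nm (tau ^+ 2 / 2) <= n ^+ 2.
Proof.
rewrite Re_normM nm2 ler_piMr ?sqr_ge0 //.
have -> : (2^-1 : R[i]) = (2^-1 : R)%:C%C by rewrite fmorphV rmorph_nat.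
by rewrite Re_norm_real ger0_norm ?invr_ge0 // invf_le1 // ler1n.
Qed.

Section step.
Variable k : nat.
Hypothesis ak : nm (ac k) <= g k.
Hypothesis ek : rnorm (ec k) <= C2 * n ^+ 2 * g k.

Let enk : rnorm (ec k) <= n * g k.
Proof.
apply: le_trans ek _; rewrite expr2 mulrA -[_ * n * g k]mulrA.
by rewrite -[leRHS]mul1r ler_wpM2r // mulr_ge0.
Qed.

Lemma bc_bound : rnorm (bc k) <= (G + 1) * g k.
Proof.
rewrite bcE; apply: le_trans (rnormD _ _) _; rewrite mulrDl; apply: lerD.
  by rewrite rnormZ mulrC; apply: ler_pM => //; [exact: rnorm_ge0 | exact: Re_norm_ge0 | exact: uc_bound].
by apply: le_trans enk _; rewrite ler_wpM2r.
Qed.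

Lemma rc_bound : rnorm (rc k) <= C4 * n ^+ 2 * g k.
Proof.
rewrite /rc; apply: le_trans (L_bound _ _) _; set s := n ^+ 2 * g k.
have s0 : 0 <= s by rewrite mulr_ge0 // exprn_ge0.
have -> : C4 * n ^+ 2 * g k = CL * (s * (C * Cz) + s * C + s * (C * (C * (G + 1)))) by rewrite /C4 /s; ring.
rewrite ler_wpM2l //.
apply: le_trans (rnormD _ _) _; apply: lerD; [apply: le_trans (rnormD _ _) _; apply: lerD|].
- rewrite rnormZ; apply: ler_pM; [exact: Re_norm_ge0 | exact: rnorm_ge0 | |].
    by rewrite Re_normM nm2 /s ler_wpM2l ?exprn_ge0.
  by apply: le_trans (MC _ _) _; rewrite ler_wpM2l // zc_bound.
- rewrite rnormZ -/n; have -> : s * C = n * (C * (n * g k)) by rewrite /s; ring.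
  by rewrite ler_wpM2l //; apply: le_trans (MC _ _) _; rewrite ler_wpM2l.
- rewrite rnormZ; have -> : s * (C * (C * (G + 1))) = n ^+ 2 * (C * (C * ((G + 1) * g k))) by rewrite /s; ring.
  apply: ler_pM; [exact: Re_norm_ge0 | exact: rnorm_ge0 | exact: nmh |].
  apply: le_trans (MC _ _) _; rewrite ler_wpM2l //; apply: le_trans (MC _ _) _; rewrite ler_wpM2l //.
  exact: bc_bound.
Qed.

Lemma ac_step : nm (ac k.+1) <= g k.+1.
Proof.
rewrite acS; apply: le_trans (Re_normD _ _) _.
rewrite /g exprS mulrDl mul1r; apply: lerD => //.
change (nm (l (rc k)) <= C1 * n ^+ 2 * g k).
have -> : C1 * n ^+ 2 * g k = C * (C4 * n ^+ 2 * g k) by rewrite /C1; ring.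
by apply: le_trans (lC _) _; rewrite ler_wpM2l // rc_bound.
Qed.

Lemma qc_bound : rnorm (rc k - l (rc k) *: uc k.+1) <= C3 * n ^+ 2 * g k.
Proof.
have -> : C3 * n ^+ 2 * g k = C4 * n ^+ 2 * g k + C * (C4 * n ^+ 2 * g k) * G by rewrite /C3; ring.
apply: le_trans (rnormB _ _) _; apply: lerD; first exact: rc_bound.
rewrite rnormZ; apply: ler_pM; [exact: Re_norm_ge0 | exact: rnorm_ge0 | | exact: uc_bound].
by apply: le_trans (lC _) _; rewrite ler_wpM2l // rc_bound.
Qed.

(** The second-order part of the mass increment is exactly tau^2 ac vc. In what remains, a third
    power of n comes from the prefactors of tau together with the size of ec. *)
Lemma ac_error : nm (ac k.+1 - ac k * (1 + tau ^+ 2 * vc k)) <= K * n ^+ 3 * g k.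
Proof.
have -> : ac k.+1 - ac k * (1 + tau ^+ 2 * vc k) =
    tau * l (M k (ec k)) + (tau ^+ 2 / 2) * (tau * ac k * l (M k (M k (zc k))) + l (M k (M k (ec k)))).
  have eb : l (M k (M k (bc k))) = ac k * (l (M k (M k (h k))) + tau * l (M k (M k (zc k)))) + l (M k (M k (ec k))).
    rewrite {1}bcE linearD linearZ /= linearD linearZ /= linearD linearZ /= /uc.
    by rewrite linearD linearZ /= linearD linearZ /= linearD linearZ.
  have er : l (rc k) = tau ^+ 2 * ac k * l (M k (zc k)) + tau * l (M k (ec k)) + tau ^+ 2 / 2 * l (M k (M k (bc k))).
    by rewrite /rc lL linearD linearZ /= linearD !linearZ.
  by rewrite acS er eb /vc; field.
set q1 := l (M k (ec k)); set q2 := l (M k (M k (zc k))); set q3 := l (M k (M k (ec k))).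
have h1 : nm q1 <= C * (C * (C2 * n ^+ 2 * g k)).
  by apply: le_trans (lC _) _; rewrite ler_wpM2l //; apply: le_trans (MC _ _) _; rewrite ler_wpM2l.
have h2 : nm q2 <= C * (C * (C * Cz)).
  apply: le_trans (lC _) _; rewrite ler_wpM2l //; apply: le_trans (MC _ _) _; rewrite ler_wpM2l //.
  by apply: le_trans (MC _ _) _; rewrite ler_wpM2l // zc_bound.
have h3 : nm q3 <= C * (C * (C * (C2 * n * g k))).
  apply: le_trans (lC _) _; rewrite ler_wpM2l //; apply: le_trans (MC _ _) _; rewrite ler_wpM2l //.
  apply: le_trans (MC _ _) _; rewrite ler_wpM2l //; apply: le_trans ek _; rewrite ler_wpM2r // ler_wpM2l //.
  by rewrite expr2 ler_piMl.
have -> : K * n ^+ 3 * g k = n * (C * (C * (C2 * n ^+ 2 * g k))) +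
    n ^+ 2 * (n * g k * (C * (C * (C * Cz))) + C * (C * (C * (C2 * n * g k)))) by rewrite /K; ring.
apply: le_trans (Re_normD _ _) _; apply: lerD; first by rewrite Re_normM ler_wpM2l.
rewrite Re_normM; apply: ler_pM; [exact: Re_norm_ge0 | exact: Re_norm_ge0 | exact: nmh |].
apply: le_trans (Re_normD _ _) _; apply: lerD => //.
rewrite 2!Re_normM; apply: ler_pM => //; [by rewrite mulr_ge0 // Re_norm_ge0 | exact: Re_norm_ge0 |].
by rewrite ler_wpM2l.
Qed.

End step.

(** Strong induction, because [duhamel] at k.+1 needs the source bounds at all earlier times j;
    there g j is replaced by the larger g k. *)
Lemma perturbation_bounds k : nm (ac k) <= g k /\ rnorm (ec k) <= C2 * n ^+ 2 * g k.
Proof.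
have [m] := ubnP k; elim: m k => // m IH k /ltnSE km.
have gm (i j : nat) : (i <= j)%N -> g i <= g j.
  by move=> ij; rewrite /g; apply: ler_weXn2l => //; rewrite lerDl mulr_ge0 // exprn_ge0.
case: k km => [|k] km.
  rewrite /ac /ec /ac /uc /bc lh /g expr0 scale1r /zc scaler0 addr0 subrr rnorm0; split.
    by rewrite normr1.
  by rewrite mulr1; apply: mulr_ge0 => //; exact: exprn_ge0.
split; first by have [a1 a2] := IH k km; exact: ac_step.
have s0 : 0 <= C3 * n ^+ 2 * g k by rewrite mulr_ge0 // mulr_ge0 // exprn_ge0.
have := @duhamel ec (fun k => rc k - l (rc k) *: uc k.+1) k.+1 _ s0 _ _ k.+1 0%N (leqnn _).
rewrite /= expr0 mulr1 => H; apply: le_trans (H _ _) _.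
- by rewrite /ec /ac /uc /bc lh scale1r /zc scaler0 addr0 subrr.
- move=> j jk; split; first exact: ecS.
    by rewrite linearB linearZ /= l_uc /GRing.scale /= mulr1 subrr.
  have [a1 a2] := IH j (leq_trans jk km).
  by apply: le_trans (qc_bound a1 a2) _; rewrite ler_wpM2l ?mulr_ge0 ?exprn_ge0 // gm.
have -> : C2 * n ^+ 2 * g k.+1 = D / (1 - rho) * (C3 * n ^+ 2 * g k.+1) by rewrite /C2 !mulrA.
rewrite ler_wpM2l ?divr_ge0 ?subr_ge0 ?(ltW rho1) // ler_wpM2l ?gm //.
by apply: mulr_ge0 => //; exact: exprn_ge0.
Qed.

End scalar.

(** The constants are fixed before tau, since tau = i th / sqrt n varies with the number of
    steps. *)
Lemma perturbation : exists C1 C2 K : R, [/\ 0 <= C1, 0 <= C2, 0 <= K &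
  forall tau : R[i], nm tau <= 1 -> C2 * nm tau <= 1 -> forall k,
    nm (ac tau k.+1 - ac tau k * (1 + tau ^+ 2 * vc k)) <= K * nm tau ^+ 3 * (1 + C1 * nm tau ^+ 2) ^+ k].
Proof.
have G0 : 0 <= C + Cz by exact: addr_ge0.
have [C4 [C40 defC4]] : exists C4, 0 <= C4 /\ C4 = CL * (C * Cz + C + C * C * (C + Cz + 1)).
  eexists; split; last exact: erefl.
  apply: mulr_ge0 => //; apply: addr_ge0; [apply: addr_ge0 => //; exact: mulr_ge0 | apply: mulr_ge0; [exact: mulr_ge0 | exact: addr_ge0]].
have C20 : 0 <= D / (1 - rho) * (C4 + C * C4 * (C + Cz)).
  apply: mulr_ge0; first by rewrite divr_ge0 // subr_ge0 ltW.
  by apply: addr_ge0 => //; apply: mulr_ge0 => //; exact: mulr_ge0.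
rewrite defC4 in C40 C20.
exists (C * (CL * (C * Cz + C + C * C * (C + Cz + 1)))); eexists; eexists; split; last first.
- move=> tau n1 nC2 k; have [a1 a2] := perturbation_bounds n1 nC2 k; exact: ac_error a1 a2.
- by apply: addr_ge0; [apply: addr_ge0|]; do ?[apply: mulr_ge0 => //].
- exact: C20.
- exact: mulr_ge0.
Qed.

Section limit.
Variables (w : nat -> R) (W : R).
Hypothesis vw : forall k, vc k = (w k)%:C%C.
Hypothesis wW : (fun n => (\sum_(k < n) w k) / n%:R) @ \oo --> W.

Let Cw := C * (C * (C * C)) + C * (C * Cz).

Lemma w_bound k : `|w k| <= Cw.
Proof.
rewrite -Re_norm_real -vw /vc; apply: le_trans (Re_normD _ _) _; apply: lerD.
  rewrite Re_normM.
  have -> : (2^-1 : R[i]) = (2^-1 : R)%:C%C by rewrite fmorphV rmorph_nat.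
  rewrite Re_norm_real [`|2^-1|]ger0_norm ?invr_ge0 //.
  apply: le_trans (_ : _ <= nm (l (M k (M k (h k))))) _.
    by rewrite ler_piMr ?Re_norm_ge0 // invf_le1 ?ler1n.
  apply: le_trans (lC _) _; rewrite ler_wpM2l //; apply: le_trans (MC _ _) _; rewrite ler_wpM2l //.
  by apply: le_trans (MC _ _) _; rewrite ler_wpM2l.
apply: le_trans (lC _) _; rewrite ler_wpM2l //; apply: le_trans (MC _ _) _; rewrite ler_wpM2l //.
exact: zc_bound.
Qed.

Let Cw0 : 0 <= Cw. Proof. exact: le_trans (w_bound 0). Qed.

Lemma exp_pow (x : R) n : 0 <= x -> (1 + x) ^+ n <= expR (n%:R * x).
Proof. by move=> x0; rewrite expRM_natl lerXn2r ?nnegrE ?addr_ge0 ?expR_ge0 // expR_ge1Dx. Qed.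

(** Both the masses and p k = exp (- t^2 (w_0 + ... + w_(k-1))) satisfy x_(k+1) = x_k (1 - t^2 w_k)
    up to O(|t|^3). Over n steps with t^2 n = th^2 the errors add up to O(th^2 |t|), while the
    factors stay below exp (Cw th^2). *)
Lemma ac_approx (th : R) : exists C2 K : R, 0 <= C2 /\ forall n (t : R), t ^+ 2 * n%:R = th ^+ 2 -> `|t| <= 1 -> C2 * `|t| <= 1 ->
  nm (ac (Complex 0 t) n - (expR (- (t ^+ 2 * \sum_(k < n) w k)))%:C%C) <= K * `|t|.
Proof.
have [C1 [C2 [K [C10 C20 K0 H]]]] := perturbation.
(* K5 |t|^3 is the error of one step: the first part comes from [perturbation], the second from exp
   y - 1 - y with y = - t^2 w_k. *)
pose K5 := K * expR (C1 * th ^+ 2) + expR (Cw * th ^+ 2) * (Cw ^+ 2 * expR Cw).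
have K50 : 0 <= K5 by rewrite addr_ge0 ?mulr_ge0 ?expR_ge0 ?exprn_ge0.
exists C2, (th ^+ 2 * K5 * expR (Cw * th ^+ 2)); split=> // n t tn t1 tC2.
have nmt : nm (Complex 0 t) = `|t| by rewrite normc_def /= expr0n add0r sqrtr_sqr.
have tau2 : (Complex 0 t : R[i]) ^+ 2 = (- t ^+ 2)%:C%C.
  change (Complex (0 * 0 - t * t) (0 * t + t * 0) = Complex (- t ^+ 2) 0); congr Complex; ring.
pose p k := expR (- (t ^+ 2 * \sum_(j < k) w j)).
have t20 : 0 <= t ^+ 2 by exact: sqr_ge0.
have tk k : (k <= n)%N -> k%:R * t ^+ 2 <= th ^+ 2 by move=> kn; rewrite -tn mulrC ler_wpM2l // ler_nat.
have H' k : (k < n)%N -> nm (ac (Complex 0 t) k.+1 - ac (Complex 0 t) k * (1 - t ^+ 2 * w k)%:C%C) <=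
    K * expR (C1 * th ^+ 2) * `|t| ^+ 3.
  move=> kn; have := H (Complex 0 t); rewrite nmt => /(_ t1 tC2 k).
  rewrite tau2 vw -rmorphM -(rmorphD _ 1) mulNr => /le_trans; apply.
  rewrite mulrAC ler_wpM2r ?exprn_ge0 // ler_wpM2l //.
  rewrite real_normK ?num_real //; apply: le_trans (exp_pow _ (mulr_ge0 C10 t20)) _.
  by rewrite ler_expR mulrCA ler_wpM2l // tk // ltnW.
have pS k : (k < n)%N -> `|p k.+1 - p k * (1 - t ^+ 2 * w k)| <= expR (Cw * th ^+ 2) * (Cw ^+ 2 * expR Cw) * `|t| ^+ 3.
  move=> kn; pose y := - (t ^+ 2 * w k).
  have -> : p k.+1 - p k * (1 - t ^+ 2 * w k) = p k * (expR y - 1 - y).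
    rewrite /p big_ord_recr /= mulrDr opprD expRD -/y; rewrite /y; ring.
  have ty : `|y| <= t ^+ 2 * Cw.
    by rewrite normrN normrM ger0_norm // ler_wpM2l // w_bound.
  have t2t : t ^+ 2 <= 1.
    by rewrite -real_normK ?num_real // exprn_ile1.
  rewrite normrM -mulrA; apply: ler_pM => //.
    rewrite ger0_norm ?expR_ge0 // ler_expR; apply: le_trans (ler_norm _) _.
    rewrite normrN normrM ger0_norm //; apply: (@le_trans _ _ (t ^+ 2 * (k%:R * Cw))).
      rewrite ler_wpM2l //; apply: le_trans (ler_norm_sum _ _ _) _.
      apply: (@le_trans _ _ (\sum_(j < k) Cw)); first by apply: ler_sum => j _; exact: w_bound.
      by rewrite sumr_const card_ord mulr_natl.
    have -> : t ^+ 2 * (k%:R * Cw) = Cw * (k%:R * t ^+ 2) by ring.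
    by rewrite ler_wpM2l // tk // ltnW.
  apply: le_trans (expR_sub1 y) _.
  rewrite [X in _ <= X]mulrAC; apply: ler_pM; rewrite ?sqr_ge0 ?expR_ge0 //; last first.
    by rewrite ler_expR; apply: le_trans ty _; rewrite ler_piMl.
  rewrite -real_normK ?num_real //; apply: (@le_trans _ _ ((t ^+ 2 * Cw) ^+ 2)).
    by apply: lerXn2r => //; rewrite nnegrE mulr_ge0.
  rewrite exprMn mulrC ler_wpM2l ?sqr_ge0 // -[t ^+ 2]real_normK ?num_real // -exprM.
  by rewrite ler_wiXn2l.
have ind k : (k <= n)%N -> nm (ac (Complex 0 t) k - (p k)%:C%C) <= k%:R * (K5 * `|t| ^+ 3) * (1 + Cw * t ^+ 2) ^+ k.
  have g1 : 1 <= 1 + Cw * t ^+ 2 by rewrite lerDl mulr_ge0.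
  elim: k => [|k IH] kn.
    by rewrite !mul0r /ac /bc lh /p big_ord0 mulr0 oppr0 expR0 subrr normr0.
  have -> : ac (Complex 0 t) k.+1 - (p k.+1)%:C%C = (ac (Complex 0 t) k.+1 - ac (Complex 0 t) k * (1 - t ^+ 2 * w k)%:C%C) +
      ((ac (Complex 0 t) k - (p k)%:C%C) * (1 - t ^+ 2 * w k)%:C%C - (p k.+1 - p k * (1 - t ^+ 2 * w k))%:C%C).
    rewrite rmorphB rmorphM /=; ring.
  apply: le_trans (Re_normD _ _) _; apply: le_trans (lerD (H' k kn) (Re_normD _ _)) _.
  rewrite Re_normM normrN !Re_norm_real.
  have e1 : `|1 - t ^+ 2 * w k| <= 1 + Cw * t ^+ 2.
    apply: le_trans (ler_normB _ _) _; rewrite normr1 lerD2l normrM ger0_norm // mulrC.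
    by rewrite ler_wpM2r // w_bound.
  have e2 := ler_pM (Re_norm_ge0 _) (normr_ge0 _) (IH (ltnW kn)) e1.
  apply: le_trans (lerD (lexx _) (lerD e2 (pS k kn))) _.
  set g := 1 + Cw * t ^+ 2 in g1 *; set A := `|t| ^+ 3.
  have A0 : 0 <= A by exact: exprn_ge0.
  have -> : K * expR (C1 * th ^+ 2) * A + (k%:R * (K5 * A) * g ^+ k * g + expR (Cw * th ^+ 2) * (Cw ^+ 2 * expR Cw) * A) =
    k%:R * (K5 * A) * g ^+ k.+1 + K5 * A by rewrite [g ^+ k.+1]exprSr /K5; ring.
  have -> : k.+1%:R * (K5 * A) * g ^+ k.+1 = k%:R * (K5 * A) * g ^+ k.+1 + K5 * A * g ^+ k.+1 by rewrite -natr1; ring.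
  by rewrite lerD2l ler_peMr ?mulr_ge0 // exprn_ege1.
apply: le_trans (ind n (leqnn n)) _.
have -> : n%:R * (K5 * `|t| ^+ 3) * (1 + Cw * t ^+ 2) ^+ n = (1 + Cw * t ^+ 2) ^+ n * (K5 * (t ^+ 2 * n%:R) * `|t|).
  have t3 : `|t| ^+ 3 = t ^+ 2 * `|t| by rewrite exprSr real_normK ?num_real.
  by rewrite t3; ring.
rewrite tn; have -> : th ^+ 2 * K5 * expR (Cw * th ^+ 2) * `|t| = expR (Cw * th ^+ 2) * (K5 * th ^+ 2 * `|t|) by ring.
apply: ler_wpM2r; first by apply: mulr_ge0 => //; apply: mulr_ge0 => //; exact: sqr_ge0.
apply: le_trans (exp_pow _ _) _; first exact: mulr_ge0.
by rewrite ler_expR mulrCA ler_wpM2l // tk.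
Qed.

Lemma ac_limit (th : R) :
  (fun n : nat => nm (ac (Complex 0 (th / Num.sqrt n%:R)) n - (expR (- (th ^+ 2 * W)))%:C%C)) @ \oo --> (0 : R).
Proof.
have [C2 [K [C20 H]]] := ac_approx th.
have small (e : R) : 0 < e -> \forall n \near \oo, `|th / Num.sqrt (n%:R : R)| <= e.
  move=> e0; near=> n.
  have n0 : (0 : R) < n%:R by near: n; exact: nbhs_infty_gtr.
  have hn : (th / e) ^+ 2 <= n%:R by apply: ltW; near: n; exact: nbhs_infty_gtr.
  rewrite normrM normfV [`|Num.sqrt _|]ger0_norm ?sqrtr_ge0 //.
  rewrite ler_pdivrMr ?sqrtr_gt0 // mulrC -ler_pdivrMr // -[e in _ / e](ger0_norm (ltW e0)) -normf_div.
  by rewrite -sqrtr_sqr ler_wsqrtr.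
have cn : (fun n : nat => `|th / Num.sqrt n%:R|) @ \oo --> (0 : R).
  apply/cvgrPdist_le => e e0; near=> n; rewrite sub0r normrN normr_id; near: n; exact: small.
have cE : (fun n : nat => expR (- (th ^+ 2 * ((\sum_(k < n) w k) / n%:R)))) @ \oo --> expR (- (th ^+ 2 * W)).
  apply: (@cvg_comp _ _ _ (fun n : nat => - (th ^+ 2 * ((\sum_(k < n) w k) / n%:R))) expR _ (nbhs (- (th ^+ 2 * W)))); last exact: continuous_expR.
  by apply: cvgN; apply: cvgM => //; exact: cvg_cst.
have : (fun n : nat => K * `|th / Num.sqrt n%:R| + `|expR (- (th ^+ 2 * ((\sum_(k < n) w k) / n%:R))) - expR (- (th ^+ 2 * W))|) @ \oo --> (0 : R).
  have z : K * 0 + `|expR (- (th ^+ 2 * W)) - expR (- (th ^+ 2 * W))| = 0 by rewrite subrr normr0 mulr0 addr0.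
  rewrite -[X in _ --> X]z.
  apply: cvgD; first by apply: cvgM => //; exact: cvg_cst.
  by apply: cvg_norm; apply: cvgB => //; exact: cvg_cst.
move=> cB; apply: (squeeze_cvgr _ (cvg_cst 0) cB); near=> n.
apply/andP; split; first exact: Re_norm_ge0.
have n0 : (0 : R) < n%:R by near: n; exact: nbhs_infty_gtr.
have tn : (th / Num.sqrt n%:R) ^+ 2 * n%:R = th ^+ 2.
  by rewrite exprMn exprVn sqr_sqrtr ?ler0n // mulfVK // lt0r_neq0.
have t1 : `|th / Num.sqrt n%:R| <= 1 by near: n; exact: small.
have t3 : `|th / Num.sqrt n%:R| <= (C2 + 1)^-1 by near: n; apply: small; rewrite invr_gt0 ltr_wpDl.
set t := th / _ in tn t1 t3 *.
have t2 : C2 * `|t| <= 1.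
  rewrite mulrC; apply: (@le_trans _ _ ((C2 + 1)^-1 * C2)); first by rewrite ler_wpM2r.
  by rewrite mulrC ler_pdivrMr ?ltr_wpDl // mul1r lerDl.
have -> : ac (Complex 0 t) n - (expR (- (th ^+ 2 * W)))%:C%C =
  (ac (Complex 0 t) n - (expR (- (t ^+ 2 * \sum_(k < n) w k)))%:C%C) +
  (expR (- (t ^+ 2 * \sum_(k < n) w k)) - expR (- (th ^+ 2 * W)))%:C%C by rewrite rmorphB addrA subrK.
apply: le_trans (Re_normD _ _) _; apply: lerD; first exact: H.
have -> : t ^+ 2 * \sum_(k < n) w k = th ^+ 2 * ((\sum_(k < n) w k) / n%:R).
  by rewrite -tn -mulrA; congr (_ * _); rewrite mulrCA mulfV ?mulr1 // lt0r_neq0.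
by rewrite Re_norm_real.
Unshelve. all: by end_near. Qed.

End limit.

End perturbation.

(** * Disintegration of bounded functions *)

Section unit_mass.
Context {R : realType} {d : measure_display} {T : measurableType d}.
Variable m : {measure set T -> \bar R}.

(** A copy of m whose type carries the proof of total mass 1, so that the structure of a probability
    can be attached to it; [fiber] uses it for the values of a kernel. *)
Definition unit_mass (h : m setT = 1%E) : set T -> \bar R := m.

Hypothesis h : m setT = 1%E.

HB.instance Definition _ := Measure.on (unit_mass h).

Let unit_massT : unit_mass h setT = 1%E. Proof. exact: h. Qed.

HB.instance Definition _ := Measure_isProbability.Build _ _ _ (unit_mass h) unit_massT.

Definition to_probability : probability T R := unit_mass h.

End unit_mass.

Definition fiber {R : realType} {d1 d2 : measure_display} {T1 : measurableType d1} {T2 : measurableType d2}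
  (k : R.-pker T1 ~> T2) (w : T1) : probability T2 R := @to_probability R d2 T2 (k w) (@prob_kernel _ _ _ _ _ k w).

Lemma fiberE {R : realType} {d1 d2 : measure_display} {T1 : measurableType d1} {T2 : measurableType d2}
  (k : R.-pker T1 ~> T2) (w : T1) (f : T2 -> R) : \int[k w]_x f x = \int[fiber k w]_x f x.
Proof. by []. Qed.

Section disintegration.
Context {R : realType} {d1 d2 : measure_display} {T1 : measurableType d1} {T2 : measurableType d2}.
Variables (P : probability T1 R) (k : R.-pker T1 ~> T2).

(** The law of (w, y) with y distributed by k w. Together with P, seen as a kernel from [unit], it
    exhibits mu as a composition of kernels: both measures agree on rectangles. *)
Definition graph_kernel (z : unit * T1) : {measure set (T1 * T2) -> \bar R} :=
  measure_function_pushforward__canonical__measure_function_Measure (k z.2) (pair1_measurable z.2).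

Let measurable_graph_kernel (U : set (T1 * T2)) : measurable U ->
  measurable_fun [set: unit * T1] (graph_kernel ^~ U).
Proof.
move=> mU; rewrite (_ : graph_kernel ^~ U = (fun x => k x (xsection U x)) \o snd); last first.
  by apply/funext => -[u x] /=; rewrite /graph_kernel /pushforward /= xsectionE.
apply: measurableT_comp; last exact: measurable_snd.
by apply: measurable_fun_xsection_finite_kernel; rewrite inE.
Qed.

HB.instance Definition _ := isKernel.Build _ _ _ _ R graph_kernel measurable_graph_kernel.

Let graph_kernel_prob z : graph_kernel z setT = 1%E.
Proof. exact: prob_kernel. Qed.

HB.instance Definition _ := Kernel_isProbability.Build _ _ _ _ R graph_kernel graph_kernel_prob.

Definition base_kernel := kprobability (measurable_cst (P : pprobability T1 R) : measurable_fun [set: unit] _).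

Variable mu : probability (T1 * T2)%type R.
Hypothesis muE : forall (E : set T1) (F : set T2), measurable E -> measurable F ->
  mu (E `*` F) = (\int[P]_(w in E) k w F)%E.

Lemma disintegration_measure A : measurable A -> mu A = kcomp base_kernel graph_kernel tt A.
Proof.
pose C := [set A1 `*` A2 | A1 in @measurable _ T1 & A2 in @measurable _ T2].
apply: (measure_unique C (fun _ => setT)).
- by rewrite measurable_prod_measurableType.
- move=> _ _ [X1 mX1 [X2 mX2 <-]] [Y1 mY1 [Y2 mY2 <-]].
  exists (X1 `&` Y1); first exact: measurableI.
  by exists (X2 `&` Y2); [exact: measurableI | rewrite setXI].
- by move=> _; exists setT => //; exists setT => //; rewrite setXTT.
- by rewrite bigcup_const.
- move=> _ [E mE [F mF <-]].
  refine (etrans (muE mE mF) _); rewrite integral_mkcond; apply: eq_integral => w _; rewrite patchE /=.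
  rewrite /graph_kernel /pushforward /=; case: ifPn => wE.
    by congr (k w _); apply/seteqP; split=> [y Fy|y []] //; split=> //; rewrite inE in wE.
  rewrite (_ : _ @^-1` _ = set0) ?measure0 //; apply/seteqP; split=> // y [/= Ew _].
  by move: wE; rewrite notin_setE.
- by move=> _; rewrite (le_lt_trans (probability_le1 mu measurableT)) // ltry.
Qed.

Lemma ge0_disintegration (F : T1 * T2 -> \bar R) : (forall z, 0 <= F z)%E -> measurable_fun setT F ->
  (\int[mu]_z F z = \int[P]_w \int[k w]_y F (w, y))%E.
Proof.
move=> F0 mF; transitivity (\int[kcomp base_kernel graph_kernel tt]_z F z)%E.
  by apply: eq_measure_integral => A mA _; exact: disintegration_measure.
rewrite integral_kcomp //; apply: eq_integral => w _.
rewrite /graph_kernel ge0_integral_pushforward //=.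
Qed.

Lemma bm_disintegration_fun (F : T1 * T2 -> R) : bm F -> bm (fun w => \int[k w]_y F (w, y)).
Proof.
move=> bF; have [mF [M HM]] := bF.
have M0 : 0 <= M by exact: le_trans (HM point).
have bs w : bm (fun y => F (w, y)).
  by split; [exact: (measurableT_comp mF (measurable_pair1 w)) | exists M => y; exact: HM].
split; last by exists M => w; rewrite fiberE; apply: bm_int_norm; [exact: bs | move=> y; exact: HM].
have mFM : measurable_fun setT (fun z => (F z + M)%:E).
  by apply/measurable_EFinP; apply: measurable_funD.
have F0 z : (0 <= (F z + M)%:E)%E.
  by rewrite lee_fin; have := HM z; rewrite ler_norml => /andP[+ _]; lra.
have mI := measurable_fun_integral_finite_kernel (fun z => (F z + M)%:E) k F0 mFM.
rewrite (_ : (fun w => \int[k w]_y F (w, y)) = (fun w => fine (\int[k w]_y (F (w, y) + M)%:E)%E - M)); last first.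
  apply/funext => w; rewrite -/(\int[k w]_y (F (w, y) + M)).
  by rewrite !fiberE (bm_intD (fiber k w) (bs w) (bm_cst M)) prob_int_cst addrK.
apply: measurable_funB => //; exact: (measurableT_comp (@fine_measurable R _ measurableT) mI).
Qed.

Lemma disintegration (F : T1 * T2 -> R) : bm F -> \int[mu]_z F z = \int[P]_w \int[k w]_y F (w, y).
Proof.
move=> bF; have [mF [M HM]] := bF.
have M0 : 0 <= M by exact: le_trans (HM point).
have bs w : bm (fun y => F (w, y)).
  by split; [exact: (measurableT_comp mF (measurable_pair1 w)) | exists M => y; exact: HM].
have mFM : measurable_fun setT (fun z => (F z + M)%:E).
  by apply/measurable_EFinP; apply: measurable_funD.
have F0 z : (0 <= (F z + M)%:E)%E.
  by rewrite lee_fin; have := HM z; rewrite ler_norml => /andP[+ _]; lra.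
(* Shifting by the bound M makes the integrand nonnegative, as [ge0_disintegration] requires. *)
have : \int[mu]_z (F z + M) = \int[P]_w \int[k w]_y (F (w, y) + M).
  rewrite /Rintegral (ge0_disintegration F0 mFM); congr fine; apply: eq_integral => w _.
  rewrite fineK //; apply: integrable_fin_num => //.
  by apply: (@bm_integrable _ _ _ (fiber k w) (fun y => F (w, y) + M)); apply: bmD => //; exact: bm_cst.
rewrite (bm_intD mu bF (bm_cst M)) prob_int_cst.
rewrite (_ : (fun w => \int[k w]_y (F (w, y) + M)) = (fun w => \int[k w]_y F (w, y) + M)); last first.
  by apply/funext => w; rewrite !fiberE (bm_intD (fiber k w) (bs w) (bm_cst M)) prob_int_cst.
by rewrite (bm_intD P (bm_disintegration_fun bF) (bm_cst M)) prob_int_cst => /addIr.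
Qed.

End disintegration.

(** * Characteristic functions along a realization *)

Section composition.
Context {R : realType} {d : nat} {X : manifold R d}.

Lemma CqX1_comp (q : R) m (f : X -> 'rV[R]_m) (S : X -> X) : (1 <= Num.truncn q)%N ->
  CqX 1 f -> CqXX q S -> CqX 1 (f \o S).
Proof.
move=> q1 cf [cS HS] a aa; have sa := atlas_smooth_chart aa.
apply: (@Reg_Cq_nat _ _ _ 1%N); first exact: chart_dom_open.
move=> j; apply: Reg_loc => x ax.
pose b := chart_at (S (cpar a x)); have hb : atlas b by exact: chart_at_atlas.
pose U := cdom a `&` (S \o cpar a) @^-1` cim b.
have oU : open U.
  rewrite openE => y [ya yb]; apply: filterI; first exact: (open_nbhs_nbhs (conj (chart_dom_open a) ya)).
  have cc : {for y, continuous (S \o cpar a)} by apply: continuous_comp; [exact: cpar_continuous | exact: cS].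
  by apply: cc; exact: (open_nbhs_nbhs (conj (chart_im_open b) yb)).
exists U; first by split=> //; exact: chart_at_mem.
have inb y : U y -> cdom b (ccoord b (S (cpar a y))) /\ cpar b (ccoord b (S (cpar a y))) = S (cpar a y).
  by move=> [_ [z bz /= <-]]; rewrite cparK.
apply: (@Reg_ext _ _ _ _ _ ((fun y => f (cpar b y) 0 j) \o (ccoord b \o S \o cpar a))) => //.
  by move=> y /inb [_ /= ->].
apply: (@Reg_comp _ _ _ _ U (cdom b)) => //; first exact: chart_dom_open.
- by move=> y /inb [].
- by apply: (CqX_Reg _ cf (atlas_smooth_chart hb)); rewrite truncn1.
- by move=> l; exact: (Cq_Reg_le l oU q1 (HS a b aa hb)).
Qed.

End composition.

Section complex_bounds.
Context {R : realType}.
Local Notation nm z := (complex.Re `|z|).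

Lemma normc_Re (a b : R) : `|a| <= nm (Complex a b).
Proof. by rewrite normc_def /= -sqrtr_sqr ler_wsqrtr // lerDl sqr_ge0. Qed.

Lemma normc_Im (a b : R) : `|b| <= nm (Complex a b).
Proof. by rewrite normc_def /= -sqrtr_sqr ler_wsqrtr // lerDr sqr_ge0. Qed.

Lemma normc_le (a b : R) : nm (Complex a b) <= `|a| + `|b|.
Proof.
rewrite normc_def /= -[leRHS]ger0_norm ?addr_ge0 // -sqrtr_sqr ler_wsqrtr //.
rewrite sqrrD !real_normK ?num_real // addrAC lerDl mulrn_wge0 // mulr_ge0 //.
Qed.

Definition expi (y : R) : R[i] := Complex (cos y) (sin y).

Lemma expi0 : expi 0 = 1.
Proof. by rewrite /expi cos0 sin0. Qed.

Lemma expiD x y : expi (x + y) = expi x * expi y.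
Proof.
rewrite /expi cosD sinD.
change (Complex (cos x * cos y - sin x * sin y) (sin x * cos y + cos x * sin y) =
  Complex (cos x * cos y - sin x * sin y) (cos x * sin y + sin x * cos y)).
by congr Complex; rewrite addrC.
Qed.

Lemma nm_expi y : nm (expi y) = 1.
Proof. by rewrite normc_def /= cos2Dsin2 sqrtr1. Qed.

(* The second order Taylor polynomial at 0 of y |-> exp (tau y). *)
Definition taylor2 (tau : R[i]) (y : R) : R[i] := 1 + tau * y%:C%C + tau ^+ 2 / 2 * (y%:C%C * y%:C%C).

Lemma taylor2E (t y : R) : taylor2 (Complex 0 t) y = Complex (1 - (t * y) ^+ 2 / 2) (t * y).
Proof.
have e : (Complex 0 t : R[i]) = 'i%C * t%:C%C.
  by change (Complex 0 t = Complex (0 * t - 1 * 0) (0 * 0 + 1 * t)); congr Complex; ring.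
have i2 : ('i%C : R[i]) ^+ 2 = -1 by rewrite sqr_i.
rewrite /taylor2 e exprMn i2.
have -> : Complex (1 - (t * y) ^+ 2 / 2) (t * y) = (1 - (t * y) ^+ 2 / 2)%:C%C + 'i%C * (t * y)%:C%C.
  by change (Complex (1 - (t * y) ^+ 2 / 2) (t * y) = Complex (1 - (t * y) ^+ 2 / 2 + (0 * (t * y) - 1 * 0)) (0 + (0 * 0 + 1 * (t * y)))); congr Complex; ring.
by rewrite rmorphB rmorph1 rmorphM fmorphV rmorph_nat rmorphXn !rmorphM /=; field.
Qed.

Lemma expi_taylor2 (t y : R) : nm (expi (t * y) - taylor2 (Complex 0 t) y) <= 2 * `|t * y| ^+ 3.
Proof.
rewrite taylor2E; apply: le_trans (normc_le _ _) _; rewrite mulr_natl mulr2n.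
by apply: lerD; [exact: cos_sub3 | exact: sin_sub3].
Qed.

(** Induction on |E - F| + 1 <= (1 + q)^n for the exact product E and the approximate one F: every
    factor errs by at most q, |E| = 1, and |F| <= |E - F| + 1. *)
Lemma expi_prod (t M : R) n (y : nat -> R) : (forall j, `|y j| <= M) ->
  nm (expi (t * \sum_(j < n) y j) - \prod_(j < n) taylor2 (Complex 0 t) (y j)) <=
  expR (n%:R * (2 * (`|t| * M) ^+ 3)) - 1.
Proof.
move=> yM; set q := 2 * _.
have q0 : 0 <= q by rewrite mulr_ge0 // exprn_ge0 // mulr_ge0 // (le_trans _ (yM 0%N)).
rewrite lerBrDr; apply: le_trans (exp_pow n q0); elim: n => [|n IH].
  by rewrite !big_ord0 mulr0 expi0 subrr normr0 add0r.
have -> : \sum_(j < n.+1) y j = \sum_(j < n) y j + y n by rewrite big_ord_recr.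
have -> : \prod_(j < n.+1) taylor2 (Complex 0 t) (y j) = \prod_(j < n) taylor2 (Complex 0 t) (y j) * taylor2 (Complex 0 t) (y n).
  by rewrite big_ord_recr.
rewrite mulrDr expiD; move: IH.
set E := expi _; set F := \prod_(_ < _) _; set e := expi _; set p := taylor2 _ _ => IH.
have ep : nm (e - p) <= q.
  apply: le_trans (expi_taylor2 _ _) _; rewrite ler_wpM2l // normrM.
  by rewrite lerXn2r ?nnegrE ?mulr_ge0 // ?(le_trans _ (yM 0%N)) // ler_wpM2l.
have -> : E * e - F * p = e * (E - F) + (e - p) * F by ring.
have nF : nm F <= nm (E - F) + 1.
  have e1 := Re_normD (- (E - F)) E; rewrite normrN nm_expi in e1.
  have eF : - (E - F) + E = F by rewrite opprB subrK.
  by apply: le_trans e1; rewrite eF.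
apply: (@le_trans _ _ (nm (E - F) + q * (nm (E - F) + 1) + 1)).
  rewrite lerD2r; apply: le_trans (Re_normD _ _) _; rewrite !Re_normM nm_expi mul1r lerD2l.
  by apply: ler_pM => //; exact: Re_norm_ge0.
rewrite addrAC -{1}[nm (E - F) + 1]mul1r -mulrDl exprS ler_wpM2l // addr_ge0 //.
Qed.

End complex_bounds.

Section fixed_realization.
Context {R : realType} {d : nat} {X : manifold R d} {B : normedModType R[i]}.
Local Notation nm z := (complex.Re `|z|).
Variables (L M : nat -> {linear B -> B}) (l : {linear B -> R[i]^o}) (h : nat -> B).
Variables (C D rho : R).
Hypotheses (C0 : 0 <= C) (D0 : 0 <= D) (rho0 : 0 <= rho) (rho1 : rho < 1).
Hypothesis hC : forall k, rnorm (h k) <= C.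
Hypothesis lC : forall b, nm (l b) <= C * rnorm b.
Hypothesis MC : forall k b, rnorm (M k b) <= C * rnorm b.
Hypothesis decay : forall k m b, l b = 0 -> rnorm (Lc L k m b) <= D * rho ^+ m * rnorm b.
Hypothesis Lh : forall k, L k (h k) = h k.+1.
Variables (pair : B -> (X -> R[i]) -> R[i]) (S : nat -> X -> X) (g : nat -> X -> R).
Variable nu : nat -> probability (borel X) R.
Hypothesis lE : forall b, l b = pair b (fun=> 1).
Hypothesis pair_linl : forall (z : R[i]) b b' phi, CqC 1 phi ->
  pair (z *: b + b') phi = z * pair b phi + pair b' phi.
Hypothesis pair_linr : forall z b phi phi', CqC 1 phi -> CqC 1 phi' ->
  pair b (fun x => z * phi x + phi' x) = z * pair b phi + pair b phi'.
Hypothesis pairL : forall k b phi, CqC 1 phi -> pair (L k b) phi = pair b (phi \o S k).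
Hypothesis pairM : forall k b phi, CqC 1 phi -> pair (M k b) phi = pair b (fun x => (g k x)%:C%C * phi x).
Hypothesis pairh : forall k (phi : X -> R), CqR 1 phi ->
  pair (h k) (fun x => (phi x)%:C%C) = (\int[nu k]_x phi x)%:C%C.
Hypothesis gsm : forall k, CqR 1 (g k).
Hypothesis Ssm : forall k m (f : X -> 'rV[R]_m), CqX 1 f -> CqX 1 (f \o S k).
Hypothesis gc : forall k, \int[nu k]_x g k x = 0.

Fixpoint orb (k m : nat) (x : X) : X := if m is p.+1 then S (k + p) (orb k p x) else x.

Let CqC1 : CqC 1 (fun _ : X => 1 : R[i]).
Proof. by have := CqC_real (@CqR_cst R d X 1 1); congr CqC; apply/funext => x. Qed.

Lemma CqC_S k (phi : X -> R[i]) : CqC 1 phi -> CqC 1 (phi \o S k).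
Proof. exact: Ssm. Qed.

Lemma CqR_S k (phi : X -> R) : CqR 1 phi -> CqR 1 (phi \o S k).
Proof. exact: Ssm. Qed.

Lemma CqR_orb k m (phi : X -> R) : CqR 1 phi -> CqR 1 (phi \o orb k m).
Proof. by elim: m phi => // m IH phi cp; apply: (IH (phi \o S (k + m))); exact: CqR_S. Qed.

Lemma CqR_bm (phi : X -> R) : CqR 1 phi -> bm (phi : borel X -> R).
Proof.
move=> /CqR_continuous cp; split; first exact: continuous_measurable_borel.
exact: continuous_bounded_compact.
Qed.

Lemma mass_L k b : l (L k b) = l b.
Proof. by rewrite !lE pairL. Qed.

Lemma mass_h k : l (h k) = 1.
Proof.
rewrite lE; have := pairh k (@CqR_cst R d X 1 1).
by rewrite prob_int_cst.
Qed.

Lemma pairMh k phi : CqR 1 phi ->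
  pair (M k (h k)) (fun x => (phi x)%:C%C) = (\int[nu k]_x (g k x * phi x))%:C%C.
Proof.
move=> cp; rewrite (pairM k (h k) (CqC_real cp)) -(pairh k (CqRM ler01 (gsm k) cp)).
by congr pair; apply/funext => x; rewrite rmorphM.
Qed.

Lemma mass_Mh k : l (M k (h k)) = 0.
Proof.
rewrite lE; have := pairMh k (@CqR_cst R d X 1 1).
rewrite (_ : (fun x => (g k x * 1)) = g k) ?gc //.
by apply/funext => x; rewrite mulr1.
Qed.

Definition corr k m : R := \int[nu k]_x (g k x * g (k + m) (orb k m x)).

(** Unfolding the recursion transports each M_j h_j from time j to time k. Thus zc k carries the
    past of g, and testing it with g at time k produces the correlations in [wk]. *)
Lemma pair_zc k phi : CqR 1 phi -> pair (zc L M h k) (fun x => (phi x)%:C%C) =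
  (\sum_(j < k) \int[nu j]_x (g j x * phi (orb j (k - j) x)))%:C%C.
Proof.
elim: k phi => [|k IH] phi cp /=.
  have := pair_linl (-1) 0 0 (CqC_real cp); rewrite scaler0 addr0 mulN1r addNr => ->.
  by rewrite big_ord0.
rewrite pairL; last exact: CqC_real.
have cS := CqR_S k cp; have := pair_linl 1 (zc L M h k) (M k (h k)) (CqC_real cS).
rewrite scale1r mul1r => e; refine (etrans e _); rewrite IH // pairMh // -rmorphD; congr (_%:C%C).
rewrite big_ord_recr /=; congr (_ + _); last by rewrite subSnn /= addn0.
apply: eq_bigr => j _; apply: eq_Rintegral => x _; rewrite subSn ?(ltnW (ltn_ord j)) //=.
by rewrite subnKC // ltnW.
Qed.

Definition wk k : R := (\int[nu k]_x (g k x * g k x)) / 2 + \sum_(j < k) corr j (k - j).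

Lemma vcE k : vc L M l h k = (wk k)%:C%C.
Proof.
rewrite /vc !lE; have c1 := CqC1.
rewrite [pair (M k (M k (h k))) _](_ : _ = (\int[nu k]_x (g k x * g k x))%:C%C); last first.
  rewrite pairM // -(pairMh k (gsm k)); congr pair; apply/funext => x; by rewrite mulr1.
rewrite [pair (M k (zc L M h k)) _](_ : _ = (\sum_(j < k) corr j (k - j))%:C%C); last first.
  rewrite pairM //.
  have -> : (\sum_(j < k) corr j (k - j)) = \sum_(j < k) \int[nu j]_x (g j x * g k (orb j (k - j) x)).
    by apply: eq_bigr => j _; rewrite /corr subnKC // ltnW.
  by rewrite -(pair_zc k (gsm k)); congr pair; apply/funext => x; rewrite mulr1.
by rewrite /wk rmorphD rmorphM fmorphV rmorph_nat.
Qed.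

Lemma pair_Lc k m b phi : CqR 1 phi ->
  pair (Lc L k m b) (fun x => (phi x)%:C%C) = pair b (fun x => (phi (orb k m x))%:C%C).
Proof.
elim: m phi => // m IH phi cp /=; rewrite pairL; last exact: CqC_real.
exact: (IH (phi \o S (k + m)) (CqR_S _ cp)).
Qed.

(** By the centering of g, M_k h_k has mass 0, so [decay] applies to it. *)
Lemma corr_bound k m : `|corr k m| <= C * C * (C * C) * D * rho ^+ m.
Proof.
rewrite -Re_norm_real /corr.
have -> : (\int[nu k]_x (g k x * g (k + m) (orb k m x)))%:C%C = l (M (k + m) (Lc L k m (M k (h k)))).
  rewrite lE pairM // -(pairMh k (CqR_orb k m (gsm (k + m)))) -pair_Lc //.
  by congr pair; apply/funext => x; rewrite mulr1.
apply: le_trans (lC _) _.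
have -> : C * C * (C * C) * D * rho ^+ m = C * (C * (D * rho ^+ m * (C * C))) by ring.
rewrite ler_wpM2l //; apply: le_trans (MC _ _) _; rewrite ler_wpM2l //.
apply: le_trans (decay _ _ (mass_Mh k)) _; rewrite ler_wpM2l ?mulr_ge0 ?exprn_ge0 //.
by apply: le_trans (MC _ _) _; rewrite ler_wpM2l.
Qed.

Section tau.
Variable tau : R[i].

Lemma taylor2M k (phi : X -> R[i]) : CqC 1 phi -> CqC 1 (fun x => taylor2 tau (g k x) * phi x).
Proof.
move=> cp; have c1 := CqC_mul ler01 (gsm k) cp; have c2 := CqC_mul ler01 (gsm k) c1.
have := CqC_lin (tau ^+ 2 / 2) ler01 c2 (CqC_lin tau ler01 c1 cp); congr CqC.
by apply/funext => x; rewrite /taylor2; ring.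
Qed.

(** By duality the twisted operators become factors along the orbit, so the mass of bc n is an
    integral against h 0 alone. *)
Lemma pair_bc n phi : CqC 1 phi -> pair (bc L M h tau n) phi =
  pair (h 0%N) (fun x => (\prod_(j < n) taylor2 tau (g j (orb 0 j x))) * phi (orb 0 n x)).
Proof.
elim: n phi => [|n IH] phi cp.
  by rewrite /=; congr pair; apply/funext => x; rewrite big_ord0 mul1r.
have cS := CqC_S n cp; rewrite [bc _ _ _ _ _]/= pairL // -/(bc L M h tau n); set b := bc L M h tau n.
have c1 := CqC_mul ler01 (gsm n) cS; have c2 := CqC_mul ler01 (gsm n) c1.
have -> : b + tau *: M n b + (tau ^+ 2 / 2) *: M n (M n b) = (tau ^+ 2 / 2) *: M n (M n b) + (tau *: M n b + b).
  by rewrite addrC [tau *: _ + b]addrC.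
rewrite !pair_linl // !pairM //.
rewrite -(pair_linr tau b c1 cS) -(pair_linr (tau ^+ 2 / 2) b c2 (CqC_lin tau ler01 c1 cS)).
rewrite (_ : (fun x => _) = fun x => taylor2 tau (g n x) * (phi \o S n) x); last first.
  by apply/funext => x; rewrite /taylor2; ring.
rewrite (IH _ (taylor2M n cS)); congr pair; apply/funext => x.
by rewrite big_ord_recr /= add0n mulrA.
Qed.

Lemma pair_complex k F : CqC 1 F ->
  pair (h k) F = Complex (\int[nu k]_x complex.Re (F x)) (\int[nu k]_x complex.Im (F x)).
Proof.
move=> /[dup] cF /CqCP [cR cI].
have := pair_linr 'i%C (h k) (CqC_real cI) (CqC_real cR); rewrite !pairh //.
rewrite (_ : (fun x => _) = F); last first.
  apply/funext => x; rewrite [RHS]complexE /=; exact: addrC.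
by move=> ->; rewrite addrC [RHS]complexE.
Qed.

Lemma taylor2_prod n : CqC 1 (fun x => \prod_(j < n) taylor2 tau (g j (orb 0 j x))).
Proof.
elim: n => [|n IH].
  by have := CqC1; congr CqC; apply/funext => x; rewrite big_ord0.
have cg := CqR_orb 0 n (gsm n).
have c1 := CqC_mul ler01 cg IH; have c2 := CqC_mul ler01 cg c1.
have := CqC_lin (tau ^+ 2 / 2) ler01 c2 (CqC_lin tau ler01 c1 IH); congr CqC.
by apply/funext => x; rewrite big_ord_recr /= /taylor2; ring.
Qed.

End tau.

Definition bsum n x := \sum_(j < n) g j (orb 0 j x).

Lemma bsum_smooth n : CqR 1 (bsum n).
Proof.
elim: n => [|n IH].
  by have := @CqR_cst R d X 1 0; congr CqR; apply/funext => x; rewrite /bsum big_ord0.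
have := CqRD IH (CqR_orb 0 n (gsm n)); congr CqR.
by apply/funext => x; rewrite /bsum big_ord_recr.
Qed.

Variable Mg : R.
Hypothesis gM : forall k x, `|g k x| <= Mg.

Lemma bm_cos_bsum n t : bm (fun x : borel X => cos (t * bsum n x)).
Proof.
have [mf _] := CqR_bm (bsum_smooth n); split; last by exists 1 => x; exact: cos_max.
apply: measurableT_comp; first exact: continuous_measurable_fun (@continuous_cos R).
by apply: measurable_funM => //; exact: measurable_cst.
Qed.

Lemma bm_sin_bsum n t : bm (fun x : borel X => sin (t * bsum n x)).
Proof.
have [mf _] := CqR_bm (bsum_smooth n); split; last by exists 1 => x; exact: sin_max.
apply: measurableT_comp; first exact: continuous_measurable_fun (@continuous_sin R).
by apply: measurable_funM => //; exact: measurable_cst.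
Qed.

(** Real and imaginary parts are estimated separately by the pointwise bound [expi_prod], whence the
    leading factor 2. *)
Lemma ac_char n t : nm (Complex (\int[nu 0%N]_x cos (t * bsum n x)) (\int[nu 0%N]_x sin (t * bsum n x)) -
    ac L M l h (Complex 0 t) n) <= 2 * (expR (n%:R * (2 * (`|t| * Mg) ^+ 3)) - 1).
Proof.
pose F x := \prod_(j < n) taylor2 (Complex 0 t) (g j (orb 0 j x)).
have cF : CqC 1 F := taylor2_prod (Complex 0 t) n.
have -> : ac L M l h (Complex 0 t) n = Complex (\int[nu 0%N]_x complex.Re (F x)) (\int[nu 0%N]_x complex.Im (F x)).
  rewrite /ac lE pair_bc // -pair_complex //; congr pair; apply/funext => x; by rewrite mulr1.
have [/CqR_bm bR /CqR_bm bI] : CqR 1 (fun x => complex.Re (F x)) /\ CqR 1 (fun x => complex.Im (F x)).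
  exact: (CqCP 1 F).1.
have H x : nm (expi (t * bsum n x) - F x) <= expR (n%:R * (2 * (`|t| * Mg) ^+ 3)) - 1.
  exact: (expi_prod t n (fun j => gM j (orb 0 j x))).
have HE x : expi (t * bsum n x) - F x =
    Complex (cos (t * bsum n x) - complex.Re (F x)) (sin (t * bsum n x) - complex.Im (F x)).
  by rewrite /expi; case: (F x).
rewrite [Complex _ _ - _](_ : _ = Complex (\int[nu 0%N]_x cos (t * bsum n x) - \int[nu 0%N]_x complex.Re (F x))
    (\int[nu 0%N]_x sin (t * bsum n x) - \int[nu 0%N]_x complex.Im (F x))) //.
apply: le_trans (normc_le _ _) _; rewrite mulr_natl mulr2n.
have bc := bm_cos_bsum n t; have bs := bm_sin_bsum n t.
by rewrite -!bm_intB //; apply: lerD; apply: bm_int_norm; try exact: bmB;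
  move=> x; apply: le_trans (H x); rewrite HE; [exact: normc_Re | exact: normc_Im].
Qed.

Variable W : R.
Hypothesis wW : (fun n => (\sum_(k < n) wk k) / n%:R) @ \oo --> W.

Lemma char_limit th : (fun n : nat => nm (Complex (\int[nu 0%N]_x cos (th / Num.sqrt n%:R * bsum n x))
    (\int[nu 0%N]_x sin (th / Num.sqrt n%:R * bsum n x)) - (expR (- (th ^+ 2 * W)))%:C%C)) @ \oo --> (0 : R).
Proof.
have Mg0 : 0 <= Mg by exact: le_trans (gM 0%N point).
have aclim := @ac_limit R B L M l h C D rho C0 D0 rho0 rho1 hC lC MC decay mass_L Lh mass_h mass_Mh _ W vcE wW th.
(* With t = th / sqrt n the exponent n (2 (|t| Mg)^3) of [ac_char] equals q / sqrt n. *)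
pose q := 2 * (`|th| * Mg) ^+ 3.
have q0 : 0 <= q by rewrite mulr_ge0 // exprn_ge0 // mulr_ge0.
have c1 : (fun n : nat => 2 * (expR (q / Num.sqrt n%:R) - 1)) @ \oo --> (0 : R).
  have z : 2 * (expR 0 - 1) = 0 :> R by rewrite expR0 subrr mulr0.
  rewrite -[X in _ --> X]z.
  apply: cvgM; first exact: cvg_cst.
  apply: cvgB; last exact: cvg_cst.
  apply: (@cvg_comp _ _ _ (fun n : nat => q / Num.sqrt n%:R) expR _ (nbhs 0)); last exact: continuous_expR.
  apply/cvgrPdist_le => e e0; near=> n.
  have n0 : (0 : R) < n%:R by near: n; exact: nbhs_infty_gtr.
  have hn : (q / e) ^+ 2 <= n%:R by apply: ltW; near: n; exact: nbhs_infty_gtr.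
  rewrite sub0r normrN ger0_norm ?divr_ge0 ?sqrtr_ge0 //.
  rewrite ler_pdivrMr ?sqrtr_gt0 // mulrC -ler_pdivrMr //.
  by apply: le_trans (ler_norm _) _; rewrite -sqrtr_sqr ler_wsqrtr.
have c2 : (fun n : nat => 2 * (expR (q / Num.sqrt n%:R) - 1) +
    nm (ac L M l h (Complex 0 (th / Num.sqrt n%:R)) n - (expR (- (th ^+ 2 * W)))%:C%C)) @ \oo --> (0 : R).
  by rewrite -[X in _ --> X](addr0 (0 : R)); apply: cvgD.
apply: (squeeze_cvgr _ (cvg_cst 0) c2); near=> n.
apply/andP; split; first exact: Re_norm_ge0.
have n0 : (0 : R) < n%:R by near: n; exact: nbhs_infty_gtr.
set t := th / _; set Z := Complex _ _; set a := ac _ _ _ _ _ _.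
have -> : Z - (expR (- (th ^+ 2 * W)))%:C%C = (Z - a) + (a - (expR (- (th ^+ 2 * W)))%:C%C) by rewrite addrA subrK.
apply: le_trans (Re_normD _ _) _; apply: lerD => //.
apply: le_trans (ac_char n t) _; rewrite ler_wpM2l // lerD2r ler_expR le_eqVlt; apply/orP; left; apply/eqP.
have sn0 : Num.sqrt (n%:R : R) != 0 by rewrite sqrtr_eq0 -ltNge.
have nE : (n%:R : R) = Num.sqrt n%:R ^+ 2 by rewrite sqr_sqrtr // ltW.
rewrite /t normrM normfV [`|Num.sqrt _|]ger0_norm ?sqrtr_ge0 // {1}nE /q.
by move: (Num.sqrt n%:R) sn0 => s s0; field.
Unshelve. all: by end_near. Qed.

Lemma char_cos th : (fun n : nat => \int[nu 0%N]_x cos (th * (bsum n x / Num.sqrt n%:R))) @ \oo --> expR (- (th ^+ 2 * W)).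
Proof.
have /cvgrPdist_le H := char_limit th; apply/cvgrPdist_le => e e0; near=> n.
have : `|0 - nm (Complex (\int[nu 0%N]_x cos (th / Num.sqrt n%:R * bsum n x))
    (\int[nu 0%N]_x sin (th / Num.sqrt n%:R * bsum n x)) - (expR (- (th ^+ 2 * W)))%:C%C)| <= e by near: n; exact: H.
rewrite sub0r normrN ger0_norm ?Re_norm_ge0 // => /(le_trans (normc_Re _ _)); rewrite distrC.
rewrite (_ : \int[nu 0%N]_x cos (th * (bsum n x / Num.sqrt n%:R)) = \int[nu 0%N]_x cos (th / Num.sqrt n%:R * bsum n x)) //.
by apply: eq_Rintegral => x _; congr cos; ring.
Unshelve. all: by end_near. Qed.

Lemma char_sin th : (fun n : nat => \int[nu 0%N]_x sin (th * (bsum n x / Num.sqrt n%:R))) @ \oo --> (0 : R).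
Proof.
have /cvgrPdist_le H := char_limit th; apply/cvgrPdist_le => e e0; near=> n.
have : `|0 - nm (Complex (\int[nu 0%N]_x cos (th / Num.sqrt n%:R * bsum n x))
    (\int[nu 0%N]_x sin (th / Num.sqrt n%:R * bsum n x)) - (expR (- (th ^+ 2 * W)))%:C%C)| <= e by near: n; exact: H.
rewrite sub0r normrN ger0_norm ?Re_norm_ge0 // => /(le_trans (normc_Im _ _)) hI; rewrite sub0r normrN.
rewrite (_ : \int[nu 0%N]_x sin (th * (bsum n x / Num.sqrt n%:R)) = \int[nu 0%N]_x sin (th / Num.sqrt n%:R * bsum n x)).
  by apply: le_trans hI; rewrite oppr0 addr0.
by apply: eq_Rintegral => x _; congr sin; ring.
Unshelve. all: by end_near. Qed.

End fixed_realization.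

(** * Averages of random correlations *)

Section geometric_tails.
Context {R : realType}.
Variables (u : nat -> R) (C rho : R).
Hypotheses (C0 : 0 <= C) (rho0 : 0 <= rho) (rho1 : rho < 1).
Hypothesis uC : forall j, `|u j| <= C * rho ^+ j.

Let K := C / (1 - rho).
Let K0 : 0 <= K. Proof. by rewrite divr_ge0 // subr_ge0 ltW. Qed.
Let p m := \sum_(j < m) u j.

Lemma geom_tail m m' : (m <= m')%N -> `|p m' - p m| <= K * rho ^+ m.
Proof.
(* The stronger bound telescopes: K rho^m - K rho^(m+1) = C rho^m. *)
move=> mm; suff : `|p m' - p m| <= K * rho ^+ m - K * rho ^+ m'.
  by move=> /le_trans; apply; rewrite lerBlDr lerDl mulr_ge0 // exprn_ge0.
rewrite -(subnKC mm); elim: (m' - m)%N => [|i IH]; first by rewrite addn0 !subrr normr0.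
rewrite addnS {1}/p big_ord_recr /= -/(p (m + i)) addrAC; apply: le_trans (ler_normD _ _) _.
apply: le_trans (lerD IH (uC _)) _.
have -> : C * rho ^+ (m + i) = K * rho ^+ (m + i) - K * rho ^+ (m + i).+1.
  by rewrite exprS /K; field; rewrite lt0r_neq0 // subr_gt0.
by rewrite addrA subrK.
Qed.

Lemma geom_cvg : cvgn p.
Proof.
(* Adding the tail bound makes the sequence of partial sums nonincreasing, and the added term tends
   to 0. *)
pose a m := p m + K * rho ^+ m.
have cE : (fun m => K * rho ^+ m) @ \oo --> (0 : R).
  rewrite -[X in _ --> X](mulr0 K); apply: cvgM; first exact: cvg_cst.
  by apply: cvg_expr; rewrite ger0_norm.
have ca : cvgn a.
  apply: nonincreasing_is_cvgn; last first.
    exists (- K) => _ [m _ <-]; have := geom_tail (leq0n m).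
    rewrite /p big_ord0 subr0 expr0 mulr1 ler_norml /a => /andP[h _].
    by apply: le_trans h _; rewrite lerDl mulr_ge0 // exprn_ge0.
  apply/nonincreasing_seqP => m; rewrite /a {1}/p big_ord_recr /= -/(p m) -addrA lerD2l.
  have := uC m; rewrite ler_norml => /andP[_ h].
  have e : C * rho ^+ m = K * rho ^+ m - K * rho ^+ m.+1.
    by rewrite exprS /K; field; rewrite lt0r_neq0 // subr_gt0.
  by move: h; rewrite e lerBrDr.
have -> : p = (fun m => a m - K * rho ^+ m) by apply/funext => m; rewrite /a addrK.
by apply: is_cvgB; [exact: ca | apply/cvg_ex; exists 0].
Qed.

Lemma geom_lim_tail m : `|limn p - p m| <= K * rho ^+ m.
Proof.
apply/ler_addgt0Pr => e e0.
have /cvgrPdist_le /(_ e e0) [n _ H] : p @ \oo --> limn p by exact: geom_cvg.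
have h1 := H _ (leq_maxl n m); have h2 := geom_tail (leq_maxr n m).
have -> : limn p - p m = (limn p - p (maxn n m)) + (p (maxn n m) - p m) by rewrite addrA subrK.
by apply: le_trans (ler_normD _ _) _; rewrite addrC; apply: lerD.
Qed.

Lemma sum_rev_geom n : \sum_(j < n) rho ^+ (n.-1 - j) <= (1 - rho)^-1.
Proof.
suff -> : \sum_(j < n) rho ^+ (n.-1 - j) = (1 - rho ^+ n) / (1 - rho).
  by rewrite ler_pdivrMr ?subr_gt0 // mulVf ?lt0r_neq0 ?subr_gt0 // gerBl exprn_ge0.
elim: n => [|n IH]; first by rewrite big_ord0 expr0 subrr mul0r.
rewrite big_ord_recl /= subn0.
rewrite (eq_bigr (fun j : 'I_n => rho ^+ (n.-1 - j))); last first.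
  by move=> j _; rewrite /= /bump /= add1n; case: n j IH => [[]//|n] j _.
by rewrite IH exprS; field; rewrite lt0r_neq0 // subr_gt0.
Qed.

End geometric_tails.

Section random_correlations.
Context {R : realType} {d : measure_display} {T : measurableType d}.
Variables (P : probability T R) (sigma : T -> T).
Hypothesis hs : ergodic_system P sigma.

Lemma iter_invariant k E : measurable E -> measurable (iter k sigma @^-1` E) /\ P (iter k sigma @^-1` E) = P E.
Proof.
elim: k E => [//|k IH] E mE.
have mS : measurable (sigma @^-1` E) by rewrite -[X in measurable X]setTI; exact: (es_measurable hs).
by have [m e] := IH _ mS; split=> //; exact: etrans e (es_invariant hs mE).
Qed.

Lemma ae_iter (Q : T -> Prop) : {ae P, forall w, Q w} -> {ae P, forall w, forall k, Q (iter k sigma w)}.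
Proof.
move=> [N [mN PN HN]]; apply: ae_foralln => k.
have [m e] := iter_invariant k mN.
exists (iter k sigma @^-1` N); split=> //; first exact: etrans e PN.
by move=> w /= nQ; apply: HN.
Qed.

Variables (a : T -> R) (c : nat -> T -> R) (C rho : R).
Hypotheses (ba : bm a) (bc : forall j, bm (c j)).
Hypotheses (C0 : 0 <= C) (rho0 : 0 <= rho) (rho1 : rho < 1).
Hypothesis cC : {ae P, forall w, forall j, `|c j w| <= C * rho ^+ j}.

(** c j.+1 clipped to its almost sure bound, so that the geometric estimates hold at every w. Lag 0
    is left to the function a, hence the shift of the index. *)
Let b j w := Num.max (- (C * rho ^+ j.+1)) (Num.min (C * rho ^+ j.+1) (c j.+1 w)).

Let bC j w : `|b j w| <= C * rho ^+ j.+1.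
Proof.
have h0 : 0 <= C * rho ^+ j.+1 by rewrite mulr_ge0 // exprn_ge0.
rewrite ler_norml /b le_max lexx ge_max ge_min lexx !andbT /=; move: h0; lra.
Qed.

Let bC' j w : `|b j w| <= C * rho ^+ j.
Proof. by apply: le_trans (bC j w) _; rewrite ler_wpM2l // exprS ler_piMl ?exprn_ge0 // ltW. Qed.

Let bb j : bm (b j).
Proof.
split; last by exists (C * rho ^+ j.+1); exact: bC.
apply: measurable_maxr; first exact: measurable_cst.
by apply: measurable_minr; [exact: measurable_cst | have [] := bc j.+1].
Qed.

Let p m w := \sum_(j < m) b j w.
Let s w := limn (p ^~ w).
Let K := C / (1 - rho).

Let K0 : 0 <= K. Proof. by rewrite divr_ge0 // subr_ge0 ltW. Qed.

Let pK m w : `|p m w| <= K.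
Proof.
have := @geom_tail R (b ^~ w) C rho C0 rho0 rho1 (fun j => bC' j w) 0 m (leq0n m).
by rewrite big_ord0 subr0 expr0 mulr1.
Qed.

Let bp m : bm (p m). Proof. exact: (@bm_sum _ _ _ m b bb). Qed.

Let ps w : p ^~ w @ \oo --> s w.
Proof. exact: (@geom_cvg R (b ^~ w) C rho C0 rho0 rho1 (fun j => bC' j w)). Qed.

Let bs : bm s.
Proof.
split.
  apply: (@measurable_fun_cvg _ _ _ setT p) => // m.
  by have [] := bp m.
exists K => w; have := @geom_lim_tail R (b ^~ w) C rho C0 rho0 rho1 (fun j => bC' j w) 0.
by rewrite big_ord0 subr0 expr0 mulr1.
Qed.

(** Pairs of times j < k < n are regrouped by the earlier one, after which n.-1 - j later times
    remain. *)
Lemma sum_corr (f : nat -> nat -> R) n :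
  \sum_(k < n) \sum_(j < k) f j (k - j)%N = \sum_(j < n) \sum_(i < n.-1 - j) f j i.+1.
Proof.
elim: n => [|n IH]; first by rewrite !big_ord0.
rewrite big_ord_recr /= IH [RHS]big_ord_recr /= subnn big_ord0 addr0 -big_split /=.
apply: eq_bigr => j _; have jn := ltn_ord j; have n0 := leq_ltn_trans (leq0n j) jn.
have -> : (n - j = (n.-1 - j).+1)%N by rewrite -subSn ?prednK // -ltnS prednK.
by rewrite big_ord_recr.
Qed.

(** After regrouping, the time j contributes a partial sum of the series s at sigma^j w. Replacing
    partial sums by s costs a bounded total error r n, and Birkhoff's theorem applies to a + s. *)
Lemma corr_average : {ae P, forall w, (fun n : nat =>
    (\sum_(k < n) (a (iter k sigma w) + \sum_(j < k) c (k - j)%N (iter j sigma w))) / n%:R) @ \oo -->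
  \int[P]_w a w + limn (fun m => \sum_(1 <= j < m) \int[P]_w c j w)}.
Proof.
have bas := bmD ba bs.
have Eint : \int[P]_w (a w + s w) = \int[P]_w a w + limn (fun m => \sum_(1 <= j < m) \int[P]_w c j w).
  rewrite (bm_intD P ba bs); congr (_ + _); symmetry; apply: cvg_lim => //.
  have Eb j : \int[P]_w b j w = \int[P]_w c j.+1 w.
    apply: bm_int_ae => //; apply: filterS cC => w /(_ j.+1); rewrite ler_norml => /andP[h1 h2].
    by rewrite /b (min_idPr h2) (max_idPr h1).
  rewrite -(cvg_shiftS _ _); rewrite (_ : (fun n => _) = (fun m => \int[P]_w p m w)); last first.
    apply/funext => m; rewrite big_add1 big_mkord /p bm_int_sum //.
    by apply: eq_bigr => j _; rewrite Eb.
  apply: (@bounded_convergence _ _ _ P p s K) => //.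
  - by move=> m; have [] := bp m.
  - by have [] := bs.
  - by apply: aeW => w; exact: ps.
have := birkhoff hs bas; rewrite Eint.
have H1 := ae_iter cC; move=> H2; apply: filterS2 H1 H2 => w hc hb.
have cb k j : c j.+1 (iter k sigma w) = b j (iter k sigma w).
  have := hc k j.+1; rewrite ler_norml => /andP[h1 h2].
  by rewrite /b (min_idPr h2) (max_idPr h1).
(* The truncation at distance n.-1 - j from the end costs K rho^(n.-1 - j), and these costs sum to
   at most K / (1 - rho). *)
pose r n := \sum_(j < n) (p (n.-1 - j) (iter j sigma w) - s (iter j sigma w)).
have rb n : `|r n| <= K / (1 - rho).
  apply: le_trans (ler_norm_sum _ _ _) _.
  apply: (@le_trans _ _ (\sum_(j < n) K * rho ^+ (n.-1 - j))).
    apply: ler_sum => j _; rewrite distrC.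
    exact: (@geom_lim_tail R (b ^~ _) C rho C0 rho0 rho1 (fun j => bC' j _)).
  by rewrite -mulr_sumr ler_wpM2l // sum_rev_geom.
have rlim : (fun n : nat => r n / n%:R) @ \oo --> (0 : R).
  apply/cvgrPdist_le => e e0; near=> n.
  have n0 : (0 : R) < n%:R by near: n; exact: nbhs_infty_gtr.
  have hn : K / (1 - rho) / e <= n%:R by apply: ltW; near: n; exact: nbhs_infty_gtr.
  rewrite sub0r normrN normrM normfV (ger0_norm (ltW n0)) ler_pdivrMr //.
  by apply: le_trans (rb n) _; rewrite [leRHS]mulrC -ler_pdivrMr.
have cs : (fun n : nat => (\sum_(i < n) (a (iter i sigma w) + s (iter i sigma w))) / n%:R + r n / n%:R) @ \oo -->
    \int[P]_w a w + limn (fun m => \sum_(1 <= j < m) \int[P]_w c j w).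
  by rewrite -[X in _ --> X]addr0; apply: cvgD.
suff E : (fun n : nat => (\sum_(k < n) (a (iter k sigma w) + \sum_(j < k) c (k - j)%N (iter j sigma w))) / n%:R) =
    (fun n : nat => (\sum_(i < n) (a (iter i sigma w) + s (iter i sigma w))) / n%:R + r n / n%:R) by rewrite E.
apply/funext => n; rewrite -mulrDl; congr (_ / _).
rewrite big_split /= [in RHS]big_split /= /r sumrB -addrA; congr (_ + _); rewrite [RHS]addrC subrK.
rewrite (sum_corr (fun j i => c i (iter j sigma w))); apply: eq_bigr => j _.
by apply: eq_bigr => i _; exact: cb.
Unshelve. all: by end_near. Qed.

End random_correlations.

(** * The central limit theorem *)

Lemma ess_sup_real {R : realType} {d : measure_display} {T : measurableType d} (P : probability T R) (f : T -> \bar R) :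
  (ess_sup P f < +oo)%E -> exists2 c : R, 0 <= c & {ae P, forall w, (f w <= c%:E)%E}.
Proof.
move=> h; have H := ess_sup_ge P f; exists (Num.max 0 (fine (ess_sup P f))); first by rewrite le_max lexx.
apply: filterS H => w /le_trans; apply; move: h; case: (ess_sup P f) => [s| |] //= _.
  by rewrite lee_fin le_max lexx orbT.
by rewrite leNye.
Qed.

Section clt.
Context {R : realType} {ds du : nat} {X : riemannian R (ds + du)}.
Variables (r nu kappa K A delta eps : R) (T : X -> X) (Es : X -> 'M[R]_(ds + du)).
Hypothesis hr : 2 < r.
Variables (N : nat) (psi : 'I_N -> chart R (ds + du) X) (rad c : 'I_N -> R).
Hypothesis hpsi : adapted_charts r nu kappa T Es psi rad c.
Hypotheses (hA : 1 < A) (hdelta : 0 < delta).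
Variable vol : {finite_measure set (borel X) -> \bar R}.
Variables (B : completeNormedModType R[i]) (iota : (X -> R[i]) -> B).
Hypothesis hB : is_completion r (norm_pq psi rad c r K A delta 1 1) iota.
Variable pair : B -> (X -> R[i]) -> R[i].
Hypothesis hpair : is_pairing psi r vol iota pair.
Context {dO : measure_display} {Omega : measurableType dO}.
Variables (P : probability Omega R) (sigma : Omega -> Omega).
Hypothesis hsigma : ergodic_system P sigma.
Variable T_ : Omega -> X -> X.
Hypothesis hT_ : measurable_cocycle psi r (near_anosov psi r eps T) T_.
Variables (norm02 : (X -> R[i]) -> \bar R) (N02 : B -> R) (L : Omega -> {linear B -> B}).
Hypothesis hL : transfer_cocycle r sigma T_ iota pair norm02 N02 L.
Variables (h0 : Omega -> B) (mu_ : R.-pker Omega ~> borel X) (mu : probability (Omega * borel X)%type R).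
Hypothesis hmu : equivariant_family P sigma pair L h0 mu_ mu.
Variable g : Omega * borel X -> R.
Hypothesis hg : observable psi r P mu_ g.

Local Notation tau := (skew_product sigma T_ : Omega * borel X -> Omega * borel X).

Let r1 : (1 <= Num.truncn (r + 1))%N.
Proof. by rewrite truncn_ge_nat; move: hr; lra. Qed.

Let r1' : (1 <= Num.truncn r)%N.
Proof. by rewrite truncn_ge_nat; move: hr; lra. Qed.

Lemma T_diffeo w : diffeo (r + 1) (T_ w).
Proof. by have [[]] := hT_.1 w. Qed.

Lemma T_smooth w m (f : X -> 'rV[R]_m) : CqX 1 f -> CqX 1 (f \o T_ w).
Proof. by move=> cf; have [s _] := T_diffeo w; exact: CqX1_comp r1 cf s. Qed.

Lemma tau_measurable : measurable_fun setT tau.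
Proof.
apply: measurable_fun_pair; first exact: (measurableT_comp (es_measurable hsigma) measurable_fst).
suff J : measurable_fun [set: Omega * borel X] (fun z => T_ z.1 z.2 : borel X) by exact: J.
apply: (joint_measurable (ac_rad hpsi) (ac_dom hpsi) (ac_cover hpsi)).
- by move=> w; have [[]] := T_diffeo w.
- by move=> w; have [_ [S' [h1 h2 [h3 _]]]] := T_diffeo w; exists S'.
- move=> x W oW hW; apply: (point_measurable (ac_smooth hpsi) (ac_rad hpsi) (ac_dom hpsi) (ac_cover hpsi) x _ hT_ oW hW).
  by move: hr; lra.
Qed.

Lemma tau_iter_measurable n : measurable_fun setT (iter n tau).
Proof. by elim: n => [|n IH]; [exact: measurable_id | exact: (measurableT_comp tau_measurable IH)]. Qed.

Let S w k := T_ (iter k sigma w).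
Let gk w k (x : X) := g (iter k sigma w, x).
Let nuk w k : probability (borel X) R := fiber mu_ (iter k sigma w).

Lemma tau_iter w k m x : iter m tau (iter k sigma w, x) = (iter (k + m) sigma w, orb (S w) k m x).
Proof.
elim: m => [|m IH]; first by rewrite addn0.
by rewrite iterS IH /skew_product /= addnS.
Qed.

Lemma birkhoff_bsum n w x : birkhoff_sum tau g n (w, x) = bsum (S w) (gk w) n x.
Proof. by apply: eq_bigr => i _; have := tau_iter w 0 i x; rewrite /= add0n => ->. Qed.

Lemma observable_sup (M : R) (f : X -> R) : (CnormX psi r (@of_real R \o f) <= M%:E)%E -> forall x, `|f x| <= M.
Proof.
move=> H x; have [i [y yc <-]] := ac_cover hpsi x.
rewrite -lee_fin; apply: le_trans H.
apply: (@le_trans _ _ (Cnorm r (cdom (psi i)) ((@of_real R \o f) \o cpar (psi i)))); last first.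
  by apply: ereal_sup_ubound; exists i.
apply: ereal_sup_ubound; left; exists [::], y; split=> //.
  rewrite (ac_dom hpsi) => j; apply: lt_trans (yc j) _.
  by have := ac_rad hpsi i; lra.
by rewrite /= /enorm big_ord1 /of_real mxE eqxx mulr1n sqrtr_sqr.
Qed.

(** The properties of w that hold almost surely and are used at all times of a forward orbit, with
    bounds Ch and Mg common to all w. *)
Definition good (Ch Mg : R) w := [/\ L w (h0 w) = h0 (sigma w), rnorm (h0 w) <= Ch,
  forall phi : X -> R, CqR 1 phi -> pair (h0 w) (fun x => (phi x)%:C%C) = (\int[mu_ w]_x phi x)%:C%C,
  (CnormX psi r (fun x : X => of_real (g (w, x))) <= Mg%:E)%E & \int[mu_ w]_x g (w, x) = 0].

Lemma ae_good : exists Ch Mg : R, [/\ 0 <= Ch, 0 <= Mg & {ae P, forall w, forall k, good Ch Mg (iter k sigma w)}].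
Proof.
have [Ch Ch0 H1] := ess_sup_real (ef_bounded hmu); have [Mg Mg0 H2] := ess_sup_real (ob_bounded hg).
exists Ch, Mg; split=> //; apply: (ae_iter hsigma).
have H3 := ef_equivariant hmu; have H4 := ef_measure hmu; have H5 := ob_centered hg.
by move: H1; apply: filterS2 (filterI (filterI H2 H3) (filterI H4 H5)) => w [[? ?] [? ?]] ?; split=> //.
Qed.

Section realization.
Variables (Ch Mg : R).
Hypotheses (Ch0 : 0 <= Ch) (Mg0 : 0 <= Mg).

Lemma good_sup w : (forall k, good Ch Mg (iter k sigma w)) -> forall k x, `|gk w k x| <= Mg.
Proof. by move=> H k x; have [_ _ _ h _] := H k; exact: (observable_sup h x). Qed.

(** C and rho come before w: the decay of correlations must be uniform to be summed under the
    integral over realizations. *)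
Lemma realization : exists C rho : R, [/\ 0 <= C, 0 <= rho, rho < 1 &
  forall w, (forall k, good Ch Mg (iter k sigma w)) ->
    (forall k m, `|corr (S w) (gk w) (nuk w) k m| <= C * rho ^+ m) /\
    forall W, (fun n => (\sum_(k < n) wk (S w) (gk w) (nuk w) k) / n%:R) @ \oo --> W -> forall th,
      ((fun n : nat => \int[nuk w 0%N]_x cos (th * (bsum (S w) (gk w) n x / Num.sqrt n%:R))) @ \oo --> expR (- (th ^+ 2 * W))) /\
      ((fun n : nat => \int[nuk w 0%N]_x sin (th * (bsum (S w) (gk w) n x / Num.sqrt n%:R))) @ \oo --> (0 : R))].
Proof.
have [Cm [Cm0 Hm]] := mul_operator hr hpsi hA hdelta hB hpair Mg.
have c1 : CqC 1 (fun _ : X => 1 : R[i]).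
  by have := CqC_real (@CqR_cst R _ X 1 1); congr CqC; apply/funext => x.
have [Cl Cl0 Hl] := pair_bound hr hpsi hpair c1.
have [D [lam [D0 lam0 Hd]]] := tc_decay hL.
pose C := Ch + Cl + Cm; pose rho := expR (- lam).
have C0 : 0 <= C by rewrite !addr_ge0.
have rho1 : rho < 1 by rewrite expR_lt1 oppr_lt0.
exists (C * C * (C * C) * D), rho; split=> //; [by rewrite !mulr_ge0 // ltW | exact: expR_ge0 |].
move=> w H.
have /choice [F HF] : forall k, exists F : {linear B -> B}, (forall b, rnorm (F b) <= C * rnorm b) /\
    forall b phi, CqC 1 phi -> pair (F b) phi = pair b (fun x => (gk w k x)%:C%C * phi x).
  move=> k; have [_ _ _ h _] := H k.
  have [F [F1 F2 F3]] := Hm (gk w k) (ob_regular hg _) h.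
  pose Fl : {linear B -> B} := HB.pack F (GRing.isLinear.Build _ _ _ _ F F1).
  exists Fl; split=> [b|]; last exact: F3.
  by apply: le_trans (F2 b) _; rewrite ler_wpM2r ?rnorm_ge0 // lerDr addr_ge0.
pose l : {linear B -> R[i]^o} := HB.pack (fun b => pair b (fun=> 1))
  (GRing.isLinear.Build _ _ _ _ (fun b => pair b (fun=> 1) : R[i]^o) (fun z b b' => ip_linear hpair z b b' c1)).
pose Lw k := L (iter k sigma w); pose hw k := h0 (iter k sigma w).
have LcE k m b : Lc Lw k m b = Lcocycle sigma L m (iter k sigma w) b.
  by elim: m => //= m ->; rewrite /Lw addnC iterD.
have hC k : rnorm (hw k) <= C.
  by have [_ h _ _ _] := H k; apply: le_trans h _; rewrite /C -addrA lerDl addr_ge0.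
have lC b : complex.Re `|l b| <= C * rnorm b.
  by apply: le_trans (Hl b) _; rewrite ler_wpM2r ?rnorm_ge0 // /C addrAC lerDr addr_ge0.
have MC k b : rnorm (F k b) <= C * rnorm b by exact: (HF k).1.
have decay k m b : l b = 0 -> rnorm (Lc Lw k m b) <= D * rho ^+ m * rnorm b.
  by move=> lb; rewrite LcE /rho -expRM_natl [m%:R * _]mulrC; exact: Hd.
have Lh k : Lw k (hw k) = hw k.+1 by have [h _ _ _ _] := H k.
have pL k b phi : CqC 1 phi -> pair (Lw k b) phi = pair b (phi \o S w k) by move=> cp; exact: (tc_transfer hL).
have ph k (phi : X -> R) : CqR 1 phi -> pair (hw k) (fun x => (phi x)%:C%C) = (\int[nuk w k]_x phi x)%:C%C.
  by move=> cp; have [_ _ h _ _] := H k; exact: h.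
have gsm k : CqR 1 (gk w k) by exact: (CqR_le r1' (ob_regular hg _)).
have gc k : \int[nuk w k]_x gk w k x = 0 by have [_ _ _ _ h] := H k.
have pM k b phi (cp : CqC 1 phi) := (HF k).2 b phi cp.
have plin := pair_linr hr hpsi hB hpair.
have Ss k m (f : X -> 'rV[R]_m) : CqX 1 f -> CqX 1 (f \o S w k) by exact: T_smooth.
split.
  move=> k m; apply: (@corr_bound R _ X B Lw F l hw C D rho C0 (ltW D0) (expR_ge0 _) hC lC MC decay pair (S w) (gk w) (nuk w)) => //.
move=> W HW th.
pose Q1 := @char_cos R _ X B Lw F l hw C D rho C0 (ltW D0) (expR_ge0 _) rho1 hC lC MC decay Lh pair (S w) (gk w) (nuk w)
  (fun _ => erefl) (fun z b b' phi cp => ip_linear hpair z b b' cp) plin pL pM ph gsm Ss gc Mg (good_sup H) W HW th.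
pose Q2 := @char_sin R _ X B Lw F l hw C D rho C0 (ltW D0) (expR_ge0 _) rho1 hC lC MC decay Lh pair (S w) (gk w) (nuk w)
  (fun _ => erefl) (fun z b b' phi cp => ip_linear hpair z b b' cp) plin pL pM ph gsm Ss gc Mg (good_sup H) W HW th.
by split; [exact: Q1 | exact: Q2].
Qed.

(** g clipped to [- Mg, Mg]: bounded everywhere, as [bm] demands, and equal to g along good
    orbits. *)
Let gt (z : Omega * borel X) : R := Num.max (- Mg) (Num.min Mg (g z)).

Lemma gt_bm : bm gt.
Proof.
split; last first.
  by exists Mg => z; rewrite ler_norml /gt le_max lexx ge_max ge_min lexx !andbT /=; move: Mg0; lra.
by apply: measurable_maxr; [exact: measurable_cst | apply: measurable_minr; [exact: measurable_cst | exact: (ob_measurable hg)]].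
Qed.

Lemma gt_iter_bm n : bm (fun z => gt (iter n tau z)).
Proof.
have [m [M HM]] := gt_bm; split; last by exists M => z; exact: HM.
exact: (measurableT_comp m (tau_iter_measurable n)).
Qed.

Lemma gtE z : `|g z| <= Mg -> gt z = g z.
Proof. by rewrite ler_norml /gt => /andP[h1 h2]; rewrite (min_idPr h2) (max_idPr h1). Qed.

Let cj n w := \int[mu_ w]_x (gt (w, x) * gt (iter n tau (w, x))).

Lemma cj_bm n : bm (cj n).
Proof. exact: (bm_disintegration_fun mu_ (bmM gt_bm (gt_iter_bm n))). Qed.

Lemma gt_orbit w : (forall k, good Ch Mg (iter k sigma w)) -> forall k m x,
  gt (iter m tau (iter k sigma w, x)) = gk w (k + m) (orb (S w) k m x).
Proof. by move=> H k m x; rewrite tau_iter gtE //; exact: (good_sup H). Qed.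

Lemma cj_corr w : (forall k, good Ch Mg (iter k sigma w)) -> forall k m, cj m (iter k sigma w) = corr (S w) (gk w) (nuk w) k m.
Proof.
move=> H k m; apply: eq_Rintegral => x _; rewrite (gt_orbit H); congr (_ * _).
by have := gt_orbit H k 0 x; rewrite addn0.
Qed.

Hypothesis hgood : {ae P, forall w, forall k, good Ch Mg (iter k sigma w)}.

(** The disintegration on E times X shows that a P-null set E gives a mu-null cylinder. *)
Lemma mu_ae (Q : Omega -> Prop) : {ae P, forall w, Q w} -> {ae mu, forall z, Q z.1}.
Proof.
move=> [E [mE PE HE]]; exists (E `*` setT); split; first exact: measurableX.
  refine (etrans (ef_disintegration hmu mE measurableT) _).
  by apply: null_set_integral => //; apply: measurable_funTS; exact: measurable_kernel.
by move=> z /= hz; split=> //; exact: HE.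
Qed.

Lemma int_cj n : \int[P]_w cj n w = \int[mu]_z (g z * g (iter n tau z)).
Proof.
rewrite -(disintegration (ef_disintegration hmu) (bmM gt_bm (gt_iter_bm n))).
apply: (f_equal fine); apply: ae_eq_integral => //.
- by apply/measurable_EFinP; have [] := bmM gt_bm (gt_iter_bm n).
- apply/measurable_EFinP; apply: measurable_funM; first exact: (ob_measurable hg).
  exact: (measurableT_comp (ob_measurable hg) (tau_iter_measurable n)).
- have := mu_ae hgood; apply: filterS => -[w x] /= H _; congr EFin.
  have e1 := gt_orbit H 0 n x; have e2 := gt_orbit H 0 0 x; rewrite /= in e1 e2.
  by rewrite e1 e2 (tau_iter w 0 n x).
Qed.

Let Wlim := \int[P]_w (cj 0 w / 2) + limn (fun m => \sum_(1 <= j < m) \int[P]_w cj j w).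

(** [wk] contains half of the second moment and every correlation once, so its average is half of
    the variance. *)
Lemma WlimE : variance_series mu tau g = 2 * Wlim.
Proof.
rewrite /variance_series /Wlim mulrDr; congr (_ + _); last first.
  rewrite (_ : (fun m => \sum_(1 <= j < m) \int[P]_w cj j w) = (fun m => \sum_(1 <= j < m) \int[mu]_z (g z * g (iter j tau z)))) //.
  by apply/funext => m; apply: eq_bigr => j _; exact: int_cj.
have -> : (fun w => cj 0 w / 2) = (fun w => 2^-1 * cj 0 w) by apply/funext => w; rewrite mulrC.
rewrite (bm_intZ P _ (cj_bm 0)) mulrA mulfV // mul1r int_cj.
by apply: eq_Rintegral => z _; rewrite expr2.
Qed.

Hypothesis hvar : 0 < variance_series mu tau g.

Lemma clt_good (phi : R -> R) : continuous phi -> (exists M, forall t, `|phi t| <= M) ->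
  {ae P, forall w, (fun n : nat => \int[mu_ w]_x phi (birkhoff_sum tau g n (w, x) / Num.sqrt n%:R)) @ \oo -->
    \int[normal_prob 0 (Num.sqrt (variance_series mu tau g))]_t phi t}.
Proof.
move=> cphi bphi; have [C [rho [C0 rho0 rho1 Hr]]] := realization.
have ba : bm (fun w => cj 0 w / 2).
  by have := bmZ (2^-1) (cj_bm 0); congr bm; apply/funext => w; rewrite mulrC.
have cC : {ae P, forall w, forall j, `|cj j w| <= C * rho ^+ j}.
  apply: filterS hgood => w H j; have [h _] := Hr w H.
  by have := cj_corr H 0 j; rewrite /= => ->.
have av := corr_average hsigma ba cj_bm C0 rho0 rho1 cC.
move: av; apply: filterS2 hgood => w H av.
have [_ Hc] := Hr w H.
have HW : (fun n => (\sum_(k < n) wk (S w) (gk w) (nuk w) k) / n%:R) @ \oo --> Wlim.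
  move: av; rewrite -/Wlim; apply: cvg_trans; apply: near_eq_cvg; near=> n; congr (_ / _).
  apply: eq_bigr => k _; rewrite /wk; congr (_ / _ + _).
    rewrite cj_corr // /corr; apply: eq_Rintegral => x _ /=; by rewrite addn0.
  by apply: eq_bigr => j _; rewrite cj_corr.
(* The normal law is parametrized by its standard deviation; positivity of the variance enters here,
   through [gauss_cos] and [gauss_sin]. *)
have s0 : 0 < Num.sqrt (variance_series mu tau g) by rewrite sqrtr_gt0.
have sE : Num.sqrt (variance_series mu tau g) ^+ 2 = 2 * Wlim by rewrite sqr_sqrtr ?WlimE // -WlimE ltW.
pose Y n (x : borel X) := birkhoff_sum tau g n (w, x) / Num.sqrt n%:R.
have mY n : measurable_fun setT (Y n).
  apply: measurable_funM; last exact: measurable_cst.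
  apply: (measurableT_comp _ (pair1_measurable w)).
  rewrite /birkhoff_sum; elim: n => [|n IH].
    by under eq_fun do rewrite big_ord0; exact: measurable_cst.
  under eq_fun do rewrite big_ord_recr /=.
  by apply: measurable_funD => //; exact: (measurableT_comp (ob_measurable hg) (tau_iter_measurable n)).
have YE n x : Y n x = bsum (S w) (gk w) n x / Num.sqrt n%:R by rewrite /Y birkhoff_bsum.
apply: (@levy_continuity R _ _ (fiber mu_ w) Y (gauss 0 (Num.sqrt (variance_series mu tau g))) mY _ _ phi) => //.
- move=> t; rewrite /weak_at gauss_cos // exprMn sE.
  have -> : 2 * Wlim * t ^+ 2 / 2 = t ^+ 2 * Wlim by field.
  have [h _] := Hc _ HW t; move: h; apply: cvg_trans; apply: near_eq_cvg; near=> n.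
  by apply: eq_Rintegral => x _; rewrite YE.
- move=> t; rewrite /weak_at gauss_sin //.
  have [_ h] := Hc _ HW t; move: h; apply: cvg_trans; apply: near_eq_cvg; near=> n.
  by apply: eq_Rintegral => x _; rewrite YE.
Unshelve. all: by end_near. Qed.

End realization.

End clt.

Theorem theorem2 (R : realType)
  (ds du : nat) (X : riemannian R (ds + du)) (r nu lambda eta : R)
  (T : X -> X) (Es Eu : X -> 'M[R]_(ds + du))
  (hr : 2 < r)
  (hT : adapted_anosov r nu lambda eta T Es Eu)
  (N : nat) (psi : 'I_N -> chart R (ds + du) X) (rad c : 'I_N -> R)
  (kappa K A delta : R)
  (hpsi : adapted_charts r nu kappa T Es psi rad c)
  (hK : 0 < K) (hA : 1 < A) (hdelta : 0 < delta)
  (hAdelta : forall i, A * delta < rad i / 6)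
  (vol : {finite_measure set (borel X) -> \bar R})
  (hvol : riemannian_volume vol)
  (B : completeNormedModType R[i]) (iota : (X -> R[i]) -> B)
  (hB : is_completion r (norm_pq psi rad c r K A delta 1 1) iota)
  (pair : B -> (X -> R[i]) -> R[i])
  (hpair : is_pairing psi r vol iota pair)
  (dO : measure_display) (Omega : measurableType dO) (P : probability Omega R)
  (sigma : Omega -> Omega)
  (hOmega : borel_base R Omega) (hsigma : ergodic_system P sigma)
  (eps : R) (heps : 0 < eps) (T_ : Omega -> X -> X)
  (hT_ : measurable_cocycle psi r (near_anosov psi r eps T) T_)
  (N02 : B -> R) (L : Omega -> {linear B -> B})
  (hL : transfer_cocycle r sigma T_ iota pair
          (norm_pq psi rad c r K A delta 0 2) N02 L)
  (h0 : Omega -> B) (mu_ : R.-pker Omega ~> borel X)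
  (mu : probability (Omega * borel X)%type R)
  (hmu : equivariant_family P sigma pair L h0 mu_ mu)
  (g : Omega * borel X -> R)
  (hg : observable psi r P mu_ g)
  (hvar : 0 < variance_series mu (skew_product sigma T_) g) :
  forall phi : R -> R, continuous phi -> (exists M, forall t, `|phi t| <= M) ->
  {ae P, forall w,
    (fun n : nat => \int[mu_ w]_x
       phi (birkhoff_sum (skew_product sigma T_) g n (w, x) / Num.sqrt n%:R)) @ \oo -->
    \int[normal_prob 0 (Num.sqrt (variance_series mu (skew_product sigma T_) g))]_t
       phi t}.
Proof.
move=> phi cphi bphi.
have [Ch [Mg [Ch0 Mg0 H]]] := ae_good hsigma hmu hg.
exact: (clt_good hr hpsi hA hdelta hB hpair hsigma hT_ hL hmu hg Ch0 Mg0 H hvar cphi bphi).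
Qed.
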